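(* Let $\alpha\in(0,1)$, $f=0$ and $\mathbf u^0\in l^2$ (i.e. $\|\mathbf u^0\|_{l^2}<\infty$). Let $\mathbf u_h(t)$ be the solution of the central finite difference semi-discrete scheme and $\mathbf u_{2,h}^n$ the solution of the averaged second order backward difference ($\overline{SBD}$) fully discrete scheme with time step $\tau=T/L$. Then there is a constant $C>0$, independent of $\tau$, $n$, $h$ and $\mathbf u^0$, such that for $n=1,\dots,L$ $$\|\mathbf u_h(t_n)-\mathbf u_{2,h}^n\|_{l^2}\le C\tau^2t_n^{-2}\|\mathbf u^0\|_{l^2}.$$
   Context: Semi-discrete scheme: $N\in\mathbb N^*$, $h=1/N$, $\mathbf A=[N^2w_{i,j}]_{i,j=1}^{N-1}$ with $w_{i,i}=2$, $w_{i,j}=-1$ if $|i-j|=1$, $w_{i,j}=0$ if $|i-j|>1$. Given $\mathbf u^0\in\mathbb R^{N-1}$ (grid values of the initial datum $u_0$ at $x_i=i/N$, $1\le i\le N-1$) and $\mathbf f(t)\in\mathbb R^{N-1}$ (grid values of the source $f$), $\mathbf u_h(t)$ solves ${}_0\partial_t^\alpha(\mathbf u_h-\mathbf u^0)+\mathbf A\mathbf u_h=\mathbf f$ on $(0,T]$, where ${}_0\partial_t^\alpha v=\frac1{\Gamma(1-\alpha)}\frac{d}{dt}\int_0^t(t-\xi)^{-\alpha}v(\xi)\,d\xi$; explicitly $$\mathbf u_h(t)=\frac1{2\pi\mathbf i}\int_{\Gamma_\theta}e^{zt}z^{\alpha-1}(z^\alpha+\mathbf A)^{-1}\mathbf u^0\,dz+\frac1{2\pi\mathbf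 i}\int_{\Gamma_\theta}e^{zt}(z^\alpha+\mathbf A)^{-1}\tilde{\mathbf f}(z)\,dz,$$ with $\tilde{\mathbf f}$ the Laplace transform and $\Gamma_\theta=\{z\in\mathbb C:|\arg z|=\theta,|z|>0\}$, $\theta\in(\pi/2,\pi)$, oriented with increasing imaginary part. $\overline{SBD}$ scheme: $L\in\mathbb N^*$, $\tau=T/L$, $t_n=n\tau$, $\mathbf f^n=\mathbf f(t_n)$, $\mathbf u_{2,h}^{-1}=\mathbf u_{2,h}^0=\mathbf u^0$, and for $n=1,\dots,L$ $$\frac{\sum_{k=0}^{n-1}g_k^{(\alpha)}(\mathbf u_{2,h}^{n-k}-\mathbf u^0)-\sum_{k=0}^{n-2}g_k^{(\alpha)}(\mathbf u_{2,h}^{n-1-k}-\mathbf u^0)}{\tau}+\frac{\mathbf A(3\mathbf u_{2,h}^n+\mathbf u_{2,h}^{n-2})}{4}=\frac{\mathbf f^{n-1}+\mathbf f^n}{2},$$ where the weights are defined by the generating function $\sum_{k=0}^\infty g_k^{(\alpha)}\xi^k=\left(\frac{(1-\xi)+(1-\xi)^2/2}{\tau}\right)^{\alpha-1}$. Discrete norm: for $\mathbf v\in\mathbb R^M$, $\|\mathbf v\|_{l^2}^2=\frac1M\sum_{k=1}^Mv_k^2$. *)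

(* Defs.v *)
From HB Require Import structures.
From mathcomp Require Import all_boot all_order all_algebra.
From mathcomp Require Import all_classical all_reals all_analysis.
Set Implicit Arguments.
Unset Strict Implicit.
Unset Printing Implicit Defensive.
Import Order.TTheory GRing.Theory Num.Theory.
Import numFieldNormedType.Exports.
Local Open Scope classical_set_scope.
Local Open Scope ring_scope.

(* Built on MathComp-Analysis, over an arbitrary [R : realType]. *)

(* For M = 0 this is 0, because 0^-1 = 0 in R. *)
Definition l2norm (R : realType) (M : nat) (v : 'cV[R]_M) : R :=
  Num.sqrt (M%:R^-1 * \sum_(k < M) v k 0 ^+ 2).

(* Rows and columns are numbered from 0, which does not affect w_{i,j}. *)
Definition fdmatrix (R : realType) (N : nat) : 'M[R]_N.-1 :=
  \matrix_(i, j) (N%:R ^+ 2 *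
    (if i == j :> nat then 2
     else if (i == j.+1 :> nat) || (j == i.+1 :> nat) then -1 else 0)).

Definition Gamma (R : realType) (a : R) : R :=
  (\int[@lebesgue_measure R]_(x in `]0, +oo[) (x `^ (a - 1) * expR (- x)))%R.

(* [d] is the derivative at [t] of the restriction of [F] to [D]: two-sided
   when [t] is interior to [D], one-sided at an endpoint of an interval. *)
Definition is_derive_in (R : realType) (D : set R) (F : R -> R) (t d : R) :=
  (fun s => (F s - F t) / (s - t)) @ within D (t^') --> d.

(* [d] is the Riemann-Liouville derivative of order alpha of v at t, for v
   defined on [0, T].  The integrand takes a junk value at xi = t only, which
   is a null set. *)
Definition is_RLderive (R : realType) (alpha T : R) (v : R -> R) (t d : R) :=
  exists2 l : R,
    is_derive_in `[0, T]
      (fun s => (\int[@lebesgue_measure R]_(xi in `[0%R, s])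
                   ((s - xi) `^ (- alpha) * v xi))%R) t l
    & d = (Gamma (1 - alpha))^-1 * l.

(* [u] is the solution on [0, T] of the semi-discrete problem.  Without a
   requirement at t = 0 the equation on ]0, T] alone has other solutions,
   singular like t^(alpha - 1).  Among functions continuous on [0, T] the
   solution is unique, and then u(0) = u0 follows from the equation. *)
Definition semidiscrete_solution (R : realType) (alpha T : R) (N : nat)
    (f : R -> 'cV[R]_N.-1) (u0 : 'cV[R]_N.-1) (u : R -> 'cV[R]_N.-1) : Prop :=
  (forall i, {within `[0, T], continuous (fun t => u t i 0)}) /\
  forall t, 0 < t <= T ->
    exists2 d : 'cV[R]_N.-1,
      (forall i, is_RLderive alpha T (fun xi => (u xi - u0) i 0) t (d i 0))
      & d + fdmatrix R N *m u t = f t.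

(* The generating function at real |xi| < 1, where its base is positive and
   its power series converges; this determines the coefficients. *)
Definition sbd_weights (R : realType) (alpha tau : R) (g : nat -> R) : Prop :=
  forall xi : R, `|xi| < 1 ->
    series (fun k => g k * xi ^+ k) @ \oo -->
      (((1 - xi) + (1 - xi) ^+ 2 / 2) / tau) `^ (alpha - 1).

(* [u n] is u^n, for integer n >= -1. *)
Definition sbd_solution (R : realType) (alpha T : R) (N L : nat)
    (f : R -> 'cV[R]_N.-1) (u0 : 'cV[R]_N.-1) (u : int -> 'cV[R]_N.-1) : Prop :=
  let tau := T / L%:R in
  [/\ u (-1) = u0, u 0 = u0 &
    exists2 g : nat -> R, sbd_weights alpha tau g &
    forall n : nat, (1 <= n <= L)%N ->
      tau^-1 *: (\sum_(0 <= k < n) g k *: (u (n%:Z - k%:Z) - u0)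
                 - \sum_(0 <= k < n.-1) g k *: (u (n%:Z - 1 - k%:Z) - u0))
      + 4^-1 *: (fdmatrix R N *m (3 *: u n%:Z + u (n%:Z - 2)))
      = 2^-1 *: (f ((n%:R - 1) * tau) + f (n%:R * tau))].

(* Main.v *)
Require Import Defs.
From HB Require Import structures.
From mathcomp Require Import all_boot all_order all_algebra.
From mathcomp Require Import all_classical all_reals all_analysis.
From mathcomp Require Import measurable_realfun.
From mathcomp.real_closed Require Import complex.
From mathcomp Require Import ring lra separable cyclic cyclotomic.
Import Order.TTheory GRing.Theory Num.Theory.
Import numFieldNormedType.Exports.
Import ComplexField.Normc.
Local Open Scope ring_scope.
Set Implicit Arguments.
Unset Strict Implicit.
Unset Printing Implicit Defensive.

(** Both evolutions decouple in the orthonormal basis of discrete sine vectors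
    ([sine_mx_eig], [sine_mx_parseval]), and [tau / t_n = 1 / n].  Hence everything
    reduces to a bound [C |v0| / n^2] for the scalar problem with an eigenvalue
    [lam > 0], uniform in [lam] and [tau] ([scalar_error]).

    Put [s = 1 - alpha] and [mu = lam tau^alpha].  Writing [U_n = v0 (1 + V_n)], the
    scalar scheme is the identity of formal power series
    [((1 - x) delta^(-s) + mu (3 + x^2) / 4) V = - mu x / (1 - x)] with
    [delta = (1 - x) (3 - x) / 2], so that [V = sbd_dev s mu] depends on [mu] only
    ([sbd_scheme_dev]).

    The error is not estimated on contour integrals: the scheme is compared with itself
    at half the step, that is, [V_n] for [mu] with [V_2n] for [mu / 2^alpha]
    ([sbd_halving]).  The generating function of the difference has a third logarithmic
    derivative of order [|1 - z|^(-2)] in the unit disc, because the relative consistency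
    error of [delta] is quadratic at [z = 1] and because the symbol satisfies a sector
    condition; Cauchy's estimate on the circle of radius [n / (n + 1)] then bounds the
    difference by [C / n^2], uniformly in [mu] ([coef_decay]).  Halving infinitely often
    sums a geometric series ([sbd_halvings]), so it only remains to know that the scheme
    converges, without any rate.

    Convergence goes through backward Euler convolution quadrature, which is [O(1 / k)]
    close to the scheme at index [k] ([sbd_be_close]) and is satisfied exactly by averages
    of the exact solution: integrating the Volterra form of the equation against the gamma
    densities [p (p t)^k e^(-p t) / k!] turns convolutions into Cauchy products
    ([conv_avg]) and the kernel [t^(-alpha)] into the coefficients of [(1 - x)^(-s)]
    ([gamma_pdf_avg]).  These densities concentrate at [k / p] ([wavg_concentration]).
    As the equation is only known up to time [T], the averaged equation has a residual;
    it is exponentially small for [k <= r^2 p T] with [r < 1], by a Chernoff argument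
    ([gamma_pdf_tilt], [residual_bound]), and the coercivity of the symbol absorbs it
    ([energy_bound], [wavg_be_dev]).  This gives the estimate at time [r^2 t_n], and
    continuity in time and in [mu] gives it at [t_n]. *)

(** * Formal power series *)

(** Convergence is kept apart: the discrete equations are solved coefficientwise. *)
Definition fps (A : Type) := nat -> A.

Section FormalPowerSeries.
Variable A : comNzRingType.
Implicit Types f g h : fps A.

HB.instance Definition _ := GRing.Zmodule.copy (fps A) (nat -> A).

Definition fps_one : fps A := fun n => (n == 0%N)%:R.
Definition fps_mul f g : fps A := fun n => \sum_(i < n.+1) f i * g (n - i)%N.

(* A coefficient of a product only sees truncations of the factors, so that the ring
   axioms are inherited from polynomials. *)
Let trunc n f : {poly A} := \poly_(i < n.+1) f i.

Let fps_mul_trunc n m f g : (m <= n)%N -> fps_mul f g m = (trunc n f * trunc n g)`_m.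
Proof.
move=> mn; rewrite coefM; apply: eq_bigr => i _.
rewrite !coef_poly ltnS (leq_trans (leq_ord i) mn).
by rewrite ltnS (leq_trans (leq_subr _ _) mn).
Qed.

Let trunc_mul n m f g : (m <= n)%N ->
  (trunc n (fps_mul f g))`_m = (trunc n f * trunc n g)`_m.
Proof. by move=> mn; rewrite coef_poly ltnS mn (fps_mul_trunc _ _ mn). Qed.

Let fps_mulC : commutative fps_mul.
Proof. by move=> f g; apply/funext => n; rewrite !(fps_mul_trunc _ _ (leqnn n)) mulrC. Qed.

Let fps_mulA : associative fps_mul.
Proof.
move=> f g h; apply/funext => n; rewrite !(fps_mul_trunc _ _ (leqnn n)).
rewrite (_ : _`_n = (trunc n f * (trunc n g * trunc n h))`_n); last first.
  by rewrite !coefM; apply: eq_bigr => i _; rewrite trunc_mul// leq_subr.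
rewrite mulrA !coefM; apply: eq_bigr => i _.
by rewrite trunc_mul// leq_ord.
Qed.

Let fps_mul1 : left_id fps_one fps_mul.
Proof.
move=> f; apply/funext => n; rewrite /fps_mul big_ord_recl /fps_one eqxx mul1r subn0.
by rewrite big1 ?addr0// => i _; rewrite mul0r.
Qed.

Let fps_mulDl : left_distributive fps_mul +%R.
Proof.
move=> f g h; apply/funext => n.
rewrite [RHS](_ : _ = fps_mul f h n + fps_mul g h n)// /fps_mul -big_split/=.
by apply: eq_bigr => i _; rewrite -mulrDl.
Qed.

Let fps_one_neq0 : fps_one != 0.
Proof.
apply/eqP => /(congr1 (fun f => f 0%N)) /eqP.
by rewrite /fps_one eqxx [X in _ == X](_ : _ = 0)// oner_eq0.
Qed.

HB.instance Definition _ := GRing.Zmodule_isComNzRing.Build (fps A)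
  fps_mulA fps_mulC fps_mul1 fps_mulDl fps_one_neq0.

Definition fpsC (a : A) : fps A := fun n => if n is 0 then a else 0.
Definition fpsX : fps A := fun n => (n == 1%N)%:R.

Lemma fpsME f g n : (f * g) n = \sum_(i < n.+1) f i * g (n - i)%N.
Proof. by []. Qed.
Lemma fpsDE f g n : (f + g) n = f n + g n. Proof. by []. Qed.
Lemma fpsNE f n : (- f) n = - f n. Proof. by []. Qed.
Lemma fpsBE f g n : (f - g) n = f n - g n. Proof. by []. Qed.
Lemma fps1E n : (1 : fps A) n = (n == 0%N)%:R. Proof. by []. Qed.

Lemma fpsCM a f n : (fpsC a * f) n = a * f n.
Proof.
rewrite fpsME big_ord_recl subn0 big1 ?addr0//= => i _.
by rewrite /fpsC/= mul0r.
Qed.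

Lemma fpsXM f n : (fpsX * f) n = if n is m.+1 then f m else 0.
Proof.
rewrite fpsME; case: n => [|n]; first by rewrite big_ord1 mul0r.
rewrite 2!big_ord_recl mul0r add0r big1 => [|i _]; last by rewrite mul0r.
by rewrite /= mul1r addr0 subSS subn0.
Qed.

Lemma fpsC1 : fpsC 1 = 1. Proof. by apply/funext => -[]. Qed.
Lemma fpsC0 : fpsC 0 = 0. Proof. by apply/funext => -[]. Qed.
Lemma fpsCD a b : fpsC (a + b) = fpsC a + fpsC b.
Proof. by apply/funext => -[|n]; rewrite fpsDE//= addr0. Qed.
Lemma fpsCN a : fpsC (- a) = - fpsC a.
Proof. by apply/funext => -[|n]; rewrite fpsNE//= oppr0. Qed.
Lemma fpsCM2 a b : fpsC (a * b) = fpsC a * fpsC b.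
Proof. by apply/funext => n; rewrite fpsCM; case: n => [|n]//=; rewrite mulr0. Qed.
Lemma fpsCn n : fpsC n%:R = n%:R.
Proof. by elim: n => [|n IH]; rewrite ?fpsC0// !mulrS fpsCD fpsC1 IH. Qed.

Lemma fps_mul0 f g : (f * g) 0%N = f 0%N * g 0%N.
Proof. by rewrite fpsME big_ord1. Qed.

End FormalPowerSeries.

(** The coefficients of the quotient solve a triangular system whose diagonal entry is
    the constant term. *)
Lemma fps_div (F : fieldType) (q y : fps F) : q 0%N != 0 -> exists x : fps F, q * x = y.
Proof.
move=> q0.
pose step (l : seq F) : F :=
  (y (size l) - \sum_(i < size l) q (size l - i)%N * nth 0 l i) / q 0%N.
pose pre := fix pre n : seq F := if n is m.+1 then rcons (pre m) (step (pre m)) else [::].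
have szp n : size (pre n) = n by elim: n => //= n IH; rewrite size_rcons IH.
pose x : fps F := fun n => step (pre n).
have prex n i : (i < n)%N -> nth 0 (pre n) i = x i.
  elim: n => //= n IH; rewrite ltnS leq_eqVlt nth_rcons szp => /orP[/eqP->|lin].
    by rewrite ltnn eqxx.
  by rewrite lin IH.
exists x; apply/funext => n.
rewrite mulrC fpsME big_ord_recr/= subnn [X in _ + X * _]/x /step szp.
rewrite (eq_bigr (fun i : 'I_n => q (n - i)%N * nth 0 (pre n) i)); last first.
  by move=> i _; rewrite prex// mulrC.
by rewrite mulfVK// addrC subrK.
Qed.

Lemma fps_mulI (F : fieldType) (q x y : fps F) : q 0%N != 0 -> q * x = q * y -> x = y.
Proof.
move=> q0 /eqP; rewrite -subr_eq0 -mulrBr => /eqP qxy.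
suff d0 n : (x - y) n = 0.
  by apply/funext => n; apply/eqP; rewrite -subr_eq0 -fpsBE d0.
elim/ltn_ind: n => n IH.
have := congr1 (fun f : fps F => f n) qxy.
rewrite fpsME big_ord_recl subn0 big1 ?addr0 => [/eqP|i _].
  by rewrite mulf_eq0 (negbTE q0)/= => /eqP.
by rewrite /= IH ?mulr0// /bump/= add1n; rewrite ltn_subrL/= (leq_ltn_trans _ (ltn_ord i)).
Qed.

Lemma fps_mul_eq (A : comNzRingType) (f g g' : fps A) n :
  (forall i, (i <= n)%N -> g i = g' i) -> (f * g) n = (f * g') n.
Proof. by move=> e; rewrite !fpsME; apply: eq_bigr => i _; rewrite e// leq_subr. Qed.

(** The formal derivative, which turns an ODE for jets into a recurrence. *)
Definition fderiv (A : comNzRingType) (f : fps A) : fps A := fun n => f n.+1 *+ n.+1.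

Lemma fderivM (A : comNzRingType) (f g : fps A) :
  fderiv (f * g) = fderiv f * g + f * fderiv g.
Proof.
apply/funext => n.
pose t m (h : fps A) : {poly A} := \poly_(i < m) h i.
have tM m (h k : fps A) : (h * k) m = (t m.+1 h * t m.+1 k)`_m.
  rewrite coefM; apply: eq_bigr => i _; rewrite !coef_poly ltnS leq_ord.
  by rewrite ltnS leq_subr.
have tM' m (h k : fps A) : (fderiv h * k) m = ((t m.+2 h)^`() * t m.+2 k)`_m.
  rewrite coefM; apply: eq_bigr => i _; rewrite coef_deriv !coef_poly.
  by rewrite !ltnS leq_ord (leq_trans (leq_subr _ _))// leqnSn.
rewrite /fderiv tM -coef_deriv derivM coefD fpsDE -tM' [f * _]mulrC.
by rewrite (mulrC (t _ f)) -tM'.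
Qed.

(** * Evaluation of power series inside the unit disc *)

Section Evaluation.
Local Open Scope classical_set_scope.
Local Open Scope ring_scope.
Variable R : realType.
Local Notation C := R[i].
Implicit Types (f g : fps C) (z w : C) (rho : R).

Lemma normc_ge0 z : 0 <= normc z. Proof. by case: z => a b; exact: sqrtr_ge0. Qed.
Lemma normcX z n : normc (z ^+ n) = normc z ^+ n.
Proof. by elim: n => [|n IH]; rewrite ?normc1// !exprS normcM IH. Qed.
Lemma normc_real (a : R) : normc a%:C%C = `|a|.
Proof. by rewrite /normc/= expr0n addr0 sqrtr_sqr. Qed.
Lemma normc_realp (a : R) : 0 <= a -> normc a%:C%C = a.
Proof. by move=> a0; rewrite normc_real ger0_norm. Qed.
Lemma normc_nat n : normc (n%:R : C) = n%:R.
Proof.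
have -> : (n%:R : C) = (n%:R : R)%:C%C by rewrite rmorph_nat.
by rewrite normc_realp.
Qed.
Lemma normcB z w : normc (z - w) <= normc z + normc w.
Proof. by rewrite -(normcN w); exact: le_normcD. Qed.
Lemma normcBC z w : normc (z - w) = normc (w - z).
Proof. by rewrite -normcN opprB. Qed.
Lemma le_normcB z w : normc z - normc w <= normc (z - w).
Proof. by rewrite lerBlDr; apply: le_trans (le_normcD _ _); rewrite subrK. Qed.
Lemma normc_eq0 z : (normc z == 0) = (z == 0).
Proof. by apply/eqP/eqP => [/eq0_normc//|->]; exact: normc0. Qed.
Lemma normc_gt0 z : (0 < normc z) = (z != 0).
Proof. by rewrite lt0r normc_ge0 andbT normc_eq0. Qed.
Lemma normc_sum I (r : seq I) (P : pred I) (F : I -> C) :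
  normc (\sum_(i <- r | P i) F i) <= \sum_(i <- r | P i) normc (F i).
Proof.
elim/big_rec2 : _ => [|i a b _ h]; first by rewrite normc0.
by apply: le_trans (le_normcD _ _) _; rewrite lerD2l.
Qed.
Lemma normc_Re z : `|complex.Re z| <= normc z.
Proof.
case: z => a b /=; rewrite -(sqrtr_sqr a) ler_wsqrtr// lerDl sqr_ge0//.
Qed.
Lemma normc_Im z : `|complex.Im z| <= normc z.
Proof.
case: z => a b /=; rewrite -(sqrtr_sqr b) ler_wsqrtr// lerDr sqr_ge0//.
Qed.
Lemma normc_le z : normc z <= `|complex.Re z| + `|complex.Im z|.
Proof.
rewrite -ler_sqr ?nnegrE ?addr_ge0 ?normc_ge0//; case: z => a b /=.
rewrite sqr_sqrtr ?addr_ge0 ?sqr_ge0// sqrrD !real_normK ?num_real//.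
by rewrite -addrA lerD2l lerDr mulrn_wge0// mulr_ge0.
Qed.
Lemma normc_conj z : normc (conjc z) = normc z.
Proof. by case: z => a b; rewrite /normc/= sqrrN. Qed.
Lemma mulc_conj z : z * conjc z = (normc z ^+ 2)%:C%C.
Proof.
case: z => a b; rewrite /normc/= sqr_sqrtr ?addr_ge0 ?sqr_ge0//.
by apply/eqP; rewrite eq_complex/=; apply/andP; split; apply/eqP; ring.
Qed.
Lemma cReM z w : complex.Re (z * w) =
  complex.Re z * complex.Re w - complex.Im z * complex.Im w.
Proof. by case: z w => a b [c d]. Qed.
Lemma cImM z w : complex.Im (z * w) =
  complex.Re z * complex.Im w + complex.Im z * complex.Re w.
Proof. by case: z w => a b [c d]. Qed.
Lemma cReD z w : complex.Re (z + w) = complex.Re z + complex.Re w.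
Proof. by case: z w => a b [c d]. Qed.
Lemma cImD z w : complex.Im (z + w) = complex.Im z + complex.Im w.
Proof. by case: z w => a b [c d]. Qed.
Lemma cReN z : complex.Re (- z) = - complex.Re z.
Proof. by case: z => a b. Qed.
Lemma cImN z : complex.Im (- z) = - complex.Im z.
Proof. by case: z => a b. Qed.
Lemma cRe_sum I (r : seq I) (P : pred I) (F : I -> C) :
  complex.Re (\sum_(i <- r | P i) F i) = \sum_(i <- r | P i) complex.Re (F i).
Proof. by elim/big_rec2 : _ => //= i a b _ <-; rewrite cReD. Qed.
Lemma cIm_sum I (r : seq I) (P : pred I) (F : I -> C) :
  complex.Im (\sum_(i <- r | P i) F i) = \sum_(i <- r | P i) complex.Im (F i).
Proof. by elim/big_rec2 : _ => //= i a b _ <-; rewrite cImD. Qed.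

Definition ccvg (S : nat -> C) (l : C) := (fun n => normc (S n - l)) @ \oo --> (0 : R).

Lemma ccvg_bound S l (e : nat -> R) :
  (forall n, normc (S n - l) <= e n) -> e @ \oo --> (0 : R) -> ccvg S l.
Proof.
move=> h e0; apply: (squeeze_cvgr _ (cvg_cst _) e0).
by apply: nearW => n; rewrite normc_ge0 h.
Qed.

Lemma ccvg_unique S l m : ccvg S l -> ccvg S m -> l = m.
Proof.
move=> hl hm; apply/eqP; rewrite -subr_eq0 -normc_eq0.
have h : (fun n => normc (S n - l) + normc (S n - m)) @ \oo --> (0 : R).
  by rewrite -[0]addr0; exact: cvgD.
rewrite eq_le normc_ge0 andbT.
have hc : (fun=> normc (l - m)) @ \oo --> normc (l - m) by exact: cvg_cst.
rewrite -(cvg_lim _ h)// -(cvg_lim _ hc)//.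
apply: ler_lim; [by apply/cvg_ex; eexists; exact: hc|by apply/cvg_ex; eexists; exact: h|].
apply: nearW => n; rewrite [normc (S n - l)]normcBC.
by apply: le_trans (le_normcD _ _); rewrite addrA subrK.
Qed.

Lemma ccvgD S T l m : ccvg S l -> ccvg T m -> ccvg (fun n => S n + T n) (l + m).
Proof.
move=> hl hm; apply: (@ccvg_bound _ _ (fun n => normc (S n - l) + normc (T n - m))).
  by move=> n; rewrite opprD addrACA le_normcD.
by rewrite -[0]addr0; exact: cvgD.
Qed.

Lemma ccvgZ (a : C) S l : ccvg S l -> ccvg (fun n => a * S n) (a * l).
Proof.
move=> hl; apply: (@ccvg_bound _ _ (fun n => normc a * normc (S n - l))).
  by move=> n; rewrite -mulrBr normcM.
by rewrite -(mulr0 (normc a)); apply: cvgMr.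
Qed.

Lemma ccvg_cst l : ccvg (fun=> l) l.
Proof. by rewrite /ccvg subrr normc0; exact: cvg_cst. Qed.

Lemma ccvg_le S l (B : R) : ccvg S l -> (\forall n \near \oo, normc (S n) <= B) -> normc l <= B.
Proof.
move=> hl hB; have h : (fun n => normc (S n - l) + B) @ \oo --> (0 + B : R).
  by apply: cvgD => //; exact: cvg_cst.
have hc : (fun=> normc l) @ \oo --> normc l by exact: cvg_cst.
rewrite -(add0r B) -(cvg_lim _ h)// -(cvg_lim _ hc)//.
apply: ler_lim; [by apply/cvg_ex; eexists; exact: hc|by apply/cvg_ex; eexists; exact: h|].
near=> n; rewrite normcBC -lerBlDl.
apply: (@le_trans _ _ (normc (S n))); last by near: n.
by rewrite lerBlDr; apply: le_trans (le_normcD _ _); rewrite addrC subrK.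
Unshelve. all: by end_near. Qed.

(** Absolute convergence is expressed by bounded partial sums, which is the form that
    comparison arguments produce. *)
Definition abssum rho f := exists B, forall N, \sum_(n < N) normc (f n) * rho ^+ n <= B.
Definition indisc f := forall rho, 0 <= rho < 1 -> abssum rho f.

(** Real and imaginary parts are summed separately, which gives access to the theory of
    real series and a value for every series. *)
Definition ev z f : C :=
  (limn (series (fun n => complex.Re (f n * z ^+ n))) +i*
   limn (series (fun n => complex.Im (f n * z ^+ n))))%C.

Lemma abssum_cvg rho f : 0 <= rho -> abssum rho f ->
  cvgn (series (fun n => normc (f n) * rho ^+ n)).
Proof.
move=> r0 [B hB]; apply: nondecreasing_is_cvgn.
  apply: nondecreasing_series => n _ _; by rewrite mulr_ge0 ?normc_ge0 ?exprn_ge0.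
by exists B => _ [n _ <-]; rewrite /series/= big_mkord.
Qed.

Lemma ev_cvg_abs z f : abssum (normc z) f ->
  ccvg (fun N => \sum_(n < N) f n * z ^+ n) (ev z f).
Proof.
move=> h; have hc := abssum_cvg (normc_ge0 z) h.
pose F (p : C -> R) := series (fun n => p (f n * z ^+ n)).
have Fc (p : C -> R) : (forall w, `|p w| <= normc w) -> cvgn (F p).
  move=> pn; apply: normed_cvg; apply: series_le_cvg hc => n /=.
  - by [].
  - by rewrite mulr_ge0 ?normc_ge0 ?exprn_ge0 ?normc_ge0.
  - by rewrite -normcX -normcM.
have c1 := Fc _ normc_Re; have c2 := Fc _ normc_Im.
apply: (@ccvg_bound _ _ (fun n => `|F (@complex.Re R) n - limn (F (@complex.Re R))| +
     `|F (@complex.Im R) n - limn (F (@complex.Im R))|)).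
  move=> n; apply: le_trans (normc_le _) _.
  by rewrite cReD cImD cReN cImN cRe_sum cIm_sum /F /series/= !big_mkord.
have z0 (u : R^nat) : cvgn u -> (fun n => `|u n - limn u|) @ \oo --> (0 : R).
  move=> hu; have hs : (fun n => u n - limn u) @ \oo --> limn u - limn u.
    by apply: cvgB => //; exact: cvg_cst.
  by rewrite -(@normr0 _ R) -(subrr (limn u)); exact: cvg_norm hs.
by rewrite -[0]addr0; apply: cvgD; exact: z0.
Qed.

Lemma ev_cvg z f : normc z < 1 -> indisc f ->
  ccvg (fun N => \sum_(n < N) f n * z ^+ n) (ev z f).
Proof. by move=> z1 hf; apply: ev_cvg_abs; apply: hf; rewrite normc_ge0. Qed.

Lemma evP z f l : normc z < 1 -> indisc f ->
  ccvg (fun N => \sum_(n < N) f n * z ^+ n) l -> ev z f = l.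
Proof. by move=> z1 hf; apply: ccvg_unique; exact: ev_cvg. Qed.

Lemma ev_finite f m z : normc z < 1 -> (forall n, (m <= n)%N -> f n = 0) ->
  indisc f /\ ev z f = \sum_(n < m) f n * z ^+ n.
Proof.
move=> z1 h.
have e (A : zmodType) (F : nat -> A) N : (forall n, (m <= n)%N -> F n = 0) -> (m <= N)%N ->
    \sum_(n < N) F n = \sum_(n < m) F n.
  move=> hF mN; rewrite -!(big_mkord xpredT) (@big_cat_nat _ _ _ m)//=.
  by rewrite [X in _ + X](_ : _ = 0) ?addr0// big_nat_cond big1// => i /andP[/andP[/hF]].
have hf : indisc f.
  move=> rho /andP[r0 r1]; exists (\sum_(n < m) normc (f n) * rho ^+ n) => N.
  have p0 n : 0 <= normc (f n) * rho ^+ n by rewrite mulr_ge0 ?normc_ge0 ?exprn_ge0.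
  rewrite -(e _ (fun n => normc (f n) * rho ^+ n) (maxn m N)) ?leq_maxl//; last first.
    by move=> n /h ->; rewrite normc0 mul0r.
  rewrite -!(big_mkord xpredT (fun n => normc (f n) * rho ^+ n)).
  by rewrite (@big_cat_nat _ _ _ N _ (maxn m N))//= ?leq_maxr// lerDl sumr_ge0.
split=> //; apply: evP => //; rewrite /ccvg.
apply: cvg_near_cst.
exists m => // N /= mN; rewrite (e _ (fun n => f n * z ^+ n)) ?subrr ?normc0// => n /h ->; by rewrite mul0r.
Qed.

Lemma indiscD f g : indisc f -> indisc g -> indisc (f + g).
Proof.
move=> hf hg rho hr; have [B hB] := hf _ hr; have [D hD] := hg _ hr.
exists (B + D) => N; apply: le_trans (lerD (hB N) (hD N)).
rewrite -big_split/= ler_sum// => i _; rewrite -mulrDl ler_wpM2r ?le_normcD//.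
by case/andP: hr => r0 _; rewrite exprn_ge0.
Qed.

Lemma indiscN f : indisc f -> indisc (- f).
Proof.
move=> hf rho hr; have [B hB] := hf _ hr; exists B => N.
by apply: le_trans (hB N); rewrite ler_sum// => i _; rewrite normcN.
Qed.

Lemma indiscB f g : indisc f -> indisc g -> indisc (f - g).
Proof. by move=> hf hg; apply: indiscD => //; exact: indiscN. Qed.

Lemma evD z f g : normc z < 1 -> indisc f -> indisc g -> ev z (f + g) = ev z f + ev z g.
Proof.
move=> z1 hf hg; apply: evP => //; first exact: indiscD.
rewrite (_ : (fun N => _) = fun N => \sum_(n < N) f n * z ^+ n + \sum_(n < N) g n * z ^+ n).
  by apply: ccvgD; exact: ev_cvg.
by apply/funext => N; rewrite -big_split/=; apply: eq_bigr => i _; rewrite -mulrDl.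
Qed.

Lemma indiscC a : indisc (fpsC a).
Proof.
have z1 : normc (0 : C) < 1 by rewrite normc0.
by case: (@ev_finite (fpsC a) 1 0 z1) => // -[|n].
Qed.

Lemma indiscX : indisc (fpsX C).
Proof.
have z1 : normc (0 : C) < 1 by rewrite normc0.
by case: (@ev_finite (fpsX C) 2 0 z1) => // -[|[|n]].
Qed.

Lemma sum_conv (A : comNzRingType) (f g : nat -> A) N :
  \sum_(n < N) \sum_(i < n.+1) f i * g (n - i)%N =
  \sum_(i < N) \sum_(j < N | (i + j < N)%N) f i * g j.
Proof.
rewrite (eq_bigr (fun n : 'I_N => \sum_(i < N | (i <= n)%N) f i * g (n - i)%N)); last first.
  move=> n _; rewrite (big_ord_widen_cond N xpredT (fun i => f i * g (n - i)%N))//.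
rewrite (exchange_big_dep xpredT)//=; apply: eq_bigr => i _.
rewrite -(big_mkord (fun n => (i <= n)%N) (fun n => f i * g (n - i)%N)).
rewrite -(big_mkord (fun j => (i + j < N)%N) (fun j => f i * g j)).
have iN := ltnW (ltn_ord i).
rewrite (@big_cat_nat _ _ _ i _ N)//= big_nat_cond big1 ?add0r; last first.
  by move=> j /andP[/andP[_ ji] ij]; rewrite leqNgt ji in ij.
rewrite -{1}(add0n (i : nat)) big_addn.
rewrite [RHS](@big_cat_nat _ _ _ (N - i)%N _ N)//= ?leq_subr// [X in _ + X]big_nat_cond.
rewrite [X in _ + X]big1 ?addr0; last first.
  move=> j /andP[/andP[h _]]; rewrite ltnNge => /negP[].
  by rewrite -leq_subLR.
rewrite big_nat_cond [RHS]big_nat_cond; apply: eq_big => [j|j _]; last by rewrite addnK.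
by rewrite leq_addl/= ltn_subRL; case: (i + j < N)%N.
Qed.

(** Comparing the triangle [i + j < N] with the square [i, j < N]. *)
Lemma sum_conv_le (a b : nat -> R) N : (forall n, 0 <= a n) -> (forall n, 0 <= b n) ->
  \sum_(n < N) \sum_(i < n.+1) a i * b (n - i)%N <= (\sum_(n < N) a n) * (\sum_(n < N) b n).
Proof.
move=> a0 b0; rewrite sum_conv mulr_suml ler_sum// => i _; rewrite mulr_sumr.
rewrite [X in X <= _]big_mkcond/= ler_sum// => j _.
by case: ifP => // _; rewrite mulr_ge0.
Qed.

Lemma sum_conv_dist f g N :
  normc (\sum_(n < N) (f * g) n - (\sum_(n < N) f n) * (\sum_(n < N) g n)) <=
  (\sum_(n < N) normc (f n)) * (\sum_(n < N) normc (g n)) -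
  \sum_(n < N) \sum_(i < n.+1) normc (f i) * normc (g (n - i)%N).
Proof.
rewrite (eq_bigr (fun n : 'I_N => \sum_(i < n.+1) f i * g (n - i)%N))//.
rewrite sum_conv (sum_conv (fun i => normc (f i)) (fun i => normc (g i))) normcBC.
have e (A : comNzRingType) (F G : nat -> A) : (\sum_(n < N) F n) * (\sum_(n < N) G n) -
    \sum_(i < N) \sum_(j < N | (i + j < N)%N) F i * G j =
    \sum_(i < N) \sum_(j < N | ~~ (i + j < N)%N) F i * G j.
  rewrite mulr_suml -sumrB; apply: eq_bigr => i _; rewrite mulr_sumr.
  by rewrite (bigID (fun j : 'I_N => (i + j < N)%N))/= addrAC subrr add0r.
rewrite e (e _ (fun i => normc (f i)) (fun i => normc (g i))); apply: le_trans (normc_sum _ _ _) _; apply: ler_sum => i _.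
by apply: le_trans (normc_sum _ _ _) _; apply: ler_sum => j _; rewrite normcM.
Qed.

Lemma indiscM f g : indisc f -> indisc g -> indisc (f * g).
Proof.
move=> hf hg rho /andP[r0 r1]; have hr : 0 <= rho < 1 by rewrite r0.
have [B hB] := hf _ hr; have [D hD] := hg _ hr.
pose a n := normc (f n) * rho ^+ n; pose b n := normc (g n) * rho ^+ n.
have a0 n : 0 <= a n by rewrite mulr_ge0 ?normc_ge0 ?exprn_ge0.
have b0 n : 0 <= b n by rewrite mulr_ge0 ?normc_ge0 ?exprn_ge0.
exists (B * D) => N.
apply: (@le_trans _ _ (\sum_(n < N) \sum_(i < n.+1) a i * b (n - i)%N)).
  apply: ler_sum => n _; rewrite fpsME.
  apply: (@le_trans _ _ ((\sum_(i < n.+1) normc (f i * g (n - i)%N)) * rho ^+ n)).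
    by rewrite ler_wpM2r ?exprn_ge0// normc_sum.
  rewrite mulr_suml ler_sum// => i _; rewrite normcM /a /b mulrACA -exprD subnKC//.
  by rewrite leq_ord.
apply: le_trans (sum_conv_le _ a0 b0) _; apply: ler_pM; rewrite ?sumr_ge0 ?hB ?hD//.
Qed.

(** The difference between the sums over a square and over a triangle is bounded by the
    same difference for absolute values, which tends to 0. *)
Lemma evM z f g : normc z < 1 -> indisc f -> indisc g -> ev z (f * g) = ev z f * ev z g.
Proof.
move=> z1 hf hg; have hz : 0 <= normc z < 1 by rewrite normc_ge0.
pose F : fps C := fun n => f n * z ^+ n; pose G : fps C := fun n => g n * z ^+ n.
have FG n : (f * g) n * z ^+ n = (F * G) n.
  rewrite !fpsME mulr_suml; apply: eq_bigr => i _.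
  by rewrite /F /G mulrACA -exprD subnKC// leq_ord.
pose a n := normc (F n); pose b n := normc (G n).
have a0 n : 0 <= a n by exact: normc_ge0.
have b0 n : 0 <= b n by exact: normc_ge0.
have ca : cvgn (series a).
  have := abssum_cvg (normc_ge0 z) (hf _ hz).
  by congr (cvgn (series _)); apply/funext => n; rewrite /a normcM normcX.
have cb : cvgn (series b).
  have := abssum_cvg (normc_ge0 z) (hg _ hz).
  by congr (cvgn (series _)); apply/funext => n; rewrite /b normcM normcX.
pose c n := \sum_(i < n.+1) a i * b (n - i)%N.
have c0 n : 0 <= c n by apply: sumr_ge0 => i _; rewrite mulr_ge0.
have sE (u : nat -> R) N : series u N = \sum_(n < N) u n by rewrite /series/= big_mkord.
have lab : series a N * series b N @[N --> \oo] --> limn (series a) * limn (series b).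
  exact: cvgM.
have c1 N : series c N <= series a N * series b N by rewrite !sE; exact: sum_conv_le.
have c2 N : series a N * series b N <= series c N.*2.
  rewrite !sE /c sum_conv mulr_suml.
  have h i : (i < N)%N -> a i * (\sum_(n < N) b n) <= \sum_(j < N.*2 | (i + j < N.*2)%N) a i * b j.
    move=> iN; rewrite mulr_sumr (big_ord_widen N.*2 (fun j => a i * b j)) ?leq_addl -?addnn ?leq_addr//.
    rewrite [X in X <= _]big_mkcond [X in _ <= X]big_mkcond/= ler_sum// => j _.
    case: ifP => jN; last by case: ifP => // _; rewrite mulr_ge0.
    by rewrite (leq_trans (_ : _ < i + N)%N) ?ltn_add2l// leq_add2r ltnW.
  apply: (@le_trans _ _ (\sum_(i < N) \sum_(j < N.*2 | (i + j < N.*2)%N) a i * b j)).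
    by apply: ler_sum => i _; exact: h.
  rewrite (big_ord_widen N.*2 (fun i => \sum_(j < N.*2 | (i + j < N.*2)%N) a i * b j)); last first.
    by rewrite -addnn leq_addr.
  rewrite [X in X <= _]big_mkcond/= ler_sum// => i _; case: ifP => // _.
  by apply: sumr_ge0 => j _; rewrite mulr_ge0.
have cc : cvgn (series c).
  apply: nondecreasing_is_cvgn; first exact: nondecreasing_series.
  have nda := nondecreasing_series (fun n (_ : (0 <= n)%N) (_ : xpredT n) => a0 n).
  have ndb := nondecreasing_series (fun n (_ : (0 <= n)%N) (_ : xpredT n) => b0 n).
  exists (limn (series a) * limn (series b)) => _ [n _ <-].
  apply: le_trans (c1 n) _; apply: ler_pM.
  - by rewrite sE sumr_ge0.
  - by rewrite sE sumr_ge0.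
  - exact: nondecreasing_cvgn_le.
  - exact: nondecreasing_cvgn_le.
have lc : limn (series c) = limn (series a) * limn (series b).
  apply/eqP; rewrite eq_le; apply/andP; split.
    rewrite -(cvg_lim _ lab)//; apply: ler_lim => //; last exact: nearW.
    by apply/cvg_ex; eexists; exact: lab.
  have h2 : series c N.*2 @[N --> \oo] --> limn (series c).
    apply: (cvg_comp (fun N => N.*2) (series c)) cc.
    by apply/cvgnyPge => A; exists A => // n /= An; rewrite -addnn (leq_trans An)// leq_addr.
  rewrite -(cvg_lim _ lab)// -(cvg_lim _ h2)//; apply: ler_lim.
  - by apply/cvg_ex; eexists; exact: lab.
  - by apply/cvg_ex; eexists; exact: h2.
  - exact: nearW.
apply: evP => //; first exact: indiscM.
pose SF N := \sum_(n < N) F n; pose SG N := \sum_(n < N) G n.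
have hF : ccvg SF (ev z f) by exact: ev_cvg.
have hG : ccvg SG (ev z g) by exact: ev_cvg.
apply: (@ccvg_bound _ _ (fun N => (series a N * series b N - series c N) +
   (series a N * normc (SG N - ev z g) + normc (SF N - ev z f) * normc (ev z g)))).
  move=> N; rewrite (eq_bigr (fun n : 'I_N => (F * G) n)); last by move=> n _; rewrite FG.
  rewrite (_ : _ - _ = (\sum_(n < N) (F * G) n - SF N * SG N) + (SF N * (SG N - ev z g) +
     (SF N - ev z f) * ev z g)); last by ring.
  apply: le_trans (le_normcD _ _) _; apply: lerD.
    by apply: le_trans (sum_conv_dist _ _ _) _; rewrite !sE.
  apply: le_trans (le_normcD _ _) _; rewrite !normcM lerD2r ler_wpM2r ?normc_ge0//.
  by rewrite sE; exact: normc_sum.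
rewrite (_ : 0 = (limn (series a) * limn (series b) - limn (series c)) +
   (limn (series a) * 0 + 0 * normc (ev z g))); last by rewrite lc; ring.
apply: cvgD; first exact: cvgB.
apply: cvgD; first exact: cvgM.
by apply: cvgM => //; exact: cvg_cst.
Qed.

End Evaluation.

(** * Jets along the logarithmic variable *)

Section Jets.
Variable R : realType.
Local Notation C := R[i].
Local Open Scope classical_set_scope.
Local Open Scope ring_scope.
Implicit Types (f g : fps C) (z w : C) (rho r : R).

Lemma indisc_scale f (a : C) : indisc f -> indisc (fun n => a * f n).
Proof.
move=> hf; rewrite (_ : (fun n => _) = (fpsC a * f : fps C)); last first.
  by apply/funext => n; rewrite fpsCM.
by apply: indiscM => //; exact: indiscC.
Qed.

Lemma ev_scale f (a : C) z : normc z < 1 -> indisc f -> ev z (fun n => a * f n) = a * ev z f.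
Proof.
move=> z1 hf; apply: evP => //; first exact: indisc_scale.
rewrite (_ : (fun N => _) = (fun N => a * \sum_(n < N) f n * z ^+ n)).
  by apply: ccvgZ; exact: ev_cvg.
by apply/funext => N; rewrite mulr_sumr; apply: eq_bigr => i _; rewrite mulrA.
Qed.

Lemma evB f g z : normc z < 1 -> indisc f -> indisc g -> ev z (f - g) = ev z f - ev z g.
Proof.
move=> z1 hf hg; rewrite evD//; last exact: indiscN.
congr (_ + _); rewrite -[RHS]mulN1r -ev_scale//; congr ev; apply/funext => n.
by rewrite fpsNE mulN1r.
Qed.

Lemma evC a z : normc z < 1 -> ev z (fpsC a) = a.
Proof.
move=> z1; have h n : (1 <= n)%N -> fpsC a n = 0 by case: n.
by have [_ ->] := ev_finite z1 h; rewrite big_ord1 expr0 mulr1.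
Qed.

Lemma ev1 z : normc z < 1 -> ev z 1 = 1.
Proof. by move=> z1; rewrite -fpsC1 evC. Qed.

Lemma evX z : normc z < 1 -> ev z (fpsX C) = z.
Proof.
move=> z1; have h n : (2 <= n)%N -> fpsX C n = 0 by case: n => [//|[//|n]].
by have [_ ->] := ev_finite z1 h; rewrite big_ord_recl big_ord1/= mul0r add0r mul1r expr1.
Qed.

Lemma indisc1 : indisc (1 : fps C).
Proof. by rewrite -fpsC1; exact: indiscC. Qed.

Lemma indisc_le f g (B : R) : (forall n, normc (g n) <= B * normc (f n)) -> indisc f -> indisc g.
Proof.
move=> h hf rho hr; have [D hD] := hf _ hr; exists (`|B| * D) => N.
apply: le_trans (_ : \sum_(n < N) `|B| * (normc (f n) * rho ^+ n) <= _).
  rewrite ler_sum// => i _; rewrite mulrA ler_wpM2r ?exprn_ge0//; first by case/andP: hr.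
  by apply: le_trans (h i) _; rewrite ler_wpM2r ?normc_ge0// ler_norm.
by rewrite -mulr_sumr ler_wpM2l.
Qed.

Lemma indisc_natmul f : indisc f -> indisc (fun n => f n * n%:R).
Proof.
move=> hf rho /andP[r0 r1]; pose s := (1 + rho) / 2.
have rs : rho < s by rewrite /s; lra.
have s1 : s < 1 by rewrite /s; lra.
have s0 : 0 <= s by lra.
have hs : 0 <= s < 1 by rewrite s0.
have [B hB] := hf s hs.
have key n : n%:R * (s - rho) * rho ^+ n <= s ^+ n.
    elim: n => [|n IH]; first by rewrite !mul0r expr0.
    have rsn : rho ^+ n <= s ^+ n by rewrite lerXn2r ?nnegrE// ltW.
    have sn0 : 0 <= s ^+ n by rewrite exprn_ge0.
    have rn0 : 0 <= rho ^+ n by rewrite exprn_ge0.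
    rewrite -natr1 !exprS.
    have h1 := ler_wpM2l r0 IH.
    have h2 : (s - rho) * (rho * rho ^+ n) <= (s - rho) * s ^+ n.
      apply: ler_wpM2l; first by lra.
      by apply: le_trans rsn; rewrite ler_piMl// ltW.
    lra.
exists (B / (s - rho)) => N; rewrite ler_pdivlMr ?subr_gt0//.
  apply: le_trans (hB N); rewrite mulr_suml ler_sum// => i _.
  rewrite normcM normc_nat.
  rewrite (_ : _ * _ * _ * _ = normc (f i) * (i%:R * (s - rho) * rho ^+ i)); last by ring.
by rewrite ler_wpM2l ?normc_ge0.
Qed.

(** The operator [theta^k / k!], where [theta = z d/dz]. *)
Definition theta_pow k f : fps C := fun n => f n * (n%:R ^+ k / k`!%:R).

Lemma indisc_theta_pow k f : indisc f -> indisc (theta_pow k f).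
Proof.
move=> hf; rewrite (_ : theta_pow k f = fun n => (k`!%:R)^-1 * (f n * n%:R ^+ k)); last first.
  by apply/funext => n; rewrite /theta_pow; ring.
apply: indisc_scale; elim: k => [|k IH].
  by rewrite (_ : (fun n => _) = f)//; apply/funext => n; rewrite expr0 mulr1.
rewrite (_ : (fun n => _) = (fun n => f n * n%:R ^+ k * n%:R)); first exact: indisc_natmul IH.
by apply/funext => n; rewrite exprSr mulrA.
Qed.

(** Taylor coefficients at [eps = 0] of [f (z * exp eps)]. *)
Definition jet z f : fps C := fun k => ev z (theta_pow k f).

Lemma fact_neq0 k : (k`!%:R : C) != 0.
Proof. by rewrite pnatr_eq0 -lt0n fact_gt0. Qed.

Lemma ev_sum m (F : 'I_m -> fps C) z : normc z < 1 -> (forall i, indisc (F i)) ->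
  indisc (\sum_i F i) /\ ev z (\sum_i F i) = \sum_i ev z (F i).
Proof.
move=> z1; elim: m F => [|m IH] F hF.
  rewrite !big_ord0; have [h1 h2] := @ev_finite R 0 0 z z1 (fun n _ => erefl).
  by split => //; rewrite h2 big_ord0.
have [h1 h2] := IH (fun i => F (widen_ord (leqnSn m) i)) (fun i => hF _).
rewrite !big_ord_recr/=; split; first exact: indiscD.
by rewrite evD// h2.
Qed.

Lemma fps_sumE (A : comNzRingType) I (s : seq I) (P : pred I) (F : I -> fps A) n :
  (\sum_(i <- s | P i) F i) n = \sum_(i <- s | P i) F i n.
Proof. by elim/big_rec2 : _ => // i a b _ <-. Qed.

(** On monomials this is the binomial expansion of [(i + j)^k]. *)
Lemma jetM z f g : normc z < 1 -> indisc f -> indisc g -> jet z (f * g) = jet z f * jet z g.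
Proof.
move=> z1 hf hg; apply/funext => k.
have -> : jet z (f * g) k =
    ev z (\sum_(a < k.+1) theta_pow a f * theta_pow (k - a) g).
  congr ev; apply/funext => n; rewrite fps_sumE /theta_pow fpsME mulr_suml.
  under [RHS]eq_bigr do rewrite fpsME.
  rewrite exchange_big/=; apply: eq_bigr => i _.
  rewrite (_ : \sum__ _ = f i * g (n - i)%N *
      \sum_(a < k.+1) ((i%:R : C) ^+ a / a`!%:R * ((n - i)%:R ^+ (k - a) / (k - a)`!%:R))); last first.
    by rewrite mulr_sumr; apply: eq_bigr => a _; ring.
  congr (_ * _); rewrite -{1}(subnK (leq_ord i)) natrD exprDn mulr_suml.
  apply: eq_bigr => a _; rewrite -mulr_natr.
  have ak := leq_ord a; have := bin_fact ak => /(congr1 (fun m => (m%:R : C))).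
  rewrite !natrM => e.
  have a0 := fact_neq0 a; have ka0 := fact_neq0 (k - a); have k0 := fact_neq0 k.
  have -> : ('C(k, a)%:R : C) = k`!%:R / (a`!%:R * (k - a)`!%:R).
    by rewrite -e mulfK// mulf_neq0.
  by field; rewrite a0 ka0 k0.
have [_ ->] := @ev_sum k.+1 (fun a : 'I_k.+1 => theta_pow a f * theta_pow (k - a) g) z z1
  (fun a => indiscM (indisc_theta_pow a hf) (indisc_theta_pow (k - a) hg)).
rewrite fpsME; apply: eq_bigr => a _.
by rewrite evM//; exact: indisc_theta_pow.
Qed.

Lemma jetD z f g : normc z < 1 -> indisc f -> indisc g -> jet z (f + g) = jet z f + jet z g.
Proof.
move=> z1 hf hg; apply/funext => k; rewrite fpsDE /jet -evD//; try exact: indisc_theta_pow.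
by congr ev; apply/funext => n; rewrite /theta_pow !fpsDE mulrDl.
Qed.

Lemma jetN z f : normc z < 1 -> indisc f -> jet z (- f) = - jet z f.
Proof.
move=> z1 hf; apply/funext => k; rewrite fpsNE -[RHS]mulN1r /jet -ev_scale//; last exact: indisc_theta_pow.
by congr ev; apply/funext => n; rewrite /theta_pow fpsNE mulN1r mulNr.
Qed.

Lemma jetB z f g : normc z < 1 -> indisc f -> indisc g -> jet z (f - g) = jet z f - jet z g.
Proof. by move=> z1 hf hg; rewrite jetD ?jetN//; exact: indiscN. Qed.

Lemma jetC z a : normc z < 1 -> jet z (fpsC a) = fpsC a.
Proof.
move=> z1; apply/funext => k; rewrite /jet.
have h n : (1 <= n)%N -> theta_pow k (fpsC a) n = 0 by case: n => // n _; rewrite /theta_pow mul0r.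
have [_ ->] := @ev_finite R _ 1 z z1 h.
rewrite big_ord1 expr0 mulr1 /theta_pow/=; case: k {h} => [|k]; last by rewrite expr0n mul0r mulr0.
by rewrite expr0 fact0 divr1 mulr1.
Qed.

Lemma jetX z k : normc z < 1 -> jet z (fpsX C) k = z / k`!%:R.
Proof.
move=> z1; rewrite /jet.
have h n : (2 <= n)%N -> theta_pow k (fpsX C) n = 0.
  by case: n => [//|[//|n]] _; rewrite /theta_pow mul0r.
have [_ ->] := @ev_finite R _ 2 z z1 h.
by rewrite big_ord_recl big_ord1/= /theta_pow/= expr1n mul0r mul0r add0r mul1r expr1 mul1r mulrC.
Qed.

Lemma jet0 z f : jet z f 0%N = ev z f.
Proof. by congr ev; apply/funext => n; rewrite /theta_pow expr0 fact0 divr1 mulr1. Qed.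

Lemma jet_fderiv z f : normc z < 1 -> indisc f ->
  fderiv (jet z f) = jet z (fun n => n%:R * f n).
Proof.
move=> z1 hf; apply/funext => k; rewrite /fderiv -mulr_natl /jet -ev_scale//; last exact: indisc_theta_pow.
congr ev; apply/funext => n; rewrite /theta_pow factS natrM exprS.
have k0 := fact_neq0 k; have k1 : (1 + k%:R : C) != 0 by rewrite addrC natr1 pnatr_eq0.
by rewrite -natr1; field; rewrite k0 addrC.
Qed.

(** Substitution of [c eps] for [eps].  Passing from [z] to [z^2] doubles the logarithmic
    variable. *)
Definition jscale (c : C) (J : fps C) : fps C := fun k => c ^+ k * J k.

Lemma jscaleM c J K : jscale c (J * K) = jscale c J * jscale c K.
Proof.
apply/funext => k; rewrite /jscale !fpsME mulr_sumr; apply: eq_bigr => i _.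
rewrite (_ : c ^+ k = c ^+ i * c ^+ (k - i)); first by ring.
by rewrite -exprD subnKC// leq_ord.
Qed.
Lemma jscaleD c J K : jscale c (J + K) = jscale c J + jscale c K.
Proof. by apply/funext => k; rewrite /jscale !fpsDE mulrDr. Qed.
Lemma jscaleN c J : jscale c (- J) = - jscale c J.
Proof. by apply/funext => k; rewrite /jscale !fpsNE mulrN. Qed.
Lemma jscaleC c a : jscale c (fpsC a) = fpsC a.
Proof. by apply/funext => -[|k]; rewrite /jscale ?expr0 ?mul1r//= mulr0. Qed.
Lemma fderiv_jscale c J : fderiv (jscale c J) = fpsC c * jscale c (fderiv J).
Proof. by apply/funext => k; rewrite fpsCM /fderiv /jscale exprS -mulrA -!mulrnAr. Qed.

(** ** Weighted bounds on the first four jet coefficients *)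

(** The weight [r] will be the distance to the singularity at 1: a function of size [B]
    that is homogeneous near 1 keeps this size after each operator [r theta].  Order three
    is what decay of order [n^-2] of the coefficients requires. *)
Definition bnd r (B : R) (J : fps C) := forall k, (k <= 3)%N -> normc (J k) * r ^+ k <= B.

Lemma bnd_ge0 r B J : bnd r B J -> 0 <= B.
Proof. by move/(_ 0%N isT); apply: le_trans; rewrite mulr1 normc_ge0. Qed.

Lemma bnd_le r B B' J : B <= B' -> bnd r B J -> bnd r B' J.
Proof. by move=> BB h k /h; move/le_trans; apply. Qed.

Lemma bndD r A B J K : 0 <= r -> bnd r A J -> bnd r B K -> bnd r (A + B) (J + K).
Proof.
move=> r0 hJ hK k k3; apply: le_trans (lerD (hJ k k3) (hK k k3)).
by rewrite -mulrDl ler_wpM2r ?exprn_ge0// fpsDE le_normcD.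
Qed.

Lemma bndN r A J : bnd r A J -> bnd r A (- J).
Proof. by move=> h k /h; rewrite fpsNE normcN. Qed.

Lemma bndB r A B J K : 0 <= r -> bnd r A J -> bnd r B K -> bnd r (A + B) (J - K).
Proof. by move=> r0 hJ hK; apply: bndD => //; exact: bndN. Qed.

Lemma bndZ r A J (a : C) : bnd r A J -> bnd r (normc a * A) (fpsC a * J).
Proof. by move=> h k k3; rewrite fpsCM normcM -mulrA ler_wpM2l ?normc_ge0// h. Qed.

Lemma bndM r A B J K : 0 <= r -> bnd r A J -> bnd r B K -> bnd r (4 * (A * B)) (J * K).
Proof.
move=> r0 hJ hK k k3; have A0 := bnd_ge0 hJ; have B0 := bnd_ge0 hK.
rewrite fpsME; apply: (@le_trans _ _ (\sum_(i < k.+1) A * B)).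
  apply: le_trans (ler_wpM2r (exprn_ge0 _ r0) (normc_sum _ _ _)) _.
  rewrite mulr_suml ler_sum// => i _; rewrite normcM.
  rewrite -[in X in _ * X](subnKC (leq_ord i)) exprD mulrACA.
  apply: ler_pM; rewrite ?mulr_ge0 ?normc_ge0 ?exprn_ge0 ?hJ ?hK//.
    exact: leq_trans (leq_ord i) k3.
  exact: leq_trans (leq_subr _ _) k3.
rewrite sumr_const card_ord -[X in X <= _]mulr_natl ler_wpM2r ?mulr_ge0//.
by rewrite ler_nat ltnS.
Qed.

Lemma bndC r a : bnd r (normc a) (fpsC a).
Proof.
move=> [|k] k3; first by rewrite mulr1.
by rewrite /fpsC normc0 mul0r normc_ge0.
Qed.

(* Discrete Gronwall inequality, for the triangular systems solved by jets. *)
Lemma sum_gronwall (X : nat -> R) (K X0 : R) m : 0 <= K -> 0 <= X0 ->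
  (forall k, (k <= m)%N -> X k <= X0 + K * \sum_(i < k) X i) ->
  forall k, (k <= m)%N -> X k <= X0 * (1 + K) ^+ k.
Proof.
move=> K0 X00 h; elim/ltn_ind => k IH km; apply: le_trans (h k km) _.
have s n : X0 + K * \sum_(i < n) X0 * (1 + K) ^+ i = X0 * (1 + K) ^+ n.
  elim: n => [|n e]; first by rewrite big_ord0 mulr0 addr0 mulr1.
  by rewrite big_ord_recr/= mulrDr addrA e exprS; ring.
rewrite -s lerD2l ler_wpM2l// ler_sum// => i _; apply: IH => //.
by rewrite (leq_trans (ltnW (ltn_ord i))).
Qed.

(** Dividing jets is solving a triangular system, so that only the size [c] of the leading
    coefficient of the divisor is lost. *)
Lemma bnd_div r (A Y c : R) (q x y : fps C) : 0 <= r -> 0 < c -> 0 <= A ->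
  c <= normc (q 0%N) -> bnd r (A * c) q -> bnd r Y y -> q * x = y ->
  bnd r (Y / c * (1 + A) ^+ 3) x.
Proof.
move=> r0 c0 A0 hc hq hy e; have Y0 := bnd_ge0 hy.
have h k : (k <= 3)%N -> normc (x k) * r ^+ k <= Y / c + A * \sum_(i < k) normc (x i) * r ^+ i.
  move=> k3; have := congr1 (fun f : fps C => f k) e.
  rewrite mulrC fpsME big_ord_recr/= subnn => ek.
  have -> : A * \sum_(i < k) normc (x i) * r ^+ i = (A * c * \sum_(i < k) normc (x i) * r ^+ i) / c.
    by field; rewrite gt_eqF.
  rewrite -mulrDl ler_pdivlMr//.
  apply: (@le_trans _ _ (normc (x k * q 0%N) * r ^+ k)).
    rewrite normcM [X in _ <= X]mulrAC ler_wpM2l// ?mulr_ge0 ?normc_ge0 ?exprn_ge0//.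
  have -> : x k * q 0%N = y k - \sum_(i < k) x i * q (k - i)%N by rewrite -ek addrAC subrr add0r.
  apply: le_trans (ler_wpM2r (exprn_ge0 _ r0) (normcB _ _)) _.
  rewrite mulrDl; apply: lerD; first exact: hy.
  apply: le_trans (ler_wpM2r (exprn_ge0 _ r0) (normc_sum _ _ _)) _.
  rewrite mulr_suml mulr_sumr ler_sum// => i _.
  have -> : r ^+ k = r ^+ (k - i) * r ^+ i by rewrite -exprD subnK// ltnW.
  rewrite normcM [X in X <= _](_ : _ = (normc (q (k - i)%N) * r ^+ (k - i)) * (normc (x i) * r ^+ i)); last by ring.
  rewrite ler_wpM2r ?mulr_ge0 ?normc_ge0 ?exprn_ge0// hq//.
  exact: leq_trans (leq_subr _ _) k3.
have Yc : 0 <= Y / c by rewrite divr_ge0// ltW.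
move=> k k3; apply: le_trans (@sum_gronwall (fun k => normc (x k) * r ^+ k) A (Y / c) 3 A0 Yc h k k3) _.
by rewrite ler_wpM2l// ler_weXn2l// lerDl.
Qed.

(** The same recurrence for a linear ODE [p' = psi p]: relative bounds on [psi] bound
    [p] relatively to its value. *)
Lemma bnd_ode r (A : R) (p psi : fps C) : 0 <= r -> 0 <= A ->
  fderiv p = psi * p ->
  (forall k, (k <= 2)%N -> normc (psi k) * r ^+ k.+1 <= A) ->
  bnd r (normc (p 0%N) * (1 + A) ^+ 3) p /\
  forall k, (0 < k <= 3)%N -> normc (p k) * r ^+ k <= 3 * A * (normc (p 0%N) * (1 + A) ^+ 3).
Proof.
move=> r0 A0 e hpsi; pose X k := normc (p k) * r ^+ k.
have X0 k : 0 <= X k by rewrite mulr_ge0 ?normc_ge0 ?exprn_ge0.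
have h k : (k < 3)%N -> X k.+1 <= A * \sum_(i < k.+1) X i.
  move=> k3; have := congr1 (fun f : fps C => f k) e.
  rewrite /fderiv mulrC fpsME => ek.
  apply: (@le_trans _ _ (normc (p k.+1 *+ k.+1) * r ^+ k.+1)).
    rewrite ler_wpM2r ?exprn_ge0// -mulr_natr normcM normc_nat.
    by rewrite ler_peMr ?normc_ge0// ler1n.
  rewrite ek; apply: le_trans (ler_wpM2r (exprn_ge0 _ r0) (normc_sum _ _ _)) _.
  rewrite mulr_suml mulr_sumr ler_sum// => i _.
  have -> : r ^+ k.+1 = r ^+ (k - i).+1 * r ^+ i by rewrite -exprD addSn subnK// leq_ord.
  rewrite normcM.
  rewrite [X in X <= _](_ : _ = (normc (psi (k - i)%N) * r ^+ (k - i).+1) * X i); last by rewrite /X; ring.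
  by rewrite ler_wpM2r// hpsi// (leq_trans (leq_subr _ _)).
have b k : (k <= 3)%N -> X k <= X 0%N * (1 + A) ^+ k.
  apply: sum_gronwall => // -[|j] j3; first by rewrite big_ord0 mulr0 addr0.
  by apply: le_trans (h j j3) _; rewrite lerDr.
have b3 k : (k <= 3)%N -> X k <= X 0%N * (1 + A) ^+ 3.
  by move=> k3; apply: le_trans (b k k3) _; rewrite ler_wpM2l// ler_weXn2l// lerDl.
have x0 : X 0%N = normc (p 0%N) by rewrite /X mulr1.
split; first by rewrite -x0; exact: b3.
case=> // k /= k3; apply: le_trans (h k k3) _; rewrite -x0 mulrAC mulrC ler_wpM2r//.
rewrite mulrC; apply: (@le_trans _ _ (\sum_(i < k.+1) X 0%N * (1 + A) ^+ 3)).
  by rewrite ler_sum// => i _; rewrite b3// (leq_trans (ltnW (ltn_ord i))).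
rewrite sumr_const card_ord -[X in X <= _]mulr_natr ler_wpM2l ?ler_nat//.
by rewrite mulr_ge0// exprn_ge0// addr_ge0.
Qed.

End Jets.

(** * Averages over roots of unity *)

Section RootsOfUnity.
Variable R : realType.
Local Notation C := R[i].
Local Open Scope classical_set_scope.
Local Open Scope ring_scope.
Implicit Types (f g : fps C) (z w : C) (rho : R).

Lemma prim_root_ex n : (n > 0)%N -> exists w : C, n.-primitive_root w.
Proof.
pose p : {poly C} := 'X^n - 1; have [r Dp] := closed_field_poly_normal p.
move=> n_gt0; rewrite (monicP _) ?monicXnsubC // scale1r in Dp.
have rn1 : all n.-unity_root r by apply/allP => z; rewrite -root_prod_XsubC -Dp.
have sz_r : (n < (size r).+1)%N by rewrite -(size_prod_XsubC r id) -Dp size_XnsubC.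
have [|z _ hz] := hasP (has_prim_root n_gt0 rn1 _ sz_r); last by exists z.
by rewrite -separable_prod_XsubC -Dp separable_Xn_sub_1 // pnatr_eq0 -lt0n.
Qed.

Definition root_unity K : C := projT1 (cid (prim_root_ex (ltn0Sn K))).

Lemma root_unityP K : K.+1.-primitive_root (root_unity K).
Proof. by rewrite /root_unity; case: cid. Qed.

Lemma normc_root_unity K : normc (root_unity K) = 1.
Proof.
have := prim_expr_order (root_unityP K) => /(congr1 (@normc R)).
by rewrite normcX normc1 => /eqP; rewrite pexpr_eq1 ?normc_ge0// => /eqP.
Qed.

Definition circ_pt rho K (j : nat) : C := rho%:C%C * root_unity K ^+ j.

Lemma normc_circ_pt rho K j : 0 <= rho -> normc (circ_pt rho K j) = rho.
Proof.
by move=> r0; rewrite normcM normcX normc_root_unity expr1n mulr1 normc_realp.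
Qed.

Lemma circ_pt_ortho rho K k l : 0 <= rho -> (l < K.+1)%N ->
  \sum_(j < K.+1) circ_pt rho K j ^+ k * conjc (circ_pt rho K j ^+ l) =
  if (k == l %[mod K.+1])%N then K.+1%:R * (rho ^+ (k + l))%:C%C else 0.
Proof.
move=> r0 lK; set w := root_unity K.
have w1 : w ^+ K.+1 = 1 := prim_expr_order (root_unityP K).
have cw : conjc w = w ^+ K.
  apply: (mulfI (_ : w != 0)); first by rewrite -normc_eq0 normc_root_unity oner_neq0.
  by rewrite mulc_conj normc_root_unity expr1n -exprS w1.
pose v := w ^+ (k + K * l).
have -> : \sum_(j < K.+1) circ_pt rho K j ^+ k * conjc (circ_pt rho K j ^+ l) =
    (rho ^+ (k + l))%:C%C * \sum_(j < K.+1) v ^+ j.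
  rewrite mulr_sumr; apply: eq_bigr => j _; rewrite /circ_pt !exprMn -/w.
  have -> : conjc ((rho%:C ^+ l)%C * (w ^+ j) ^+ l) = (rho ^+ l)%:C%C * (conjc w ^+ j) ^+ l.
    have cX (x : C) i : conjc (x ^+ i) = conjc x ^+ i by exact: (rmorphXn (@conjc R)).
    have cM (x y : C) : conjc (x * y) = conjc x * conjc y by exact: (rmorphM (@conjc R)).
    by rewrite cM !cX conjc_real (rmorphXn (real_complex R)).
  rewrite mulrACA -(rmorphXn (real_complex R)) -rmorphM/= -exprD; congr (_ * _).
  rewrite cw -!exprM -exprD /v -?exprM; congr (_ ^+ _).
  by rewrite mulnDl; congr (_ + _)%N; rewrite mulnC // mulnAC -mulnA mulnC.
have vE : (v == 1) = (k == l %[mod K.+1])%N.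
  rewrite /v -(expr0 w) (eq_prim_root_expr (root_unityP K)).
  rewrite -(eqn_modDr l) add0n -addnA (_ : (K * l + l)%N = (l * K.+1)%N); last first.
    by rewrite mulnS mulnC addnC.
  by rewrite addnC modnMDl.
rewrite -vE; case: eqP => [->|/eqP v1].
  by under eq_bigr do rewrite expr1n; rewrite sumr_const card_ord mulrC.
have : (v - 1) * (\sum_(j < K.+1) v ^+ j) = 0.
  by rewrite -subrX1 /v -exprM mulnC exprM w1 expr1n subrr.
by move=> /eqP; rewrite mulf_eq0 subr_eq0 (negbTE v1)/= => /eqP ->; rewrite mulr0.
Qed.

Definition tail_abs rho f K : R :=
  limn (series (fun n => normc (f n) * rho ^+ n)) - \sum_(n < K) normc (f n) * rho ^+ n.

Lemma tail_abs_cvg rho f : 0 <= rho < 1 -> indisc f -> tail_abs rho f @ \oo --> (0 : R).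
Proof.
move=> hr hf; have hc := abssum_cvg (proj1 (andP hr)) (hf _ hr).
rewrite -(subrr (limn (series (fun n => normc (f n) * rho ^+ n)))).
apply: cvgB; first exact: cvg_cst.
rewrite (_ : (fun K => _) = series (fun n => normc (f n) * rho ^+ n))//.
by apply/funext => N; rewrite /series/= big_mkord.
Qed.

Lemma tail_absP rho f K N : 0 <= rho < 1 -> indisc f ->
  \sum_(K <= n < N) normc (f n) * rho ^+ n <= tail_abs rho f K.
Proof.
move=> hr hf; have hc := abssum_cvg (proj1 (andP hr)) (hf _ hr).
have p0 n : 0 <= normc (f n) * rho ^+ n.
  by rewrite mulr_ge0 ?normc_ge0 ?exprn_ge0//; case/andP: hr.
have le N' : \sum_(n < N') normc (f n) * rho ^+ n <= limn (series (fun n => normc (f n) * rho ^+ n)).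
  have := nondecreasing_cvgn_le (nondecreasing_series (fun n (_ : (0 <= n)%N) (_ : xpredT n) => p0 n)) hc N'.
  by rewrite /series/= big_mkord.
case: (leqP K N) => KN; last first.
  by rewrite big_geq ?(ltnW KN)// /tail_abs subr_ge0 le.
rewrite /tail_abs lerBrDl; apply: le_trans (le N).
by rewrite -!(big_mkord xpredT (fun n => normc (f n) * rho ^+ n)) (@big_cat_nat _ _ _ K 0 N).
Qed.

Lemma ccvg_sum m (S : 'I_m -> nat -> C) (l : 'I_m -> C) :
  (forall i, ccvg (S i) (l i)) -> ccvg (fun n => \sum_i S i n) (\sum_i l i).
Proof.
elim: m S l => [|m IH] S l h.
  rewrite big_ord0 (_ : (fun n => _) = fun=> 0); first exact: ccvg_cst.
  by apply/funext => n; rewrite big_ord0.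
rewrite big_ord_recr (_ : (fun n => _) =
  (fun n => \sum_(i < m) S (widen_ord (leqnSn m) i) n + S ord_max n)); last first.
  by apply/funext => n; rewrite big_ord_recr.
by apply: ccvgD => //; apply: IH.
Qed.

(** Averaging against [conj z^n] extracts the coefficient [n], up to aliasing with the
    coefficients of index at least [K + 1]. *)
Lemma circ_mean_coef rho f K n : 0 <= rho < 1 -> indisc f -> (n < K.+1)%N ->
  normc (K.+1%:R^-1 * \sum_(j < K.+1) ev (circ_pt rho K j) f * conjc (circ_pt rho K j ^+ n) -
         f n * (rho ^+ (n + n))%:C%C) <= rho ^+ n * tail_abs rho f K.+1.
Proof.
move=> hr hf nK; have [r0 r1] := andP hr.
pose z j := circ_pt rho K j.
pose S N : C := K.+1%:R^-1 * \sum_(j < K.+1) (\sum_(k < N) f k * z j ^+ k) * conjc (z j ^+ n)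
   - f n * (rho ^+ (n + n))%:C%C.
have hS : ccvg S (K.+1%:R^-1 * \sum_(j < K.+1) ev (z j) f * conjc (z j ^+ n) -
         f n * (rho ^+ (n + n))%:C%C).
  apply: ccvgD; last exact: ccvg_cst.
  apply: ccvgZ; apply: (@ccvg_sum K.+1 (fun j N => (\sum_(k < N) f k * z j ^+ k) * conjc (z j ^+ n))
    (fun j => ev (z j) f * conjc (z j ^+ n))) => j.
  rewrite mulrC (_ : (fun N => _) = fun N => conjc (z j ^+ n) * \sum_(k < N) f k * z j ^+ k); last first.
    by apply/funext => N; rewrite mulrC.
  by apply: ccvgZ; apply: ev_cvg => //; rewrite normc_circ_pt.
apply: ccvg_le hS _; exists K.+1 => // N /= KN.
have K0 : (K.+1%:R : C) != 0 by rewrite pnatr_eq0.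
have -> : S N = \sum_(k < N | (k != n :> nat) && (k == n %[mod K.+1])%N) f k * (rho ^+ (k + n))%:C%C.
  have nN : (n < N)%N by exact: leq_trans nK KN.
  rewrite /S (eq_bigr (fun j : 'I_K.+1 => \sum_(k < N) f k * (z j ^+ k * conjc (z j ^+ n)))); last first.
    by move=> j _; rewrite mulr_suml; apply: eq_bigr => k _; rewrite mulrA.
  rewrite exchange_big/= (eq_bigr (fun k : 'I_N => if (k == n %[mod K.+1])%N
     then K.+1%:R * (f k * (rho ^+ (k + n))%:C%C) else 0)); last first.
    move=> k _; rewrite -mulr_sumr circ_pt_ortho//.
    by case: ifP => _; rewrite ?mulr0// mulrCA.
  rewrite -big_mkcond/= -mulr_sumr mulrA mulVf// mul1r.
  rewrite (bigD1 (Ordinal nN))/= ?eqxx// addrAC subrr add0r.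
  by apply: eq_bigl => k; rewrite andbC.
apply: le_trans (normc_sum _ _ _) _.
apply: le_trans (_ : rho ^+ n * \sum_(K.+1 <= k < N) normc (f k) * rho ^+ k <= _); last first.
  by rewrite ler_wpM2l ?exprn_ge0// tail_absP.
rewrite mulr_sumr.
have -> : \sum_(K.+1 <= k < N) rho ^+ n * (normc (f k) * rho ^+ k) =
    \sum_(k < N | (K.+1 <= k)%N) normc (f k) * rho ^+ (k + n).
  rewrite big_geq_mkord; apply: eq_bigr => k _; rewrite exprD; ring.
rewrite [X in X <= _]big_mkcond [X in _ <= X]big_mkcond/= ler_sum// => k _.
case: ifP => [/andP[kn kmod]|_]; last first.
  by case: ifP => // _; rewrite mulr_ge0 ?normc_ge0 ?exprn_ge0.
have Kk : (K.+1 <= k)%N.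
  rewrite leqNgt; apply/negP => kK; move: kmod; rewrite !modn_small//.
  by rewrite (negbTE kn).
by rewrite Kk normcM normc_realp ?exprn_ge0.
Qed.

(** A bound of order [|1 - z|^-2] on the circle of radius [rho] yields a coefficient bound:
    the average of [|1 - z|^-2] is that of a squared geometric sum. *)
Lemma mean_inv_sq rho K : 0 <= rho < 1 ->
  K.+1%:R^-1 * \sum_(j < K.+1) (normc (1 - circ_pt rho K j) ^+ 2)^-1 <=
  ((1 - rho ^+ K.+1) ^+ 2)^-1 / (1 - rho).
Proof.
move=> hr; have [r0 r1] := andP hr; set q := 1 - rho ^+ K.+1.
have q0 : 0 < q by rewrite subr_gt0 exprn_ilt1.
pose z j := circ_pt rho K j.
have zK j : z j ^+ K.+1 = (rho ^+ K.+1)%:C%C.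
  rewrite /z /circ_pt exprMn -exprM mulnC exprM (prim_expr_order (root_unityP K)).
  by rewrite expr1n mulr1 rmorphXn.
have z1 j : 1 - z j != 0.
  rewrite subr_eq0; apply/eqP => e; have := normc_circ_pt K j r0.
  by rewrite -/(z j) -e normc1 => e1; rewrite -e1 ltxx in r1.
pose G j : C := \sum_(k < K.+1) z j ^+ k.
have zG j : (normc (1 - z j) ^+ 2)^-1 = (q ^+ 2)^-1 * normc (G j) ^+ 2.
  have := subrX1 (z j) K.+1; rewrite zK -/(G j) => /(congr1 (@normc R)).
  have -> : normc ((rho ^+ K.+1)%:C%C - 1) = q.
    rewrite normcBC (_ : 1 - _ = (1 - rho ^+ K.+1)%:C%C); last by rewrite rmorphB rmorph1.
    by rewrite normc_realp ?ltW.
  rewrite normcM => e.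
  have n0 : normc (1 - z j) != 0 by rewrite normc_eq0.
  rewrite normcBC in e.
  have q1 : normc (1 - z j) * normc (G j) != 0 by rewrite -e gt_eqF.
  rewrite e.
  have g0 : normc (G j) != 0 by move: q1; rewrite mulf_eq0 negb_or => /andP[].
  by field; rewrite ?g0 ?n0.
rewrite (eq_bigr (fun j : 'I_K.+1 => (q ^+ 2)^-1 * normc (G j) ^+ 2)); last by move=> j _; exact: zG.
rewrite -mulr_sumr mulrCA ler_wpM2l ?invr_ge0 ?exprn_ge0 ?(ltW q0)//.
have key : \sum_(j < K.+1) normc (G j) ^+ 2 = K.+1%:R * \sum_(k < K.+1) rho ^+ (k + k).
  apply: (@complexI R); rewrite !rmorphM !rmorph_sum/= rmorph_nat.
  rewrite (eq_bigr (fun j : 'I_K.+1 => \sum_(k < K.+1) \sum_(l < K.+1) z j ^+ k * conjc (z j ^+ l))); last first.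
    move=> j _; rewrite -mulc_conj mulr_suml; apply: eq_bigr => k _.
    by rewrite -mulr_sumr rmorph_sum.
  rewrite exchange_big mulr_sumr/=; apply: eq_bigr => k _.
  rewrite exchange_big/= (bigD1 k)//= circ_pt_ortho// eqxx big1 ?addr0 => [|l lk].
    by [].
  rewrite circ_pt_ortho// !modn_small// ifF//.
  by apply/negbTE; rewrite eq_sym; exact: lk.
rewrite key mulKf ?pnatr_eq0//.
have e N : (\sum_(k < N) rho ^+ (k + k)) * (1 - rho) <= 1 - rho ^+ N.
  elim: N => [|N IH]; first by rewrite big_ord0 mul0r subrr.
  rewrite big_ord_recr/= mulrDl exprS exprD.
  have p1 : rho ^+ N <= 1 by rewrite exprn_ile1// ltW.
  have p0 : 0 <= rho ^+ N by rewrite exprn_ge0.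
  have : rho ^+ N * rho ^+ N * (1 - rho) <= rho ^+ N * (1 - rho).
    by rewrite ler_wpM2r ?subr_ge0 ?(ltW r1)// ler_piMl.
  move: IH; lra.
by rewrite -[X in _ <= X]mul1r ler_pdivlMr ?subr_gt0// (le_trans (e _))// gerBl exprn_ge0.
Qed.


(** Cauchy's estimate with the radius left free. *)
Lemma coef_bound_radius f rho n (A : R) : 0 <= rho < 1 -> indisc f ->
  (forall z, normc z = rho -> normc (ev z f) * normc (1 - z) ^+ 2 <= A) ->
  normc (f n) * rho ^+ n * (1 - rho) <= A.
Proof.
move=> hr hf hA; have [r0 r1] := andP hr.
have A0 : 0 <= A.
  apply: le_trans (hA rho%:C%C _); last by rewrite normc_realp.
  by rewrite mulr_ge0 ?exprn_ge0 ?normc_ge0.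
case: (eqVneq rho 0) => [r00|rN0].
  rewrite r00 subr0 mulr1; case: n => [|n]; last by rewrite expr0n mulr0.
  have := hA 0; rewrite normc0 r00 => /(_ erefl).
  rewrite subr0 normc1 expr1n !mulr1 => h.
  suff -> : f 0%N = ev 0 f by [].
  symmetry; apply: evP => //; rewrite ?normc0//.
  apply: cvg_near_cst; exists 1%N => // -[|N] //= _.
  rewrite big_ord_recl big1 => [|i _]; last by rewrite expr0n mulr0.
  by rewrite expr0 mulr1 addr0 subrr normc0.
have rp : 0 < rho by rewrite lt0r rN0.
have step K : (n < K.+1)%N -> normc (f n) * rho ^+ n <=
    A * (((1 - rho ^+ K.+1) ^+ 2)^-1 / (1 - rho)) + tail_abs rho f K.+1.
  move=> nK; have := circ_mean_coef hr hf nK.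
  set m := _ * \sum_(_ < _) _ => h.
  have hm : normc m <= rho ^+ n * (A * (((1 - rho ^+ K.+1) ^+ 2)^-1 / (1 - rho))).
    rewrite /m normcM normcV normc_nat.
    apply: le_trans (_ : K.+1%:R^-1 * (\sum_(j < K.+1)
        rho ^+ n * (A * (normc (1 - circ_pt rho K j) ^+ 2)^-1)) <= _).
      rewrite ler_wpM2l ?invr_ge0//; apply: le_trans (normc_sum _ _ _) _.
      rewrite ler_sum// => j _; rewrite normcM normc_conj normcX normc_circ_pt// mulrC.
      rewrite ler_wpM2l ?exprn_ge0// ler_pdivlMr ?hA ?normc_circ_pt//.
      rewrite exprn_gt0// normc_gt0 subr_eq0; apply/eqP => e.
      by have := normc_circ_pt K j r0; rewrite -e normc1 => e1; rewrite -e1 ltxx in r1.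
    rewrite -mulr_sumr mulrCA ler_wpM2l ?exprn_ge0//.
    by rewrite -mulr_sumr mulrCA ler_wpM2l// mean_inv_sq.
  have : normc (f n * (rho ^+ (n + n))%:C%C) <= normc m + rho ^+ n * tail_abs rho f K.+1.
    rewrite -lerBlDl; apply: le_trans _ h; rewrite normcBC; exact: le_normcB.
  rewrite normcM normc_realp ?exprn_ge0// exprD mulrA => h2.
  have rn : 0 < rho ^+ n by rewrite exprn_gt0.
  rewrite -(ler_pM2r rn); apply: le_trans h2 _.
  by rewrite mulrDl [tail_abs _ _ _ * _]mulrC lerD2r mulrC.
rewrite -ler_pdivlMr ?subr_gt0//.
have hlim : (fun K => A * (((1 - rho ^+ K.+1) ^+ 2)^-1 / (1 - rho)) + tail_abs rho f K.+1) @ \oo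
    --> A * (((1 - 0) ^+ 2)^-1 / (1 - rho)) + 0.
  have hs (u : R^nat) (l : R) : u @ \oo --> l -> (fun K => u K.+1) @ \oo --> l.
    by move=> hu; rewrite (cvg_shiftS u).
  apply: cvgD; last by apply: hs; exact: tail_abs_cvg.
  apply: cvgMr; apply: cvgMl; apply: cvgV; first by rewrite subr0 expr1n oner_neq0.
  have c : (fun K => 1 - rho ^+ K.+1) @ \oo --> (1 - 0 : R).
    apply: cvgB; first exact: cvg_cst.
    by apply: (hs (fun K => rho ^+ K) 0); apply: cvg_expr; rewrite ger0_norm.
  by rewrite expr2; under eq_fun do rewrite expr2; exact: cvgM.
rewrite subr0 expr1n invr1 mul1r addr0 in hlim.
have hc : (fun=> normc (f n) * rho ^+ n) @ \oo --> normc (f n) * rho ^+ n by exact: cvg_cst.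
rewrite -(cvg_lim _ hlim)// -(cvg_lim _ hc)//; apply: ler_lim.
- by apply/cvg_ex; eexists; exact: hc.
- by apply/cvg_ex; eexists; exact: hlim.
- by exists n => // K /= nK; apply: step; rewrite ltnS.
Qed.

(** The radius of all Cauchy estimates: [1 - rho] is as small as [1 / (n + 1)], while
    [rho ^ n] does not degenerate. *)
Lemma radius_pow n : (0 < n)%N -> expR (-1) <= (n%:R / n.+1%:R : R) ^+ n.
Proof.
move=> n0; have np : (0 : R) < n%:R by rewrite ltr0n.
have e : (n%:R / n.+1%:R : R) = (1 + n%:R^-1)^-1.
  by rewrite -natr1; field; rewrite natr1 !pnatr_eq0 -lt0n n0.
have h : (1 + n%:R^-1 : R) ^+ n <= expR 1.
  have -> : expR 1 = expR n%:R^-1 ^+ n :> R by rewrite -expRM_natl mulfV// gt_eqF.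
  have h0 : (0 : R) <= 1 + n%:R^-1 by rewrite addr_ge0// invr_ge0.
  by rewrite lerXn2r ?nnegrE ?expR_ge0// expR_ge1Dx.
rewrite e exprVn expRN lef_pV2 ?posrE ?expR_gt0//.
Qed.

Lemma radius_in n : (0 <= (n%:R / n.+1%:R : R) < 1).
Proof.
by rewrite divr_ge0//= ltr_pdivrMr ?ltr0n// mul1r ltr_nat.
Qed.

(** Coefficients decay like [n^-2] when the third jet coefficient has a singularity of
    order [|1 - z|^-2] at 1: three derivatives gain [n^-3], the singularity costs [n]. *)
Lemma coef_decay f n (A : R) : (0 < n)%N -> indisc f ->
  (forall z, normc z = n%:R / n.+1%:R -> normc (jet z f 3) * normc (1 - z) ^+ 2 <= A) ->
  normc (f n) * n%:R ^+ 2 <= 12 * expR 1 * A.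
Proof.
move=> n0 hf hA; set rho : R := n%:R / n.+1%:R.
have hr := radius_in n; have [r0 r1] := andP hr.
have := coef_bound_radius n hr (indisc_theta_pow 3 hf) hA.
have np : (0 : R) < n%:R by rewrite ltr0n.
have e1 : 1 - rho = n.+1%:R^-1.
  by rewrite /rho -natr1; field; rewrite natr1 pnatr_eq0.
rewrite -/rho e1 /theta_pow normcM normcM normcX normcV !normc_nat => h.
have f6 : (3`! = 6)%N by [].
rewrite f6 in h.
have hp := radius_pow n0; rewrite -/rho in hp.
have A0 : 0 <= A.
  apply: le_trans (hA rho%:C%C _); last by rewrite normc_realp.
  by rewrite mulr_ge0 ?exprn_ge0 ?normc_ge0.
have h1 : normc (f n) * n%:R ^+ 3 * expR (-1) <= 6 * A * n.+1%:R.
  rewrite -ler_pdivrMr ?ltr0n// mulrC -ler_pdivrMl// mulrC.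
  apply: le_trans h; rewrite [X in X <= _](_ : _ = normc (f n) * (n%:R ^+ 3 / 6) * expR (-1) / n.+1%:R); last by ring.
  by rewrite ler_wpM2r ?invr_ge0// ler_wpM2l// !mulr_ge0 ?normc_ge0 ?exprn_ge0 ?invr_ge0.
have h2 : 6 * A * n.+1%:R <= 12 * A * n%:R.
  have : (n.+1%:R : R) <= 2 * n%:R.
    by rewrite -natrM ler_nat mul2n -addnn -addn1 leq_add2l.
  by move=> h2; have := ler_wpM2l (mulr_ge0 (ler0n R 6) A0) h2; lra.
have h3 := le_trans h1 h2.
rewrite expRN -ler_pdivlMr ?invr_gt0 ?expR_gt0// invrK in h3.
rewrite -(ler_pM2r np) (_ : _ * _ * _ = normc (f n) * n%:R ^+ 3); last by ring.
by apply: le_trans h3 _; rewrite le_eqVlt; apply/orP; left; apply/eqP; ring.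
Qed.

(** ** Energy estimate *)

(* Finitely many coefficients of [W] occur, so that the aliasing error is a finite sum of
   tails. *)
Lemma circ_mean_cvg rho f (W : fps C) m : 0 <= rho < 1 -> indisc f ->
  ccvg (fun K => K.+1%:R^-1 * \sum_(j < K.+1) ev (circ_pt rho K j) f *
           conjc (\sum_(n < m) W n * circ_pt rho K j ^+ n))
       (\sum_(n < m) conjc (W n) * (f n * (rho ^+ (n + n))%:C%C)).
Proof.
move=> hr hf.
pose T n K := K.+1%:R^-1 * \sum_(j < K.+1) ev (circ_pt rho K j) f * conjc (circ_pt rho K j ^+ n).
rewrite (_ : (fun K => _) = fun K => \sum_(n < m) conjc (W n) * T n K); last first.
  apply/funext => K; under [RHS]eq_bigr do rewrite /T mulrCA mulr_sumr.
  rewrite -mulr_sumr exchange_big/=; congr (_ * _); apply: eq_bigr => j _.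
  rewrite rmorph_sum/= mulr_sumr; apply: eq_bigr => n _.
  by rewrite rmorphM/= mulrCA.
apply: (@ccvg_sum m (fun n K => conjc (W n) * T n K)) => n; apply: ccvgZ.
have h0 : (fun K => rho ^+ n * tail_abs rho f K.+1) @ \oo --> (0 : R).
  rewrite -(mulr0 (rho ^+ n)); apply: cvgMr.
  have := tail_abs_cvg hr hf; by rewrite -(cvg_shiftS (tail_abs rho f)).
rewrite /ccvg; apply: (squeeze_cvgr _ (cvg_cst _) h0).
exists n => // K /= nK; rewrite normc_ge0/=.
by apply: circ_mean_coef => //; rewrite ltnS.
Qed.

Lemma ccvg_Re (S : nat -> C) l : ccvg S l -> (fun n => complex.Re (S n)) @ \oo --> complex.Re l.
Proof.
move=> h; apply/cvgrPdist_le => e e0.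
have /cvgrPdist_le/(_ e e0) [N _ hN] := h; exists N => // n /= Nn.
apply: le_trans (hN n Nn); rewrite sub0r normrN.
apply: le_trans (ler_norm _); rewrite normcBC.
by apply: le_trans (normc_Re _); rewrite cReD cReN.
Qed.

Lemma Re_conj_mul (u v : C) : complex.Re (u * v * conjc v) = complex.Re u * normc v ^+ 2.
Proof. by rewrite -mulrA mulc_conj cReM/= mulr0 subr0. Qed.

(** Parseval on the circle of radius [rho]: the average of [Re (A |W|^2)] is a weighted inner
    product of the coefficients of [W] and of [A W]. *)
Lemma energy (A W : fps C) m (c rho : R) : 0 <= rho < 1 -> indisc A ->
  (forall n, (m <= n)%N -> W n = 0) ->
  (forall z, normc z < 1 -> c <= complex.Re (ev z A)) ->
  c * \sum_(n < m) normc (W n) ^+ 2 * rho ^+ (n + n) <=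
  \sum_(n < m) complex.Re (conjc (W n) * (A * W) n) * rho ^+ (n + n).
Proof.
move=> hr hA hW hc; have [r0 r1] := andP hr.
have z0 : normc (0 : C) < 1 by rewrite normc0.
have hWd : indisc W by case: (ev_finite z0 hW).
have Wev z : normc z < 1 -> ev z W = \sum_(n < m) W n * z ^+ n by move=> /ev_finite/(_ hW)[].
have c1 := ccvg_Re (circ_mean_cvg W m hr (indiscM hA hWd)).
have c2 := ccvg_Re (circ_mean_cvg W m hr hWd).
have e2 : complex.Re (\sum_(n < m) conjc (W n) * (W n * (rho ^+ (n + n))%:C%C)) =
    \sum_(n < m) normc (W n) ^+ 2 * rho ^+ (n + n).
  rewrite cRe_sum; apply: eq_bigr => n _.
  by rewrite mulrA [conjc _ * _]mulrC mulc_conj cReM/= mulr0 subr0.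
have e1 : complex.Re (\sum_(n < m) conjc (W n) * ((A * W) n * (rho ^+ (n + n))%:C%C)) =
    \sum_(n < m) complex.Re (conjc (W n) * (A * W) n) * rho ^+ (n + n).
  rewrite cRe_sum; apply: eq_bigr => n _.
  by rewrite mulrA [LHS]cReM/= mulr0 subr0.
rewrite e1 in c1; rewrite e2 in c2.
have c3 := cvgMr (FF := eventually_filter) (a := c) c2.
rewrite -(cvg_lim _ c1)// -(cvg_lim _ c3)//; apply: ler_lim.
- by apply/cvg_ex; eexists; exact: c3.
- by apply/cvg_ex; eexists; exact: c1.
apply: nearW => K.
have KE : (K.+1%:R^-1 : C) = (K.+1%:R^-1)%:C%C by rewrite fmorphV rmorph_nat.
rewrite KE !cReM/= !mul0r !subr0 mulrCA ler_wpM2l ?invr_ge0//.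
rewrite !cRe_sum mulr_sumr ler_sum// => j _.
have zj : normc (circ_pt rho K j) < 1 by rewrite normc_circ_pt.
rewrite evM// -Wev// Re_conj_mul mulc_conj/= ler_wpM2r ?sqr_ge0//.
exact: hc.
Qed.

End RootsOfUnity.

(** * Complex powers on the right half plane and the binomial series *)

Section ComplexPower.
Variable R : realType.
Local Notation C := R[i].
Local Open Scope classical_set_scope.
Local Open Scope ring_scope.
Implicit Types (z w : C) (s t : R).

Definition cexp z : C :=
  (expR (complex.Re z) * cos (complex.Im z) +i* (expR (complex.Re z) * sin (complex.Im z)))%C.

(** On the right half plane the argument is an arctangent, and no branch has to be chosen. *)
Definition clog z : C := (ln (normc z) +i* atan (complex.Im z / complex.Re z))%C.

Lemma cexp0 : cexp 0 = 1.
Proof. by rewrite /cexp/= expR0 cos0 sin0 mulr1 mulr0. Qed.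

Lemma cexpD z w : cexp (z + w) = cexp z * cexp w.
Proof.
rewrite /cexp cReD cImD expRD sinD cosD; apply/eqP; rewrite eq_complex/=.
by apply/andP; split; apply/eqP; ring.
Qed.

Lemma normc_cexp z : normc (cexp z) = expR (complex.Re z).
Proof.
rewrite /cexp /normc !exprMn -mulrDr cos2Dsin2 mulr1 sqrtr_sqr ger0_norm//.
Qed.

Lemma cexp_neq0 z : cexp z != 0.
Proof. by rewrite -normc_gt0 normc_cexp expR_gt0. Qed.

Lemma cexpN z : cexp (- z) = (cexp z)^-1.
Proof.
by apply: (mulfI (cexp_neq0 z)); rewrite -cexpD subrr cexp0 mulfV ?cexp_neq0.
Qed.

Lemma Re_gt0_neq0 z : 0 < complex.Re z -> z != 0.
Proof. by move=> h; apply/eqP => e; rewrite e/= ltxx in h. Qed.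

Lemma cexp_clog z : 0 < complex.Re z -> cexp (clog z) = z.
Proof.
move=> h; have n0 : 0 < normc z by rewrite normc_gt0 Re_gt0_neq0.
rewrite /cexp /clog /= lnK ?posrE//.
case: z h n0 => x y /= x0 n0; have xN : x != 0 by rewrite gt_eqF.
set a := atan (y / x); set n := Num.sqrt _.
have ca : n * cos a = x.
  rewrite /a cos_atan /n.
  have -> : x ^+ 2 + y ^+ 2 = x ^+ 2 * (1 + (y / x) ^+ 2) by field.
  rewrite sqrtrM ?sqr_ge0// sqrtr_sqr gtr0_norm// mulfK//.
  by rewrite sqrtr_eq0 -ltNge ltr_pwDl// sqr_ge0.
have sa : sin a = y / x * cos a.
  have := atanK (y / x); rewrite -/a /tan => <-.
  rewrite mulfVK// gt_eqF// cos_gt0_pihalf//.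
  by rewrite atan_gtNpi2 atan_ltpi2.
by rewrite sa ca mulrCA ca mulfVK.
Qed.

Lemma clog_Im z : - (pi / 2) < complex.Im (clog z) < pi / 2.
Proof. by rewrite /clog/= atan_gtNpi2 atan_ltpi2. Qed.

Lemma cos_eq1_small d : cos d = 1 -> `|d| < 2 * pi -> d = 0 :> R.
Proof.
move=> cd hd; have h : sin (d / 2) = 0.
  have e : d = (d / 2) *+ 2 by rewrite -mulr_natr mulfVK.
  move: cd; rewrite {1}e cos_mulr2n => cd.
  have c1 : cos (d / 2) ^+ 2 = 1 by move: cd; rewrite -mulr_natr; lra.
  by apply/eqP; rewrite -sqrf_eq0 sin2cos2 c1 subrr.
apply/eqP; apply/negPn/negP => d0.
have : 0 < sin (`|d| / 2).
  apply: sin_gt0_pi; rewrite divr_gt0 ?normr_gt0//= ltr_pdivrMr//.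
  by rewrite mulrC.
by case: (ger0P d) => _; rewrite ?mulNr ?sinN h ?oppr0 ltxx.
Qed.

(** Both sides have the same exponential, and their imaginary parts differ by less than
    [2 pi]. *)
Lemma clogM z w : 0 < complex.Re z -> 0 < complex.Re w -> 0 < complex.Re (z * w) ->
  clog (z * w) = clog z + clog w.
Proof.
move=> z0 w0 zw0.
have nz : 0 < normc z by rewrite normc_gt0 Re_gt0_neq0.
have nw : 0 < normc w by rewrite normc_gt0 Re_gt0_neq0.
set d := clog (z * w) - (clog z + clog w).
have re0 : complex.Re d = 0.
  by rewrite /d cReD cReN cReD /clog/= normcM lnM ?posrE// subrr.
have ed : cexp d = 1.
  by rewrite /d cexpD cexpN cexpD !cexp_clog// mulfV// mulf_neq0// Re_gt0_neq0.
have cd : cos (complex.Im d) = 1.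
  have : expR (complex.Re d) * cos (complex.Im d) = 1 := congr1 (@complex.Re R) ed.
  by rewrite re0 expR0 mul1r.
have im0 : complex.Im d = 0.
  apply: cos_eq1_small => //.
  have /andP[a1 a2] := clog_Im (z * w); have /andP[b1 b2] := clog_Im z.
  have /andP[c1 c2] := clog_Im w.
  have p0 := pi_gt0 R.
  by rewrite /d cImD cImN cImD ltr_norml; apply/andP; split; lra.
apply/eqP; rewrite -subr_eq0 -/d eq_complex; apply/andP; split; apply/eqP => //.
Qed.

Definition cpow s z : C := cexp (s%:C%C * clog z).

Lemma cpow_neq0 s z : cpow s z != 0. Proof. exact: cexp_neq0. Qed.

Lemma cpowM s z w : 0 < complex.Re z -> 0 < complex.Re w -> 0 < complex.Re (z * w) ->
  cpow s (z * w) = cpow s z * cpow s w.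
Proof. by move=> z0 w0 zw0; rewrite /cpow clogM// mulrDr cexpD. Qed.

Lemma cpow_real s (a : R) : 0 < a -> cpow s a%:C%C = (a `^ s)%:C%C.
Proof.
move=> a0; rewrite /cpow /clog normc_realp ?ltW//= mul0r atan0.
rewrite /cexp/= !mulr0 !mul0r subr0 add0r cos0 sin0 mulr0 mulr1.
by rewrite /powR gt_eqF.
Qed.

Lemma cpowD s t z : cpow (s + t) z = cpow s z * cpow t z.
Proof. by rewrite /cpow rmorphD mulrDl cexpD. Qed.

Lemma cpow1 z : 0 < complex.Re z -> cpow 1 z = z.
Proof. by move=> z0; rewrite /cpow rmorph1 mul1r cexp_clog. Qed.

Lemma normc_cpow s z : normc (cpow s z) = expR (s * ln (normc z)).
Proof. by rewrite /cpow normc_cexp cReM/= mul0r subr0. Qed.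

Lemma cexp_sub1 z : normc (cexp z - 1) <= 3 * expR (normc z) * normc z.
Proof.
have ab (u : R) : `|expR u - 1| <= `|u| * expR `|u|.
  case: (ger0P u) => u0.
    have h := expR_ge1Dx (- u).
    rewrite ger0_norm ?subr_ge0 ?expR_ge1//; last by rewrite -expR0 ler_expR.
    have e : expR u * expR (- u) = 1 by rewrite -expRD subrr expR0.
    have := ler_wpM2l (expR_ge0 u) h; rewrite e mulrDr mulr1 mulrN; lra.
  have h := expR_ge1Dx u; have h1 : 1 <= expR (- u) by rewrite -expR0 ler_expR oppr_ge0 ltW.
  have h2 : expR u <= 1 by rewrite -expR0 ler_expR ltW.
  rewrite ler0_norm ?subr_le0//.
  apply: (@le_trans _ _ (- u)); first by lra.
  by rewrite ler_peMr// oppr_ge0 ltW.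
have trig (f df : R -> R) : (forall x, is_derive x (1 : R) f (df x)) ->
    (forall x, `|df x| <= 1) -> forall y, `|f y - f 0| <= `|y|.
  move=> fd fb y.
  have cf a b : {within `[a, b], continuous f}.
    apply: continuous_subspaceT => x; apply: differentiable_continuous.
    by apply/derivable1_diffP; have := fd x => -[].
  case: (ger0P y) => y0.
    have [c _ ->] := MVT_segment y0 (fun x _ => fd x) (cf 0 y).
    by rewrite subr0 normrM (ger0_norm y0) ler_piMl.
  have [c _ e] := MVT_segment (ltW y0) (fun x _ => fd x) (cf y 0).
  by rewrite distrC e sub0r normrM normrN (ltr0_norm y0) ler_piMl// oppr_ge0 ltW.
have hs y : `|sin y| <= `|y| :> R.
  have := trig sin cos (fun x => is_derive_sin x) (fun x => _) y.
  by rewrite sin0 subr0; apply => x; rewrite ler_norml cos_geN1 cos_le1.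
have hc y : `|cos y - 1| <= `|y| :> R.
  have := trig cos (fun x => - sin x) (fun x => is_derive_cos x) (fun x => _) y.
  by rewrite cos0; apply => x; rewrite normrN ler_norml sin_geN1 sin_le1.
have hx := normc_Re z; have hy := normc_Im z; have n0 := normc_ge0 z.
case: z hx hy n0 => x y; set n := normc _ => hx hy n0.
rewrite /= in hx hy.
have ex : expR x <= expR n by rewrite ler_expR (le_trans _ hx)// ler_norm.
have ex0 := expR_ge0 x.
apply: le_trans (normc_le _) _; rewrite /cexp/= subr0.
have h1 : `|expR x * cos y - 1| <= expR n * n + expR n * n.
  rewrite (_ : _ - 1 = expR x * (cos y - 1) + (expR x - 1)); last by ring.
  apply: le_trans (ler_normD _ _) _; apply: lerD.
    rewrite normrM (ger0_norm ex0); apply: ler_pM => //.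
    exact: le_trans (hc y) hy.
  apply: le_trans (ab x) _; rewrite mulrC; apply: ler_pM => //.
  by rewrite ler_expR.
have h2 : `|expR x * sin y| <= expR n * n.
  rewrite normrM (ger0_norm ex0); apply: ler_pM => //.
  exact: le_trans (hs y) hy.
by apply: le_trans (lerD h1 h2) _; rewrite le_eqVlt; apply/orP; left; apply/eqP; ring.
Qed.

Lemma clog_near1 z (m : R) : 0 < m -> m <= complex.Re z -> m <= 1 ->
  normc (clog z) <= 2 / m * normc (z - 1).
Proof.
move=> m0 hm m1; have z0 : 0 < complex.Re z by exact: lt_le_trans hm.
have nz : m <= normc z.
  by apply: le_trans hm _; apply: le_trans (normc_Re z); rewrite ler_norm.
have nz0 : 0 < normc z by exact: lt_le_trans nz.
apply: le_trans (normc_le _) _.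
rewrite mulrAC mulr_natl mulr2n mulrDl; apply: lerD => /=.
  have d1 : `|normc z - 1| <= normc (z - 1).
    rewrite ler_norml; apply/andP; split.
      by rewrite lerNl opprB -[1]normc1 normcBC le_normcB.
    by rewrite -[1]normc1 le_normcB.
  rewrite ler_pdivlMr//; apply: le_trans d1.
  case: (lerP 1 (normc z)) => n1.
    have l0 := ln_ge0 n1.
    rewrite (ger0_norm l0).
    have h : ln (normc z) <= normc z - 1.
      by rewrite -{1}(subrK 1 (normc z)) addrC le_ln1Dx//; lra.
    apply: le_trans (_ : ln (normc z) <= _) => //.
    by rewrite ler_piMr.
  have h : ln (normc z)^-1 <= (normc z)^-1 - 1.
    by rewrite -{1}(subrK 1 (normc z)^-1) addrC le_ln1Dx//; rewrite ltrBrDr addrC subrr invr_gt0.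
  rewrite lnV ?posrE// in h.
  rewrite ler0_norm; last by rewrite ln_le0// ltW.
  have h2 := ler_wpM2r (ltW m0) h; apply: le_trans h2 _.
  have h3 : (normc z)^-1 - 1 = (1 - normc z) / normc z by field; rewrite gt_eqF.
  rewrite h3 mulrAC ler_pdivrMr// ler_wpM2l// subr_ge0 ltW//.
have at1 (u : R) : `|atan u| <= `|u|.
  have cf a b : {within `[a, b], continuous (@atan R)}.
    by apply: continuous_subspaceT => x; exact: continuous_atan.
  have db x : `|(1 + x ^+ 2)^-1| <= 1 :> R.
    rewrite ger0_norm ?invr_ge0 ?addr_ge0 ?sqr_ge0//.
    by rewrite invf_le1 ?ltr_pwDl ?sqr_ge0// lerDl sqr_ge0.
  case: (ger0P u) => u0.
    have [c _] := MVT_segment u0 (fun x _ => is_derive1_atan x) (cf 0 u).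
    by rewrite atan0 !subr0 => ->; rewrite normrM (ger0_norm u0) ler_piMl.
  have [c _] := MVT_segment (ltW u0) (fun x _ => is_derive1_atan x) (cf u 0).
  rewrite atan0 !sub0r => e; rewrite -normrN e normrM normrN (ltr0_norm u0) ler_piMl//.
  by rewrite oppr_ge0 ltW.
apply: le_trans (at1 _) _; rewrite normrM normfV (gtr0_norm z0).
have hi : `|complex.Im z| <= normc (z - 1).
  by apply: le_trans (normc_Im _); rewrite cImD cImN/= oppr0 addr0.
apply: ler_pM; rewrite ?invr_ge0// ?(ltW z0)//.
by rewrite lef_pV2// posrE.
Qed.

(** ** Binomial series *)

(** The coefficients of [(1 - x)^(-s)]. *)
Definition binom_coef s (k : nat) : R := \prod_(j < k) ((s + j%:R) / j.+1%:R).

Lemma binom_coefS s k : k.+1%:R * binom_coef s k.+1 = (s + k%:R) * binom_coef s k.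
Proof.
rewrite /binom_coef big_ord_recr/= mulrCA [k.+1%:R * _]mulrC mulfVK ?pnatr_eq0//.
by rewrite mulrC.
Qed.

Lemma binom_coef_ge0 s k : 0 <= s -> 0 <= binom_coef s k.
Proof. by move=> s0; apply: prodr_ge0 => j _; rewrite divr_ge0// addr_ge0. Qed.

Lemma binom_coef_le1 s k : 0 <= s <= 1 -> binom_coef s k <= 1.
Proof.
move=> /andP[s0 s1]; rewrite /binom_coef.
apply: le_trans (_ : \prod_(j < k) 1 <= 1); last by rewrite big1.
apply: ler_prod => j _; rewrite divr_ge0 ?addr_ge0//=.
by rewrite ler_pdivrMr ?ltr0n// mul1r -natr1 addrC lerD2l.
Qed.

Definition binser s : fps C := fun k => (binom_coef s k)%:C%C.

Lemma indisc_bounded (f : fps C) (B : R) : (forall n, normc (f n) <= B) -> indisc f.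
Proof.
move=> hB rho /andP[r0 r1]; have B0 : 0 <= B by exact: le_trans (normc_ge0 _) (hB 0%N).
exists (B / (1 - rho)) => N; rewrite ler_pdivlMr ?subr_gt0//.
apply: (@le_trans _ _ ((\sum_(n < N) B * rho ^+ n) * (1 - rho))).
  rewrite ler_wpM2r ?subr_ge0 ?(ltW r1)// ler_sum// => i _.
  by rewrite ler_wpM2r ?exprn_ge0.
rewrite -mulr_sumr -mulrA ler_piMr// mulrC -opprB mulNr -subrX1 opprB.
by rewrite gerBl exprn_ge0.
Qed.

Lemma indisc_binser s : 0 <= s <= 1 -> indisc (binser s).
Proof.
move=> hs; apply: (@indisc_bounded _ 1) => n; have [s0 _] := andP hs.
by rewrite normc_realp ?binom_coef_ge0// binom_coef_le1.
Qed.

(** [theta = z d/dz] acts on the binomial series as multiplication by [s z / (1 - z)]. *)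
Lemma binser_theta s :
  (1 - fpsX C) * (fun n => n%:R * binser s n : C) = fpsC s%:C%C * (fpsX C * binser s).
Proof.
apply/funext => n; rewrite mulrBl mul1r fpsBE fpsCM !fpsXM.
case: n => [|n]; first by rewrite mul0r mulr0 subr0.
rewrite /binser -!(rmorph_nat (real_complex R)) -!rmorphM -rmorphB/=; congr (_%:C)%C.
by rewrite binom_coefS mulrDl addrK.
Qed.

End ComplexPower.

(** ** The sum of the binomial series *)

Section BinomialSum.
Variable R : realType.
Local Notation C := R[i].
Local Open Scope classical_set_scope.
Local Open Scope ring_scope.
Implicit Types (f g : R -> R) (t : R).

Lemma is_deriveM1 f g t df dg : is_derive t (1 : R) f df -> is_derive t (1 : R) g dg ->
  is_derive t (1 : R) (fun x => f x * g x) (df * g t + f t * dg).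
Proof.
move=> hf hg; have [d e] := is_deriveM hf hg; split; first exact: d.
by rewrite [LHS]e /GRing.scale/= addrC; congr (_ + _); rewrite mulrC.
Qed.

Lemma is_deriveD1 f g t df dg : is_derive t (1 : R) f df -> is_derive t (1 : R) g dg ->
  is_derive t (1 : R) (fun x => f x + g x) (df + dg).
Proof. by move=> hf hg; exact: is_deriveD. Qed.

Lemma is_deriveN1 f t df : is_derive t (1 : R) f df ->
  is_derive t (1 : R) (fun x => - f x) (- df).
Proof. by move=> hf; exact: is_deriveN. Qed.

Lemma is_derive_comp1 f g t df dg : is_derive t (1 : R) f df -> is_derive (f t) (1 : R) g dg ->
  is_derive t (1 : R) (fun x => g (f x)) (dg * df).
Proof. by move=> hf hg; have := is_derive1_comp hg hf; exact. Qed.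

Lemma is_deriveV1 f t df : f t != 0 -> is_derive t (1 : R) f df ->
  is_derive t (1 : R) (fun x => (f x)^-1) (- (f t) ^- 2 * df).
Proof.
move=> f0 hf; have [d e] := hf; split.
  exact: derivableV.
by rewrite deriveV// e /GRing.scale.
Qed.

Lemma is_derive_cst1 (c t : R) : is_derive t (1 : R) (fun=> c) 0.
Proof. exact: is_derive_cst. Qed.
Lemma is_derive_id1 (t : R) : is_derive t (1 : R) (fun x => x) 1.
Proof. exact: is_derive_id. Qed.

Lemma part_series_cvg (p : C -> R) (h : fps C) (w : C) :
  (forall x, `|p x| <= normc x) -> normc w < 1 -> indisc h ->
  cvgn (series (fun n => p (h n * w ^+ n))).
Proof.
move=> pn w1 hh; have hw : 0 <= normc w < 1 by rewrite normc_ge0.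
have hc := abssum_cvg (normc_ge0 w) (hh _ hw).
apply: normed_cvg; apply: series_le_cvg hc => n /=.
- by [].
- by rewrite mulr_ge0 ?normc_ge0 ?exprn_ge0 ?normc_ge0.
- by rewrite -normcX -normcM.
Qed.

Lemma cRe_mulr (t : R) (w : C) : complex.Re (t%:C%C * w) = t * complex.Re w.
Proof. by rewrite cReM/= mul0r subr0. Qed.
Lemma cIm_mulr (t : R) (w : C) : complex.Im (t%:C%C * w) = t * complex.Im w.
Proof. by rewrite cImM/= mul0r addr0. Qed.

Variables (s : R) (z : C).
Hypothesis s01 : 0 <= s <= 1.
Hypothesis z1 : normc z < 1.

Let P := binser s : fps C.
Let Q1 : fps C := fun k => (s + k%:R)%:C%C * z * P k.
Let Q2 : fps C := fun k => (s + k.+1%:R)%:C%C * (s + k%:R)%:C%C * z ^+ 2 * P k.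

Let indP : indisc P. Proof. exact: indisc_binser. Qed.

Let indQ1 : indisc Q1.
Proof.
rewrite (_ : Q1 = (fun n => (s%:C%C * z) * P n) + (fun n => z * (P n * n%:R)) :> fps C).
  by apply: indiscD; apply: indisc_scale => //; exact: indisc_natmul.
by apply/funext => n; rewrite fpsDE /Q1 rmorphD/= rmorph_nat; ring.
Qed.

Let indQ2 : indisc Q2.
Proof.
rewrite (_ : Q2 = (fun n => ((s + 1)%:C%C * z) * Q1 n) + (fun n => z * (Q1 n * n%:R)) :> fps C).
  by apply: indiscD; apply: indisc_scale => //; exact: indisc_natmul.
by apply/funext => n; rewrite fpsDE /Q2 /Q1 -natr1 !rmorphD/= !rmorph_nat rmorph1; ring.
Qed.

Let PS k : k.+1%:R * P k.+1 = (s + k%:R)%:C%C * P k.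
Proof.
by rewrite /P /binser -(rmorph_nat (real_complex R)) -!rmorphM/= binom_coefS.
Qed.

Section Part.
(* [p] will be the real or the imaginary part: real power series are differentiated
   along the ray through [z]. *)
Variable p : C -> R.
Hypothesis pn : forall x, `|p x| <= normc x.
Hypothesis pZ : forall (t : R) x, p (t%:C%C * x) = t * p x.

Let c : R^nat := fun k => p (P k * z ^+ k).

Let cE (t : R) : pseries c t = series (fun n => p (P n * (t%:C%C * z) ^+ n)).
Proof.
congr series; apply/funext => n; rewrite /c/= mulrC -pZ rmorphXn; congr p.
by rewrite exprMn; ring.
Qed.

Let d1E (t : R) : pseries (pseries_diffs c) t = series (fun n => p (Q1 n * (t%:C%C * z) ^+ n)).
Proof.
congr series; apply/funext => n; rewrite /pseries_diffs /c/= -pZ mulrC -pZ rmorphXn rmorph_nat; congr p.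
by rewrite [n.+1%:R * _]mulrA PS /Q1 exprMn exprS; ring.
Qed.

Let d2E (t : R) : pseries (pseries_diffs (pseries_diffs c)) t =
  series (fun n => p (Q2 n * (t%:C%C * z) ^+ n)).
Proof.
congr series; apply/funext => n; rewrite /pseries_diffs /c/= -!pZ mulrC -pZ rmorphXn !rmorph_nat; congr p.
rewrite [n.+2%:R * _]mulrA PS [_ * (_ * P n.+1 * _)](_ : _ =
  (s + n.+1%:R)%:C%C * (n.+1%:R * P n.+1) * z ^+ n.+2); last by ring.
by rewrite PS /Q2 exprMn !exprS; ring.
Qed.

Lemma part_binser_derive t : `|t| <= 1 ->
  is_derive t (1 : R) (fun x => limn (series (fun n => p (P n * (x%:C%C * z) ^+ n))))
    (limn (series (fun n => p (Q1 n * (t%:C%C * z) ^+ n)))).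
Proof.
move=> t1; pose K := 2 / (1 + normc z); have n0 := normc_ge0 z; have z1' := z1.
have K1 : 1 < K by rewrite /K ltr_pdivlMr; lra.
have Kz : normc (K%:C%C * z) < 1.
  rewrite normcM normc_realp; last by lra.
  by rewrite /K mulrAC ltr_pdivrMr; lra.
have := @pseries_snd_diffs R c K t.
rewrite cE d1E d2E (d1E t) (_ : (fun x => limn (pseries c x)) = (fun x =>
   limn (series (fun n => p (P n * (x%:C%C * z) ^+ n))))); last first.
  by apply/funext => x; rewrite cE.
apply; try exact: part_series_cvg.
by rewrite (ger0_norm (_ : 0 <= K)) ?(le_lt_trans t1)//; lra.
Qed.
End Part.

Let ode (t : R) : `|t| <= 1 ->
  (1 - t%:C%C * z) * ev (t%:C%C * z) Q1 = s%:C%C * z * ev (t%:C%C * z) P.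
Proof.
move=> t1; set w := t%:C%C * z.
have w1 : normc w < 1.
  by rewrite normcM normc_real; apply: le_lt_trans z1; rewrite ler_piMl ?normc_ge0.
have hT : indisc (fun n => n%:R * P n).
  rewrite (_ : (fun n => _) = (fun n => P n * n%:R)); first exact: indisc_natmul.
  by apply/funext => n; rewrite mulrC.
have -> : ev w Q1 = z * (s%:C%C * ev w P + ev w (fun n => n%:R * P n)).
  rewrite -ev_scale// -evD//; last exact: indisc_scale.
  rewrite -ev_scale//; last by apply: indiscD => //; exact: indisc_scale.
  by congr ev; apply/funext => n; rewrite fpsDE /Q1 rmorphD/= rmorph_nat; ring.
have ind1 := @indisc1 R; have indX := @indiscX R.
have := congr1 (ev w) (binser_theta s).
rewrite !evM ?evB ?ev1 ?evX ?evC//; try exact: indiscC; try exact: indiscM; try exact: indiscB.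
move=> e; rewrite mulrCA mulrDr e; ring.
Qed.


Let log_derive (t : R) (u v : R -> R) (du dv : R) :
  0 < u t -> is_derive t (1 : R) u du -> is_derive t (1 : R) v dv ->
  is_derive t (1 : R) (fun x => 2^-1 * ln (u x ^+ 2 + v x ^+ 2))
     ((u t * du + v t * dv) / (u t ^+ 2 + v t ^+ 2)) /\
  is_derive t (1 : R) (fun x => atan (v x / u x))
     ((dv * u t - v t * du) / (u t ^+ 2 + v t ^+ 2)).
Proof.
move=> u0 hu hv; have uN : u t != 0 by rewrite gt_eqF.
have n0 : 0 < u t ^+ 2 + v t ^+ 2 by rewrite ltr_pwDl ?exprn_gt0 ?sqr_ge0.
split.
  have h : is_derive t (1 : R) (fun x => u x ^+ 2 + v x ^+ 2)
      ((du * u t + u t * du) + (dv * v t + v t * dv)).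
    rewrite (_ : (fun x => _) = fun x => u x * u x + v x * v x); last first.
      by apply/funext => x; rewrite !expr2.
    by apply: is_deriveD1; apply: is_deriveM1.
  have h2 := is_deriveM1 (is_derive_cst1 2^-1 t) (is_derive_comp1 h (is_derive1_ln n0)).
  refine (is_derive_eq h2 _); rewrite mul0r add0r; field.
  by rewrite gt_eqF.
have h := is_deriveM1 hv (is_deriveV1 uN hu).
have h2 := is_derive_comp1 h (is_derive1_atan _); refine (is_derive_eq h2 _).
field; rewrite uN /=.
have -> : u t ^+ 2 + v t ^+ 2 != 0 by rewrite gt_eqF.
by [].
Qed.

Lemma is_derive_continuous_itv (f df : R -> R) (a b : R) :
  (forall t, a <= t <= b -> is_derive t (1 : R) f (df t)) -> {within `[a, b], continuous f}.
Proof.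
move=> h; apply: derivable_within_continuous => t; rewrite in_itv/= => /h [].
by [].
Qed.

(** The binomial series solves the same linear ODE along each ray as the power function. *)
Lemma ev_binser : ev z (binser s) = cpow (- s) (1 - z).
Proof.
pose a := complex.Re z; pose b := complex.Im z.
have za : `|a| < 1 by exact: le_lt_trans (normc_Re z) z1.
pose u (t : R) := 1 - t * a; pose v (t : R) := - (t * b).
have zt t : 0 <= t <= 1 -> 0 < u t.
  move=> /andP[t0 t1]; rewrite /u subr_gt0; apply: le_lt_trans za.
  apply: le_trans (ler_norm _) _; rewrite normrM (ger0_norm t0).
  by rewrite ler_piMl.
have uvE t : 1 - t%:C%C * z = (u t +i* v t)%C.
  rewrite /u /v /a /b; case: (z) => x y; apply/eqP; rewrite eq_complex/=.
  by apply/andP; split; apply/eqP; ring.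
pose Lr t := 2^-1 * ln (u t ^+ 2 + v t ^+ 2); pose Li t := atan (v t / u t).
have LE t : 0 <= t <= 1 -> clog (1 - t%:C%C * z) = (Lr t +i* Li t)%C.
  move=> ht; rewrite /clog uvE/= /Lr /Li; congr (_ +i* _)%C.
  have n0 : 0 < u t ^+ 2 + v t ^+ 2 by rewrite ltr_pwDl ?exprn_gt0 ?sqr_ge0 ?zt.
  rewrite -{2}(sqr_sqrtr (ltW n0)) lnXn ?sqrtr_gt0// -[X in _ = _ * X]mulr_natl mulKf//.
have du t : is_derive t (1 : R) u (- a).
  have h := is_deriveD1 (is_derive_cst1 1 t) (is_deriveN1 (is_deriveM1 (is_derive_id1 t) (is_derive_cst1 a t))).
  by refine (is_derive_eq h _); rewrite mulr0 mul1r addr0 add0r.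
have dv t : is_derive t (1 : R) v (- b).
  have h := is_deriveN1 (is_deriveM1 (is_derive_id1 t) (is_derive_cst1 b t)).
  by refine (is_derive_eq h _); rewrite mulr0 mul1r addr0.
pose dLr t := (u t * - a + v t * - b) / (u t ^+ 2 + v t ^+ 2).
pose dLi t := (- b * u t - v t * - a) / (u t ^+ 2 + v t ^+ 2).
have dL t : 0 <= t <= 1 -> is_derive t (1 : R) Lr (dLr t) /\ is_derive t (1 : R) Li (dLi t).
  by move=> ht; apply: log_derive => //; exact: zt.
have dLE t : 0 <= t <= 1 -> (1 - t%:C%C * z) * (dLr t +i* dLi t)%C = - z.
  move=> ht; have n0 : u t ^+ 2 + v t ^+ 2 != 0.
    by rewrite gt_eqF// ltr_pwDl ?exprn_gt0 ?sqr_ge0 ?zt.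
  rewrite uvE (_ : z = (a +i* b)%C); last by rewrite /a /b; case: (z).
  apply/eqP; rewrite eq_complex/= /dLr /dLi.
  by apply/andP; split; apply/eqP; field.
pose Gr t := expR (s * Lr t) * cos (s * Li t); pose Gi t := expR (s * Lr t) * sin (s * Li t).
have GE t : 0 <= t <= 1 -> cpow s (1 - t%:C%C * z) = (Gr t +i* Gi t)%C.
  by move=> ht; rewrite /cpow LE// /cexp cRe_mulr cIm_mulr.
have dG t : 0 <= t <= 1 ->
   is_derive t (1 : R) Gr (s * (dLr t * Gr t - dLi t * Gi t)) /\
   is_derive t (1 : R) Gi (s * (dLr t * Gi t + dLi t * Gr t)).
  move=> ht; have [h1 h2] := dL t ht.
  have e1 := is_deriveM1 (is_derive_cst1 s t) h1; have e2 := is_deriveM1 (is_derive_cst1 s t) h2.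
  have x1 := is_derive_comp1 e1 (is_derive_expR _).
  have c1 := is_derive_comp1 e2 (is_derive_cos _).
  have s1 := is_derive_comp1 e2 (is_derive_sin _).
  split; [refine (is_derive_eq (is_deriveM1 x1 c1) _)|refine (is_derive_eq (is_deriveM1 x1 s1) _)];
    rewrite /Gr /Gi; ring.
pose Fr t := complex.Re (ev (t%:C%C * z) P); pose Fi t := complex.Im (ev (t%:C%C * z) P).
pose F'r t := complex.Re (ev (t%:C%C * z) Q1); pose F'i t := complex.Im (ev (t%:C%C * z) Q1).
have dF t : 0 <= t <= 1 -> is_derive t (1 : R) Fr (F'r t) /\ is_derive t (1 : R) Fi (F'i t).
  move=> /andP[t0 t1]; split; apply: part_binser_derive; rewrite ?ger0_norm//.
  - exact: normc_Re. - exact: cRe_mulr. - exact: normc_Im. - exact: cIm_mulr.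
have key t : 0 <= t <= 1 ->
    (F'r t +i* F'i t)%C * (Gr t +i* Gi t)%C + (Fr t +i* Fi t)%C *
     (s%:C%C * ((dLr t +i* dLi t)%C * (Gr t +i* Gi t)%C)) = 0.
  move=> ht; have [t0 t1] := andP ht.
  have w0 : 1 - t%:C%C * z != 0 by apply: Re_gt0_neq0; rewrite uvE/= zt.
  apply: (mulfI w0); rewrite mulr0.
  have := ode (_ : `|t| <= 1); rewrite ger0_norm// => /(_ t1).
  have -> : ev (t%:C%C * z) Q1 = (F'r t +i* F'i t)%C by rewrite /F'r /F'i; case: (ev _ _).
  have -> : ev (t%:C%C * z) P = (Fr t +i* Fi t)%C by rewrite /Fr /Fi; case: (ev _ _).
  move=> e; rewrite [LHS](_ : _ = ((1 - t%:C%C * z) * (F'r t +i* F'i t)%C) * (Gr t +i* Gi t)%C +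
    (Fr t +i* Fi t)%C * s%:C%C * (Gr t +i* Gi t)%C *
       ((1 - t%:C%C * z) * (dLr t +i* dLi t)%C)); last by ring.
  by rewrite e dLE//; ring.
have cst (h dh : R -> R) : (forall t, 0 <= t <= 1 -> is_derive t (1 : R) h (dh t)) ->
    (forall t, 0 <= t <= 1 -> dh t = 0) -> h 1 = h 0.
  move=> hd h0; have hc := is_derive_continuous_itv hd.
  have [|c] := @MVT_segment R h dh 0 1 ler01 _ hc.
    by move=> x; rewrite in_itv/= => /andP[x0 x1]; apply: hd; rewrite !ltW.
  rewrite in_itv/= => /h0 -> /eqP; rewrite mul0r subr_eq0 => /eqP.
  by [].
have hr : Fr 1 * Gr 1 - Fi 1 * Gi 1 = Fr 0 * Gr 0 - Fi 0 * Gi 0.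
  apply: (cst (fun t => Fr t * Gr t - Fi t * Gi t)
    (fun t => (F'r t * Gr t + Fr t * (s * (dLr t * Gr t - dLi t * Gi t))) -
              (F'i t * Gi t + Fi t * (s * (dLr t * Gi t + dLi t * Gr t))))) => t ht.
    have [f1 f2] := dF t ht; have [g1 g2] := dG t ht.
    by apply: is_deriveD1; [|apply: is_deriveN1]; exact: is_deriveM1.
  have := congr1 (@complex.Re R) (key t ht); rewrite /= => <-; ring.
have hi : Fr 1 * Gi 1 + Fi 1 * Gr 1 = Fr 0 * Gi 0 + Fi 0 * Gr 0.
  apply: (cst (fun t => Fr t * Gi t + Fi t * Gr t)
    (fun t => (F'r t * Gi t + Fr t * (s * (dLr t * Gi t + dLi t * Gr t))) +
              (F'i t * Gr t + Fi t * (s * (dLr t * Gr t - dLi t * Gi t))))) => t ht.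
    have [f1 f2] := dF t ht; have [g1 g2] := dG t ht.
    by apply: is_deriveD1; exact: is_deriveM1.
  have := congr1 (@complex.Im R) (key t ht); rewrite /= => <-; ring.
have prod1 : ev z P * cpow s (1 - z) = ev 0 P * cpow s 1.
  have h1 : (fun t : R => is_true (0 <= t <= 1)) 1 by rewrite ler01/=.
  have h0 : (fun t : R => is_true (0 <= t <= 1)) 0 by rewrite lexx/=.
  have := GE 1 h1; rewrite rmorph1 mul1r => ->.
  have := GE 0 h0; rewrite rmorph0 mul0r subr0 => ->.
  have -> : ev z P = (Fr 1 +i* Fi 1)%C by rewrite /Fr /Fi rmorph1 mul1r; case: (ev _ _).
  have -> : ev 0 P = (Fr 0 +i* Fi 0)%C by rewrite /Fr /Fi rmorph0 mul0r; case: (ev _ _).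
  by apply/eqP; rewrite eq_complex/= hr hi !eqxx.
have c1 : cpow s 1 = 1.
  by have := cpow_real s (@ltr01 R); rewrite powR1.
have e0 : ev 0 P = 1.
  have z0 : normc (0 : C) < 1 by rewrite normc0.
  apply: evP => //; apply: cvg_near_cst; exists 1%N => // -[|N] //= _.
  rewrite big_ord_recl big1 => [|i _]; last by rewrite expr0n mulr0.
  by rewrite expr0 mulr1 addr0 /P /binser /binom_coef big_ord0 subrr normc0.
move: prod1; rewrite c1 e0 mulr1 => h.
have cs : cpow (- s) (1 - z) = (cpow s (1 - z))^-1.
  by rewrite /cpow rmorphN mulNr cexpN.
by apply: (mulIf (cpow_neq0 s (1 - z))); rewrite -/P h cs mulVf ?cpow_neq0.
Qed.

End BinomialSum.

(** * Symbols of the discrete equations *)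

Section Symbols.
Variable R : realType.
Local Notation C := R[i].
Local Open Scope classical_set_scope.
Local Open Scope ring_scope.
Implicit Types (z w : C) (r mu : R).

Variable s : R.
Hypothesis s01 : 0 < s < 1.

Let s0 : 0 < s. Proof. by case/andP: s01. Qed.
Let s1 : s < 1. Proof. by case/andP: s01. Qed.
Let s01' : 0 <= s <= 1. Proof. by rewrite !ltW. Qed.

Local Notation x := (fpsX C).

(** [delta_pow] is [delta^(-s)] for [delta = (1 - x) (3 - x) / 2], the generating function
    of the second order backward difference, and [phi3] is its factor
    [((3 - x) / 2)^(-s)].  The scalar schemes are [sbd_sym mu * V = - mu x / (1 - x)] and,
    for backward Euler convolution quadrature, [be_sym mu * V = - mu / (1 - x)]. *)
Definition geom : fps C := fun=> 1.
Definition binser3 : fps C := fun n => 3^-1 ^+ n * binser s n.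
Definition kap : C := ((3 / 2) `^ (- s))%:C%C.
Definition phi3 : fps C := fpsC kap * binser3.
Definition delta_pow : fps C := binser s * phi3.
Definition bsym : fps C := (1 - x) * delta_pow.
Definition gsym : fps C := fpsC 4^-1 * (3 + x * x).
Definition sbd_sym mu : fps C := bsym + fpsC mu%:C%C * gsym.
Definition be_sym mu : fps C := (1 - x) * binser s + fpsC mu%:C%C.

Lemma geomE : (1 - x) * geom = 1.
Proof.
apply/funext => n; rewrite mulrBl mul1r fpsBE fpsXM fps1E.
by case: n => [|n]; rewrite /geom ?subr0 ?subrr.
Qed.

Lemma indisc_geom : indisc geom.
Proof. by apply: (@indisc_bounded _ _ 1) => n; rewrite normc1. Qed.

Lemma indisc_1x : indisc (1 - x).
Proof. by apply: indiscB; [exact: indisc1|exact: indiscX]. Qed.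

Lemma normc3V : normc (3^-1 : C) = 3^-1.
Proof. by rewrite normcV normc_nat. Qed.

Lemma indisc_binser3 : indisc binser3.
Proof.
apply: (@indisc_le _ (binser s) _ 1); last exact: indisc_binser.
move=> n; rewrite normcM mul1r ler_piMl ?normc_ge0// normcX normc3V.
by rewrite exprn_ile1//; lra.
Qed.

Lemma indisc_phi3 : indisc phi3.
Proof. by apply: indiscM; [exact: indiscC|exact: indisc_binser3]. Qed.

Lemma indisc_delta_pow : indisc delta_pow.
Proof. by apply: indiscM; [exact: indisc_binser|exact: indisc_phi3]. Qed.

Lemma indisc_bsym : indisc bsym.
Proof. by apply: indiscM; [exact: indisc_1x|exact: indisc_delta_pow]. Qed.

Lemma indisc_gsym : indisc gsym.
Proof.
apply: indiscM; first exact: indiscC.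
apply: indiscD; last by apply: indiscM; exact: indiscX.
by rewrite -fpsCn; exact: indiscC.
Qed.

Lemma indisc_sbd_sym mu : indisc (sbd_sym mu).
Proof.
apply: indiscD; first exact: indisc_bsym.
by apply: indiscM; [exact: indiscC|exact: indisc_gsym].
Qed.

Lemma indisc_be_sym mu : indisc (be_sym mu).
Proof.
apply: indiscD; last exact: indiscC.
by apply: indiscM; [exact: indisc_1x|exact: indisc_binser].
Qed.

Lemma Re_lt_normc z (m : R) : normc z < m -> - m < complex.Re z < m.
Proof. by move=> h; rewrite -ltr_norml; apply: le_lt_trans h; exact: normc_Re. Qed.

Lemma Re_1z z : normc z < 1 -> 0 < complex.Re (1 - z).
Proof. by move=> /Re_lt_normc/andP[_ h]; rewrite cReD cReN/= subr_gt0. Qed.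

Lemma normc_z3 z : normc (z / 3) = normc z / 3.
Proof. by rewrite normcM normc3V. Qed.

Lemma Re_1z3 z : normc z < 1 -> 2 / 3 < complex.Re (1 - z / 3).
Proof.
move=> h; have /Re_lt_normc/andP[_ h'] : normc (z / 3) < 1 / 3.
  by rewrite normc_z3 ltr_pM2r// invr_gt0.
by rewrite cReD cReN/=; lra.
Qed.

Lemma ev_binser3 z : normc z < 1 -> ev z binser3 = cpow (- s) (1 - z / 3).
Proof.
move=> z1; have z3 : normc (z / 3) < 1 by rewrite normc_z3; lra.
rewrite -(ev_binser s01' z3).
have e n : binser3 n * z ^+ n = binser s n * (z / 3) ^+ n.
  by rewrite /binser3 exprMn exprVn; ring.
by rewrite /ev; congr (limn (series _) +i* limn (series _))%C; apply/funext => n; rewrite e.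
Qed.

Lemma kapE : kap = cpow (- s) (3 / 2).
Proof.
rewrite /kap -cpow_real; last by rewrite divr_gt0.
by rewrite rmorphM/= fmorphV !rmorph_nat.
Qed.

Lemma ev_phi3 z : normc z < 1 -> ev z phi3 = cpow (- s) ((3 - z) / 2).
Proof.
move=> z1; rewrite evM//; [|exact: indiscC|exact: indisc_binser3].
rewrite evC// ev_binser3// kapE.
have h3 : (3 / 2 : C) = (3 / 2 : R)%:C%C by rewrite rmorphM/= fmorphV !rmorph_nat.
have e : (3 / 2 : C) * (1 - z / 3) = (3 - z) / 2 by field.
have r3 := Re_1z3 z1.
have r2 : 0 < complex.Re ((3 / 2 : C) * (1 - z / 3)).
  by rewrite h3 cRe_mulr; rewrite mulr_gt0//; lra.
by rewrite -cpowM ?e//; [rewrite h3/= divr_gt0|lra|rewrite -e].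
Qed.

Lemma ev_bsym z : normc z < 1 ->
  ev z bsym = cpow (1 - s) (1 - z) * cpow (- s) ((3 - z) / 2).
Proof.
move=> z1; rewrite evM//; [|exact: indisc_1x|exact: indisc_delta_pow].
rewrite evB//; [|exact: indisc1|exact: indiscX]; rewrite ev1// evX//.
rewrite evM//; [|exact: indisc_binser|exact: indisc_phi3].
by rewrite ev_phi3// ev_binser// mulrA cpowD cpow1// Re_1z.
Qed.

Lemma Re_cexp_ge0 w : - (pi / 2) < complex.Im w < pi / 2 -> 0 <= complex.Re (cexp w).
Proof. by move=> h; rewrite /cexp/= mulr_ge0 ?expR_ge0// ltW// cos_gt0_pihalf. Qed.

(** The two factors contribute arguments of opposite orders [1 - s] and [s], so that the
    argument of the symbol stays within [pi / 2]. *)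
Lemma Re_bsym z : normc z < 1 -> 0 <= complex.Re (ev z bsym).
Proof.
move=> z1; rewrite ev_bsym// /cpow -cexpD; apply: Re_cexp_ge0.
rewrite cImD !cIm_mulr.
have /andP[a1 a2] := clog_Im (1 - z); have /andP[b1 b2] := clog_Im ((3 - z) / 2).
set a := complex.Im _ in a1 a2 *; set b := complex.Im _ in b1 b2 *.
have p0 := pi_gt0 R; have s0' := s0; have s1' := s1.
apply/andP; split; nra.
Qed.

Lemma ev_gsym z : normc z < 1 -> ev z gsym = (3 + z * z) / 4.
Proof.
move=> z1; have i3 : indisc (3 : fps C) by rewrite -fpsCn; exact: indiscC.
have ixx : indisc (x * x) by apply: indiscM; exact: indiscX.
rewrite evM//; [|exact: indiscC|exact: indiscD].
rewrite evC// evD// evM//; try exact: indiscX.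
by rewrite evX// (_ : (3 : fps C) = fpsC 3) ?evC -?fpsCn// mulrC.
Qed.

Lemma normc_zz z : normc z < 1 -> normc (z * z) < 1.
Proof. by move=> z1; rewrite normcM; have := normc_ge0 z => h; nra. Qed.

Lemma Re_div_nat w n : complex.Re (w / n.+1%:R) = complex.Re w / n.+1%:R.
Proof.
have -> : w / n.+1%:R = (n.+1%:R^-1)%:C%C * w by rewrite fmorphV rmorph_nat mulrC.
by rewrite cRe_mulr mulrC.
Qed.

Lemma Re_gsym z : normc z < 1 -> 1 / 2 <= complex.Re (ev z gsym).
Proof.
move=> z1; rewrite ev_gsym// (_ : 4 = 4%:R :> C)// Re_div_nat cReD.
have /Re_lt_normc/andP[h _] := normc_zz z1.
have -> : complex.Re (3 : C) = 3.
  by rewrite -(rmorph_nat (real_complex R)).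
lra.
Qed.

Lemma normc_gsym z : normc z < 1 -> normc (ev z gsym) <= 1.
Proof.
move=> z1; rewrite ev_gsym// normcM normcV !normc_nat ler_pdivrMr// mul1r.
apply: le_trans (le_normcD _ _) _; rewrite normc_nat.
by have := normc_zz z1 => h; lra.
Qed.

(** Sector condition: a symbol with nonnegative real part cannot cancel [mu g]. *)
Lemma sector_lower (b g : C) mu : 0 <= mu -> 0 <= complex.Re b ->
  1 / 2 <= complex.Re g -> normc g <= 1 ->
  normc b + mu <= 5 * normc (b + mu%:C%C * g).
Proof.
move=> mu0 hb hg g1; set N := normc (b + _).
have h1 : mu / 2 <= N.
  apply: (le_trans _ (normc_Re (b + mu%:C%C * g))); apply: (le_trans _ (ler_norm _)).
  by rewrite cReD cRe_mulr; nra.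
have h2 : normc b <= N + mu.
  rewrite -[b in normc b](addrK (mu%:C%C * g)); apply: le_trans (normcB _ _) _.
  by rewrite lerD2l normcM normc_realp// ler_piMr.
lra.
Qed.

Lemma ev_sbd_sym mu z : normc z < 1 ->
  ev z (sbd_sym mu) = ev z bsym + mu%:C%C * ev z gsym.
Proof.
move=> z1; rewrite evD//; [|exact: indisc_bsym|by apply: indiscM; [exact: indiscC|exact: indisc_gsym]].
by rewrite evM// ?evC//; [exact: indiscC|exact: indisc_gsym].
Qed.

Lemma Re_sbd_sym mu z : 0 <= mu -> normc z < 1 -> mu / 2 <= complex.Re (ev z (sbd_sym mu)).
Proof.
move=> mu0 z1; rewrite ev_sbd_sym// cReD cRe_mulr.
have h1 := Re_bsym z1; have h2 := Re_gsym z1; nra.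
Qed.

Lemma ev_asym z : normc z < 1 -> ev z ((1 - x) * binser s) = cpow (1 - s) (1 - z).
Proof.
move=> z1; rewrite evM//; [|exact: indisc_1x|exact: indisc_binser].
rewrite evB//; [|exact: indisc1|exact: indiscX].
by rewrite ev1// evX// ev_binser// cpowD cpow1// Re_1z.
Qed.

Lemma Re_asym z : normc z < 1 -> 0 <= complex.Re (ev z ((1 - x) * binser s)).
Proof.
move=> z1; rewrite ev_asym//; apply: Re_cexp_ge0; rewrite cIm_mulr.
have /andP[a1 a2] := clog_Im (1 - z); set a := complex.Im _ in a1 a2 *.
have p0 := pi_gt0 R; have s0' := s0; have s1' := s1.
apply/andP; split; nra.
Qed.

Lemma ev_be_sym mu z : normc z < 1 ->
  ev z (be_sym mu) = ev z ((1 - x) * binser s) + mu%:C%C.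
Proof.
move=> z1; rewrite evD ?evC//; last exact: indiscC.
by apply: indiscM; [exact: indisc_1x|exact: indisc_binser].
Qed.

Lemma Re_be_sym mu z : 0 <= mu -> normc z < 1 -> mu <= complex.Re (ev z (be_sym mu)).
Proof. by move=> mu0 z1; rewrite ev_be_sym// cReD/= lerDr Re_asym. Qed.

(** ** Solving equations whose symbol is accretive *)

(** Half of the energy is absorbed by Young's inequality. *)
Lemma energy_bound (A W F : fps C) m (c rho : R) : 0 < c -> 0 <= rho < 1 -> indisc A ->
  (forall n, (n < m)%N -> (A * W) n = F n) ->
  (forall z, normc z < 1 -> c <= complex.Re (ev z A)) ->
  \sum_(n < m) normc (W n) ^+ 2 * rho ^+ (n + n) <=
  (c ^+ 2)^-1 * \sum_(n < m) normc (F n) ^+ 2 * rho ^+ (n + n).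
Proof.
move=> c0 hr hA hW hc; have [r0 r1] := andP hr.
pose W' : fps C := fun n => if (n < m)%N then W n else 0.
have W'0 n : (m <= n)%N -> W' n = 0 by rewrite /W' ltnNge => ->.
have := energy hr hA W'0 hc.
rewrite (eq_bigr (fun n : 'I_m => normc (W n) ^+ 2 * rho ^+ (n + n))); last first.
  by move=> n _; rewrite /W' ltn_ord.
set S := \sum_(n < m) _ => h.
have h2 : c * S <= \sum_(n < m) (c / 2 * (normc (W n) ^+ 2 * rho ^+ (n + n)) +
     (2 * c)^-1 * (normc (F n) ^+ 2 * rho ^+ (n + n))).
  apply: le_trans h _; apply: ler_sum => n _.
  have -> : (A * W') n = F n.
    rewrite -hW//; apply: fps_mul_eq => i ni.
    by rewrite /W' (leq_ltn_trans ni).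
  rewrite mulrA [X in _ <= _ + X]mulrA -mulrDl ler_wpM2r ?exprn_ge0//.
  apply: le_trans (ler_norm _) _; apply: le_trans (normc_Re _) _.
  rewrite /W' ltn_ord normcM normc_conj.
  set a := normc _; set b := normc _.
  have : 0 <= (2 * c)^-1 * (c * a - b) ^+ 2.
    by rewrite mulr_ge0 ?sqr_ge0// invr_ge0 mulr_ge0// ltW.
  rewrite (_ : _ * _ ^+ 2 = c / 2 * a ^+ 2 + (2 * c)^-1 * b ^+ 2 - a * b); last first.
    by field; rewrite gt_eqF.
  by rewrite subr_ge0.
rewrite big_split/= -!mulr_sumr -/S in h2.
set T := \sum_(n < m) _ in h2 *.
have h3 : c / 2 * S <= (2 * c)^-1 * T by lra.
rewrite -(ler_pM2l (_ : 0 < c / 2)) ?divr_gt0//.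
apply: le_trans h3 _; rewrite le_eqVlt; apply/orP; left; apply/eqP.
by field; rewrite gt_eqF.
Qed.

(** Bounded weighted sums of squares for every radius below 1 are stronger than absolute
    convergence at every smaller radius. *)
Lemma indisc_solve (A W F : fps C) (c : R) : 0 < c -> indisc A -> indisc F ->
  A * W = F -> (forall z, normc z < 1 -> c <= complex.Re (ev z A)) -> indisc W.
Proof.
move=> c0 hA hF e hc rho /andP[r0 r1].
pose t := (1 + rho) / 2; have rt : rho < t by rewrite /t; lra.
have t1 : t < 1 by rewrite /t; lra.
have t0 : 0 < t by lra.
have ht : 0 <= t < 1 by rewrite ltW.
have [B hB] := hF t ht.
have B0 : 0 <= B by have := hB 0%N; rewrite big_ord0.
have W2 n : normc (W n) * t ^+ n <= B / c.
  have := @energy_bound A W F n.+1 c t c0 ht hA (fun n _ => congr1 (fun f : fps C => f n) e) hc.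
  rewrite big_ord_recr/= => h.
  have h1 : (normc (W n) * t ^+ n) ^+ 2 <= (c ^+ 2)^-1 * B ^+ 2.
    apply: (@le_trans _ _ ((c ^+ 2)^-1 * \sum_(i < n.+1) normc (F i) ^+ 2 * t ^+ (i + i))).
      apply: le_trans _ h; rewrite exprMn -exprM muln2 -addnn lerDr.
      by rewrite sumr_ge0// => i _; rewrite mulr_ge0 ?sqr_ge0 ?exprn_ge0// ltW.
    rewrite ler_wpM2l ?invr_ge0 ?sqr_ge0//.
    apply: (@le_trans _ _ ((\sum_(i < n.+1) normc (F i) * t ^+ i) ^+ 2)).
      rewrite expr2 mulr_suml ler_sum// => i _.
      rewrite exprD expr2 mulrACA ler_wpM2l ?mulr_ge0 ?normc_ge0 ?exprn_ge0 ?(ltW t0)//.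
      rewrite (bigD1 i)//= lerDl sumr_ge0// => j _.
      by rewrite mulr_ge0 ?normc_ge0 ?exprn_ge0 ?(ltW t0).
    by rewrite lerXn2r ?nnegrE// sumr_ge0// => j _; rewrite mulr_ge0 ?normc_ge0 ?exprn_ge0 ?(ltW t0).
  have p1 : 0 <= normc (W n) * t ^+ n by rewrite mulr_ge0 ?normc_ge0 ?exprn_ge0 ?(ltW t0).
  have p2 : 0 <= B / c by rewrite divr_ge0 ?(ltW c0).
  rewrite -ler_sqr ?nnegrE//.
  by rewrite [X in _ <= X]exprMn exprVn [X in _ <= X]mulrC.
pose q := rho / t; have q1 : q < 1 by rewrite /q ltr_pdivrMr// mul1r.
have q0 : 0 <= q by rewrite divr_ge0// ltW.
have hq : 0 <= q < 1 by rewrite q0.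
have hbd : indisc (fun=> (B / c)%:C%C : C).
  by apply: (@indisc_bounded _ _ (normc ((B / c)%:C%C : C))).
have [D hD] := hbd q hq.
exists D => N; apply: le_trans (hD N); apply: ler_sum => n _.
rewrite normc_realp ?divr_ge0 ?(ltW c0)//.
have -> : rho ^+ n = t ^+ n * q ^+ n by rewrite -exprMn /q mulrCA mulfV ?mulr1// gt_eqF.
by rewrite mulrA ler_wpM2r ?exprn_ge0.
Qed.

Lemma bsym0 : bsym 0%N = kap.
Proof.
rewrite /bsym fps_mul0 fpsBE fps1E subr0 mul1r /delta_pow fps_mul0 /phi3 fps_mul0.
by rewrite /binser3 expr0 /binser /binom_coef big_ord0 !mul1r mulr1.
Qed.

Lemma gsym0 : gsym 0%N = (3 / 4 : R)%:C%C.
Proof.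
rewrite /gsym fpsCM fpsDE fps_mul0 mul0r addr0 -fpsCn/= mulrC.
by rewrite rmorphM/= fmorphV !rmorph_nat.
Qed.

Lemma sbd_sym0 mu : 0 <= mu -> sbd_sym mu 0%N != 0.
Proof.
move=> mu0; rewrite /sbd_sym fpsDE fpsCM bsym0 gsym0 /kap -rmorphM -rmorphD/= -normc_gt0.
by rewrite normc_realp ?addr_ge0 ?ltr_wpDr ?powR_gt0 ?powR_ge0 ?mulr_ge0.
Qed.

Lemma be_sym0 mu : 0 <= mu -> be_sym mu 0%N != 0.
Proof.
move=> mu0; rewrite /be_sym fpsDE fps_mul0 fpsBE fps1E subr0 mul1r.
rewrite /binser /binom_coef big_ord0/= -rmorphD/= -normc_gt0.
by rewrite normc_realp ?addr_ge0// ltr_wpDr.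
Qed.

(** Deviations from the initial value 1 of the discrete solutions, with
    [mu = lam tau^alpha].  The absolute value makes the quotient exist for every [mu]. *)
Definition sbd_dev mu : fps C :=
  projT1 (cid (fps_div (fpsC (- mu%:C%C) * (x * geom)) (sbd_sym0 (normr_ge0 mu)))).
Definition be_dev mu : fps C :=
  projT1 (cid (fps_div (fpsC (- mu%:C%C) * geom) (be_sym0 (normr_ge0 mu)))).

Lemma sbd_devP mu : 0 <= mu -> sbd_sym mu * sbd_dev mu = fpsC (- mu%:C%C) * (x * geom).
Proof. by move=> mu0; rewrite /sbd_dev; case: cid => y /=; rewrite ger0_norm. Qed.

Lemma be_devP mu : 0 <= mu -> be_sym mu * be_dev mu = fpsC (- mu%:C%C) * geom.
Proof. by move=> mu0; rewrite /be_dev; case: cid => y /=; rewrite ger0_norm. Qed.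

Lemma indisc_sbd_dev mu : 0 < mu -> indisc (sbd_dev mu).
Proof.
move=> mu0; apply: (indisc_solve (c := mu / 2) _ (indisc_sbd_sym mu) _ (sbd_devP (ltW mu0))).
- by rewrite divr_gt0.
- by apply: indiscM; [exact: indiscC|apply: indiscM; [exact: indiscX|exact: indisc_geom]].
- by move=> z; apply: Re_sbd_sym; exact: ltW.
Qed.

Lemma indisc_be_dev mu : 0 < mu -> indisc (be_dev mu).
Proof.
move=> mu0; apply: (indisc_solve (c := mu) _ (indisc_be_sym mu) _ (be_devP (ltW mu0))) => //.
- by apply: indiscM; [exact: indiscC|exact: indisc_geom].
- by move=> z; apply: Re_be_sym; exact: ltW.
Qed.

End Symbols.

(** * Jet bounds for the symbols *)

Section SymbolJets.
Variable R : realType.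
Local Notation C := R[i].
Local Open Scope classical_set_scope.
Local Open Scope ring_scope.
Implicit Types (z w : C) (mu : R).

Variable s : R.
Hypothesis s01 : 0 < s < 1.

Let s0 : 0 < s. Proof. by case/andP: s01. Qed.
Let s1 : s < 1. Proof. by case/andP: s01. Qed.
Let s01' : 0 <= s <= 1. Proof. by rewrite !ltW. Qed.

Local Notation x := (fpsX C).
Local Notation rad z := (normc (1 - z)).

Lemma jet1 z : normc z < 1 -> jet z 1 = 1.
Proof. by move=> z1; rewrite -fpsC1 jetC. Qed.

Lemma jet_nat z n : normc z < 1 -> jet z n%:R = n%:R.
Proof. by move=> z1; rewrite -fpsCn jetC. Qed.

Lemma rad_gt0 z : normc z < 1 -> 0 < rad z.
Proof.
by move=> z1; rewrite normc_gt0 subr_eq0; apply/eqP => e; rewrite -e normc1 ltxx in z1.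
Qed.

Lemma rad_lt2 z : normc z < 1 -> rad z < 2.
Proof. by move=> z1; have := normcB 1 z; rewrite normc1 => h; lra. Qed.

Lemma bndX z : normc z < 1 -> bnd (rad z) 8 (jet z x).
Proof.
move=> z1 k k3; rewrite jetX// normcM normcV normc_nat.
have r0 := ltW (rad_gt0 z1); have r2 := ltW (rad_lt2 z1).
apply: (@le_trans _ _ (1 * 2 ^+ 3)); last by rewrite mul1r; lra.
apply: ler_pM; rewrite ?mulr_ge0 ?normc_ge0 ?exprn_ge0//.
  rewrite ler_pdivrMr ?ltr0n ?fact_gt0// mul1r (le_trans (ltW z1))//.
  by rewrite ler1n fact_gt0.
apply: (@le_trans _ _ (2 ^+ k)); first by rewrite lerXn2r ?nnegrE.
by rewrite ler_weXn2l// ler1n.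
Qed.

Lemma jet_1X z : normc z < 1 -> jet z (1 - x) = 1 - jet z x.
Proof.
by move=> z1; rewrite jetB ?jet1//; [exact: indisc1|exact: indiscX].
Qed.

Lemma jet_1X0 z : normc z < 1 -> (1 - jet z x) 0%N = 1 - z.
Proof. by move=> z1; rewrite fpsBE jetX// fact0 divr1. Qed.

Lemma bnd1X z : normc z < 1 -> bnd (rad z) (4 * rad z) (1 - jet z x).
Proof.
move=> z1; have r0 := ltW (rad_gt0 z1); have r2 := ltW (rad_lt2 z1).
case=> [|k] k3; first by rewrite jet_1X0// expr0 mulr1 ler_peMl// ler1n.
rewrite fpsBE fps1E sub0r normcN jetX// normcM normcV normc_nat exprSr mulrA.
rewrite ler_wpM2r//.
apply: (@le_trans _ _ (1 * 2 ^+ 2)); last by rewrite mul1r; lra.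
apply: ler_pM; rewrite ?mulr_ge0 ?normc_ge0 ?exprn_ge0//.
  rewrite ler_pdivrMr ?ltr0n ?fact_gt0// mul1r (le_trans (ltW z1))//.
  by rewrite ler1n fact_gt0.
apply: (@le_trans _ _ (2 ^+ k)); first by rewrite lerXn2r ?nnegrE.
by rewrite ler_weXn2l// ler1n.
Qed.

Lemma bnd_nat r n : bnd r n%:R (n%:R : fps C).
Proof. by rewrite -fpsCn -[X in bnd _ X _]normc_nat; exact: bndC. Qed.

(** Division of jets reduces this to [bnd_ode]. *)
Lemma jet_ode_bound r (A Y c : R) (q y p : fps C) : 0 <= r -> 0 < c -> 0 <= A ->
  c <= normc (q 0%N) -> bnd r (A * c) q -> bnd r Y y -> q * fderiv p = y * p ->
  let A' := Y / c * (1 + A) ^+ 3 * r in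
  bnd r (normc (p 0%N) * (1 + A') ^+ 3) p /\
  forall k, (0 < k <= 3)%N -> normc (p k) * r ^+ k <= 3 * A' * (normc (p 0%N) * (1 + A') ^+ 3).
Proof.
move=> r0 c0 A0 hc hq hy e A'.
have q0 : q 0%N != 0 by rewrite -normc_gt0 (lt_le_trans c0).
have [psi hpsi] := fps_div y q0.
have Y0 := bnd_ge0 hy.
have A'0 : 0 <= A' by rewrite /A' !mulr_ge0 ?exprn_ge0 ?addr_ge0 ?invr_ge0 ?(ltW c0).
refine (@bnd_ode _ _ _ _ psi r0 A'0 _ _).
  by apply: (fps_mulI q0); rewrite e mulrA hpsi.
move=> k k2; rewrite exprSr mulrA ler_wpM2r//.
by apply: (bnd_div r0 c0 A0 hc hq hy hpsi); exact: leq_trans k2 _.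
Qed.

Lemma jet_binser_ode z : normc z < 1 ->
  (1 - jet z x) * fderiv (jet z (binser s)) = (fpsC s%:C%C * jet z x) * jet z (binser s).
Proof.
move=> z1; have iP := indisc_binser s01'.
have iT : indisc (fun n => n%:R * binser s n : C).
  rewrite (_ : (fun n => _) = (fun n => binser s n * n%:R)); first exact: indisc_natmul.
  by apply/funext => n; rewrite mulrC.
rewrite jet_fderiv// -jet_1X// -jetM//; last exact: indisc_1x.
rewrite binser_theta jetM//; [|exact: indiscC|by apply: indiscM; [exact: indiscX|]].
by rewrite jetC// jetM// ?mulrA//; exact: indiscX.
Qed.

Lemma binser3_theta :
  (3 - x) * (fun n => n%:R * phi3 s n) = fpsC s%:C%C * (x * phi3 s).
Proof.
apply/funext => n; rewrite mulrBl fpsBE -fpsCn !fpsCM !fpsXM /phi3.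
case: n => [|n]; first by rewrite mul0r !mulr0 subr0.
rewrite !fpsCM /binser3 /binser.
have h := binom_coefS s n.
have h' : (n.+1%:R : C) * (binom_coef s n.+1)%:C%C = (s%:C%C + n%:R) * (binom_coef s n)%:C%C.
  by rewrite -(rmorph_nat (real_complex R) n.+1) -rmorphM/= h rmorphM rmorphD/= rmorph_nat.
rewrite [X in X - _](_ : _ = kap s * 3^-1 ^+ n * (n.+1%:R * (binom_coef s n.+1)%:C%C)); last first.
  by rewrite exprS; field.
by rewrite h'; ring.
Qed.

Lemma jet_phi3_ode z : normc z < 1 ->
  (3 - jet z x) * fderiv (jet z (phi3 s)) = (fpsC s%:C%C * jet z x) * jet z (phi3 s).
Proof.
move=> z1; have iP := indisc_phi3 s01.
have iT : indisc (fun n => n%:R * phi3 s n : C).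
  rewrite (_ : (fun n => _) = (fun n => phi3 s n * n%:R)); first exact: indisc_natmul.
  by apply/funext => n; rewrite mulrC.
have i3 : indisc (3 : fps C) by rewrite -fpsCn; exact: indiscC.
rewrite jet_fderiv// -[X in X - _](jet_nat 3 z1) -jetB//; last exact: indiscX.
rewrite -jetM//; last by apply: indiscB => //; exact: indiscX.
rewrite binser3_theta jetM//; [|exact: indiscC|by apply: indiscM; [exact: indiscX|]].
by rewrite jetC// jetM// ?mulrA//; exact: indiscX.
Qed.

Lemma bnd_sX z : normc z < 1 -> bnd (rad z) 8 (fpsC s%:C%C * jet z x).
Proof.
move=> z1; apply: bnd_le (bndZ _ (bndX z1)).
by rewrite normc_realp ?(ltW s0)// ler_piMl// ltW.
Qed.

Lemma jet_binser_bnd : exists K, 0 <= K /\ forall z, normc z < 1 ->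
  bnd (rad z) (K * normc (ev z (binser s))) (jet z (binser s)).
Proof.
exists ((1 + 8 * (1 + 4) ^+ 3) ^+ 3); split.
  by rewrite exprn_ge0// addr_ge0// mulr_ge0// exprn_ge0.
move=> z z1; have r0 := rad_gt0 z1.
have q0 : rad z <= normc ((1 - jet z x) 0%N) by rewrite jet_1X0.
have [h _] := jet_ode_bound (ltW r0) r0 (ler0n _ 4) q0 (bnd1X z1) (bnd_sX z1) (jet_binser_ode z1).
apply: bnd_le h; rewrite jet0 mulrC (_ : 8 / rad z * _ * rad z = 8 * (1 + 4) ^+ 3)//.
by field; rewrite gt_eqF.
Qed.

Lemma cpow_half2 w : 1 / 2 <= normc w <= 2 -> 1 / 2 <= normc (cpow (- s) w) <= 2.
Proof.
move=> /andP[w1 w2]; have w0 : 0 < normc w by lra.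
have l2 : expR (ln 2) = 2 :> R by rewrite lnK ?posrE.
have h1 : ln (normc w) <= ln 2 by rewrite ler_ln ?posrE.
have h2 : - ln 2 <= ln (normc w).
  by rewrite -lnV ?posrE// ler_ln ?posrE ?invr_gt0//; lra.
have l0 : 0 <= ln 2 :> R by rewrite ln_ge0// ler1n.
rewrite normc_cpow; apply/andP; split.
  rewrite div1r -l2 -expRN ler_expR; have := s0; have := s1; nra.
rewrite -[X in _ <= X]l2 ler_expR; have := s0; have := s1; nra.
Qed.

Lemma Re_3z z : normc z < 1 -> 1 <= complex.Re ((3 - z) / 2).
Proof.
move=> z1; rewrite (_ : 2 = 2%:R :> C)// Re_div_nat cReD cReN.
have /Re_lt_normc/andP[_ h] := z1.
have -> : complex.Re (3 : C) = 3 by rewrite -(rmorph_nat (real_complex R)).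
lra.
Qed.

Lemma normc_3z z : normc z < 1 -> 1 <= normc ((3 - z) / 2) <= 2.
Proof.
move=> z1; apply/andP; split.
  by apply: le_trans (Re_3z z1) _; apply: le_trans (normc_Re _); rewrite ler_norm.
rewrite normcM normcV normc_nat ler_pdivrMr//.
by have := normcB 3 z; rewrite normc_nat => h; lra.
Qed.

Lemma ev_phi3_bound z : normc z < 1 -> 1 / 2 <= normc (ev z (phi3 s)) <= 2.
Proof.
move=> z1; rewrite ev_phi3//; apply: cpow_half2.
by have /andP[h1 h2] := normc_3z z1; rewrite h2 andbT; lra.
Qed.

Lemma cpow_near1 w (m : R) : 0 < m -> m <= complex.Re w -> m <= 1 -> normc (w - 1) <= m ->
  normc (cpow (- s) w - 1) <= 6 * expR 2 / m * normc (w - 1).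
Proof.
move=> m0 hm m1 hw; have h := clog_near1 m0 hm m1.
have n1 : normc ((- s)%:C%C * clog w) <= 2 / m * normc (w - 1).
  rewrite normcM normc_real normrN gtr0_norm//; apply: le_trans h.
  by rewrite ler_piMl ?normc_ge0// ltW.
have n2 : normc ((- s)%:C%C * clog w) <= 2.
  apply: le_trans n1 _; rewrite mulrAC ler_pdivrMr//.
  by rewrite ler_pM2l.
apply: le_trans (cexp_sub1 _) _.
rewrite (_ : 6 * _ / m * _ = 3 * expR 2 * (2 / m * normc (w - 1))); last by ring.
apply: ler_pM => //; rewrite ?mulr_ge0 ?expR_ge0 ?normc_ge0//.
by rewrite ler_pM2l// ler_expR.
Qed.

(** Unlike the binomial series, [phi3] is regular at 1, where it takes the value 1; this
    gains a factor [rad z] on the difference. *)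
Lemma jet_phi3_bnd : exists K, 0 <= K /\ forall z, normc z < 1 ->
  bnd (rad z) K (jet z (phi3 s)) /\ bnd (rad z) (K * rad z) (jet z (phi3 s) - 1).
Proof.
pose c : R := 8 / 2 * (1 + 6) ^+ 3.
have c0 : 0 <= c by rewrite /c mulr_ge0 ?exprn_ge0.
pose K1 := 2 * (1 + c * 2) ^+ 3; pose K2 := 3 * c * K1; pose K3 := 12 * expR 2 : R.
have K10 : 0 <= K1 by rewrite /K1 mulr_ge0// exprn_ge0// addr_ge0// mulr_ge0.
have K20 : 0 <= K2 by apply: mulr_ge0 => //; apply: mulr_ge0.
have K30 : 0 <= K3 by rewrite /K3 mulr_ge0// expR_ge0.
exists (K1 + K2 + K3); split; first by rewrite !addr_ge0.
move=> z z1; have r0 := rad_gt0 z1; have r2 := rad_lt2 z1.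
have q0 : 2 <= normc ((3 - jet z x) 0%N).
  have := normc_3z z1; rewrite fpsBE -fpsCn jetX// fact0 divr1 /= normcM normcV normc_nat.
  by rewrite ler_pdivlMr// mul1r => /andP[].
have bq : bnd (rad z) (6 * 2) (3 - jet z x).
  apply: bnd_le (bndB (ltW r0) (bnd_nat (rad z) 3) (bndX z1)).
  by lra.
have [h1 h2] := jet_ode_bound (ltW r0) (ltr0n _ 2) (ler0n _ 6) q0 bq (bnd_sX z1) (jet_phi3_ode z1).
rewrite jet0 -/c in h1 h2.
have /andP[p1 p2] := ev_phi3_bound z1.
have cr : (1 + c * rad z) ^+ 3 <= (1 + c * 2) ^+ 3.
  rewrite lerXn2r ?nnegrE ?addr_ge0 ?mulr_ge0 ?(ltW r0)//.
  by rewrite lerD2l ler_wpM2l// ltW.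
have b1 : normc (ev z (phi3 s)) * (1 + c * rad z) ^+ 3 <= K1.
  by apply: ler_pM; rewrite ?normc_ge0 ?exprn_ge0 ?addr_ge0 ?mulr_ge0 ?(ltW r0).
split.
  by apply: bnd_le h1; apply: le_trans b1 _; rewrite -addrA lerDl addr_ge0.
case=> [|k] k3.
  rewrite expr0 mulr1 fpsBE fps1E jet0 ev_phi3//.
  have hh : normc ((3 - z) / 2 - 1) = rad z / 2.
    have -> : (3 - z) / 2 - 1 = (1 - z) / 2 by field.
    by rewrite normcM normcV normc_nat.
  have n1 : normc ((3 - z) / 2 - 1) <= 1 by rewrite hh; lra.
  apply: le_trans (cpow_near1 ltr01 (Re_3z z1) (lexx _) n1) _.
  rewrite hh (_ : _ * (rad z / 2) = 3 * expR 2 * rad z); last by field.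
  rewrite ler_wpM2r ?(ltW r0)//.
  have e0 := expR_ge0 (2 : R).
  by rewrite /K3; lra.
rewrite fpsBE fps1E subr0; apply: le_trans (h2 k.+1 k3) _.
rewrite (_ : 3 * (c * rad z) * _ = 3 * c * (normc (ev z (phi3 s)) * (1 + c * rad z) ^+ 3) * rad z); last by ring.
rewrite ler_wpM2r ?(ltW r0)//.
apply: (@le_trans _ _ K2); last by lra.
by rewrite /K2 ler_wpM2l// mulr_ge0.
Qed.

(** Size of [(1 - z)^alpha], against which all symbols are measured. *)
Definition asize z : R := rad z * normc (ev z (binser s)).

Lemma asize_ge0 z : 0 <= asize z. Proof. by rewrite mulr_ge0 ?normc_ge0. Qed.

Lemma asize_gt0 z : normc z < 1 -> 0 < asize z.
Proof.
by move=> z1; rewrite mulr_gt0 ?rad_gt0// normc_gt0 ev_binser ?cpow_neq0.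
Qed.

Lemma ev_bsym_size z : normc z < 1 -> asize z / 2 <= normc (ev z (bsym s)).
Proof.
move=> z1; have iP := indisc_binser s01'; have iF := indisc_phi3 s01.
rewrite evM//; [|exact: indisc_1x|exact: indiscM].
rewrite evB//; [|exact: indisc1|exact: indiscX]; rewrite ev1// evX// evM// !normcM mulrA.
by have /andP[h _] := ev_phi3_bound z1; have := asize_ge0 z; rewrite /asize; nra.
Qed.

(** The factor [1 - x] turns the constant source [1 / (1 - x)] into a polynomial. *)
Definition sbd_poly mu := (1 - x) * sbd_sym s mu.
Definition be_poly mu := (1 - x) * be_sym s mu.

Lemma jet_gsym z : normc z < 1 -> jet z (gsym R) = fpsC 4^-1 * (3 + jet z x * jet z x).
Proof.
move=> z1; have i3 : indisc (3 : fps C) by rewrite -fpsCn; exact: indiscC.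
have ixx : indisc (x * x) by apply: indiscM; exact: indiscX.
have ix := @indiscX R; have i4 : indisc (fpsC (4^-1 : C)) by exact: indiscC.
have iD : indisc (3 + x * x) by exact: indiscD.
by rewrite jetM// jetC// jetD// jet_nat// jetM.
Qed.

Lemma bnd_gsym z : normc z < 1 -> bnd (rad z) 65 (jet z (gsym R)).
Proof.
move=> z1; have r0 := ltW (rad_gt0 z1); rewrite jet_gsym//.
apply: bnd_le (bndZ 4^-1 (bndD r0 (bnd_nat _ 3) (bndM r0 (bndX z1) (bndX z1)))).
by rewrite normcV normc_nat; lra.
Qed.

Lemma jet_bsym z : normc z < 1 ->
  jet z (bsym s) = (1 - jet z x) * (jet z (binser s) * jet z (phi3 s)).
Proof.
move=> z1; have iP := indisc_binser s01'; have iF := indisc_phi3 s01.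
have iD : indisc (delta_pow s) by exact: indisc_delta_pow.
by have i1 := @indisc_1x R; rewrite /bsym jetM// jet_1X// /delta_pow jetM.
Qed.

Lemma jet_sbd_poly z mu : normc z < 1 ->
  jet z (sbd_poly mu) = (1 - jet z x) * (jet z (bsym s) + fpsC mu%:C%C * jet z (gsym R)).
Proof.
move=> z1; rewrite jetM//; [|exact: indisc_1x|exact: indisc_sbd_sym].
have ig : indisc (fpsC mu%:C%C * gsym R) by apply: indiscM; [exact: indiscC|exact: indisc_gsym].
rewrite jet_1X// jetD//; last exact: indisc_bsym.
by rewrite jetM ?jetC//; [exact: indiscC|exact: indisc_gsym].
Qed.

(** The constant 10 is 5 from the sector condition times 2 from the size of [bsym]. *)
Lemma sbd_poly0 z mu : normc z < 1 -> 0 <= mu ->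
  rad z * (asize z + mu) / 10 <= normc (jet z (sbd_poly mu) 0%N).
Proof.
move=> z1 mu0; rewrite jet0 evM//; [|exact: indisc_1x|exact: indisc_sbd_sym].
rewrite evB//; [|exact: indisc1|exact: indiscX]; rewrite ev1// evX// normcM.
rewrite -mulrA ler_wpM2l ?normc_ge0// ev_sbd_sym//.
have h := sector_lower mu0 (Re_bsym s01 z1) (Re_gsym z1) (normc_gsym z1).
have h2 := ev_bsym_size z1; lra.
Qed.

Lemma jet_bsym_bnd : exists K, 0 <= K /\ forall z, normc z < 1 ->
  bnd (rad z) (K * asize z) (jet z (bsym s)).
Proof.
have [K1 [K10 h1]] := jet_binser_bnd; have [K2 [K20 h2]] := jet_phi3_bnd.
exists (64 * (K1 * K2)); split; first by rewrite !mulr_ge0.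
move=> z z1; have r0 := ltW (rad_gt0 z1); rewrite jet_bsym//.
apply: bnd_le (bndM r0 (bnd1X z1) (bndM r0 (h1 z z1) (proj1 (h2 z z1)))).
by rewrite /asize le_eqVlt; apply/orP; left; apply/eqP; ring.
Qed.

Lemma sbd_poly_bnd : exists K, 0 <= K /\ forall z mu, normc z < 1 -> 0 <= mu ->
  bnd (rad z) (K * (rad z * (asize z + mu) / 10)) (jet z (sbd_poly mu)).
Proof.
have [K1 [K10 h1]] := jet_bsym_bnd.
exists (160 * (K1 + 65)); split; first by rewrite mulr_ge0// addr_ge0.
move=> z mu z1 mu0; have r0 := ltW (rad_gt0 z1); rewrite jet_sbd_poly//.
have b2 := bndZ mu%:C%C (bnd_gsym z1); rewrite normc_realp// in b2.
apply: bnd_le (bndM r0 (bnd1X z1) (bndD r0 (h1 z z1) b2)).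
have a0 := asize_ge0 z.
rewrite (_ : 4 * (4 * rad z * (K1 * asize z + mu * 65)) =
  rad z * (16 * (K1 * asize z + 65 * mu))); last by ring.
rewrite (_ : 160 * _ * _ = rad z * (16 * ((K1 + 65) * (asize z + mu)))); last by field.
by rewrite ler_wpM2l// ler_wpM2l//; nra.
Qed.

Lemma sbd_devE mu : 0 <= mu -> sbd_poly mu * sbd_dev s mu = fpsC (- mu%:C%C) * x.
Proof.
move=> mu0; rewrite /sbd_poly -mulrA sbd_devP// mulrCA; congr (_ * _).
by rewrite mulrCA geomE mulr1.
Qed.

Lemma be_devE mu : 0 <= mu -> be_poly mu * be_dev s mu = fpsC (- mu%:C%C).
Proof. by move=> mu0; rewrite /be_poly -mulrA be_devP// mulrCA geomE mulr1. Qed.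

Lemma indisc_sbd_poly mu : indisc (sbd_poly mu).
Proof. by apply: indiscM; [exact: indisc_1x|exact: indisc_sbd_sym]. Qed.

Lemma jet_sbd_devE z mu : normc z < 1 -> 0 < mu ->
  jet z (sbd_poly mu) * jet z (sbd_dev s mu) = fpsC (- mu%:C%C) * jet z x.
Proof.
move=> z1 mu0; rewrite -jetM//; [|exact: indisc_sbd_poly|exact: indisc_sbd_dev].
by rewrite sbd_devE ?(ltW mu0)// jetM ?jetC//; [exact: indiscC|exact: indiscX].
Qed.

(** Crude bound for the discrete solution; it suffices away from [z = 1]. *)
Lemma sbd_dev_bnd : exists K, 0 <= K /\ forall z mu, normc z < 1 -> 0 < mu ->
  bnd (rad z) (K / rad z) (jet z (sbd_dev s mu)).
Proof.
have [K1 [K10 h1]] := sbd_poly_bnd.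
exists (80 * (1 + K1) ^+ 3); split; first by rewrite mulr_ge0// exprn_ge0// addr_ge0.
move=> z mu z1 mu0; have r0 := rad_gt0 z1; have a0 := asize_gt0 z1.
have c0 : 0 < rad z * (asize z + mu) / 10 by rewrite divr_gt0// mulr_gt0// addr_gt0.
have y1 : bnd (rad z) (8 * mu) (fpsC (- mu%:C%C) * jet z x).
  apply: bnd_le (bndZ _ (bndX z1)).
  by rewrite normcN normc_realp ?(ltW mu0)// mulrC.
apply: bnd_le (bnd_div (ltW r0) c0 K10 (sbd_poly0 z1 (ltW mu0)) (h1 z mu z1 (ltW mu0)) y1
  (jet_sbd_devE z1 mu0)).
rewrite [X in _ <= X]mulrAC ler_wpM2r ?exprn_ge0 ?addr_ge0//.
rewrite (_ : 8 * mu / _ = 80 / rad z * (mu / (asize z + mu))); last first.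
  by field; rewrite !gt_eqF ?addr_gt0.
rewrite ler_piMr ?divr_ge0 ?(ltW r0)// ler_pdivrMr ?addr_gt0// mul1r.
by rewrite lerDr ltW.
Qed.

End SymbolJets.

(** * Halving the step *)

Section Doubling.
Variable R : realType.
Local Notation C := R[i].
Local Open Scope classical_set_scope.
Local Open Scope ring_scope.
Implicit Types (z w : C) (mu : R).

Variable s : R.
Hypothesis s01 : 0 < s < 1.

Let s0 : 0 < s. Proof. by case/andP: s01. Qed.
Let s1 : s < 1. Proof. by case/andP: s01. Qed.
Let s01' : 0 <= s <= 1. Proof. by rewrite !ltW. Qed.

Local Notation x := (fpsX C).
Local Notation rad z := (normc (1 - z)).

Lemma jet_delta_ode z : normc z < 1 ->
  (1 - jet z x) * (3 - jet z x) * fderiv (jet z (delta_pow s)) =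
  fpsC s%:C%C * jet z x * (4 - 2 * jet z x) * jet z (delta_pow s).
Proof.
move=> z1; have iP := indisc_binser s01'; have iF := indisc_phi3 s01.
rewrite /delta_pow jetM// fderivM.
have e1 := jet_binser_ode s01 z1; have e2 := jet_phi3_ode s01 z1.
set X := jet z x in e1 e2 *; set p := jet z (binser s) in e1 e2 *.
set q := jet z (phi3 s) in e1 e2 *.
transitivity ((3 - X) * ((1 - X) * fderiv p) * q + (1 - X) * p * ((3 - X) * fderiv q)); first by ring.
by rewrite e1 e2; ring.
Qed.

Lemma ev_delta_pow z : normc z < 1 ->
  ev z (delta_pow s) = cpow (- s) (1 - z) * cpow (- s) ((3 - z) / 2).
Proof.
move=> z1; rewrite evM//; [|exact: indisc_binser|exact: indisc_phi3].
by rewrite ev_phi3// ev_binser.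
Qed.

Lemma pair_size_arith (A B F E Y0 sg : R) : 0 <= A -> 0 <= B -> F <= 2 -> 1 / 2 <= E ->
  1 / 8 <= Y0 -> 1 / 2 <= sg -> B * F = sg * (A * E * Y0) -> A / 64 <= B.
Proof.
move=> A0 B0 f2 e1 y1 sg2 h.
have h1 : A * (1 / 2) * (1 / 8) <= A * E * Y0.
  apply: ler_pM => //; rewrite ?mulr_ge0//; try lra.
  by rewrite ler_wpM2l.
have h2 : 1 / 2 * (A * (1 / 2) * (1 / 8)) <= sg * (A * E * Y0).
  by apply: ler_pM; rewrite ?mulr_ge0//; lra.
have : B * F <= B * 2 by rewrite ler_wpM2l.
by rewrite h; lra.
Qed.

Lemma size_arith (p q A B : R) : 0 < p -> p <= q -> 0 <= A -> A / 64 <= B -> p * A / 64 <= q * B.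
Proof.
move=> p0 pq A0 h; rewrite -mulrA; apply: ler_pM => //; first exact: ltW.
by rewrite divr_ge0.
Qed.

Lemma pair_final_arith (m a r c1 c2 k e8 e3 : R) : 0 < r -> 0 <= a -> 0 < m ->
  0 <= k -> 0 <= e8 -> 0 <= e3 -> c1 = r * (a + m) / 10 -> c1 / 64 <= c2 ->
  m * (4 * (8 * (4 * (4 * r * (k * ((a + m) * r ^+ 2)))))) / c2 * e8 / c1 * e3 <=
  4 * (8 * (4 * (4 * k))) * 640 * e8 * 10 * e3 * r.
Proof.
move=> r0 a0 m0 k0 e80 e30 c1E c12.
have am : 0 < a + m by rewrite ltr_wpDl.
have c1_gt0 : 0 < c1 by rewrite c1E divr_gt0// mulr_gt0.
have c2_gt0 : 0 < c2 by apply: lt_le_trans c12; rewrite divr_gt0.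
have d1 : m / c1 <= 10 / r.
  rewrite c1E ler_pdivrMr; last by rewrite divr_gt0// mulr_gt0.
  by rewrite (_ : 10 / r * _ = a + m) ?lerDr//; field; rewrite gt_eqF.
have d2 : (a + m) * r / c2 <= 640.
  rewrite ler_pdivrMr//; have -> : (a + m) * r = 640 * (c1 / 64) by rewrite c1E; field.
  by move: c12; lra.
have -> : m * (4 * (8 * (4 * (4 * r * (k * ((a + m) * r ^+ 2)))))) / c2 * e8 / c1 * e3 =
    (512 * k * e8 * e3 * r ^+ 2) * ((m / c1) * ((a + m) * r / c2)).
  by field; rewrite !gt_eqF.
have p0 : 0 <= 512 * k * e8 * e3 * r ^+ 2.
  exact: mulr_ge0 (mulr_ge0 (mulr_ge0 (mulr_ge0 (ler0n _ 512) k0) e80) e30) (exprn_ge0 2 (ltW r0)).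
apply: (@le_trans _ _ (512 * k * e8 * e3 * r ^+ 2 * (10 / r * 640))).
  rewrite ler_wpM2l//; apply: ler_pM => //.
    by rewrite divr_ge0 ?(ltW c1_gt0) ?(ltW m0).
  by apply: divr_ge0; [exact: mulr_ge0 (ltW am) (ltW r0)|exact: ltW].
rewrite le_eqVlt; apply/orP; left; apply/eqP.
by field; rewrite gt_eqF.
Qed.

(** The point [xi = eta^2] for the coarse step corresponds to the two points [eta] and
    [- eta] for the fine one.  When [Re eta >= 0], only [eta] can approach 1. *)
Section Pair.
Variable eta : C.
Hypothesis eta1 : normc eta < 1.
Hypothesis Re_eta : 0 <= complex.Re eta.

Let xi := eta * eta.
Let xi1 : normc xi < 1. Proof. exact: normc_zz. Qed.
Let r := rad eta.
Let r0 : 0 < r. Proof. exact: rad_gt0. Qed.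
Let r2 : r < 2. Proof. exact: rad_lt2. Qed.
Let X := jet eta x.
Let J2 f := jscale 2 (jet xi f).

Lemma J2X : J2 x = X * X.
Proof.
rewrite /X -jetM//; try exact: indiscX.
apply/funext => k; rewrite /J2 /jscale jetX// /jet.
have h n : (3 <= n)%N -> theta_pow k (x * x) n = 0.
  by case: n => [//|[//|[//|n]]] _; rewrite /theta_pow fpsXM /fpsX mul0r.
have [_ ->] := ev_finite eta1 h.
have xx n : theta_pow k (x * x) n = (n == 2%N)%:R * (n%:R ^+ k / k`!%:R).
  by rewrite /theta_pow fpsXM; case: n => [|n].
have sum3 (F : nat -> C) : \sum_(n < 3) F n = F 0%N + F 1%N + F 2%N.
  by rewrite !big_ord_recr big_ord0 /= add0r.
rewrite (sum3 (fun n => theta_pow k (x * x) n * eta ^+ n)) !xx.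
by rewrite /xi /=; ring.
Qed.

Lemma one_plus_eta : 1 <= normc (1 + eta).
Proof.
apply: le_trans (_ : complex.Re (1 + eta) <= _); first by rewrite cReD/= lerDl.
by apply: le_trans (normc_Re _); rewrite ler_norm.
Qed.

Let w1 := (1 + eta) / 2.
Let w2 := (3 - xi) / 2.
Let w3 := (3 - eta) / 2.

Let pt := jet eta (delta_pow s).
Let p2t := J2 (delta_pow s).

Let pt0 : pt 0%N != 0.
Proof. by rewrite /pt jet0 ev_delta_pow// mulf_neq0 ?cpow_neq0. Qed.

Let sig : R := 2 `^ (- s).

Let sig_gt0 : 0 < sig. Proof. exact: powR_gt0. Qed.
Let sig_le1 : sig <= 1.
Proof. by rewrite /sig -[X in _ <= X](powRr0 (2 : R)) ler_powR ?ler1n// oppr_le0 ltW. Qed.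

(* [Y] is the jet of the power [- s] of the ratio of [delta (z^2)] to [2 delta z]. *)
Lemma ratio_jet : exists2 Y : fps C, p2t = fpsC sig%:C%C * (pt * Y) &
  Y 0%N = cpow (- s) w1 * cpow (- s) w2 / cpow (- s) w3.
Proof.
have sN : sig%:C%C != 0 :> C by rewrite -normc_gt0 (normc_realp (ltW sig_gt0)) sig_gt0.
have [Y' hY'] := fps_div p2t pt0.
exists (fpsC sig%:C%C^-1 * Y').
  by rewrite mulrCA [fpsC sig%:C%C * _]mulrA -fpsCM2 mulfV// fpsC1 mul1r hY'.
rewrite fpsCM.
have := congr1 (fun f : fps C => f 0%N) hY'; rewrite fps_mul0 => e.
have -> : Y' 0%N = p2t 0%N / pt 0%N by rewrite -e mulrC mulKf.
rewrite /p2t /J2 /jscale expr0 mul1r /pt !jet0 !ev_delta_pow//.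
have h2 : (2 : C) = (2 : R)%:C%C by rewrite rmorph_nat.
have e1 : 1 + eta = 2 * w1 by rewrite /w1; field.
have Rw1 : 0 < complex.Re w1.
  by rewrite /w1 (_ : 2 = 2%:R :> C)// Re_div_nat divr_gt0// cReD/= ltr_pwDl.
have R1e : 0 < complex.Re (1 + eta) by rewrite cReD/= ltr_pwDl.
have -> : 1 - xi = (1 - eta) * (1 + eta) by rewrite /xi; ring.
rewrite cpowM ?Re_1z//; last first.
  by rewrite (_ : _ * _ = 1 - xi) ?Re_1z// /xi; ring.
have -> : cpow (- s) (1 + eta) = sig%:C%C * cpow (- s) w1.
  rewrite e1 cpowM -?e1//; last by rewrite h2/=.
  by rewrite h2 cpow_real.
have c1 := cpow_neq0 (- s) (1 - eta); have c3 := cpow_neq0 (- s) w3.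
rewrite -/w2 -/w3; field.
by rewrite ?sN ?c1 ?c3.
Qed.

Variable Y : fps C.
Hypothesis hY : p2t = fpsC sig%:C%C * (pt * Y).
Hypothesis Y0E : Y 0%N = cpow (- s) w1 * cpow (- s) w2 / cpow (- s) w3.

(** The logarithmic derivative of [Y] contains the factor [1 - X]: the coarse and the fine
    difference quotients agree to second order at 1. *)
Lemma ratio_ode :
  (1 + X) * (3 - X * X) * (3 - X) * fderiv Y =
  fpsC s%:C%C * X * (1 - X) * (2 * (X * X) - 6 * X - 12) * Y.
Proof.
have sN : sig%:C%C != 0 :> C by rewrite -normc_gt0 (normc_realp (ltW sig_gt0)) sig_gt0.
have o1 := jet_delta_ode eta1; rewrite -/X -/pt in o1.
have e2 : (1 - jet xi x) * (fpsC 3 - jet xi x) * fderiv (jet xi (delta_pow s)) =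
    fpsC s%:C%C * jet xi x * (fpsC 4 - fpsC 2 * jet xi x) * jet xi (delta_pow s).
  by rewrite !fpsCn; exact: jet_delta_ode.
have o2 := congr1 (jscale 2) e2.
rewrite -fpsC1 !(jscaleM, jscaleD, jscaleN, jscaleC) in o2.
rewrite -/(J2 x) -/(J2 (delta_pow s)) J2X -/p2t fpsC1 in o2.
have d2 : fderiv p2t = fpsC 2 * jscale 2 (fderiv (jet xi (delta_pow s))).
  by rewrite /p2t /J2 fderiv_jscale.
rewrite !fpsCn in o2 d2.
have o3 : (1 - X * X) * (3 - X * X) * fderiv p2t =
    2 * (fpsC s%:C%C * (X * X) * (4 - 2 * (X * X)) * p2t).
  by rewrite d2 mulrCA o2.
rewrite hY in o3.
have dC : fderiv (fpsC sig%:C%C * (pt * Y)) = fpsC sig%:C%C * (fderiv pt * Y + pt * fderiv Y).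
  rewrite fderivM (_ : fderiv (fpsC _) = 0) ?mul0r ?add0r ?fderivM//.
  by apply/funext => n; rewrite /fderiv mul0rn.
rewrite dC in o3.
have q0 : ((1 - X) * (1 - X) * pt) 0%N != 0.
  by rewrite !fps_mul0 !jet_1X0// !mulf_neq0// -normc_gt0.
have c0 : (fpsC sig%:C%C : fps C) 0%N != 0 by [].
apply: (fps_mulI c0); apply: (fps_mulI q0).
set g := fpsC sig%:C%C in o3 *; set t := fpsC s%:C%C in o1 o3 *.
set D := fderiv Y in o3 *; set dp := fderiv pt in o1 o3.
have o4 : (1 - X * X) * (3 - X * X) * (g * (pt * D)) * ((1 - X) * (3 - X)) =
   2 * (t * (X * X) * (4 - 2 * (X * X)) * (g * (pt * Y))) * ((1 - X) * (3 - X)) -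
   (1 - X * X) * (3 - X * X) * g * Y * (t * X * (4 - 2 * X) * pt).
  rewrite -o1 -o3; ring.
rewrite [LHS](_ : _ = (1 - X * X) * (3 - X * X) * (g * (pt * D)) * ((1 - X) * (3 - X))); last by ring.
rewrite o4; ring.
Qed.


Let chiA : R := 10 ^+ 6.
Let chiY : R := 10 ^+ 7.
Definition chi_const : R := 10 ^+ 7 / 4 * (1 + 10 ^+ 6) ^+ 3.

Lemma chi_const_ge0 : 0 <= chi_const.
Proof. apply: mulr_ge0; first by apply: divr_ge0 => //; apply: exprn_ge0.
by apply: exprn_ge0; apply: addr_ge0 => //; apply: exprn_ge0. Qed.

Let Re_w1 : 1 / 2 <= complex.Re w1.
Proof.
by rewrite /w1 (_ : 2 = 2%:R :> C)// Re_div_nat ler_wpM2r// cReD/= lerDl.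
Qed.

Lemma w1_half : 1 / 2 <= normc w1 <= 2.
Proof.
rewrite (le_trans Re_w1)/=; last by apply: le_trans (normc_Re _); rewrite ler_norm.
rewrite /w1 normcM normcV normc_nat ler_pdivrMr//.
have := le_normcD 1 eta; rewrite normc1; have := eta1; lra.
Qed.

Lemma ratio0_bounds : 1 / 8 <= normc (Y 0%N) <= 8.
Proof.
have /andP[a1 a2] := cpow_half2 s01 w1_half.
have h2 : 1 / 2 <= normc w2 <= 2 by have /andP[h ->] := normc_3z xi1; rewrite andbT; lra.
have h3 : 1 / 2 <= normc w3 <= 2 by have /andP[h ->] := normc_3z eta1; rewrite andbT; lra.
have /andP[b1 b2] := cpow_half2 s01 h2; have /andP[c1 c2] := cpow_half2 s01 h3.
rewrite Y0E !normcM normcV.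
set a := normc _ in a1 a2 *; set b := normc _ in b1 b2 *; set c := normc _ in c1 c2 *.
have c0 : 0 < c by lra.
rewrite ler_pdivlMr// ler_pdivrMr//; apply/andP; split; nra.
Qed.

Lemma ratio0_near1 : normc (Y 0%N - 1) <= (36 + 8 * expR 2) * r ^+ 2.
Proof.
have e2 : 0 <= expR 2 :> R by exact: expR_ge0.
case: (lerP r (1 / 2)) => hr; last first.
  apply: le_trans (normcB _ _) _; rewrite normc1.
  have /andP[_ h] := ratio0_bounds.
  have : 1 / 4 <= r ^+ 2 by rewrite expr2; nra.
  by move: h; nra.
have w3N : w3 != 0.
  by apply: Re_gt0_neq0; apply: lt_le_trans (Re_3z eta1).
pose q := w1 * w2 / w3.
have qw : w1 * w2 = q * w3 by rewrite /q mulfVK.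
have n3 : 2 <= normc (3 - eta).
  have /andP[h _] := normc_3z eta1; move: h.
  by rewrite normcM normcV normc_nat ler_pdivlMr// mul1r.
have q1 : normc (q - 1) <= r ^+ 2.
  have n30 : 3 - eta != 0 by rewrite -normc_gt0; lra.
  have -> : q - 1 = - ((1 - eta) ^+ 2 * ((eta + 3) / (2 * (3 - eta)))).
    by rewrite /q /w1 /w2 /w3 /xi; field.
  rewrite normcN normcM normcX -/r ler_piMr ?exprn_ge0 ?(ltW r0)//.
  rewrite normcM normcV normcM normc_nat ler_pdivrMr; last by rewrite mulr_gt0//; lra.
  rewrite mul1r; have := le_normcD eta 3; rewrite normc_nat; have := eta1; lra.
have rr : r ^+ 2 <= 1 / 4 by rewrite expr2; have := r0; nra.
have Rq : 3 / 4 <= complex.Re q.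
  have := normc_Re (q - 1); rewrite cReD cReN/= => h.
  by have := ler_norm (- (complex.Re q - 1)); rewrite normrN; lra.
have Rw2 : 1 <= complex.Re w2 by exact: Re_3z.
have Rw3 : 1 <= complex.Re w3 by exact: Re_3z.
have Rw12 : 0 < complex.Re (w1 * w2).
  pose t := 1 - eta.
  have e : w1 * w2 - 1 = t / 2 - t ^+ 2 + t ^+ 3 / 4.
    by rewrite /w1 /w2 /t /xi; field.
  have h1 : normc (w1 * w2 - 1) <= r / 2 + r ^+ 2 + r ^+ 3 / 4.
    rewrite e; apply: le_trans (le_normcD _ _) _; apply: lerD.
      apply: le_trans (normcB _ _) _; apply: lerD; last by rewrite normcX.
      by rewrite normcM normcV normc_nat.
    by rewrite normcM normcV normc_nat normcX.
  have h2 : r ^+ 3 <= 1 / 8.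
    by rewrite exprS; have := r0; nra.
  have := normc_Re (w1 * w2 - 1); rewrite cReD cReN/= => h.
  have := ler_norm (- (complex.Re (w1 * w2) - 1)); rewrite normrN; lra.
have -> : Y 0%N = cpow (- s) q.
  rewrite Y0E -cpowM//; [|by have := Re_w1; lra|by lra].
  rewrite qw cpowM; [|lra|lra|by rewrite -qw].
  by rewrite mulfK ?cpow_neq0.
have m0 : 0 < 3 / 4 :> R by lra.
have m1 : 3 / 4 <= 1 :> R by lra.
have qm : normc (q - 1) <= 3 / 4 by apply: le_trans q1 _; lra.
apply: le_trans (cpow_near1 s01 m0 Rq m1 qm) _.
apply: (@le_trans _ _ (8 * expR 2 * r ^+ 2)); last first.
  by rewrite ler_wpM2r ?exprn_ge0 ?(ltW r0)//; lra.
rewrite (_ : 6 * _ / _ = 8 * expR 2); last by field.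
by rewrite ler_wpM2l// mulr_ge0.
Qed.

Definition ratio_const : R := 36 + 8 * expR 2 + 24 * chi_const * (1 + chi_const * 4) ^+ 3.

Lemma ratio_const_ge0 : 0 <= ratio_const.
Proof.
have k0 := chi_const_ge0; apply: addr_ge0.
  by apply: addr_ge0 => //; apply: mulr_ge0 => //; exact: expR_ge0.
apply: mulr_ge0; first by apply: mulr_ge0.
by apply: exprn_ge0; apply: addr_ge0 => //; apply: mulr_ge0.
Qed.

(** The value is of order [r^2] by expansion at 1, and the higher coefficients by
    integration of an ODE whose coefficient is of order [r]. *)
Lemma ratio_near1 : bnd r (ratio_const * r ^+ 2) (Y - 1).
Proof.
have k0 := chi_const_ge0; have r0' := ltW r0.
have bX : bnd r 8 X by exact: bndX.
have b1X : bnd r (4 * r) (1 - X) by exact: bnd1X.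
have q0 : 4 <= normc (((1 + X) * (3 - X * X) * (3 - X)) 0%N).
  rewrite !fps_mul0 fpsDE !fpsBE fps_mul0 -!fpsCn fps1E /X jetX// fact0 divr1 /= !normcM.
  have h1 := one_plus_eta.
  have h2 : 2 <= normc (3 - eta * eta).
    have /andP[h _] := normc_3z xi1; move: h; rewrite normcM normcV normc_nat.
    by rewrite ler_pdivlMr// mul1r.
  have h3 : 2 <= normc (3 - eta).
    have /andP[h _] := normc_3z eta1; move: h; rewrite normcM normcV normc_nat.
    by rewrite ler_pdivlMr// mul1r.
  apply: (@le_trans _ _ (1 * 2 * 2)); first by lra.
  by apply: ler_pM => //; apply: ler_pM.
have bq : bnd r (chiA * 4) ((1 + X) * (3 - X * X) * (3 - X)).
  have b1 : bnd r 9 (1 + X).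
    by apply: bnd_le (bndD r0' (bnd_nat r 1) bX); lra.
  have b2 : bnd r (4 * (8 * 10)) (3 - X * X).
    by apply: bnd_le (bndB r0' (bnd_nat r 3) (bndM r0' bX bX)); lra.
  have b3 : bnd r 11 (3 - X).
    by apply: bnd_le (bndB r0' (bnd_nat r 3) bX); lra.
  by apply: bnd_le (bndM r0' (bndM r0' b1 b2) b3); rewrite /chiA; lra.
have by1 : bnd r (chiY * r) (fpsC s%:C%C * X * (1 - X) * (2 * (X * X) - 6 * X - 12)).
  have b1 : bnd r (10 ^+ 4) (2 * (X * X) - 6 * X - 12).
    apply: bnd_le (bndB r0' (bndB r0' (bndM r0' (bnd_nat r 2) (bndM r0' bX bX))
      (bndM r0' (bnd_nat r 6) bX)) (bnd_nat r 12)); lra.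
  by apply: bnd_le (bndM r0' (bndM r0' (bnd_sX s01 eta1) b1X) b1); rewrite /chiY; lra.
have A0 : 0 <= chiA by exact: exprn_ge0.
have [_ h] := jet_ode_bound r0' (ltr0n _ 4) A0 q0 bq by1 ratio_ode.
have A'E : chiY * r / 4 * (1 + chiA) ^+ 3 * r = chi_const * r ^+ 2.
  by rewrite /chi_const -/chiA -/chiY; ring.
rewrite A'E in h.
have /andP[_ y8] := ratio0_bounds.
have rr : r ^+ 2 <= 4 by rewrite expr2; have := r0; have := r2; nra.
case=> [|k] k3.
  rewrite expr0 mulr1 fpsBE fps1E; apply: le_trans ratio0_near1 _.
  rewrite ler_wpM2r ?exprn_ge0// /ratio_const lerDl.
  apply: mulr_ge0; first by rewrite mulr_ge0.
  by rewrite exprn_ge0// addr_ge0// mulr_ge0.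
rewrite fpsBE fps1E subr0; apply: le_trans (h k.+1 k3) _.
have hp : (1 + chi_const * r ^+ 2) ^+ 3 <= (1 + chi_const * 4) ^+ 3.
  rewrite lerXn2r ?nnegrE ?addr_ge0 ?mulr_ge0 ?exprn_ge0//.
  by rewrite lerD2l ler_wpM2l.
have hp0 : 0 <= (1 + chi_const * r ^+ 2) ^+ 3.
  by rewrite exprn_ge0// addr_ge0// mulr_ge0// exprn_ge0.
have hy : normc (Y 0%N) * (1 + chi_const * r ^+ 2) ^+ 3 <= 8 * (1 + chi_const * 4) ^+ 3.
  by apply: ler_pM; rewrite ?normc_ge0.
rewrite (_ : 3 * (chi_const * r ^+ 2) * _ = 3 * chi_const * (normc (Y 0%N) * (1 + chi_const * r ^+ 2) ^+ 3) * r ^+ 2); last by ring.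
rewrite ler_wpM2r ?exprn_ge0//.
apply: (@le_trans _ _ (3 * chi_const * (8 * (1 + chi_const * 4) ^+ 3))).
  by rewrite ler_wpM2l// mulr_ge0.
rewrite /ratio_const (_ : 3 * chi_const * _ = 24 * chi_const * (1 + chi_const * 4) ^+ 3); last by ring.
by rewrite lerDr addr_ge0// mulr_ge0// expR_ge0.
Qed.


(** ** One step of halving, near and away from 1 *)

Variables (mu mu' : R).
Hypothesis mu'0 : 0 < mu'.
Hypothesis muE : mu = 2 * sig * mu'.

Let mu0 : 0 < mu. Proof. by rewrite muE !mulr_gt0. Qed.

Let W := J2 (sbd_dev s mu).
Let v := jet eta (sbd_dev s mu').
Let Qm := J2 (sbd_poly s mu).
Let Q' := jet eta (sbd_poly s mu').
Let q4 : fps C := fpsC 4^-1.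
Let m' : fps C := fpsC mu'%:C%C.
Let g : fps C := fpsC sig%:C%C.

Let jet_bsymE z : normc z < 1 -> jet z (bsym s) = (1 - jet z x) * jet z (delta_pow s).
Proof.
by move=> z1; rewrite jet_bsym// /delta_pow jetM//; [exact: indisc_binser|exact: indisc_phi3].
Qed.

Let fmuE : (fpsC mu%:C%C : fps C) = 2 * g * m'.
Proof. by rewrite muE !rmorphM/= rmorph_nat !fpsCM2 fpsCn. Qed.

Let QmE : Qm = (1 - X * X) * ((1 - X * X) * (g * (pt * Y)) + 2 * g * m' * (q4 * (3 + X * X * (X * X)))).
Proof.
rewrite /Qm /J2 jet_sbd_poly// jet_bsymE// jet_gsym// -!fpsCn -fpsC1.
rewrite !(jscaleM, jscaleD, jscaleN, jscaleC) fmuE.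
by rewrite -/(J2 x) -/(J2 (delta_pow s)) J2X -/p2t hY fpsC1 !fpsCn.
Qed.

Let Q'E : Q' = (1 - X) * ((1 - X) * pt + m' * (q4 * (3 + X * X))).
Proof. by rewrite /Q' jet_sbd_poly// jet_bsymE// jet_gsym. Qed.

Let eqW : Qm * W = - (2 * g * m') * (X * X).
Proof.
have h := congr1 (jscale 2) (jet_sbd_devE s01 xi1 mu0).
by rewrite !jscaleM jscaleC -/(J2 x) J2X fpsCN fmuE in h.
Qed.

Let eqv : Q' * v = - m' * X.
Proof. by rewrite /Q' /v jet_sbd_devE// fpsCN. Qed.

(* Second-order consistency is the factor [(1 - X)^2] extracted here. *)
Lemma pair_identity : Qm * (Q' * (2 * W - v)) =
  m' * (X * ((1 - X) * (g * ((1 - X) * pt * ((1 - X) * (1 - X) + (1 + X) * (1 + X) * (Y - 1)) +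
     2 * m' * q4 * ((1 - X) * (1 - X) * (X * X * X + 3 * (X * X) + 3 * X + 3)))))).
Proof.
transitivity (2 * (Qm * W) * Q' - (Q' * v) * Qm); first by ring.
by rewrite eqW eqv QmE Q'E; ring.
Qed.

Let a := asize s eta.

(** The sizes at [xi = eta^2] and at [eta] are comparable, since [1 - xi] is the product
    of [1 - eta] and of [1 + eta], which lies between 1 and 2 in modulus. *)
Lemma binser_pair_size : a / 64 <= asize s xi.
Proof.
rewrite /a /asize.
have rxi : r <= rad xi.
  have -> : 1 - xi = (1 - eta) * (1 + eta) by rewrite /xi; ring.
  by rewrite normcM ler_peMr ?normc_ge0// one_plus_eta.
have hp : p2t 0%N = sig%:C%C * (pt 0%N * Y 0%N).
  by rewrite hY fpsCM fps_mul0.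
have hx : ev xi (delta_pow s) = sig%:C%C * (ev eta (delta_pow s) * Y 0%N).
  by have := hp; rewrite /p2t /J2 /jscale expr0 mul1r /pt !jet0.
have eD z : normc z < 1 -> normc (ev z (delta_pow s)) = normc (ev z (binser s)) * normc (ev z (phi3 s)).
  by move=> z1; rewrite -normcM -evM//; [exact: indisc_binser|exact: indisc_phi3].
have nrm (p q y : C) : p = sig%:C%C * (q * y) -> normc p = sig * (normc q * normc y).
  by move=> ->; rewrite normcM normcM normc_realp// ltW.
have h := etrans (esym (eD xi xi1)) (etrans (nrm _ _ _ hx)
  (congr1 (fun t => sig * (t * normc (Y 0%N))) (eD eta eta1))).
have /andP[f1 f2] := ev_phi3_bound s01 xi1; have /andP[e1 e2] := ev_phi3_bound s01 eta1.
have /andP[y1 y2] := ratio0_bounds.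
have sg : 1 / 2 <= sig.
  rewrite /sig powRN div1r lef_pV2 ?posrE ?powR_gt0//.
  by rewrite -[X in _ <= X](powRr1 (ler0n R 2)) ler_powR ?ler1n// ltW.
have h3 := pair_size_arith (normc_ge0 _) (normc_ge0 _) f2 e1 y1 sg h.
exact: size_arith r0 rxi (normc_ge0 _) h3.
Qed.

(** Up to the contribution of [- eta], the jet [2 W - v] is twice that of the difference
    between the coarse solution and the fine one sampled at even indices. *)
Lemma pair_bound (K1 K2 : R) : 0 <= K1 -> 0 <= K2 ->
  (forall z, normc z < 1 -> bnd (rad z) (K1 * asize s z) (jet z (bsym s))) ->
  (forall z mu, normc z < 1 -> 0 <= mu ->
     bnd (rad z) (K2 * (rad z * (asize s z + mu) / 10)) (jet z (sbd_poly s mu))) ->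
  let Kn := 4 * (8 * (4 * (4 * (4 * (K1 * (64 + 4 * (324 * ratio_const))) + 4 * (2 * (64 * 10 ^+ 5)))))) in
  bnd r (Kn * 640 * (1 + 8 * K2) ^+ 3 * 10 * (1 + K2) ^+ 3 * r) (2 * W - v).
Proof.
move=> K10 K20 hB hQ Kn; have r0' := ltW r0.
have a0 : 0 < a by exact: asize_gt0.
have rc0 := ratio_const_ge0.
have bX : bnd r 8 X by exact: bndX.
have b1X : bnd r (4 * r) (1 - X) by exact: bnd1X.
have b2X : bnd r (64 * r ^+ 2) ((1 - X) * (1 - X)).
  by apply: bnd_le (bndM r0' b1X b1X); rewrite le_eqVlt; apply/orP; left; apply/eqP; ring.
have b1pX : bnd r 324 ((1 + X) * (1 + X)).
  have b9 : bnd r 9 (1 + X) by apply: bnd_le (bndD r0' (bnd_nat r 1) bX); lra.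
  by apply: bnd_le (bndM r0' b9 b9); lra.
have bB : bnd r (K1 * a) ((1 - X) * pt) by rewrite /X /pt -jet_bsymE//; exact: hB.
have bY := ratio_near1.
have b3 : bnd r (10 ^+ 5) (X * X * X + 3 * (X * X) + 3 * X + 3).
  apply: bnd_le (bndD r0' (bndD r0' (bndD r0' (bndM r0' (bndM r0' bX bX) bX)
    (bndM r0' (bnd_nat r 3) (bndM r0' bX bX))) (bndM r0' (bnd_nat r 3) bX)) (bnd_nat r 3)); lra.
have n1 : bnd r (4 * (K1 * (64 + 4 * (324 * ratio_const))) * (a * r ^+ 2))
    ((1 - X) * pt * ((1 - X) * (1 - X) + (1 + X) * (1 + X) * (Y - 1))).
  apply: bnd_le (bndM r0' bB (bndD r0' b2X (bndM r0' b1pX bY))).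
  by rewrite le_eqVlt; apply/orP; left; apply/eqP; ring.
have n2 : bnd r (4 * (2 * (64 * 10 ^+ 5)) * (mu' * r ^+ 2))
    (2 * m' * q4 * ((1 - X) * (1 - X) * (X * X * X + 3 * (X * X) + 3 * X + 3))).
  have -> : 2 * m' * q4 = fpsC (2 * mu'%:C%C * 4^-1) :> fps C by rewrite !fpsCM2 fpsCn.
  apply: bnd_le (bndZ _ (bndM r0' b2X b3)).
  rewrite normcM (normcM 2) normcV !normc_nat (normc_realp (ltW mu'0)).
  have h : 0 <= mu' * r ^+ 2 by rewrite mulr_ge0 ?exprn_ge0 ?(ltW mu'0).
  rewrite (_ : 2 * mu' / 4 * _ = 2 / 4 * 4 * (64 * 10 ^+ 5) * (mu' * r ^+ 2)); last by ring.
  by rewrite ler_wpM2r//; lra.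
pose k1 := 4 * (K1 * (64 + 4 * (324 * ratio_const))); pose k2 : R := 4 * (2 * (64 * 10 ^+ 5)).
have k10 : 0 <= k1 := mulr_ge0 (ler0n _ 4) (mulr_ge0 K10 (addr_ge0 (ler0n _ 64)
  (mulr_ge0 (ler0n _ 4) (mulr_ge0 (ler0n _ 324) rc0)))).
have k20 : 0 <= k2 := mulr_ge0 (ler0n _ 4) (mulr_ge0 (ler0n _ 2) (mulr_ge0 (ler0n _ 64)
  (exprn_ge0 5 (ler0n _ 10)))).
have n3 : bnd r ((k1 + k2) * ((a + mu') * r ^+ 2)) (g * ((1 - X) * pt * ((1 - X) * (1 - X) + (1 + X) * (1 + X) * (Y - 1)) +
     2 * m' * q4 * ((1 - X) * (1 - X) * (X * X * X + 3 * (X * X) + 3 * X + 3)))).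
  apply: bnd_le (bndZ _ (bndD r0' n1 n2)).
  rewrite normc_realp ?(ltW sig_gt0)// -/k1 -/k2.
  have ar : 0 <= a * r ^+ 2 by rewrite mulr_ge0 ?exprn_ge0 ?(ltW a0).
  have mr : 0 <= mu' * r ^+ 2 by rewrite mulr_ge0 ?exprn_ge0 ?(ltW mu'0).
  apply: (@le_trans _ _ (k1 * (a * r ^+ 2) + k2 * (mu' * r ^+ 2))).
    by rewrite ler_piMl// addr_ge0// mulr_ge0.
  have := mulr_ge0 k10 mr; have := mulr_ge0 k20 ar; lra.
have n4 := bndZ mu'%:C%C (bndM r0' bX (bndM r0' b1X n3)).
rewrite normc_realp ?(ltW mu'0)// -/m' -pair_identity in n4.
pose c2 := rad xi * (asize s xi + mu) / 10; pose c1 := r * (a + mu') / 10.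
have rxi : r <= rad xi.
  have -> : 1 - xi = (1 - eta) * (1 + eta) by rewrite /xi; ring.
  by rewrite normcM ler_peMr ?normc_ge0// one_plus_eta.
have sg : 1 / 2 <= sig.
  rewrite /sig powRN div1r lef_pV2 ?posrE ?powR_gt0//.
  by rewrite -[X in _ <= X](powRr1 (ler0n R 2)) ler_powR ?ler1n// ltW.
have c1_gt0 : 0 < c1 by rewrite /c1 divr_gt0// mulr_gt0// addr_gt0.
have c2l : c1 / 64 <= c2.
  rewrite /c1 /c2 mulrAC ler_wpM2r// -mulrA; apply: ler_pM => //.
    by rewrite divr_ge0// addr_ge0// ltW.
  rewrite mulrDl; apply: lerD; first exact: binser_pair_size.
  by rewrite muE; have := mu'0; nra.
have c2_gt0 : 0 < c2 by apply: lt_le_trans c2l; rewrite divr_gt0.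
have qm0 : c2 <= normc (Qm 0%N).
  by rewrite /Qm /J2 /jscale expr0 mul1r; apply: sbd_poly0 => //; exact: ltW.
have bQm : bnd r (8 * K2 * c2) Qm.
  move=> k k3; have := hQ xi mu xi1 (ltW mu0) k k3; rewrite -/c2 => h.
  rewrite /Qm /J2 /jscale normcM normcX normc_nat -!mulrA.
  apply: ler_pM; rewrite ?exprn_ge0 ?mulr_ge0 ?normc_ge0 ?exprn_ge0//.
    apply: (@le_trans _ _ (2 ^+ 3)); last by lra.
    by rewrite ler_weXn2l// ler1n.
  apply: le_trans h; rewrite ler_wpM2l ?normc_ge0// lerXn2r ?nnegrE ?normc_ge0//.
have A0 : 0 <= 8 * K2 by rewrite mulr_ge0.
have z1 := bnd_div r0' c2_gt0 A0 qm0 bQm n4 (erefl _).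
have bQ' : bnd r (K2 * c1) Q' by apply: hQ => //; exact: ltW.
have q'0 : c1 <= normc (Q' 0%N) by apply: sbd_poly0 => //; exact: ltW.
have z2 := bnd_div r0' c1_gt0 K20 q'0 bQ' z1 (erefl _).
apply: bnd_le z2.
apply: pair_final_arith => //; [exact: ltW|exact: addr_ge0|exact: exprn_ge0 (addr_ge0 _ A0)|].
exact: exprn_ge0 (addr_ge0 _ K20).
Qed.

End Pair.


(** ** Even part of a power series *)

Definition even_part (f : fps C) : fps C := fun n => f n.*2.

Lemma sum_even (A : zmodType) (F : nat -> A) N :
  \sum_(n < N.*2) F n = \sum_(n < N) (F n.*2 + F n.*2.+1).
Proof.
elim: N => [|N IH]; first by rewrite !big_ord0.
by rewrite doubleS !big_ord_recr/= IH addrA.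
Qed.

Lemma indisc_even f : indisc f -> indisc (even_part f).
Proof.
move=> hf rho /andP[r0 r1]; pose t := Num.sqrt rho.
have tt : t * t = rho by rewrite -expr2 sqr_sqrtr.
have ht : 0 <= t < 1.
  rewrite sqrtr_ge0/=; have h : 0 <= t by exact: sqrtr_ge0.
  rewrite ltNge; apply/negP => t1; have h1 : 1 <= t * t by nra.
  by rewrite tt leNgt r1 in h1.
have [B hB] := hf t ht; exists B => N; apply: le_trans (hB N.*2).
rewrite (sum_even (fun n => normc (f n) * t ^+ n)) ler_sum// => n _.
rewrite /even_part -tt -expr2 -exprM mul2n lerDl mulr_ge0 ?normc_ge0 ?exprn_ge0//.
by case/andP: ht.
Qed.

Lemma ccvg_even (S : nat -> C) l : ccvg S l -> ccvg (fun n => S n.*2) l.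
Proof.
rewrite /ccvg => h; apply: (cvg_comp (fun n => n.*2) (fun n => normc (S n - l))) h.
by apply/cvgnyPge => A; exists A => // n /= An; rewrite -addnn (leq_trans An)// leq_addr.
Qed.

(** The power of 2 comes from the logarithmic variable of [eta^2], twice that of [eta]. *)
Lemma jet_even f (eta : C) k : normc eta < 1 -> indisc f ->
  2 ^+ k * jet (eta * eta) (even_part f) k = (jet eta f k + jet (- eta) f k) / 2.
Proof.
move=> eta1 hf; have xi1 := normc_zz eta1.
have neta1 : normc (- eta) < 1 by rewrite normcN.
have he := indisc_theta_pow k (indisc_even hf); have ho := indisc_theta_pow k hf.
have c1 := ccvgZ (2 ^+ k) (ev_cvg xi1 he).
have c2 := ccvgZ 2^-1 (ccvgD (ccvg_even (ev_cvg eta1 ho)) (ccvg_even (ev_cvg neta1 ho))).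
rewrite [RHS]mulrC; apply: ccvg_unique c1 _; move: c2.
congr (ccvg _ _); apply/funext => N.
rewrite (sum_even (fun n => theta_pow k f n * eta ^+ n)).
rewrite (sum_even (fun n => theta_pow k f n * (- eta) ^+ n)) -big_split mulr_sumr mulr_sumr.
apply: eq_bigr => n _ /=.
have sq : (- eta) ^+ n.*2 = eta ^+ n.*2 by rewrite -mul2n !exprM sqrrN.
have sq1 : (- eta) ^+ n.*2.+1 = - eta ^+ n.*2.+1 by rewrite exprS sq exprS mulNr.
have sq2 : (eta * eta) ^+ n = eta ^+ n.*2 by rewrite -expr2 -exprM mul2n.
have d2 : (n.*2%:R : C) ^+ k = 2 ^+ k * n%:R ^+ k by rewrite -exprMn -mul2n natrM.
rewrite sq sq1 sq2 /theta_pow /even_part d2; field.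
exact: fact_neq0.
Qed.

Lemma jscale_comb (J J' : fps C) :
  (2 * jscale 2 J - J') 3%N = 2 * (2 ^+ 3 * J 3%N) - J' 3%N.
Proof. by rewrite fpsBE -fpsCn fpsCM. Qed.

Lemma halving_arith (j j2 w v : C) (r r' A B : R) :
  2 ^+ 3 * j2 = (w + v) / 2 -> normc (2 * (2 ^+ 3 * j) - w) * r ^+ 3 <= A * r ->
  normc v * r' ^+ 3 <= B / r' -> 0 < r -> r < 2 -> 1 <= r' -> r' < 2 ->
  normc (j - j2) * (r * r') ^+ 2 <= A + B.
Proof.
move=> he hz hn r0 r2 rp rp2.
have e8 : 16 * (j - j2) = (2 * (2 ^+ 3 * j) - w) - v.
  rewrite mulrBr (_ : 16 * j2 = 2 * (2 ^+ 3 * j2)); last by ring.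
  by rewrite he; field.
have hD : 16 * normc (j - j2) <= normc (2 * (2 ^+ 3 * j) - w) + normc v.
  by rewrite -[16 in X in X <= _](normc_nat R 16) -normcM e8 normcB.
move: hz hn hD; set a := normc (_ - w); set b := normc v; set d := normc _ => hz hn hD.
have a0 : 0 <= a by exact: normc_ge0.
have b0 : 0 <= b by exact: normc_ge0.
have d0 : 0 <= d by exact: normc_ge0.
have ha : a * r ^+ 2 <= A.
  by rewrite -(ler_pM2r r0) -mulrA -exprSr.
have A0 : 0 <= A by apply: le_trans ha; rewrite mulr_ge0 ?exprn_ge0 ?(ltW r0).
have B0 : 0 <= B.
  have : 0 <= B / r' by apply: le_trans hn; rewrite mulr_ge0// exprn_ge0//; lra.
  by rewrite pmulr_lge0// invr_gt0; lra.
have hb : b <= B.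
  apply: (@le_trans _ _ (b * r' ^+ 3)); first by rewrite ler_peMr// exprn_ege1.
  apply: le_trans hn _; rewrite ler_pdivrMr; last by lra.
  by rewrite ler_peMr.
apply: (@le_trans _ _ (d * (4 * r ^+ 2))).
  rewrite ler_wpM2l// exprMn mulrC ler_wpM2r ?exprn_ge0 ?(ltW r0)//.
  by rewrite expr2; nra.
have h1 : 16 * (d * (4 * r ^+ 2)) <= (a + b) * (4 * r ^+ 2).
  by rewrite mulrA ler_wpM2r// mulr_ge0// exprn_ge0// ltW.
have h2 : b * r ^+ 2 <= B * 4.
  apply: ler_pM => //; first by rewrite exprn_ge0// ltW.
  by rewrite expr2; nra.
lra.
Qed.

(** At [eta^2], choosing the root with [Re eta >= 0], [pair_bound] controls the contribution
    of [eta] and the crude bound [sbd_dev_bnd] that of [- eta], which stays away from 1. *)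
Theorem sbd_halving : exists K, 0 <= K /\ forall mu mu', 0 < mu' -> mu = 2 * 2 `^ (- s) * mu' ->
  forall n, (0 < n)%N ->
  normc (sbd_dev s mu n - sbd_dev s mu' n.*2) * n%:R ^+ 2 <= K.
Proof.
have [K1 [K10 hB]] := jet_bsym_bnd s01; have [K2 [K20 hQ]] := sbd_poly_bnd s01.
have [K3 [K30 hV]] := sbd_dev_bnd s01.
pose Kp := 4 * (8 * (4 * (4 * (4 * (K1 * (64 + 4 * (324 * ratio_const))) + 4 * (2 * (64 * 10 ^+ 5))))))
  * 640 * (1 + 8 * K2) ^+ 3 * 10 * (1 + K2) ^+ 3.
have Kp0 : 0 <= Kp.
  have t1 : 0 <= 4 * (K1 * (64 + 4 * (324 * ratio_const))) :=
    mulr_ge0 (ler0n _ 4) (mulr_ge0 K10 (addr_ge0 (ler0n _ 64)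
      (mulr_ge0 (ler0n _ 4) (mulr_ge0 (ler0n _ 324) ratio_const_ge0)))).
  have t2 : 0 <= 4 * (2 * (64 * 10 ^+ 5)) :> R := mulr_ge0 (ler0n _ 4) (mulr_ge0 (ler0n _ 2)
    (mulr_ge0 (ler0n _ 64) (exprn_ge0 5 (ler0n _ 10)))).
  have t3 := mulr_ge0 (ler0n R 4) (mulr_ge0 (ler0n R 8) (mulr_ge0 (ler0n R 4)
    (mulr_ge0 (ler0n R 4) (addr_ge0 t1 t2)))).
  exact: mulr_ge0 (mulr_ge0 (mulr_ge0 (mulr_ge0 t3 (ler0n _ 640))
    (exprn_ge0 3 (addr_ge0 ler01 (mulr_ge0 (ler0n _ 8) K20)))) (ler0n _ 10))
    (exprn_ge0 3 (addr_ge0 ler01 K20)).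
have hP : forall eta mu mu', normc eta < 1 -> 0 <= complex.Re eta -> 0 < mu' ->
    mu = 2 * 2 `^ (- s) * mu' -> bnd (rad eta) (Kp * rad eta)
      (2 * jscale 2 (jet (eta * eta) (sbd_dev s mu)) - jet eta (sbd_dev s mu')).
  move=> eta mu mu' eta1 Re_eta mu'0 muE.
  have [Y hY Y0E] := ratio_jet eta1 Re_eta.
  exact: (pair_bound eta1 Re_eta hY Y0E mu'0 muE K10 K20 hB hQ).
clearbody Kp.
exists (12 * expR 1 * (Kp + K3)); split.
  by rewrite mulr_ge0 ?addr_ge0// mulr_ge0// expR_ge0.
move=> mu mu' mu'0 muE n n0; set f := sbd_dev s mu; set f' := sbd_dev s mu'.
have mu0 : 0 < mu by rewrite muE !mulr_gt0// powR_gt0.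
have i1 : indisc f by exact: indisc_sbd_dev.
have i2 : indisc f' by exact: indisc_sbd_dev.
have i3 := indisc_even i2.
rewrite (_ : f n - f' n.*2 = (f - even_part f') n)//.
apply: (coef_decay n0); first exact: indiscB.
move=> xi nxi; have /andP[_ hr] := radius_in R n.
have [eta eE Re_eta] : exists2 eta : C, xi = eta * eta & 0 <= complex.Re eta.
  have h := sqr_sqrtc xi; rewrite expr2 in h.
  case: (lerP 0 (complex.Re (sqrtc xi))) => hs; first by exists (sqrtc xi).
  exists (- sqrtc xi); first by rewrite mulrNN.
  by rewrite cReN oppr_ge0 ltW.
have eta1 : normc eta < 1.
  rewrite ltNge; apply/negP => e1; have := nxi; rewrite eE normcM => e.
  have : 1 <= normc eta * normc eta by nra.
  by rewrite e leNgt hr.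
have neta1 : normc (- eta) < 1 by rewrite normcN.
have xi1 : normc xi < 1 by rewrite nxi.
have hz := hP eta mu mu' eta1 Re_eta mu'0 muE 3%N isT.
have hn := hV (- eta) mu' neta1 mu'0 3%N isT.
have he := jet_even 3 eta1 i2; rewrite -eE in he hz.
rewrite jetB// fpsBE.
have r0 := rad_gt0 eta1; have r2 := rad_lt2 eta1.
have rp : 1 <= rad (- eta) by rewrite opprK; exact: one_plus_eta.
have rp2 : rad (- eta) < 2 by exact: rad_lt2.
have hx : normc (1 - xi) = rad eta * rad (- eta).
  by rewrite -normcM eE; congr normc; ring.
rewrite hx; rewrite jscale_comb in hz.
exact: halving_arith he hz hn r0 r2 rp rp2.
Qed.

End Doubling.

(** * Comparison with the first-order scheme, and dependence on the parameter *)

Section Comparison.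
Variable R : realType.
Local Notation C := R[i].
Local Open Scope classical_set_scope.
Local Open Scope ring_scope.
Implicit Types (z w : C) (mu nu : R).

Variable s : R.
Hypothesis s01 : 0 < s < 1.

Let s0 : 0 < s. Proof. by case/andP: s01. Qed.
Let s1 : s < 1. Proof. by case/andP: s01. Qed.
Let s01' : 0 <= s <= 1. Proof. by rewrite !ltW. Qed.

Local Notation x := (fpsX C).
Local Notation rad z := (normc (1 - z)).

Lemma indisc_be_poly mu : indisc (be_poly s mu).
Proof. by apply: indiscM; [exact: indisc_1x|exact: indisc_be_sym]. Qed.

Lemma jet_be_poly z mu : normc z < 1 ->
  jet z (be_poly s mu) = (1 - jet z x) * ((1 - jet z x) * jet z (binser s) + fpsC mu%:C%C).
Proof.
move=> z1; have iP := indisc_binser s01'; have i1 := @indisc_1x R.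
have iD : indisc ((1 - x) * binser s) by exact: indiscM.
rewrite /be_poly /be_sym jetM// ?jet_1X//; last by apply: indiscD => //; exact: indiscC.
by rewrite jetD// ?jetC// ?jetM// ?jet_1X//; exact: indiscC.
Qed.

Lemma be_poly0 z mu : normc z < 1 -> 0 <= mu ->
  rad z * (asize s z + mu) / 5 <= normc (jet z (be_poly s mu) 0%N).
Proof.
move=> z1 mu0; have iP := indisc_binser s01'; have i1 := @indisc_1x R.
have ix := @indiscX R; have i11 := @indisc1 R.
have iS : indisc (be_sym s mu) by exact: indisc_be_sym.
rewrite jet0 /be_poly evM// evB// ev1// evX// normcM -mulrA ler_wpM2l ?normc_ge0// ev_be_sym//.
have r1 : 1 / 2 <= complex.Re (1 : C) by rewrite /=; lra.
have n1 : normc (1 : C) <= 1 by rewrite normc1.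
have h := sector_lower mu0 (Re_asym s01 z1) r1 n1.
rewrite mulr1 in h.
have e : normc (ev z ((1 - x) * binser s)) = asize s z.
  by rewrite evM// evB// ev1// evX// normcM.
by rewrite e in h; lra.
Qed.

Lemma first_order_arith (m a r k e e' : R) : 0 < r -> 0 <= a -> 0 < m -> 0 <= k ->
  0 <= e -> 0 <= e' ->
  m * (k * (r * (r * (a + m)))) / (r * (a + m) / 5) * e / (r * (a + m) / 10) * e' <= 50 * k * e * e'.
Proof.
move=> r0 a0 m0 k0 e0 e'0; have am : 0 < a + m by rewrite ltr_wpDl.
have -> : m * (k * (r * (r * (a + m)))) / (r * (a + m) / 5) * e / (r * (a + m) / 10) * e' =
    (50 * k * e * e') * (m / (a + m)) by field; rewrite !gt_eqF.
apply: ler_piMr; first exact: mulr_ge0 (mulr_ge0 (mulr_ge0 (ler0n _ 50) k0) e0) e'0.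
by rewrite ler_pdivrMr// mul1r lerDr.
Qed.

(** The two symbols agree at 1 up to a relative error of order [1 - z], which compensates
    the singularity [1 / rad z] of the solutions. *)
Lemma first_order_jet : exists K, 0 <= K /\ forall z nu, normc z < 1 -> 0 < nu ->
  bnd (rad z) K (jet z (sbd_dev s nu - be_dev s nu)).
Proof.
have [K1 [K10 h1]] := jet_binser_bnd s01; have [K2 [K20 h2]] := jet_phi3_bnd s01.
have [K3 [K30 h3]] := sbd_poly_bnd s01.
pose k := 16 * (4 * (16 * K1 * (K2 + 4)) + 44).
have k0 : 0 <= k.
  exact: mulr_ge0 (ler0n _ 16) (addr_ge0 (mulr_ge0 (ler0n _ 4) (mulr_ge0 (mulr_ge0 (ler0n _ 16) K10)
    (addr_ge0 K20 (ler0n _ 4)))) (ler0n _ 44)).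
pose kE := 80 * (16 * K1 + 1).
have kE0 : 0 <= kE.
  exact: mulr_ge0 (ler0n _ 80) (addr_ge0 (mulr_ge0 (ler0n _ 16) K10) ler01).
have e10 : 0 <= (1 + kE) ^+ 3 by apply: exprn_ge0; exact: addr_ge0 ler01 kE0.
have e20 : 0 <= (1 + K3) ^+ 3 by apply: exprn_ge0; exact: addr_ge0 ler01 K30.
exists (50 * k * (1 + kE) ^+ 3 * (1 + K3) ^+ 3); split.
  exact: mulr_ge0 (mulr_ge0 (mulr_ge0 (ler0n _ 50) k0) e10) e20.
move=> z nu z1 nu0; have r0 := rad_gt0 z1; have r0' := ltW r0.
have hq0 := sbd_poly0 s01 z1 (ltW nu0); have he0 := be_poly0 z1 (ltW nu0).
have bQ := h3 z nu z1 (ltW nu0); have a0 := asize_gt0 s01 z1.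
have bX := bndX z1; have b1X := bnd1X z1.
have bA : bnd (rad z) (16 * K1 * asize s z) ((1 - jet z x) * jet z (binser s)).
  apply: bnd_le (bndM r0' b1X (h1 z z1)).
  by rewrite /asize le_eqVlt; apply/orP; left; apply/eqP; ring.
have [_ bF] := h2 z z1.
have iV := indisc_sbd_dev s01 nu0; have iB := indisc_be_dev s01 nu0.
have eQ := jet_sbd_devE s01 z1 nu0.
have eB : jet z (be_poly s nu) * jet z (be_dev s nu) = fpsC (- nu%:C%C).
  rewrite -jetM//; last exact: indisc_be_poly.
  by rewrite be_devE ?(ltW nu0)// jetC.
have EQ := jet_sbd_poly s01 nu z1; rewrite jet_bsym// jet_gsym// in EQ.
have EB := jet_be_poly nu z1.
rewrite jetB//.
set X := jet z x in bX b1X bA eQ EQ EB; set p := jet z (binser s) in bA EQ EB.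
set f := jet z (phi3 s) in bF EQ; set Q := jet z (sbd_poly s nu) in hq0 bQ eQ EQ.
set E := jet z (be_poly s nu) in he0 eB EB.
set v := jet z (sbd_dev s nu) in eQ *; set b := jet z (be_dev s nu) in eB *.
set q4 := fpsC (4^-1 : C) in EQ; set m := fpsC (nu%:C%C : C) in EQ EB.
have q44 : q4 * 4 = 1 by rewrite /q4 -(fpsCn C 4) -fpsCM2 mulVf ?fpsC1// pnatr_eq0.
have mN : fpsC (- nu%:C%C) = - m :> fps C by rewrite fpsCN.
have key : E * (Q * (v - b)) = m * ((1 - X) * ((1 - X) * p * ((f - 1) + (1 - X)) + m * (q4 * ((1 - X) * (3 - X))))).
  transitivity (Q * v * E - E * b * Q); first by ring.
  rewrite eQ eB mN EQ EB.
  have -> : q4 * ((1 - X) * (3 - X)) = q4 * (3 + X * X) - (q4 * 4) * X by ring.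
  rewrite q44; ring.
have n1 : bnd (rad z) (4 * (16 * K1 * (K2 + 4)) * (asize s z * rad z))
    ((1 - X) * p * ((f - 1) + (1 - X))).
  apply: bnd_le (bndM r0' bA (bndD r0' bF b1X)).
  by rewrite le_eqVlt; apply/orP; left; apply/eqP; ring.
have n2 : bnd (rad z) (nu * (44 * rad z)) (m * (q4 * ((1 - X) * (3 - X)))).
  have b3 : bnd (rad z) 11 (3 - X).
    by apply: bnd_le (bndB r0' (bnd_nat _ 3) bX); lra.
  have := bndZ nu%:C%C (bndZ 4^-1 (bndM r0' b1X b3)).
  rewrite (normc_realp (ltW nu0)) normcV normc_nat.
  by rewrite (_ : 4^-1 * _ = 44 * rad z)//; field.
have n3 : bnd (rad z) (nu * (k * (rad z * (rad z * (asize s z + nu))))) (E * (Q * (v - b))).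
  rewrite key; apply: bnd_le (bndZ _ (bndM r0' b1X (bndD r0' n1 n2))).
  rewrite (normc_realp (ltW nu0)) ler_wpM2l ?(ltW nu0)//.
  have g0 := mulr_ge0 (ler0n R 4) (mulr_ge0 (mulr_ge0 (ler0n _ 16) K10) (addr_ge0 K20 (ler0n _ 4))).
  set u := 4 * (16 * K1 * (K2 + 4)) in g0 *.
  have -> : 4 * (4 * rad z * (u * (asize s z * rad z) + nu * (44 * rad z))) =
    (rad z * rad z) * (16 * (u * asize s z + 44 * nu)) by ring.
  have -> : k * (rad z * (rad z * (asize s z + nu))) =
    (rad z * rad z) * (16 * ((u + 44) * (asize s z + nu))) by rewrite /k -/u; ring.
  rewrite ler_wpM2l ?mulr_ge0// ler_wpM2l//.
  have := mulr_ge0 g0 (ltW nu0); have := ltW a0; lra.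
have bE : bnd (rad z) (kE * (rad z * (asize s z + nu) / 5)) E.
  rewrite EB; have bm := bndC (rad z) (nu%:C%C : C); rewrite (normc_realp (ltW nu0)) in bm.
  apply: bnd_le (bndM r0' b1X (bndD r0' bA bm)).
  have -> : 4 * (4 * rad z * (16 * K1 * asize s z + nu)) = rad z * (16 * (16 * K1 * asize s z + nu)) by ring.
  have -> : kE * (rad z * (asize s z + nu) / 5) = rad z * (16 * ((16 * K1 + 1) * (asize s z + nu))).
    by rewrite /kE; field.
  rewrite ler_wpM2l// ler_wpM2l//.
  have := mulr_ge0 (mulr_ge0 (ler0n R 16) K10) (ltW nu0); have := ltW a0; lra.
have am : 0 < rad z * (asize s z + nu) by rewrite mulr_gt0// addr_gt0.
have c1 : 0 < rad z * (asize s z + nu) / 10 by rewrite divr_gt0.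
have c2 : 0 < rad z * (asize s z + nu) / 5 by rewrite divr_gt0.
have d1 := bnd_div r0' c2 kE0 he0 bE n3 (erefl _).
have d2 := bnd_div r0' c1 K30 hq0 bQ d1 (erefl _).
apply: bnd_le d2; exact: first_order_arith r0 (ltW a0) nu0 k0 e10 e20.
Qed.

(** Jets of size 1 have a third coefficient of order [|1 - z|^-3], hence one power of [n]
    more than in [coef_decay]. *)
Theorem sbd_be_close : exists K, 0 <= K /\ forall nu, 0 < nu -> forall n, (0 < n)%N ->
  normc (sbd_dev s nu n - be_dev s nu n) * n%:R <= K.
Proof.
have [K [K0 hK]] := first_order_jet.
have e0 := expR_ge0 (1 : R).
have c0 : 0 <= 24 * expR 1 * K :> R := mulr_ge0 (mulr_ge0 (ler0n _ 24) e0) K0.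
exists (24 * expR 1 * K); split=> //.
move=> nu nu0 n n0; have np : (0 : R) < n%:R by rewrite ltr0n.
have iV := indisc_sbd_dev s01 nu0; have iB := indisc_be_dev s01 nu0.
have hA z : normc z = n%:R / n.+1%:R ->
    normc (jet z (sbd_dev s nu - be_dev s nu) 3) * normc (1 - z) ^+ 2 <= K * n.+1%:R.
  move=> nz; have /andP[_ hr] := radius_in R n.
  have z1 : normc z < 1 by rewrite nz.
  have := hK z nu z1 nu0 3%N isT; have r0 := rad_gt0 z1.
  have rl : n.+1%:R^-1 <= rad z.
    have := le_normcB 1 z; rewrite normc1 nz; apply: le_trans.
    by rewrite le_eqVlt; apply/orP; left; apply/eqP; rewrite -natr1; field; rewrite natr1 pnatr_eq0.
  set d := normc _; set r := normc _ in r0 rl *; rewrite exprS => h.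
  have d0 : 0 <= d * r ^+ 2 by rewrite mulr_ge0 ?normc_ge0 ?exprn_ge0 ?(ltW r0).
  rewrite -ler_pdivrMr ?ltr0n//; apply: le_trans h.
  by rewrite (_ : d * (r * r ^+ 2) = d * r ^+ 2 * r) ?ler_wpM2l//; ring.
have := coef_decay n0 (indiscB iV iB) hA.
rewrite fpsBE => h.
have e2 (t : R) : t * n%:R * n%:R = t * n%:R ^+ 2 by ring.
rewrite -(ler_pM2r np) e2; apply: le_trans h _.
have n1 : (n.+1%:R : R) <= 2 * n%:R by rewrite -natrM ler_nat mul2n -addnn -addn1 leq_add2l.
have h2 : 12 * expR 1 * K * n.+1%:R <= 12 * expR 1 * K * (2 * n%:R).
  apply: ler_wpM2l => //; exact: mulr_ge0 (mulr_ge0 (ler0n _ 12) e0) K0.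
by apply: le_trans (_ : _ <= 12 * expR 1 * K * (2 * n%:R)) _; [rewrite mulrA|]; lra.
Qed.

(** Iterated halving sums a geometric series. *)
Lemma sbd_halvings : exists K, 0 <= K /\ forall mu n j, 0 < mu -> (0 < n)%N ->
  normc (sbd_dev s mu n - sbd_dev s (mu / (2 * 2 `^ (- s)) ^+ j) (n * 2 ^ j)%N) * n%:R ^+ 2 <= K.
Proof.
have [K [K0 hK]] := sbd_halving s01.
exists (2 * K); split; first by rewrite mulr_ge0.
move=> mu n j mu0 n0; set q := 2 * 2 `^ (- s).
have q0 : 0 < q by rewrite mulr_gt0// powR_gt0.
have np : (0 : R) < n%:R by rewrite ltr0n.
suff : normc (sbd_dev s mu n - sbd_dev s (mu / q ^+ j) (n * 2 ^ j)%N) * n%:R ^+ 2 <=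
    2 * K * (1 - 4^-1 ^+ j).
  move=> h; apply: le_trans h _; apply: ler_piMr; first exact: mulr_ge0.
  by rewrite gerBl exprn_ge0// invr_ge0.
elim: j => [|j IH].
  by rewrite expr0 divr1 expn0 muln1 subrr normc0 mul0r expr0 subrr mulr0.
have hs := hK (mu / q ^+ j) (mu / q ^+ j.+1).
have p1 : 0 < mu / q ^+ j.+1 by rewrite divr_gt0// exprn_gt0.
have qj : q ^+ j != 0 by rewrite gt_eqF// exprn_gt0.
have p2 : mu / q ^+ j = q * (mu / q ^+ j.+1).
  by rewrite exprS; field; rewrite ?qj ?(gt_eqF q0).
have nj : (0 < n * 2 ^ j)%N by rewrite muln_gt0 n0 expn_gt0.
have h := hs p1 p2 _ nj.
have e : ((n * 2 ^ j).*2 = n * 2 ^ j.+1)%N by rewrite -mul2n mulnCA expnS.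
have e4 : ((n * 2 ^ j)%:R : R) ^+ 2 = n%:R ^+ 2 * 4 ^+ j.
  by rewrite natrM exprMn -[in LHS](natrX _ (2 ^ j)) -expnM mulnC expnM natrX.
rewrite e e4 in h.
set u := sbd_dev s mu n in IH *; set v := sbd_dev s _ (n * 2 ^ j)%N in IH h.
set w := sbd_dev s _ (n * 2 ^ j.+1)%N in h *.
have t : normc (u - w) <= normc (u - v) + normc (v - w).
  by apply: le_trans (le_normcD _ _); rewrite addrA subrK.
have n2 : 0 <= n%:R ^+ 2 :> R by rewrite exprn_ge0// ltW.
have f0 : (0 : R) < 4 ^+ j by rewrite exprn_gt0.
have h' : normc (v - w) * n%:R ^+ 2 <= K / 4 ^+ j.
  by rewrite ler_pdivlMr// -mulrA.
apply: le_trans (ler_wpM2r n2 t) _; rewrite mulrDl; apply: le_trans (lerD IH h') _.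
rewrite !exprVn [4 ^+ j.+1]exprS invfM.
have i0 : 0 <= K * (4 ^+ j)^-1 by rewrite mulr_ge0// invr_ge0 ltW.
set g := (4 ^+ j)^-1 in i0 *; lra.
Qed.

(** The difference of two solutions solves the equation of one of them, with a source
    proportional to [mu - mu']. *)
Lemma sbd_dev_lipschitz mu n : 0 < mu -> exists G, 0 <= G /\
  forall mu', mu / 2 <= mu' -> normc (sbd_dev s mu n - sbd_dev s mu' n) <= G * `|mu - mu'|.
Proof.
move=> mu0; pose F : fps C := x * geom R + gsym R * sbd_dev s mu.
pose T := \sum_(i < n.+1) normc (F i) ^+ 2 * (2^-1 : R) ^+ (i + i).
have T0 : 0 <= T by apply: sumr_ge0 => i _; rewrite mulr_ge0 ?sqr_ge0 ?exprn_ge0 ?invr_ge0.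
pose G := 4 / mu * Num.sqrt T * 2 ^+ n.
exists G; split; first by rewrite /G !mulr_ge0 ?invr_ge0 ?sqrtr_ge0 ?exprn_ge0 ?(ltW mu0).
move=> mu' hmu; have mu'0 : 0 < mu' by apply: lt_le_trans hmu; rewrite divr_gt0.
have e : sbd_sym s mu' * (sbd_dev s mu - sbd_dev s mu') = fpsC (mu' - mu)%:C%C * F.
  rewrite mulrBr (sbd_devP s (ltW mu'0)).
  have -> : sbd_sym s mu' = sbd_sym s mu + fpsC (mu' - mu)%:C%C * gsym R.
    rewrite /sbd_sym -addrA -mulrDl -fpsCD; congr (_ + fpsC _ * _).
    by rewrite rmorphB/= addrC subrK.
  rewrite mulrDl (sbd_devP s (ltW mu0)) /F rmorphB/= fpsCD !fpsCN.
  ring.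
have hr : 0 <= (2^-1 : R) < 1 by rewrite invr_ge0 ler0n/= invf_lt1// ltr1n.
have c0 : 0 < mu' / 2 by rewrite divr_gt0.
have hW i : (i < n.+1)%N -> (sbd_sym s mu' * (sbd_dev s mu - sbd_dev s mu')) i =
    (fpsC (mu' - mu)%:C%C * F) i by rewrite e.
have hRe z : normc z < 1 -> mu' / 2 <= complex.Re (ev z (sbd_sym s mu')).
  exact: Re_sbd_sym (ltW mu'0).
have := energy_bound c0 hr (indisc_sbd_sym s01 mu') hW hRe.
rewrite big_ord_recr/= fpsBE; set d := normc (_ - _) => h.
have h1 : d ^+ 2 * 2^-1 ^+ (n + n) <= ((mu' / 2) ^+ 2)^-1 * ((mu' - mu) ^+ 2 * T).
  apply: le_trans (_ : _ <= ((mu' / 2) ^+ 2)^-1 * \sum_(i < n.+1)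
     normc ((fpsC (mu' - mu)%:C%C * F) i) ^+ 2 * 2^-1 ^+ (i + i)) _.
    apply: le_trans _ h; rewrite lerDr sumr_ge0// => i _.
    by rewrite mulr_ge0 ?sqr_ge0 ?exprn_ge0 ?invr_ge0.
  rewrite ler_wpM2l ?invr_ge0 ?sqr_ge0// mulr_sumr ler_sum// => i _.
  by rewrite fpsCM normcM normc_real exprMn real_normK ?num_real// [X in _ <= X]mulrA.
have d0 : 0 <= d by exact: normc_ge0.
have h2 : d * 2^-1 ^+ n <= 2 / mu' * (`|mu - mu'| * Num.sqrt T).
  rewrite -ler_sqr ?nnegrE.
  - rewrite !exprMn -exprM muln2 -addnn; apply: le_trans h1 _.
    rewrite sqr_sqrtr// real_normK ?num_real// -[(mu - mu') ^+ 2]sqrrN opprB.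
    rewrite exprVn le_eqVlt; apply/orP; left; apply/eqP; field.
    by rewrite gt_eqF.
  - by rewrite mulr_ge0// exprn_ge0// invr_ge0.
  - by rewrite mulr_ge0 ?divr_ge0 ?(ltW mu'0)// mulr_ge0// sqrtr_ge0.
have h3 : 2 / mu' <= 4 / mu.
  by rewrite ler_pdivrMr// mulrAC ler_pdivlMr//; lra.
have p0 : (0 : R) < 2 ^+ n by rewrite exprn_gt0.
have h4 : d <= 2 / mu' * (`|mu - mu'| * Num.sqrt T) * 2 ^+ n.
  by rewrite -ler_pdivrMr// -exprVn.
apply: le_trans h4 _; rewrite /G (_ : _ * _ * _ * `|_| = 4 / mu * (`|mu - mu'| * Num.sqrt T) * 2 ^+ n); last by ring.
by rewrite ler_wpM2r ?(ltW p0)// ler_wpM2r// mulr_ge0// sqrtr_ge0.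
Qed.

End Comparison.

(** * Gamma integrals *)

Section HalfLine.
Local Open Scope classical_set_scope.
Local Open Scope ring_scope.
Variable R : realType.
Implicit Types f g F : R -> R.
Local Notation leb := (@lebesgue_measure R).

(** Lebesgue measure is determined by half-open intervals, on which the rescaled image
    measure has the same value. *)
Lemma affine_integral (p q : R) (f : R -> \bar R) : 0 < p ->
  measurable_fun setT f -> (forall x, 0 <= f x)%E ->
  (\int[leb]_x f x = p%:E * \int[leb]_x f (p * x + q)%R)%E.
Proof.
move=> p0 mf f0.
pose phi := (fun x => p * x + q) : measurableTypeR R -> measurableTypeR R.
have mphi : measurable_fun setT phi.
  by apply: measurable_funD; [apply: measurable_funM|]; rewrite //; exact: measurable_cst.
have p0' : 0 <= p by exact: ltW.
pose pm : {measure set (measurableTypeR R) -> \bar R} := mscale (NngNum p0') (pushforward leb phi).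
have E : forall A, measurable A -> leb A = pm mphi A.
  apply: (lebesgue_measure_unique (mu := pm mphi)) => _ [[a b]] _ <-.
  have -> : pm mphi `]a, b]%classic = (p%:E * leb (phi @^-1` `]a, b]))%E by [].
  have -> : phi @^-1` `]a, b] = `](a - q) / p, (b - q) / p]%classic.
    apply/seteqP; split => x; rewrite /phi /= !in_itv /= => /andP[h1 h2]; apply/andP; split.
    - by rewrite ltr_pdivrMr // ltrBlDr mulrC.
    - by rewrite ler_pdivlMr // lerBrDr mulrC.
    - by move: h1; rewrite ltr_pdivrMr // ltrBlDr mulrC.
    - by move: h2; rewrite ler_pdivlMr // lerBrDr mulrC.
  rewrite !lebesgue_measure_itv /= !lte_fin ltr_pM2r ?invr_gt0 // ltrD2r.
  case: ifP => _; last by rewrite mule0.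
  rewrite -!EFinD -EFinM; congr EFin; field; exact: lt0r_neq0.
have := ge0_integral_pushforward mphi leb measurableT mf (fun x _ => f0 x).
rewrite preimage_setT => <-.
have := ge0_integral_mscale (pushforward leb phi) measurableT (NngNum p0') mf (fun x _ => f0 x).
move=> /= <-.
by apply: eq_measure_integral => A mA _; exact: E.
Qed.

(** Over the segments [1/n, n] the integrals of [f] and of [g] are monotone in [n], so that
    they converge separately and no integrability is assumed. *)
Lemma FTC_halfline f g F :
  (forall t, 0 < t -> {for t, continuous f}) -> (forall t, 0 < t -> {for t, continuous g}) ->
  (forall t, 0 < t -> 0 <= f t) -> (forall t, 0 < t -> 0 <= g t) ->
  (forall t : R, 0 < t -> is_derive t (1 : R) F (f t - g t)) ->
  F n.+1%:R @[n --> \oo] --> 0 -> F n.+1%:R^-1 @[n --> \oo] --> 0 ->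
  (\int[leb]_(x in `]0%R, +oo[) (f x)%:E = \int[leb]_(x in `]0%R, +oo[) (g x)%:E)%E.
Proof.
move=> cf cg f0 g0 dF Foo F0.
pose S n := `[(n.+1%:R^-1 : R), n.+1%:R]%classic.
have SE : \bigcup_n S n = `]0, +oo[%classic.
  apply/seteqP; split => [x [n _]|x]; rewrite /S /= !in_itv /= ?andbT.
    by move=> /andP[+ _]; apply: lt_le_trans; rewrite invr_gt0.
  move=> x0; exists (Num.truncn x + Num.truncn x^-1)%N => //=; rewrite in_itv /=; apply/andP; split.
    rewrite -[leRHS]invrK lef_pV2 ?posrE ?invr_gt0 //.
    apply/ltW/(lt_le_trans (truncnS_gt _)); rewrite ler_nat ltnS leq_addl //.
  by apply/ltW/(lt_le_trans (truncnS_gt _)); rewrite ler_nat ltnS leq_addr.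
have Spos n x : S n x -> 0 < x.
  by rewrite /S /= in_itv /= => /andP[+ _]; apply: lt_le_trans; rewrite invr_gt0.
have Snd : nondecreasing_seq S.
  move=> m n mn; apply/subsetPset => x; rewrite /S /= !in_itv /= => /andP[h1 h2].
  rewrite (le_trans _ h1) ?(le_trans h2) ?ler_nat ?ltnS //.
  by rewrite lef_pV2 ?posrE // ler_nat ltnS.
have mS n : measurable (S n : set (measurableTypeR R)) by exact: measurable_itv.
have contS (h : R -> R) n : (forall t, 0 < t -> {for t, continuous h}) -> {within S n, continuous h}.
  by move=> ch; apply: continuous_in_subspaceT => x /set_mem /Spos; exact: ch.
have intS (h : R -> R) n : (forall t, 0 < t -> {for t, continuous h}) -> leb.-integrable (S n) (EFin \o h).
  by move=> ch; apply: continuous_compact_integrable; [exact: segment_compact|exact: contS].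
have mfS (h : R -> R) n : (forall t, 0 < t -> {for t, continuous h}) -> measurable_fun (S n : set (measurableTypeR R)) (EFin \o h).
  by move=> /(intS _ n)/integrableP[].
(* The index is shifted because the segment is reduced to a point for [n = 0]. *)
have key n : (\int[leb]_(x in S n.+1) (f x)%:E = \int[leb]_(x in S n.+1) (g x)%:E
    + (F n.+2%:R - F n.+2%:R^-1)%:E)%E.
  have lt12 : (n.+2%:R^-1 : R) < n.+2%:R.
    by apply: (@lt_trans _ _ 1); [rewrite invf_lt1 // ltr1n|rewrite ltr1n].
  have h : (\int[leb]_(x in S n.+1) (f x - g x)%:E = (F n.+2%:R)%:E - (F n.+2%:R^-1)%:E)%E.
    apply: continuous_FTC2 => //.
    - by apply: contS => t t0; apply: cvgB; [exact: cf|exact: cg].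
    - split.
      + move=> x; rewrite in_itv /= => /andP[hx _]; apply: ex_derive; apply: dF.
        by apply: lt_trans hx; rewrite invr_gt0.
      + apply: cvg_at_right_filter; apply: differentiable_continuous.
        apply/derivable1_diffP; apply: ex_derive; apply: dF; by rewrite invr_gt0.
      + apply: cvg_at_left_filter; apply: differentiable_continuous.
        apply/derivable1_diffP; apply: ex_derive; exact: dF.
    - move=> x; rewrite in_itv /= => /andP[hx _].
      have x0 : 0 < x by apply: lt_trans hx; rewrite invr_gt0.
      by rewrite derive1E; apply: derive_val; exact: dF.
  have h2 := integralB_EFin (mS n.+1) (intS f n.+1 cf) (intS g n.+1 cg).
  have fin1 := integrable_fin_num (mS n.+1) (intS f n.+1 cf).
  have fin2 := integrable_fin_num (mS n.+1) (intS g n.+1 cg).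
  rewrite EFinB -h (_ : (\int[leb]_(x in S n.+1) (f x - g x)%:E = \int[leb]_(x in S n.+1) (f x)%:E
    - \int[leb]_(x in S n.+1) (g x)%:E)%E); last exact: h2.
  by rewrite addeC subeK.
have nnf : forall i x, S i x -> (0 <= (EFin \o f) x)%E by move=> i x /Spos h; rewrite lee_fin f0.
have nng : forall i x, S i x -> (0 <= (EFin \o g) x)%E by move=> i x /Spos h; rewrite lee_fin g0.
have limf := ge0_nondecreasing_set_cvg_integral (mu := leb) Snd mS (fun n => mfS f n cf) nnf.
have limg := ge0_nondecreasing_set_cvg_integral (mu := leb) Snd mS (fun n => mfS g n cg) nng.
rewrite SE in limf limg.
have limF : (F n.+2%:R - F n.+2%:R^-1)%:E @[n --> \oo] --> (0 : \bar R).
  have h1 : F n.+2%:R @[n --> \oo] --> 0.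
    by rewrite -(cvg_shiftS (fun n => F n.+1%:R)) in Foo.
  have h2 : F n.+2%:R^-1 @[n --> \oo] --> 0.
    by rewrite -(cvg_shiftS (fun n => F n.+1%:R^-1)) in F0.
  have h3 : (F n.+2%:R - F n.+2%:R^-1) @[n --> \oo] --> (0 : R).
    by rewrite -[X in _ --> X](subr0 (0 : R)); exact: cvgB h1 h2.
  by apply/fine_cvgP; split; [exact: nearW|exact: h3].
have limf' : (\int[leb]_(x in S n.+1) (f x)%:E)%E @[n --> \oo] --> (\int[leb]_(x in `]0%R, +oo[) (f x)%:E)%E.
  by move: limf; rewrite -(cvg_shiftS (fun n => \int[leb]_(x in S n) (f x)%:E)%E).
have limg' : (\int[leb]_(x in S n.+1) (g x)%:E)%E @[n --> \oo] --> (\int[leb]_(x in `]0%R, +oo[) (g x)%:E)%E.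
  by move: limg; rewrite -(cvg_shiftS (fun n => \int[leb]_(x in S n) (g x)%:E)%E).
have hD : (\int[leb]_(x in `]0%R, +oo[) (g x)%:E +? (0 : \bar R))%E.
  by apply: fin_num_adde_defl.
have lim2 := cvgeD hD limg' limF; rewrite adde0 in lim2.
rewrite (funext key) in limf'.
by rewrite -(cvg_lim (@ereal_hausdorff R) limf'); apply: cvg_lim; [exact: ereal_hausdorff|exact: lim2].
Qed.

Lemma is_derive_pow1 k (t : R) : is_derive t (1 : R) (fun x => x ^+ k.+1) (k.+1%:R * t ^+ k).
Proof.
elim: k => [|k IH].
  by rewrite mul1r expr0; exact: is_derive_id1.
have h := is_deriveM1 (is_derive_id1 t) IH.
have -> : (fun x : R => x ^+ k.+2) = (fun x => x * x ^+ k.+1) by apply/funext => x; rewrite exprS.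
refine (is_derive_eq h _).
by rewrite mul1r -(natr1 k.+1) mulrCA -exprS mulrDl mul1r addrC.
Qed.

Section GammaIntegrals.
Variable c : R.
Hypothesis c1 : 0 < c + 1.
Hypothesis c0 : c <= 0.

(** The integer part of the exponent is kept apart for the recurrence in [k]. *)
Definition powexp (k : nat) (t : R) : R := t `^ c * t ^+ k * expR (- t).

Lemma powexp_ge0 k t : 0 <= t -> 0 <= powexp k t.
Proof. by move=> t0; rewrite /powexp !mulr_ge0 ?powR_ge0 ?expR_ge0 ?exprn_ge0. Qed.

Lemma is_derive_powexp k (t : R) : 0 < t ->
  is_derive t (1 : R) (powexp k.+1) ((c + 1 + k%:R) * powexp k t - powexp k.+1 t).
Proof.
move=> t0.
have h1 : is_derive t (1 : R) (fun x => x `^ c) (c * t `^ (c - 1)).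
  have ht : t \in `]0, +oo[%R by rewrite in_itv /= t0.
  split; first exact: derivable_powR.
  by rewrite -derive1E powR_derive1.
have h2 : is_derive t (1 : R) (fun x => x ^+ k.+1) (k.+1%:R * t ^+ k).
  exact: is_derive_pow1.
have h3 : is_derive t (1 : R) (fun x => expR (- x)) (- expR (- t)).
  have h := is_derive_comp1 (is_deriveN1 (is_derive_id1 t)) (is_derive_expR (- t)).
  by refine (is_derive_eq h _); rewrite mulrN1.
have h := is_deriveM1 (is_deriveM1 h1 h2) h3; refine (is_derive_eq h _).
rewrite /powexp powRB ?(gt_eqF t0) //; last by rewrite implybT.
rewrite powRr1 ?ltW // exprS -(natr1 k); field; exact: lt0r_neq0.
Qed.

Lemma powexp_continuous k (t : R) : 0 < t -> {for t, continuous (powexp k)}.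
Proof.
move=> t0; apply: cvgM; first (apply: cvgM; last exact: exprn_continuous).
  have := @derivable_powR R 1 c t; rewrite in_itv /= t0 => /(_ isT) /derivable1_diffP.
  exact: differentiable_continuous.
by apply: continuous_comp; [exact: continuousN|exact: continuous_expR].
Qed.

Lemma powexp_at0 k : powexp k.+1 n.+1%:R^-1 @[n --> \oo] --> (0 : R).
Proof.
have h0 : (n.+1%:R^-1 : R) @[n --> \oo] --> (0 : R) by exact: cvg_harmonic.
have h : (n.+1%:R^-1 : R) `^ (c + 1) @[n --> \oo] --> (0 : R).
  rewrite -(powR0 (lt0r_neq0 c1)).
  rewrite (powR0 (lt0r_neq0 c1)).
  refine (cvg_comp _ _ _ (powR_cvg0 c1)) => A /= [e /= e0 HA].
  have /cvgrPdist_lt/(_ e e0) := h0; apply: filterS => n hn /=.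
  by apply: HA => /=; rewrite ?invr_gt0.
apply: (squeeze_cvgr _ (cvg_cst 0) h); apply: nearW => n.
have n0 : 0 < n.+1%:R^-1 :> R by rewrite invr_gt0.
rewrite powexp_ge0 ?(ltW n0) //= /powexp powRD ?(gt_eqF n0) ?implybT // powRr1 ?(ltW n0) // exprS -!mulrA.
rewrite ler_wpM2l ?powR_ge0 // ler_piMr ?(ltW n0) // mulr_ile1 ?expR_ge0 ?exprn_ge0 ?(ltW n0) //.
by rewrite exprn_ile1 ?(ltW n0) // invf_le1 ?ler1n.
Qed.

Lemma powexp_aty k : powexp k.+1 n.+1%:R @[n --> \oo] --> (0 : R).
Proof.
have h0 : (n.+1%:R^-1 : R) @[n --> \oo] --> (0 : R) by exact: cvg_harmonic.
have h : ((k.+2)`!%:R * n.+1%:R^-1 : R) @[n --> \oo] --> (0 : R).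
  by rewrite -[X in _ --> X](mulr0 ((k.+2)`!%:R : R)); apply: cvgM; [exact: cvg_cst|].
apply: (squeeze_cvgr _ (cvg_cst 0) h); apply: nearW => n.
have n0 : 0 < n.+1%:R :> R by [].
rewrite powexp_ge0 ?(ltW n0) //= /powexp.
have h1 : (n.+1%:R : R) `^ c <= 1.
  by rewrite -[leRHS](powRr0 (n.+1%:R : R)) ler_powR // ler1n.
have h2 : (n.+1%:R : R) ^+ k.+2 / (k.+2)`!%:R <= expR n.+1%:R.
  by apply: le_trans (expR_ge1Dxn k.+1 (ltW n0)); rewrite lerDr.
rewrite expRN ler_pdivrMr ?expR_gt0 // mulrAC ler_pdivlMr //.
rewrite -mulrA -exprSr; apply: (@le_trans _ _ (n.+1%:R ^+ k.+2)).
  by rewrite ler_piMl // exprn_ge0.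
by rewrite mulrC -ler_pdivrMr ?ltr0n ?fact_gt0.
Qed.

Lemma powexp_recE k : ((c + 1 + k%:R)%:E * \int[leb]_(x in `]0%R, +oo[) (powexp k x)%:E
   = \int[leb]_(x in `]0%R, +oo[) (powexp k.+1 x)%:E)%E.
Proof.
have ck : 0 <= c + 1 + k%:R by rewrite addr_ge0 // ltW.
rewrite -ge0_integralZl_EFin //; first last.
- apply/measurable_EFinP; apply: open_continuous_measurable_fun => // x.
  by rewrite inE /= in_itv /= andbT => x0; exact: powexp_continuous.
- by move=> x /=; rewrite in_itv /= andbT => x0; rewrite lee_fin powexp_ge0 // ltW.
apply: (@FTC_halfline (fun t => (c + 1 + k%:R) * powexp k t) _ (powexp k.+1)).
- by move=> t t0; apply: cvgM; [exact: cvg_cst|exact: powexp_continuous].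
- by move=> t t0; exact: powexp_continuous.
- by move=> t t0; rewrite mulr_ge0 // powexp_ge0 // ltW.
- by move=> t t0; rewrite powexp_ge0 // ltW.
- by move=> t t0; exact: is_derive_powexp.
- exact: powexp_aty.
- exact: powexp_at0.
Qed.

Lemma measurable_powexp k : measurable_fun (`]0, +oo[ : set (measurableTypeR R)) (powexp k).
Proof.
apply: open_continuous_measurable_fun => // x.
by rewrite inE /= in_itv /= andbT => x0; exact: powexp_continuous.
Qed.

End GammaIntegrals.

Lemma powexp0_int k : (\int[leb]_(x in `]0%R, +oo[) (powexp 0 k x)%:E = (k`!%:R)%:E)%E.
Proof.
elim: k => [|k IH]; last first.
  rewrite -powexp_recE // ?add0r ?ltr01 // IH -EFinM factS natrM addrC -natr1; congr (_ * _)%:E.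
rewrite fact0 -(integral_exponential_pdf (ltr01 : 0 < (1 : R))) /exponential_pdf.
transitivity (\int[leb]_x ((fun y : R => (1 * expR (- 1 * y))%:E) \_ `[0%R, +oo[) x)%E; last first.
  by apply: eq_integral => x _; rewrite /= /patch; case: ifP.
rewrite -integral_mkcond -integral_itv_obnd_cbnd; last first.
  apply/measurable_EFinP; apply: measurable_funM; first exact: measurable_cst.
  apply: measurableT_comp; first exact: measurable_expR.
  by apply: measurable_funM; [exact: measurable_cst|exact: measurable_id].
apply: eq_integral => x; rewrite inE /= in_itv /= andbT => x0.
by rewrite /powexp powRr0 expr0 !mul1r mulN1r.
Qed.

Section GammaIntegrals2.
Variable c : R.
Hypothesis c1 : 0 < c + 1.
Hypothesis c0 : c <= 0.

(** The recurrence transfers finiteness from exponent [c + 1], where the integrand is at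
    most [(1 + t) e^-t]. *)
Lemma GammaE : (\int[leb]_(x in `]0%R, +oo[) (powexp c 0 x)%:E = (Gamma (c + 1))%:E)%E.
Proof.
have E : (\int[leb]_(x in `]0%R, +oo[) (x `^ (c + 1 - 1) * expR (- x))%:E =
          \int[leb]_(x in `]0%R, +oo[) (powexp c 0 x)%:E)%E.
  by apply: eq_integral => x _; rewrite /powexp expr0 mulr1 addrK.
rewrite /Gamma /Rintegral E fineK //.
have nn k x : (`]0, +oo[%classic : set R) x -> (0 <= (powexp c k x)%:E)%E.
  by rewrite /= in_itv /= andbT => x0; rewrite lee_fin powexp_ge0 // ltW.
have nn0 k x : (`]0, +oo[%classic : set R) x -> (0 <= (powexp 0 k x)%:E)%E.
  by rewrite /= in_itv /= andbT => x0; rewrite lee_fin powexp_ge0 // ltW.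
have h1 : (\int[leb]_(x in `]0%R, +oo[) (powexp c 1 x)%:E < +oo)%E.
  apply: (@le_lt_trans _ _ (\int[leb]_(x in `]0%R, +oo[) ((powexp 0 0 x)%:E + (powexp 0 1 x)%:E))%E).
    apply: ge0_le_integral => //.
    - by move=> x; exact: nn.
    - by apply/measurable_EFinP; exact: measurable_powexp.
    - by apply: emeasurable_funD; apply/measurable_EFinP; exact: measurable_powexp.
    move=> x; rewrite /= in_itv /= andbT => x0; rewrite lee_fin /powexp !powRr0 expr0 expr1 !mul1r.
    have -> : expR (- x) + x * expR (- x) = (1 + x) * expR (- x) by ring.
    rewrite ler_wpM2r ?expR_ge0 //.
    have [x1|x1] := leP x 1.
      have e : x `^ c * x = x `^ (c + 1).
        by rewrite powRD ?(gt_eqF x0) ?implybT // powRr1 // ltW.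
      apply: (@le_trans _ _ 1); last by rewrite lerDl ltW.
      have e1 : (1 : R) = 1 `^ (c + 1) by rewrite powR1.
      rewrite e [leRHS]e1 ge0_ler_powR ?nnegrE // ?(ltW c1) // ltW //.
    apply: (@le_trans _ _ x); last by rewrite lerDr.
    rewrite ler_piMl ?(ltW x0) //.
    by rewrite -[leRHS](powRr0 x) ler_powR // ltW.
  rewrite ge0_integralD //.
  - by rewrite !powexp0_int -EFinD ltry.
  - by move=> x; exact: nn0.
  - by apply/measurable_EFinP; exact: measurable_powexp.
  - by move=> x; exact: nn0.
  - by apply/measurable_EFinP; exact: measurable_powexp.
have h0 : (0 <= \int[leb]_(x in `]0%R, +oo[) (powexp c 0 x)%:E)%E.
  by apply: integral_ge0 => x; exact: nn.
move: h1; rewrite -powexp_recE // addr0 => h1.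
rewrite ge0_fin_numE //; move: h0 h1; case: (\int[leb]_(x in `]0%R, +oo[) (powexp c 0 x)%:E)%E => [r| |].
- by move=> _ _; exact: ltry.
- by move=> _; rewrite gt0_muley ?ltxx ?lte_fin.
- by [].
Qed.

Lemma Gamma_gt0 : 0 < Gamma (c + 1).
Proof.
rewrite -lte_fin -GammaE.
apply: (@lt_le_trans _ _ (\int[leb]_(x in (`]0%R, 1%R] : set (measurableTypeR R))) (expR (-1))%:E)%E).
  rewrite integral_cst //= lebesgue_measure_itv /= lte_fin ltr01 -EFinB -EFinM lte_fin subr0 mulr1.
  exact: expR_gt0.
apply: (@le_trans _ _ (\int[leb]_(x in (`]0%R, 1%R] : set (measurableTypeR R))) (powexp c 0 x)%:E)%E).
  apply: ge0_le_integral => //.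
  - apply/measurable_EFinP; apply: (measurable_funS _ _ (measurable_powexp c 0)) => //.
    by move=> x /=; rewrite !in_itv /= => /andP[->].
  move=> x; rewrite /= in_itv /= => /andP[x0 x1]; rewrite lee_fin /powexp expr0 mulr1.
  rewrite -[leLHS]mul1r ler_pM ?expR_ge0 //; last by rewrite ler_expR lerN2.
  have -> : x `^ c = (x `^ (- c))^-1 by rewrite -powRN opprK.
  have e1 : (1 : R) = 1 `^ (- c) by rewrite powR1.
  rewrite invf_ge1 ?powR_gt0 // [leRHS]e1 ge0_ler_powR ?nnegrE ?oppr_ge0 // ltW //.
apply: ge0_subset_integral => //.
- by apply/measurable_EFinP; exact: measurable_powexp.
- by move=> x /=; rewrite in_itv /= andbT => x0; rewrite lee_fin powexp_ge0 // ltW.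
- by move=> x /=; rewrite !in_itv /= => /andP[->].
Qed.

Lemma powexp_int k : (\int[leb]_(x in `]0%R, +oo[) (powexp c k x)%:E =
   (Gamma (c + 1) * binom_coef (c + 1) k * k`!%:R)%:E)%E.
Proof.
elim: k => [|k IH].
  by rewrite GammaE /binom_coef big_ord0 fact0 !mulr1.
rewrite -powexp_recE // IH -EFinM factS natrM; congr EFin.
have := binom_coefS (c + 1) k => h.
transitivity (Gamma (c + 1) * ((c + 1 + k%:R) * binom_coef (c + 1) k) * k`!%:R); first by ring.
rewrite -h; ring.
Qed.

End GammaIntegrals2.

End HalfLine.

(** * Averages against gamma densities *)

Section GammaKernels.
Local Open Scope classical_set_scope.
Local Open Scope ring_scope.
Variable R : realType.
Local Notation leb := (@lebesgue_measure R).
Local Notation mR := (measurableTypeR R).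

(** The density of the sum of [k + 1] independent exponential times of rate [p], which
    concentrates at [k / p]. *)
Definition gamma_pdf (p : R) (k : nat) (t : R) : R :=
  if 0 < t then p * ((p * t) ^+ k / k`!%:R * expR (- (p * t))) else 0.

(** Extended by 0, so that a convolution over [0, t] is an integral over the whole line. *)
Definition pos_powR (c t : R) : R := if 0 < t then t `^ c else 0.

Lemma gamma_pdf_ge0 p k t : 0 <= p -> 0 <= gamma_pdf p k t.
Proof.
rewrite /gamma_pdf; case: ifP => // t0 p0.
by rewrite !mulr_ge0 ?invr_ge0 ?expR_ge0 ?exprn_ge0 ?mulr_ge0 // ltW.
Qed.

Lemma pos_powR_ge0 c t : 0 <= pos_powR c t.
Proof. by rewrite /pos_powR; case: ifP => // _; exact: powR_ge0. Qed.

Lemma measurable_if_pos (f : R -> R) : measurable_fun (setT : set mR) f ->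
  measurable_fun (setT : set mR) (fun t => if 0 < t then f t else 0).
Proof.
move=> mf; apply: measurable_fun_ifT => //.
by apply: measurable_fun_ltr; [exact: measurable_cst|exact: measurable_id].
Qed.

Lemma measurable_gamma_pdf p k : measurable_fun (setT : set mR) (gamma_pdf p k).
Proof.
apply: measurable_if_pos; apply: measurable_funM; first exact: measurable_cst.
have h : measurable_fun (setT : set mR) (fun t => p * t).
  by apply: measurable_funM; [exact: measurable_cst|exact: measurable_id].
apply: measurable_funM.
  by apply: measurable_funM; [exact: measurable_funX|exact: measurable_cst].
by apply: measurableT_comp; [exact: measurable_expR|apply: measurableT_comp].
Qed.

Lemma measurable_pos_powR c : measurable_fun (setT : set mR) (pos_powR c).
Proof. by apply: measurable_if_pos; exact: measurable_powR. Qed.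

Lemma gamma_pdf_step p k t : 0 < p -> t * gamma_pdf p k t = (k.+1%:R / p) * gamma_pdf p k.+1 t.
Proof.
move=> p0; rewrite /gamma_pdf; case: ifP => _; last by rewrite !mulr0.
rewrite exprS factS natrM.
have : k.+1%:R != 0 :> R by rewrite pnatr_eq0.
have : k`!%:R != 0 :> R by rewrite pnatr_eq0 -lt0n fact_gt0.
move: (k.+1%:R : R) (k`!%:R : R) => y z z0 y0; field.
by rewrite z0 y0 gt_eqF.
Qed.

(** The binomial expansion of [(t + u)^n] is what makes averages of convolutions Cauchy
    products. *)
Lemma gamma_pdf_addition p n t u : 0 < p -> 0 < t -> 0 < u ->
  gamma_pdf p n (t + u) = p^-1 * \sum_(i < n.+1) gamma_pdf p i t * gamma_pdf p (n - i) u.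
Proof.
move=> p0 t0 u0; rewrite /gamma_pdf t0 u0 addr_gt0 //.
have -> : - (p * (t + u)) = - (p * t) + - (p * u) by ring.
rewrite expRD (_ : p * (t + u) = p * u + p * t); last by ring.
rewrite exprDn.
rewrite big_distrl big_distrl !big_distrr /=; apply: eq_bigr => i _.
have hi : (i <= n)%N by rewrite -ltnS.
rewrite -(bin_fact hi) !natrM -[_ *+ 'C(n, i)]mulr_natr.
have : 'C(n, i)%:R != 0 :> R by rewrite pnatr_eq0 -lt0n bin_gt0.
have : i`!%:R != 0 :> R by rewrite pnatr_eq0 -lt0n fact_gt0.
have : (n - i)`!%:R != 0 :> R by rewrite pnatr_eq0 -lt0n fact_gt0.
move: ('C(n, i)%:R : R) (i`!%:R : R) ((n - i)`!%:R : R) ((p * t) ^+ i) ((p * u) ^+ (n - i)) => x y z P Q z0 y0 x0.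
by field; rewrite x0 y0 z0 gt_eqF.
Qed.

Section Averages.
Variable c : R.
Hypothesis c1 : 0 < c + 1.
Hypothesis c0 : c <= 0.
Variable p : R.
Hypothesis p0 : 0 < p.

Definition pos_powR_avg k := p `^ (- c) * Gamma (c + 1) * binom_coef (c + 1) k.

Lemma pos_powR_avg_ge0 k : 0 <= pos_powR_avg k.
Proof.
rewrite /pos_powR_avg !mulr_ge0 ?powR_ge0 ?binom_coef_ge0 //; apply: ltW => //.
exact: Gamma_gt0.
Qed.

(** Gamma integrals: up to a power of [p], the averages of [t^c] are the coefficients of
    [(1 - x)^(-(c + 1))]. *)
Lemma gamma_pdf_avg k : (\int[leb]_x (pos_powR c x * gamma_pdf p k x)%:E = (pos_powR_avg k)%:E)%E.
Proof.
have h := powexp_int c1 c0 k.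
pose f (x : R) : \bar R := (if 0 < x then powexp c k x else 0)%:E.
have mf : measurable_fun (setT : set mR) f.
  apply/measurable_EFinP; apply: measurable_if_pos.
  apply: measurable_funM.
    by apply: measurable_funM; [exact: measurable_powR|exact: measurable_funX].
  by apply: measurableT_comp; [exact: measurable_expR|exact: oppr_measurable].
have f0 x : (0 <= f x)%E.
  by rewrite /f lee_fin; case: ifP => // x0; rewrite powexp_ge0 // ltW.
have e1 : (\int[leb]_x f x = (Gamma (c + 1) * binom_coef (c + 1) k * k`!%:R)%:E)%E.
  rewrite -h [RHS]integral_mkcond; apply: eq_integral => x _.
  rewrite /f /patch; have -> : (x \in (`]0%R, +oo[%classic : set R)) = (0 < x).
    by apply/idP/idP; rewrite inE /= in_itv /= andbT.
  by case: ifP.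
have e2 := affine_integral 0 p0 mf f0.
have e3 (x : mR) : (pos_powR c x * gamma_pdf p k x)%:E = ((p * (p `^ (- c) / k`!%:R))%:E * f (p * x + 0)%R)%E.
  rewrite /f addr0 /pos_powR /gamma_pdf pmulr_rgt0 // -EFinM; case: ifP => x0; last by rewrite mul0r mulr0.
  rewrite /powexp (powRM _ (ltW p0) (ltW x0)); congr EFin.
  have : p `^ (- c) * p `^ c = 1 by rewrite powRN mulVf // gt_eqF // powR_gt0.
  move=> h1; transitivity ((p `^ (- c) * p `^ c) * (x `^ c * (p * ((p * x) ^+ k / k`!%:R * expR (- (p * x)))))).
    by rewrite h1 mul1r.
  by ring.
rewrite (eq_integral _ _ (fun x _ => e3 x)) ge0_integralZl_EFin //; last 2 first.
- apply: (measurableT_comp mf); apply: measurable_funD; last exact: measurable_cst.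
  by apply: measurable_funM; [exact: measurable_cst|exact: measurable_id].
- by rewrite !mulr_ge0 ?powR_ge0 ?invr_ge0 // ltW.
rewrite EFinM muleAC -e2 e1 -EFinM; congr EFin; rewrite /pos_powR_avg; field.
by rewrite pnatr_eq0 -lt0n fact_gt0.
Qed.

Lemma gamma_pdf_shift n xi : 0 < xi ->
  (\int[leb]_t (gamma_pdf p n t * pos_powR c (t - xi))%:E =
   (p^-1 * \sum_(i < n.+1) pos_powR_avg i * gamma_pdf p (n - i) xi)%:E)%E.
Proof.
move=> xi0.
have msub : measurable_fun (setT : set mR) (fun t : mR => t - xi).
  by apply: measurable_funB; [exact: measurable_id|exact: measurable_cst].
rewrite (@affine_integral R 1 xi (fun t => (gamma_pdf p n t * pos_powR c (t - xi))%:E)) //; last 2 first.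
- apply/measurable_EFinP; apply: measurable_funM; first exact: measurable_gamma_pdf.
  by apply: (measurableT_comp (measurable_pos_powR c)).
- by move=> x; rewrite lee_fin mulr_ge0 ?pos_powR_ge0 ?gamma_pdf_ge0 // ltW.
rewrite mul1e.
have E (x : mR) : (gamma_pdf p n (1 * x + xi) * pos_powR c (1 * x + xi - xi))%:E =
    (\sum_(i < n.+1) (p^-1 * gamma_pdf p (n - i) xi)%:E * (pos_powR c x * gamma_pdf p i x)%:E)%E.
  rewrite mul1r addrK; under eq_bigr do rewrite -EFinM.
  rewrite sumEFin; congr EFin.
  have [x0|x0] := ltP 0 x; last first.
    rewrite /pos_powR ltNge x0 /= mulr0 big1 // => i _; by rewrite mul0r mulr0.
  rewrite gamma_pdf_addition // big_distrr /= big_distrl /=.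
  by apply: eq_bigr => i _; ring.
rewrite (eq_integral _ _ (fun x _ => E x)) ge0_integral_sum //; last 2 first.
- move=> i; apply/measurable_EFinP; apply: measurable_funM; first exact: measurable_cst.
  by apply: measurable_funM; [exact: measurable_pos_powR|exact: measurable_gamma_pdf].
- move=> i x _; rewrite -EFinM lee_fin.
  by rewrite !mulr_ge0 ?pos_powR_ge0 ?gamma_pdf_ge0 ?invr_ge0 // ltW.
rewrite big_distrr /= -sumEFin; apply: eq_bigr => i _.
rewrite ge0_integralZl_EFin //.
- by rewrite gamma_pdf_avg -EFinM; congr EFin; ring.
- by move=> x _; rewrite lee_fin mulr_ge0 ?pos_powR_ge0 ?gamma_pdf_ge0 // ltW.
- by apply/measurable_EFinP; apply: measurable_funM; [exact: measurable_pos_powR|exact: measurable_gamma_pdf].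
- by rewrite mulr_ge0 ?invr_ge0 ?gamma_pdf_ge0 // ltW.
Qed.

End Averages.

Lemma pos_powR_avg0 p k : 0 < p -> pos_powR_avg 0 p k = 1.
Proof.
move=> p0; have := @GammaE R 0; rewrite add0r ltr01 => /(_ isT (lexx 0)).
rewrite powexp0_int => -[g1].
rewrite /pos_powR_avg oppr0 powRr0 add0r -g1 fact0 !mul1r /binom_coef big1 // => i _.
by rewrite addrC natr1 divff // pnatr_eq0.
Qed.

Lemma gamma_pdf_int p k : 0 < p -> (\int[leb]_x (gamma_pdf p k x)%:E = 1)%E.
Proof.
move=> p0; rewrite -(pos_powR_avg0 k p0) -(gamma_pdf_avg _ _ p0) ?add0r //.
apply: eq_integral => x _; rewrite /pos_powR /gamma_pdf; case: ifP => _; last by rewrite mulr0.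
by rewrite powRr0 mul1r.
Qed.

Lemma gamma_pdf_integrable p k : 0 < p -> leb.-integrable setT (EFin \o gamma_pdf p k).
Proof.
move=> p0; apply/integrableP; split; first by apply/measurable_EFinP; exact: measurable_gamma_pdf.
rewrite (_ : (\int[leb]_x `|(EFin \o gamma_pdf p k) x| = \int[leb]_x (gamma_pdf p k x)%:E)%E); last first.
  by apply: eq_integral => x _; rewrite /= ger0_norm // gamma_pdf_ge0 // ltW.
by rewrite gamma_pdf_int // ltry.
Qed.

Definition wavg (w : R -> R) (p : R) (k : nat) : R := (\int[leb]_x (w x * gamma_pdf p k x))%R.

Section Convolution.
Variable w : R -> R.
Hypothesis mw : measurable_fun (setT : set mR) w.
Variable B : R.
Hypothesis wB : forall t, `|w t| <= B.
Variable p : R.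
Hypothesis p0 : 0 < p.

Lemma wavg_integrable k : leb.-integrable setT (fun x => (w x * gamma_pdf p k x)%:E).
Proof.
have h : leb.-integrable setT (fun x : mR => (B%:E * (EFin \o gamma_pdf p k) x)%E).
  by apply: integrableZl => //; exact: gamma_pdf_integrable.
apply: (le_integrable measurableT _ _ h) => [|x _ /=].
  by apply/measurable_EFinP; apply: measurable_funM => //; exact: measurable_gamma_pdf.
rewrite lee_fin !normrM; apply: ler_wpM2r; first exact: normr_ge0.
exact: le_trans (wB x) (ler_norm _).
Qed.

Lemma wavgE k : (\int[leb]_x (w x * gamma_pdf p k x)%:E = (wavg w p k)%:E)%E.
Proof.
rewrite /wavg /Rintegral fineK //; apply: (integrable_fin_num measurableT).
exact: wavg_integrable.
Qed.

Lemma wavg_le k : `|wavg w p k| <= B.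
Proof.
rewrite -lee_fin -abse_EFin -wavgE.
apply: (le_trans (le_abse_integral _ measurableT _)).
  by have /integrableP[] := wavg_integrable k.
apply: (@le_trans _ _ (\int[leb]_x (B%:E * (gamma_pdf p k x)%:E))%E); last first.
  rewrite ge0_integralZl_EFin //.
  - by rewrite gamma_pdf_int // mule1.
  - by move=> x _; rewrite lee_fin gamma_pdf_ge0 // ltW.
  - by apply/measurable_EFinP; exact: measurable_gamma_pdf.
  - exact: le_trans (wB 0).
apply: ge0_le_integral => //.
- apply: measurableT_comp => //; apply/measurable_EFinP.
  by apply: measurable_funM => //; exact: measurable_gamma_pdf.
- apply: measurable_funeM; apply/measurable_EFinP; exact: measurable_gamma_pdf.
move=> x _; rewrite -EFinM abse_EFin lee_fin normrM (ger0_norm (gamma_pdf_ge0 _ _ (ltW p0))).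
by rewrite ler_wpM2r // gamma_pdf_ge0 // ltW.
Qed.

Variable c : R.
Hypothesis c1 : 0 < c + 1.
Hypothesis c0 : c <= 0.
Hypothesis w0 : forall t, t <= 0 -> w t = 0.

Definition conv_ker n (z : mR * mR) : \bar R :=
  (gamma_pdf p n z.1 * (pos_powR c (z.1 - z.2) * w z.2))%:E.

Lemma measurable_conv_ker n : measurable_fun setT (conv_ker n).
Proof.
apply/measurable_EFinP; apply: measurable_funM.
  by apply: measurableT_comp; [exact: measurable_gamma_pdf|exact: measurable_fst].
apply: measurable_funM; last by apply: measurableT_comp; [exact: mw|exact: measurable_snd].
apply: measurableT_comp; first exact: measurable_pos_powR.
by apply: measurable_funB; [exact: measurable_fst|exact: measurable_snd].
Qed.

Let S n (xi : R) := p^-1 * \sum_(i < n.+1) pos_powR_avg c p i * gamma_pdf p (n - i) xi.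

Lemma shifted_avg_ge0 n xi : 0 <= S n xi.
Proof.
rewrite /S mulr_ge0 ?invr_ge0 ?(ltW p0) //; apply: sumr_ge0 => i _.
by rewrite mulr_ge0 ?pos_powR_avg_ge0 ?gamma_pdf_ge0 // ltW.
Qed.

Lemma measurable_shifted_kernel n (xi : R) : measurable_fun (setT : set mR) (fun t => gamma_pdf p n t * pos_powR c (t - xi)).
Proof.
apply: measurable_funM; first exact: measurable_gamma_pdf.
apply: measurableT_comp; first exact: measurable_pos_powR.
by apply: measurable_funB; [exact: measurable_id|exact: measurable_cst].
Qed.

Lemma conv_ker_int1 n xi : (\int[leb]_t conv_ker n (t, xi) = (w xi * S n xi)%:E)%E.
Proof.
rewrite /conv_ker /=.
have [x0|x0] := ltP 0 xi; last first.
  rewrite (w0 x0) mul0r; apply: integral0_eq => t _; by rewrite !mulr0.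
have h := gamma_pdf_shift c1 c0 p0 n x0.
transitivity (\int[leb]_t ((w xi)%:E * (gamma_pdf p n t * pos_powR c (t - xi))%:E))%E.
  by apply: eq_integral => t _; rewrite -EFinM; congr EFin; ring.
rewrite integralZl // ?h -?EFinM //.
apply/integrableP; split; first by apply/measurable_EFinP; exact: measurable_shifted_kernel.
rewrite (_ : (\int[leb]_x `|(gamma_pdf p n x * pos_powR c (x - xi))%:E| =
   \int[leb]_x (gamma_pdf p n x * pos_powR c (x - xi))%:E)%E); last first.
  by apply: eq_integral => x _; rewrite abse_EFin ger0_norm // mulr_ge0 ?pos_powR_ge0 ?gamma_pdf_ge0 // ltW.
by rewrite h ltry.
Qed.

Lemma shifted_avg_integrable n : leb.-integrable setT (EFin \o S n).
Proof.
have h : leb.-integrable setT (fun x : mR => (\sum_(i < n.+1) (p^-1 * pos_powR_avg c p i)%:E * (EFin \o gamma_pdf p (n - i)) x)%E).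
  apply: integrable_sum => // i _; apply: integrableZl => //; exact: gamma_pdf_integrable.
apply: eq_integrable h => // x _ /=.
rewrite /S; under eq_bigr do rewrite -EFinM.
rewrite sumEFin; congr EFin; rewrite big_distrr /=; apply: eq_bigr => i _; ring.
Qed.

End Convolution.

Section Convolution2.
Variable w : R -> R.
Hypothesis mw : measurable_fun (setT : set mR) w.
Variable B : R.
Hypothesis wB : forall t, `|w t| <= B.
Variable p : R.
Hypothesis p0 : 0 < p.
Variable c : R.
Hypothesis c1 : 0 < c + 1.
Hypothesis c0 : c <= 0.
Hypothesis w0 : forall t, t <= 0 -> w t = 0.

(** Tonelli in the order where the inner integral is explicit. *)
Lemma conv_integrable n : (leb \x leb)%E.-integrable setT (conv_ker w p c n).
Proof.
apply/integrable21ltyP; first exact: measurable_conv_ker.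
have E (y : mR) : (\int[leb]_x `|conv_ker w p c n (x, y)| = \int[leb]_x conv_ker (fun t => `|w t|%R) p c n (x, y))%E.
  apply: eq_integral => x _; rewrite /conv_ker /= !normrM.
  by rewrite (ger0_norm (gamma_pdf_ge0 _ _ (ltW p0))) (ger0_norm (pos_powR_ge0 _ _)).
rewrite (eq_integral _ _ (fun y _ => E y)).
have w0' t : t <= 0 -> `|w t| = 0 by move=> /w0 ->; rewrite normr0.
rewrite (eq_integral _ _ (fun y _ => conv_ker_int1 p0 c1 c0 w0' n y)).
have B0 : 0 <= B by exact: le_trans (wB 0).
have h : leb.-integrable setT (fun x : mR => (B%:E * (EFin \o (fun xi => p^-1 * \sum_(i < n.+1) pos_powR_avg c p i * gamma_pdf p (n - i) xi)%R) x)%E).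
  by apply: integrableZl => //; apply: shifted_avg_integrable.
have /integrableP[_] := h; apply: le_lt_trans.
apply: ge0_le_integral => //.
- by move=> x _; rewrite lee_fin mulr_ge0 // shifted_avg_ge0.
- apply/measurable_EFinP; apply: measurable_funM; first exact: measurableT_comp.
  by apply/measurable_EFinP; have /integrableP[] := shifted_avg_integrable p0 c n.
- apply: measurableT_comp => //; by have /integrableP[] := h.
move=> x _; rewrite /= lee_fin normrM.
rewrite [X in _ <= _ * X]ger0_norm ?shifted_avg_ge0 // ler_wpM2r ?shifted_avg_ge0 //.
by rewrite (le_trans (wB x)) // ler_norm.
Qed.

Lemma conv_avg n : (\int[leb]_t \int[leb]_xi conv_ker w p c n (t, xi) =
  (p^-1 * \sum_(i < n.+1) pos_powR_avg c p i * wavg w p (n - i))%:E)%E.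
Proof.
rewrite (Fubini (conv_integrable n)).
rewrite (eq_integral _ _ (fun y _ => conv_ker_int1 p0 c1 c0 w0 n y)).
have E (y : mR) : (w y * (p^-1 * \sum_(i < n.+1) pos_powR_avg c p i * gamma_pdf p (n - i) y))%:E =
    (\sum_(i < n.+1) (p^-1 * pos_powR_avg c p i)%:E * (w y * gamma_pdf p (n - i) y)%:E)%E.
  under [RHS]eq_bigr do rewrite -EFinM.
  rewrite sumEFin; congr EFin; rewrite !big_distrr /=; apply: eq_bigr => i _; ring.
rewrite (eq_integral _ _ (fun y _ => E y)) integral_sum //; last first.
  by move=> i; apply: integrableZl => //; exact: (wavg_integrable mw wB p0).
rewrite big_distrr /= -sumEFin; apply: eq_bigr => i _.
rewrite integralZl //; last exact: (wavg_integrable mw wB p0).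
by rewrite (wavgE mw wB p0) -EFinM; congr EFin; ring.
Qed.

End Convolution2.

End GammaKernels.

(** * Stability of the backward Euler equation *)

Section Residual.
Variable R : realType.
Local Notation C := (R[i]).
Local Notation x := (fpsX C).
Local Notation normc := (@normc R).
Variable s : R.
Hypothesis s01 : 0 < s < 1.
Variables (b : nat -> R) (v0 nu : R).
Hypothesis nu0 : 0 < nu.

(** The defect of [b] in the backward Euler equation divided by [1 - x]. *)
Definition be_residual n : R := \sum_(i < n.+1) binom_coef s i * b (n - i) +
  nu * \sum_(i < n.+1) (b (n - i) + v0).

Let bC : fps C := fun n => (b n)%:C%C.
Let rC : fps C := fun n => (be_residual n)%:C%C.

Lemma be_residualE : be_sym s nu * (bC - fpsC v0%:C%C * be_dev s nu) = (1 - x) * rC.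
Proof.
have e : rC = binser s * bC + fpsC nu%:C%C * (geom R * (bC + fpsC v0%:C%C * geom R)).
  apply/funext => n; rewrite fpsDE fpsCM !fpsME /rC /be_residual rmorphD rmorphM !rmorph_sum /=.
  congr (_ + _); first by apply: eq_bigr => i _; rewrite rmorphM.
  congr (_ * _); apply: eq_bigr => i _.
  by rewrite fpsDE fpsCM /geom mul1r mulr1 rmorphD.
have g := geomE R.
transitivity ((1 - x) * binser s * bC + fpsC nu%:C%C * bC - fpsC v0%:C%C * (be_sym s nu * be_dev s nu)).
  by rewrite /be_sym; ring.
rewrite (be_devP s (ltW nu0)) e fpsCN.
transitivity ((1 - x) * binser s * bC + fpsC nu%:C%C * (((1 - x) * geom R) * (bC + fpsC v0%:C%C * geom R))).
  by rewrite g; ring.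
by ring.
Qed.

(** The deviation solves the equation with source [(1 - x)] times the residual; at radius
    [k / (k + 1)] the energy bound loses the factor [e] only. *)
Lemma be_residual_bound k eps : (0 < k)%N -> (forall n, (n <= k)%N -> `|be_residual n| <= eps) ->
  normc ((b k)%:C%C - v0%:C%C * be_dev s nu k) <= 2 * expR 1 * nu^-1 * k.+1%:R * eps.
Proof.
move=> k0 hr.
have eps0 : 0 <= eps by exact: le_trans (normr_ge0 _) (hr 0%N (leq0n _)).
set W : fps C := bC - fpsC v0%:C%C * be_dev s nu.
have WE : W k = (b k)%:C%C - v0%:C%C * be_dev s nu k by rewrite /W fpsBE fpsCM.
rewrite -WE.
set rho : R := k%:R / k.+1%:R.
have hrho := radius_in R k; rewrite -/rho in hrho; have [rho0 rho1] := andP hrho.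
have h := energy_bound (m := k.+1) nu0 hrho (indisc_be_sym s01 nu) (fun n _ => congr1 (fun f : fps C => f n) be_residualE)
  (fun z hz => Re_be_sym s01 (ltW nu0) hz).
rewrite -/W in h.
have h1 : normc (W k) ^+ 2 * rho ^+ (k + k) <= \sum_(n < k.+1) normc (W n) ^+ 2 * rho ^+ (n + n).
  rewrite big_ord_recr /= lerDr; apply: sumr_ge0 => i _.
  by rewrite mulr_ge0 ?sqr_ge0 ?exprn_ge0.
have h2 : \sum_(n < k.+1) normc (((1 - x) * rC) n) ^+ 2 * rho ^+ (n + n) <= \sum_(n < k.+1) (2 * eps) ^+ 2.
  apply: ler_sum => n _; rewrite -[leRHS]mulr1; apply: ler_pM; rewrite ?sqr_ge0 ?exprn_ge0 //; last first.
    by rewrite exprn_ile1 ?(ltW rho1).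
  have hn : (n <= k)%N by rewrite -ltnS.
  rewrite lerXn2r ?nnegrE ?normc_ge0 ?mulr_ge0 //.
  have -> : ((1 - x) * rC) n = rC n - (if (n : nat) is m.+1 then rC m else 0).
    by rewrite mulrBl mul1r fpsBE fpsXM.
  apply: (le_trans (normcB _ _)); rewrite mulr_natl mulr2n lerD //.
    by rewrite normc_real hr.
  case: (n : nat) hn => [|m] hm; first by rewrite normc0.
  by rewrite normc_real hr // ltnW.
rewrite sumr_const card_ord -[_ *+ k.+1]mulr_natl in h2.
have h3 : normc (W k) ^+ 2 * rho ^+ (k + k) <= (nu ^+ 2)^-1 * (k.+1%:R * (2 * eps) ^+ 2).
  apply: (le_trans h1); apply: (le_trans h).
  apply: (le_trans (ler_wpM2l _ h2)); last by [].
  by rewrite invr_ge0 exprn_ge0 // ltW.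
have e1 : expR (-1) ^+ 2 <= rho ^+ (k + k).
  rewrite exprD -expr2 lerXn2r ?nnegrE ?expR_ge0 ?exprn_ge0 //.
  exact: radius_pow.
have h4 : (normc (W k) * expR (-1)) ^+ 2 <= (nu^-1 * k.+1%:R * (2 * eps)) ^+ 2.
  rewrite [leLHS]exprMn; apply: (le_trans (ler_wpM2l (sqr_ge0 _) e1)); apply: (le_trans h3).
  rewrite !exprMn exprVn -[leRHS]mulrA ler_wpM2l ?invr_ge0 ?exprn_ge0 ?(ltW nu0) //.
  rewrite ler_wpM2r ?mulr_ge0 ?exprn_ge0 //.
  by rewrite expr2 ler_peMr // ler1n.
move: h4; rewrite ler_sqr ?nnegrE ?mulr_ge0 ?normc_ge0 ?expR_ge0 ?invr_ge0 ?(ltW nu0) //.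
rewrite expRN ler_pdivrMr ?expR_gt0 // => h5; apply: (le_trans h5).
by rewrite le_eqVlt; apply/orP; left; apply/eqP; ring.
Qed.

End Residual.

(** * Convolutions at a point *)

Section ConvolutionAt.
Local Open Scope classical_set_scope.
Local Open Scope ring_scope.
Variable R : realType.
Local Notation leb := (@lebesgue_measure R).
Local Notation mR := (measurableTypeR R).

Lemma reflect_integral (q : R) (f : R -> \bar R) :
  measurable_fun (setT : set mR) f -> (forall x, 0 <= f x)%E ->
  (\int[leb]_x f x = \int[leb]_x f (q - x)%R)%E.
Proof.
move=> mf f0; rewrite (affine_integral q ltr01 mf f0) mul1e.
pose g (x : R) := f (1 * x + q)%R.
have mg : measurable_fun (setT : set mR) g.
  apply: (measurableT_comp mf); apply: measurable_funD; last exact: measurable_cst.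
  by apply: measurable_funM; [exact: measurable_cst|exact: measurable_id].
have mN : measurable_fun (setT : set mR) (-%R : mR -> mR) by exact: oppr_measurable.
have := ge0_integral_pushforward mN leb measurableT mg (fun x _ => f0 _).
rewrite preimage_setT => h.
transitivity (\int[pushforward leb (-%R : mR -> mR)]_x g x)%E.
  by apply: eq_measure_integral => A mA _; first [exact: lebesgue_measureN | exact: (esym (lebesgue_measureN _))].
rewrite h; apply: eq_integral => x _; rewrite /g /=; congr f; ring.
Qed.

(** Chernoff: the density of rate [r p] differs by a factor [e^((1 - r) p t)] and by powers
    of [r], and [t >= T]. *)
Lemma gamma_pdf_tilt (r p : R) n (T t : R) : 0 < r <= 1 -> 0 < p -> 0 <= T <= t ->
  gamma_pdf p n t <= expR (- ((1 - r) * p * T)) / r ^+ n.+1 * gamma_pdf (r * p) n t.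
Proof.
move=> /andP[r0 r1] p0 /andP[T0 tT]; rewrite /gamma_pdf; case: ifP => t0; last by rewrite mulr0.
have -> : expR (- ((1 - r) * p * T)) / r ^+ n.+1 * (r * p * ((r * p * t) ^+ n / n`!%:R * expR (- (r * p * t))))
  = p * ((p * t) ^+ n / n`!%:R * expR (- (r * p * t) + - ((1 - r) * p * T))).
  rewrite expRD -!mulrA [(r * _) ^+ n]exprMn exprS.
  have : r ^+ n != 0 by rewrite expf_neq0 // gt_eqF.
  have : n`!%:R != 0 :> R by rewrite pnatr_eq0 -lt0n fact_gt0.
  move: (r ^+ n) (n`!%:R : R) (expR _) (expR _) => a b e1 e2 b0 a0; field.
  by rewrite a0 b0 gt_eqF.
rewrite ler_wpM2l ?(ltW p0) // ler_wpM2l ?divr_ge0 ?exprn_ge0 ?mulr_ge0 ?(ltW p0) ?(ltW t0) //.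
rewrite ler_expR -subr_ge0.
have -> : - (r * p * t) - (1 - r) * p * T - - (p * t) = (1 - r) * p * (t - T) by ring.
by rewrite !mulr_ge0 ?subr_ge0 // ltW.
Qed.

Section Pointwise.
Variable w : R -> R.
Hypothesis mw : measurable_fun (setT : set mR) w.
Variable B : R.
Hypothesis wB : forall t, `|w t| <= B.
Hypothesis w0 : forall t, t <= 0 -> w t = 0.
Variable c : R.
Hypothesis c1 : 0 < c + 1.
Hypothesis c0 : c <= 0.

Let K t (xi : R) := pos_powR c (t - xi) * w xi.

Lemma measurable_convK t : measurable_fun (setT : set mR) (K t).
Proof.
apply: measurable_funM => //; apply: measurableT_comp; first exact: measurable_pos_powR.
by apply: measurable_funB; [exact: measurable_cst|exact: measurable_id].
Qed.

(** With the rate [1 / t], the density of index 0 is at least [1 / (e t)] at times in ]0, t], so that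
    the integral is at most a Gamma integral. *)
Lemma conv_point_abs t : 0 < t ->
  (\int[leb]_xi `|(K t xi)%:E| <= (B * expR 1 * Gamma (c + 1) * t `^ (c + 1))%:E)%E.
Proof.
move=> t0.
have B0 : 0 <= B by exact: le_trans (wB 0).
have tV : 0 < t^-1 by rewrite invr_gt0.
pose g (u : R) : \bar R := (pos_powR c u * gamma_pdf t^-1 0 u)%:E.
have mg : measurable_fun (setT : set mR) g.
  by apply/measurable_EFinP; apply: measurable_funM; [exact: measurable_pos_powR|exact: measurable_gamma_pdf].
have g0 u : (0 <= g u)%E by rewrite lee_fin mulr_ge0 ?pos_powR_ge0 ?gamma_pdf_ge0 // ltW.
have mgt : measurable_fun (setT : set mR) (fun xi => g (t - xi)).
  apply: (measurableT_comp mg).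
  by apply: measurable_funB; [exact: measurable_cst|exact: measurable_id].
have C0 : 0 <= B * expR 1 * t by rewrite !mulr_ge0 ?expR_ge0 // ltW.
apply: (@le_trans _ _ (\int[leb]_xi ((B * expR 1 * t)%:E * g (t - xi)%R))%E).
  apply: ge0_le_integral => //.
  - by apply: measurableT_comp => //; apply/measurable_EFinP; exact: measurable_convK.
  - exact: measurable_funeM.
  move=> xi _; rewrite /g -EFinM abse_EFin lee_fin /K.
  have [xi0|xi0] := leP xi 0.
    by rewrite (w0 xi0) mulr0 normr0 mulr_ge0 // mulr_ge0 ?pos_powR_ge0 ?gamma_pdf_ge0 // ltW.
  rewrite normrM (ger0_norm (pos_powR_ge0 _ _)) /gamma_pdf; case: ifP => h; last first.
    by rewrite /pos_powR h mul0r !mulr0.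
  rewrite mulrCA ler_wpM2l ?pos_powR_ge0 //; apply: (le_trans (wB xi)).
  rewrite expr0 fact0 divr1 mul1r mulrA mulfK ?gt_eqF // -mulrA -expRD.
  rewrite -[leLHS]mulr1 ler_wpM2l // -[leLHS]expR0 ler_expR.
  rewrite subr_ge0 mulrC ler_pdivrMr // mul1r lerBlDr lerDl ltW //.
rewrite ge0_integralZl_EFin // -(reflect_integral t mg g0) (gamma_pdf_avg c1 c0 tV).
rewrite -EFinM lee_fin /pos_powR_avg /binom_coef big_ord0 mulr1.
rewrite (_ : t^-1 `^ (- c) = t `^ c); last first.
  by rewrite -powR_inv1 ?(ltW t0) // -powRrM mulN1r opprK.
rewrite powRD ?(gt_eqF t0) ?implybT // powRr1 ?(ltW t0) //.
by rewrite le_eqVlt; apply/orP; left; apply/eqP; ring.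
Qed.

Lemma conv_point_integrable t : leb.-integrable setT (fun xi => (pos_powR c (t - xi) * w xi)%:E).
Proof.
apply/integrableP; split; first by apply/measurable_EFinP; exact: measurable_convK.
have [t0|t0] := ltP 0 t; first by apply: (le_lt_trans (conv_point_abs t0)); exact: ltry.
rewrite integral0_eq ?ltry // => xi _.
have [xi0|xi0] := leP xi 0; first by rewrite (w0 xi0) mulr0 abse0.
rewrite /pos_powR ltNge (_ : t - xi <= 0) ?mul0r ?abse0 //.
by rewrite subr_le0 (le_trans t0) // ltW.
Qed.

Lemma conv_point_bound t : 0 < t ->
  `|\int[leb]_xi (pos_powR c (t - xi) * w xi)| <= B * expR 1 * Gamma (c + 1) * t `^ (c + 1).
Proof.
move=> t0; rewrite -lee_fin -abse_EFin /Rintegral fineK; last first.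
  by apply: (integrable_fin_num measurableT); exact: conv_point_integrable.
apply: le_trans (conv_point_abs t0); apply: le_abse_integral => //.
by apply/measurable_EFinP; exact: measurable_convK.
Qed.

End Pointwise.
End ConvolutionAt.

(** * Averages of the Volterra equation *)

Section VolterraAverage.
Local Open Scope classical_set_scope.
Local Open Scope ring_scope.
Variable R : realType.
Local Notation leb := (@lebesgue_measure R).
Local Notation mR := (measurableTypeR R).
Variable s : R.
Hypothesis s01 : 0 < s < 1.
Variable w : R -> R.
Hypothesis mw : measurable_fun (setT : set mR) w.
Variable B : R.
Hypothesis wB : forall t, `|w t| <= B.
Hypothesis w0 : forall t, t <= 0 -> w t = 0.
Variables (v0 lam T : R).
Hypothesis lam0 : 0 < lam.
Hypothesis T0 : 0 < T.

Definition forced (t : R) : R := if 0 < t then w t + v0 else 0.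

(** The fractional equation integrated once in time. *)
Definition volterra_lhs (t : R) : R := \int[leb]_xi (pos_powR (s - 1) (t - xi) * w xi)
  + lam * Gamma s * \int[leb]_xi (pos_powR 0 (t - xi) * forced xi).

Hypothesis volterra : forall t, 0 < t < T -> volterra_lhs t = 0.

Let sc1 : 0 < s - 1 + 1. Proof. by rewrite subrK; case/andP: s01. Qed.
Let sc0 : s - 1 <= 0. Proof. by rewrite subr_le0 ltW //; case/andP: s01. Qed.
Let zc1 : 0 < (0 : R) + 1. Proof. by rewrite add0r. Qed.
Let zc0 : (0 : R) <= 0. Proof. exact: lexx. Qed.

Lemma measurable_forced : measurable_fun (setT : set mR) forced.
Proof. by apply: measurable_if_pos; apply: measurable_funD => //; exact: measurable_cst. Qed.

Lemma forced_le t : `|forced t| <= B + `|v0|.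
Proof.
rewrite /forced; case: ifP => _; last by rewrite normr0 addr_ge0 // (le_trans _ (wB 0)).
by apply: (le_trans (ler_normD _ _)); rewrite lerD2r.
Qed.

Lemma forced0 t : t <= 0 -> forced t = 0.
Proof. by rewrite /forced ltNge => ->. Qed.

(* The density can be put inside both convolutions, which is the form Fubini applies to. *)
Let averaged_lhs p n (u1 u2 : R -> R) (t : R) : \bar R := (\int[leb]_xi conv_ker u1 p (s - 1) n (t, xi) +
  (lam * Gamma s)%:E * \int[leb]_xi conv_ker u2 p 0 n (t, xi))%E.

Lemma Gamma_s : 0 < Gamma s.
Proof. by have := Gamma_gt0 sc1 sc0; rewrite subrK. Qed.

Lemma conv_ker_point (u : R -> R) c (D : R) p n t : 0 < c + 1 -> c <= 0 ->
  measurable_fun (setT : set mR) u -> (forall t, `|u t| <= D) -> (forall t, t <= 0 -> u t = 0) ->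
  (\int[leb]_xi conv_ker u p c n (t, xi) = (gamma_pdf p n t * \int[leb]_xi (pos_powR c (t - xi) * u xi))%:E)%E.
Proof.
move=> h1 h2 mu uB u0.
have hi := conv_point_integrable mu uB u0 h1 h2 t.
transitivity (\int[leb]_xi ((gamma_pdf p n t)%:E * (pos_powR c (t - xi) * u xi)%:E))%E.
  by apply: eq_integral => xi _; rewrite -EFinM.
rewrite integralZl // /Rintegral EFinM fineK //.
exact: (integrable_fin_num measurableT hi).
Qed.

Section Bound.
Variables (p r : R) (n : nat).
Hypothesis p0 : 0 < p.
Hypothesis r01 : 0 < r <= 1.
Let E := expR (- ((1 - r) * p * T)) / r ^+ n.+1.
Let aw t := `|w t|.
Let af t := `|forced t|.

Let maw : measurable_fun (setT : set mR) aw. Proof. exact: measurableT_comp. Qed.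
Let maf : measurable_fun (setT : set mR) af.
Proof. by apply: measurableT_comp => //; exact: measurable_forced. Qed.
Let awB t : `|aw t| <= B. Proof. by rewrite normr_id. Qed.
Let afB t : `|af t| <= B + `|v0|. Proof. by rewrite normr_id; exact: forced_le. Qed.
Let aw0 t : t <= 0 -> aw t = 0. Proof. by rewrite /aw => /w0 ->; rewrite normr0. Qed.
Let af0 t : t <= 0 -> af t = 0. Proof. by rewrite /af => /forced0 ->; rewrite normr0. Qed.
Let E0 : 0 <= E. Proof. by rewrite /E divr_ge0 ?expR_ge0 ?exprn_ge0 //; case/andP: r01 => /ltW. Qed.
Let rp0 : 0 < r * p. Proof. by rewrite mulr_gt0 //; case/andP: r01. Qed.
Let lG0 : 0 <= lam * Gamma s. Proof. by rewrite mulr_ge0 ?(ltW Gamma_s) // ltW. Qed.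

Lemma averaged_lhs_int (q : R) (u1 u2 : R -> R) (D1 D2 : R) : 0 < q ->
  measurable_fun (setT : set mR) u1 -> measurable_fun (setT : set mR) u2 ->
  (forall t, `|u1 t| <= D1) -> (forall t, `|u2 t| <= D2) ->
  (forall t, t <= 0 -> u1 t = 0) -> (forall t, t <= 0 -> u2 t = 0) ->
  leb.-integrable setT (averaged_lhs q n u1 u2) /\
  (\int[leb]_t averaged_lhs q n u1 u2 t = (q^-1 * \sum_(i < n.+1) pos_powR_avg (s - 1) q i * wavg u1 q (n - i)
    + lam * Gamma s * (q^-1 * \sum_(i < n.+1) wavg u2 q (n - i)))%:E)%E.
Proof.
move=> q0 m1 m2 b1 b2 z1 z2.
have i1 := integrable_fubini_F (conv_integrable m1 b1 q0 sc1 sc0 z1 n).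
have i2 := integrable_fubini_F (conv_integrable m2 b2 q0 zc1 zc0 z2 n).
have i2' : leb.-integrable setT (fun t : mR => ((lam * Gamma s)%:E * \int[leb]_xi conv_ker u2 q 0 n (t, xi))%E).
  by apply: integrableZl.
split; first exact: integrableD.
rewrite /averaged_lhs integralD // (conv_avg m1 b1 q0 sc1 sc0 z1) integralZl // (conv_avg m2 b2 q0 zc1 zc0 z2).
rewrite -EFinM -EFinD; congr (_ + _ * (_ * _))%:E.
by apply: eq_bigr => i _; rewrite pos_powR_avg0 // mul1r.
Qed.

(** Before [T] the left-hand side vanishes, and after [T] the tilted density dominates. *)
Lemma averaged_lhs_tilt t : (`|averaged_lhs p n w forced t| <= E%:E * averaged_lhs (r * p) n aw af t)%E.
Proof.
have N (u : R -> R) c (D : R) : 0 < c + 1 -> c <= 0 ->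
  measurable_fun (setT : set mR) u -> (forall t, `|u t| <= D) -> (forall t, t <= 0 -> u t = 0) ->
   `|\int[leb]_xi (pos_powR c (t - xi) * u xi)| <= \int[leb]_xi (pos_powR c (t - xi) * `|u xi|).
  move=> h1 h2 mu uB u0.
  apply: (le_trans (le_normr_Rintegral measurableT (conv_point_integrable mu uB u0 h1 h2 t))).
  rewrite le_eqVlt; apply/orP; left; apply/eqP; apply: eq_Rintegral => xi _.
  by rewrite normrM (ger0_norm (pos_powR_ge0 _ _)).
rewrite /averaged_lhs (conv_ker_point _ _ _ sc1 sc0 mw wB w0) (conv_ker_point _ _ _ zc1 zc0 measurable_forced forced_le forced0).
rewrite (conv_ker_point _ _ _ sc1 sc0 maw awB aw0) (conv_ker_point _ _ _ zc1 zc0 maf afB af0).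
rewrite -!EFinM -!EFinD abse_EFin lee_fin.
rewrite [X in `|X|](_ : _ = gamma_pdf p n t * volterra_lhs t); last by rewrite /volterra_lhs; ring.
rewrite [leRHS](_ : _ = E * gamma_pdf (r * p) n t * (\int[leb]_xi (pos_powR (s - 1) (t - xi) * aw xi)
   + lam * Gamma s * \int[leb]_xi (pos_powR 0 (t - xi) * af xi))); last by ring.
have h2 : 0 <= \int[leb]_xi (pos_powR (s - 1) (t - xi) * aw xi)
   + lam * Gamma s * \int[leb]_xi (pos_powR 0 (t - xi) * af xi).
  have P (u : R -> R) c : 0 <= \int[leb]_xi (pos_powR c (t - xi) * `|u xi|).
    by apply: Rintegral_ge0 => // xi _; rewrite mulr_ge0 ?pos_powR_ge0 ?normr_ge0.
  apply: addr_ge0; first by have := P w (s - 1).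
  by apply: mulr_ge0; [exact: lG0|have := P forced 0].
have h1 : 0 <= E * gamma_pdf (r * p) n t by rewrite mulr_ge0 // gamma_pdf_ge0 // ltW.
have [tT|tT] := ltP t T.
  have [t0|t0] := ltP 0 t.
    by rewrite volterra ?t0 // mulr0 normr0 mulr_ge0.
  by rewrite /gamma_pdf ltNge t0 /= mul0r normr0 mulr0 mul0r.
rewrite normrM ger0_norm ?gamma_pdf_ge0 ?(ltW p0) //; apply: ler_pM => //.
- by rewrite gamma_pdf_ge0 // ltW.
- by apply: gamma_pdf_tilt => //; rewrite (ltW T0).
rewrite /volterra_lhs; apply: (le_trans (ler_normD _ _)); apply: lerD.
  exact: (N w _ B sc1 sc0 mw wB w0).
rewrite normrM (ger0_norm lG0) ler_wpM2l //.
exact: (N forced _ _ zc1 zc0 measurable_forced forced_le forced0).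
Qed.

Lemma wavg_forced k : wavg forced p k = wavg w p k + v0.
Proof.
have h1 := wavg_integrable mw wB p0 k.
have h2 : leb.-integrable setT (fun x => (v0%:E * (EFin \o gamma_pdf p k) x)%E).
  by apply: integrableZl => //; exact: gamma_pdf_integrable.
have h3 := integralD measurableT h1 h2.
rewrite (wavgE mw wB p0) integralZl ?gamma_pdf_int // in h3; last exact: gamma_pdf_integrable.
apply: EFin_inj; rewrite -(wavgE measurable_forced forced_le p0) EFinD -[X in (_ + X)%E]mule1 -h3.
apply: eq_integral => x _; rewrite /= -EFinM -EFinD /forced /gamma_pdf; case: ifP => _; last by rewrite !mulr0 addr0.
by rewrite mulrDl.
Qed.

Lemma residual_avg : (p^-1 * \sum_(i < n.+1) pos_powR_avg (s - 1) p i * wavg w p (n - i)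
    + lam * Gamma s * (p^-1 * \sum_(i < n.+1) wavg forced p (n - i))) =
  p^-1 * (p `^ (1 - s) * Gamma s) * be_residual s (wavg w p) v0 (lam * p `^ (s - 1)) n.
Proof.
rewrite /be_residual mulrDr; congr (_ + _).
  rewrite -mulrA; congr (_ * _); rewrite big_distrr; apply: eq_bigr => i _.
  by rewrite /= /pos_powR_avg subrK opprB !mulrA.
under eq_bigr do rewrite wavg_forced.
have : p `^ (1 - s) * p `^ (s - 1) = 1.
  by rewrite -powRD ?(gt_eqF p0) ?implybT // addrC addrA subrK subrr powRr0.
move: (\sum_(i < _) _) (p `^ (1 - s)) (p `^ (s - 1)) => S a b ab.
transitivity (a * b * (lam * Gamma s * (p^-1 * S))); first by rewrite ab mul1r.
by ring.
Qed.

(** The tilted averages are again given by Gamma integrals, hence grow at most linearly in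
    [n] and polynomially in [p]. *)
Lemma residual_bound : 1 <= p ->
  `|be_residual s (wavg w p) v0 (lam * p `^ (s - 1)) n| <=
  E * r^-1 * n.+1%:R * (B + lam * (B + `|v0|)).
Proof.
move=> p1; have /andP[r0 r1] := r01.
have [i1 e1] := averaged_lhs_int p0 mw measurable_forced wB forced_le w0 forced0.
have [i2 e2] := averaged_lhs_int rp0 maw maf awB afB aw0 af0.
have h : (`|\int[leb]_t averaged_lhs p n w forced t| <= E%:E * \int[leb]_t averaged_lhs (r * p) n aw af t)%E.
  apply: (le_trans (le_abse_integral _ measurableT _)); first by have /integrableP[] := i1.
  rewrite -(integralZl measurableT i2).
  apply: ge0_le_integral => //.
  - by apply: measurableT_comp => //; have /integrableP[] := i1.
  - by apply: measurable_funeM; have /integrableP[] := i2.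
  - by move=> t _; exact: averaged_lhs_tilt.
rewrite residual_avg in e1.
rewrite e1 e2 in h.
rewrite abse_EFin in h.
rewrite -EFinM in h.
rewrite lee_fin in h.
have aP : 0 < p `^ (1 - s) by rewrite powR_gt0.
have B0 : 0 <= B by exact: le_trans (wB 0).
set D := B + lam * (B + `|v0|).
have h2 : (r * p)^-1 * (\sum_(i < n.+1) pos_powR_avg (s - 1) (r * p) i * wavg aw (r * p) (n - i))
    + lam * Gamma s * ((r * p)^-1 * \sum_(i < n.+1) wavg af (r * p) (n - i)) <=
    (r * p)^-1 * (n.+1%:R * (p `^ (1 - s) * Gamma s * D)).
  have g1 : \sum_(i < n.+1) pos_powR_avg (s - 1) (r * p) i * wavg aw (r * p) (n - i) <=
      \sum_(i < n.+1) (p `^ (1 - s) * Gamma s * B).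
    apply: ler_sum => i _; apply: (le_trans (ler_norm _)); rewrite normrM ger0_norm ?pos_powR_avg_ge0 //.
    apply: ler_pM; rewrite ?pos_powR_avg_ge0 ?normr_ge0 //; last exact: wavg_le.
    rewrite /pos_powR_avg subrK opprB -[leRHS]mulr1; apply: ler_pM.
    - by rewrite mulr_ge0 ?powR_ge0 ?(ltW Gamma_s).
    - by apply: binom_coef_ge0; case/andP: s01 => /ltW.
    - rewrite ler_wpM2r ?(ltW Gamma_s) // ge0_ler_powR ?nnegrE ?subr_ge0 ?(ltW p0) ?(ltW rp0) //.
        by case/andP: s01 => _ /ltW.
      by rewrite ler_piMl // ltW.
    - by apply: binom_coef_le1; case/andP: s01 => /ltW ? /ltW ?; apply/andP.
  have g2 : \sum_(i < n.+1) wavg af (r * p) (n - i) <= \sum_(i < n.+1) (B + `|v0|).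
    by apply: ler_sum => i _; apply: (le_trans (ler_norm _)); apply: wavg_le.
  rewrite sumr_const card_ord -[_ *+ n.+1]mulr_natl in g1.
  rewrite sumr_const card_ord -[_ *+ n.+1]mulr_natl in g2.
  have pa1 : 1 <= p `^ (1 - s).
    by rewrite -[leLHS](powRr0 p) ler_powR // subr_ge0; case/andP: s01 => _ /ltW.
  rewrite /D mulrDr [n.+1%:R * _]mulrDr mulrDr; apply: lerD.
    by rewrite ler_wpM2l ?invr_ge0 ?(ltW rp0).
  rewrite mulrCA ler_wpM2l ?invr_ge0 ?(ltW rp0) //.
  apply: (le_trans (ler_wpM2l lG0 g2)).
  rewrite [leLHS](_ : _ = n.+1%:R * (1 * Gamma s * (lam * (B + `|v0|)))); last by ring.
  rewrite ler_wpM2l // ler_wpM2r ?mulr_ge0 ?addr_ge0 ?(ltW lam0) // ler_wpM2r ?(ltW Gamma_s) //.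
have h3 := le_trans h (ler_wpM2l E0 h2).
rewrite normrM ger0_norm in h3; last by rewrite !mulr_ge0 ?invr_ge0 ?(ltW p0) ?(ltW aP) ?(ltW Gamma_s).
have q0 : 0 < p^-1 * (p `^ (1 - s) * Gamma s) by rewrite !mulr_gt0 ?invr_gt0 ?Gamma_s.
rewrite -(ler_pM2l q0); apply: (le_trans h3).
rewrite invfM le_eqVlt; apply/orP; left; apply/eqP.
clear h h2 h3; move: E D (n.+1%:R : R) (p `^ (1 - s)) (Gamma s) (p^-1) (r^-1) => e d m pa g pi ri; ring.
Qed.

End Bound.
End VolterraAverage.

(** * Concentration of the averages *)

Section Concentration.
Local Open Scope classical_set_scope.
Local Open Scope ring_scope.
Variable R : realType.
Local Notation leb := (@lebesgue_measure R).
Local Notation mR := (measurableTypeR R).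
Variable w : R -> R.
Hypothesis mw : measurable_fun (setT : set mR) w.
Variable B : R.
Hypothesis wB : forall t, `|w t| <= B.

Lemma gamma_pdf_second_moment (p y x : R) k : 0 < p ->
  gamma_pdf p k x * (x - y) ^+ 2 = y ^+ 2 * gamma_pdf p k x + - (2 * y * (k.+1%:R / p)) * gamma_pdf p k.+1 x
    + (k.+1%:R / p * (k.+2%:R / p)) * gamma_pdf p k.+2 x.
Proof.
move=> p0; have h1 := gamma_pdf_step k x p0; have h2 := gamma_pdf_step k.+1 x p0.
have -> : (k.+1%:R / p * (k.+2%:R / p)) * gamma_pdf p k.+2 x = x * (x * gamma_pdf p k x).
  by rewrite -[LHS]mulrA h1 [RHS]mulrCA h2.
rewrite mulNr -[2 * y * _ * _]mulrA -h1; ring.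
Qed.

(** Chebyshev: outside the interval of radius [d], the oscillation [2 B] is paid by the
    second moment around [y = k / p], which is [(k + 2) / p^2]. *)
Lemma wavg_concentration (p y eps d : R) k : 0 < p -> 0 < d -> 0 <= eps ->
  `|w y| <= B -> (forall x, `|x - y| < d -> `|w x - w y| <= eps) -> k%:R = p * y ->
  `|wavg w p k - w y| <= eps + 2 * B / d ^+ 2 * (k.+2%:R / p ^+ 2).
Proof.
move=> p0 d0 eps0 yB hw hk.
have B0 : 0 <= B by exact: le_trans (wB 0).
set m := 2 * B / d ^+ 2.
have m0 : 0 <= m by rewrite /m divr_ge0 ?sqr_ge0 ?mulr_ge0.
have i1 := wavg_integrable mw wB p0 k.
have i2 : leb.-integrable setT (fun x => ((- w y)%:E * (EFin \o gamma_pdf p k) x)%E).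
  by apply: integrableZl => //; exact: gamma_pdf_integrable.
pose g (x : R) : R := (eps + m * y ^+ 2) * gamma_pdf p k x + (- (m * (2 * y * (k.+1%:R / p)))) * gamma_pdf p k.+1 x
   + (m * (k.+1%:R / p * (k.+2%:R / p))) * gamma_pdf p k.+2 x.
have gE x : g x = gamma_pdf p k x * (eps + m * (x - y) ^+ 2).
  rewrite mulrDr [_ * (m * _)]mulrCA gamma_pdf_second_moment // /g; ring.
have iZ a j : leb.-integrable setT (fun x => (a%:E * (EFin \o gamma_pdf p j) x)%E).
  by apply: integrableZl => //; exact: gamma_pdf_integrable.
have ig : (\int[leb]_x (g x)%:E = ((eps + m * y ^+ 2) + (- (m * (2 * y * (k.+1%:R / p))))
   + (m * (k.+1%:R / p * (k.+2%:R / p))))%:E)%E.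
  rewrite (_ : (fun x => (g x)%:E) = (fun x => ((eps + m * y ^+ 2)%:E * (EFin \o gamma_pdf p k) x +
     (- (m * (2 * y * (k.+1%:R / p))))%:E * (EFin \o gamma_pdf p k.+1) x +
     (m * (k.+1%:R / p * (k.+2%:R / p)))%:E * (EFin \o gamma_pdf p k.+2) x)%E)) //.
  rewrite integralD //; last exact: integrableD.
  rewrite integralD // !integralZl ?gamma_pdf_int //; try exact: gamma_pdf_integrable.
  by rewrite !mule1.
have hD := integralD measurableT i1 i2.
rewrite (wavgE mw wB p0) integralZl ?gamma_pdf_int // in hD; last exact: gamma_pdf_integrable.
have hval : eps + m * (k.+2%:R / p ^+ 2) = (eps + m * y ^+ 2) + (- (m * (2 * y * (k.+1%:R / p))))
   + (m * (k.+1%:R / p * (k.+2%:R / p))).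
  have -> : y = k%:R / p by rewrite hk mulrAC divff ?mul1r // gt_eqF.
  by rewrite -!natr1; field; rewrite gt_eqF.
rewrite hval -lee_fin -ig -abse_EFin.
have -> : ((wavg w p k - w y)%:E = \int[leb]_x ((w x - w y) * gamma_pdf p k x)%:E)%E.
  rewrite EFinD -[X in (_ + X)%E]mule1 -hD; apply: eq_integral => x _.
  by rewrite /= -EFinM -EFinD mulrBl mulNr.
have mm : measurable_fun (setT : set mR) (fun x => (w x - w y) * gamma_pdf p k x).
  apply: measurable_funM; last exact: measurable_gamma_pdf.
  by apply: measurable_funB => //; exact: measurable_cst.
apply: (le_trans (le_abse_integral _ measurableT _)); first exact/measurable_EFinP.
apply: ge0_le_integral => //.
- by apply: measurableT_comp => //; apply/measurable_EFinP.
- apply/measurable_EFinP; rewrite (funext gE); apply: measurable_funM; first exact: measurable_gamma_pdf.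
  apply: measurable_funD; first exact: measurable_cst.
  apply: measurable_funM; first exact: measurable_cst.
  by apply: measurable_funX; apply: measurable_funB; [exact: measurable_id|exact: measurable_cst].
move=> x _; rewrite abse_EFin lee_fin gE normrM (ger0_norm (gamma_pdf_ge0 _ _ (ltW p0))) mulrC.
rewrite ler_wpM2l ?gamma_pdf_ge0 ?(ltW p0) //.
have [h|h] := ltP `|x - y| d.
  by apply: (le_trans (hw _ h)); rewrite lerDl mulr_ge0 ?sqr_ge0.
apply: (@le_trans _ _ (2 * B)).
  by apply: (le_trans (ler_normB _ _)); rewrite mulr_natl mulr2n lerD.
apply: (@le_trans _ _ (m * (x - y) ^+ 2)); last by rewrite lerDr.
rewrite /m -!mulrA -[leLHS]mulr1 mulrA ler_wpM2l // ?mulr_ge0 // mulrC ler_pdivlMr ?exprn_gt0 //.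
by rewrite mul1r -[leRHS]real_normK ?num_real // lerXn2r ?nnegrE ?(ltW d0).
Qed.

End Concentration.

Section VolterraLimit.
Local Open Scope classical_set_scope.
Local Open Scope ring_scope.
Variable R : realType.
Local Notation mR := (measurableTypeR R).
Local Notation normc := (@normc R).
Variable s : R.
Hypothesis s01 : 0 < s < 1.
Variable w : R -> R.
Hypothesis mw : measurable_fun (setT : set mR) w.
Variable B : R.
Hypothesis wB : forall t, `|w t| <= B.
Hypothesis w0 : forall t, t <= 0 -> w t = 0.
Variables (v0 lam T : R).
Hypothesis lam0 : 0 < lam.
Hypothesis T0 : 0 < T.
Hypothesis volterra : forall t, 0 < t < T -> volterra_lhs s w v0 lam t = 0.

(** For [n <= k = r^2 p T] the Chernoff factor is at most [e^(-(1 - r)^2 p T) / r^2], which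
    beats the powers of [p] lost in [be_residual_bound]. *)
Lemma wavg_be_dev (r : R) : 0 < r < 1 -> exists2 K, 0 <= K &
  forall p k, 1 <= p -> (0 < k)%N -> k%:R = p * (r ^+ 2 * T) ->
  normc ((wavg w p k)%:C%C - v0%:C%C * be_dev s (lam * p `^ (s - 1)) k) <= K / p.
Proof.
move=> /andP[r0 r1].
have r01 : 0 < r <= 1 by rewrite r0 ltW.
have B0 : 0 <= B by exact: le_trans (wB 0).
set D := B + lam * (B + `|v0|).
have D0 : 0 <= D by rewrite addr_ge0 // mulr_ge0 ?addr_ge0 // ltW.
set eta := T * (1 - r) ^+ 2.
have eta0 : 0 < eta by rewrite mulr_gt0 // exprn_gt0 // subr_gt0.
pose K := 2 * expR 1 * lam^-1 * (T + 1) ^+ 2 * (r ^- 2 * D) * (4`!%:R / eta ^+ 4).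
have T1 : 0 <= T + 1 by rewrite addr_ge0 // ltW.
exists K.
  by rewrite /K !mulr_ge0 ?expR_ge0 ?invr_ge0 ?exprn_ge0 ?(ltW lam0) ?(ltW r0) ?(ltW eta0).
move=> p k p1 k0 hk.
have p0 : 0 < p by exact: lt_le_trans p1.
have nu0 : 0 < lam * p `^ (s - 1) by rewrite mulr_gt0 // powR_gt0.
pose eps := expR (- (eta * p)) * (r ^- 2) * (k.+1%:R * D).
have hres n : (n <= k)%N -> `|be_residual s (wavg w p) v0 (lam * p `^ (s - 1)) n| <= eps.
  move=> nk; apply: (le_trans (residual_bound s01 mw wB w0 lam0 T0 volterra n p0 r01 p1)).
  rewrite -/D /eps -[_ * n.+1%:R * D]mulrA; apply: ler_pM.
  - by rewrite !mulr_ge0 ?invr_ge0 ?expR_ge0 ?exprn_ge0 // ltW.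
  - by rewrite mulr_ge0.
  - rewrite -[leLHS]mulrA -invfM -exprSr -[(1 - r) * p * T]mulrA.
    have -> : expR (- (eta * p)) / r ^+ 2 = expR (- ((1 - r) * (p * T))) * (expR (k%:R * (r^-1 - 1)) / r ^+ 2).
      rewrite mulrA -expRD hk; congr (expR _ / _); rewrite /eta; field; exact: lt0r_neq0.
    rewrite ler_wpM2l ?expR_ge0 // expRM_natl.
    have h : r^-1 <= expR (r^-1 - 1) by rewrite -[leLHS](addrNK 1) addrC expR_ge1Dx.
    apply: (@le_trans _ _ (r^-1 ^+ k / r ^+ 2)).
      rewrite exprVn -invfM -exprD addnC lef_pV2 ?posrE ?exprn_gt0 //.
      by rewrite ler_wiXn2l ?(ltW r0) ?(ltW r1) // addnC addn2 !ltnS.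
    by rewrite ler_wpM2r ?invr_ge0 ?exprn_ge0 ?(ltW r0) // lerXn2r ?nnegrE ?expR_ge0 ?invr_ge0 ?(ltW r0).
  - by rewrite ler_wpM2r // ler_nat ltnS.
apply: (le_trans (be_residual_bound s01 nu0 k0 hres)).
have kp : k.+1%:R <= p * (T + 1).
  rewrite -natr1 hk mulrDr mulr1 lerD // ler_wpM2l ?(ltW p0) // ler_piMl ?(ltW T0) //.
  by rewrite exprn_ile1 ?(ltW r0) ?(ltW r1).
have nuV : (lam * p `^ (s - 1))^-1 <= lam^-1 * p.
  rewrite invfM ler_wpM2l ?invr_ge0 ?(ltW lam0) // -powRN -[leRHS]powRr1 ?(ltW p0) //.
  by rewrite ler_powR // opprB lerBlDr lerDl; case/andP: s01 => /ltW.
have ex : p ^+ 3 * expR (- (eta * p)) <= 4`!%:R / eta ^+ 4 / p.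
  have h : (eta * p) ^+ 4 / 4`!%:R <= expR (eta * p).
    have ep : 0 <= eta * p by rewrite mulr_ge0 ?(ltW eta0) ?(ltW p0).
    by apply: le_trans (expR_ge1Dxn 3 ep); rewrite lerDr ler01.
  rewrite expRN ler_pdivrMr ?expR_gt0 // mulrAC ler_pdivlMr // -exprSr.
  rewrite mulrAC ler_pdivlMr ?exprn_gt0 // mulrC -exprMn.
  by rewrite [leRHS]mulrC -ler_pdivrMr ?ltr0n ?fact_gt0.
rewrite /eps.
have -> : 2 * expR 1 * (lam * p `^ (s - 1))^-1 * k.+1%:R *
  (expR (- (eta * p)) / r ^+ 2 * (k.+1%:R * D)) = (2 * expR 1) * ((lam * p `^ (s - 1))^-1 * k.+1%:R ^+ 2) *
   ((r ^- 2 * D) * expR (- (eta * p))).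
  move: (expR 1) (expR (- _)) ((lam * _)^-1) (k.+1%:R : R) (r ^- 2) => a b c d e; ring.
have e0 : 0 <= r ^- 2 * D by rewrite mulr_ge0 // invr_ge0 exprn_ge0 // ltW.
have E0 : (0 : R) <= 2 * expR 1 by rewrite mulr_ge0 // expR_ge0.
have h5 : (lam * p `^ (s - 1))^-1 * k.+1%:R ^+ 2 <= (lam^-1 * p) * (p * (T + 1)) ^+ 2.
  by apply: ler_pM => //; [rewrite invr_ge0 ltW|rewrite lerXn2r ?nnegrE // (le_trans _ kp)].
have h6 := ler_wpM2r (mulr_ge0 e0 (expR_ge0 (- (eta * p)))) (ler_wpM2l E0 h5).
apply: (le_trans h6).
have -> : 2 * expR 1 * (lam^-1 * p * (p * (T + 1)) ^+ 2) * (r ^- 2 * D * expR (- (eta * p)))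
  = (2 * expR 1 * lam^-1 * (T + 1) ^+ 2 * (r ^- 2 * D)) * (p ^+ 3 * expR (- (eta * p))).
  move: (expR 1) (expR (- _)) (lam^-1) (r ^- 2) => a b c d; ring.
rewrite /K -[leRHS]mulrA; apply: ler_wpM2l; last exact: ex.
by rewrite !mulr_ge0 ?invr_ge0 ?exprn_ge0 ?(ltW lam0) ?expR_ge0 ?(ltW r0).
Qed.

End VolterraLimit.

(** * The Volterra equation of the scalar problem *)

Section Volterra.
Local Open Scope classical_set_scope.
Local Open Scope ring_scope.
Variable R : realType.
Local Notation leb := (@lebesgue_measure R).
Local Notation mR := (measurableTypeR R).

Lemma within_near (A : set R) (f : R -> R) t e : {within A, continuous f} -> A t -> 0 < e ->
  exists2 d, 0 < d & forall y, A y -> `|t - y| < d -> `|f t - f y| < e.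
Proof.
move=> cf At e0; have h := cf t.
have {}h : f x @[x --> within A (nbhs t)] --> f t.
  by rewrite (nbhs_subspace_in At); exact: h.
move/cvgrPdist_lt/(_ e e0): h; rewrite near_withinE => /nbhs_ballP [d /= d0 hd].
by exists d => // y Ay hy; apply: hd.
Qed.

Lemma is_derive_in_interior (T t l : R) (F : R -> R) : 0 < t < T ->
  is_derive_in `[0, T] F t l -> is_derive t (1 : R) F l.
Proof.
move=> /andP[t0 tT] h.
have lim : (fun h => h^-1 *: (F (h *: 1 + t) - F t)) @ 0^' --> l.
  apply/cvgrPdist_lt => e e0; move/cvgrPdist_lt/(_ e e0): h.
  rewrite !near_withinE => /nbhs_ballP [d /= d0 hd].
  apply/nbhs_ballP; exists (Num.min d (Num.min t (T - t))) => /=.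
    by rewrite !lt_min d0 t0 subr_gt0.
  move=> x; rewrite /ball /= sub0r normrN !lt_min => /andP[xd /andP[xt xT]] x0.
  have := hd (x + t); rewrite /ball /= [t - _](_ : _ = - x); last by ring.
  rewrite normrN => /(_ xd).
  have -> : x *: (1 : R) = x by rewrite /GRing.scale /= mulr1.
  rewrite (_ : x + t - t = x); last by ring.
  have ht : x + t != t by rewrite -subr_eq0 addrK.
  have hI : `[0, T]%classic (x + t).
    rewrite /= in_itv /=; move: xt xT; rewrite !ltr_norml => /andP[h1 h2] /andP[h3 h4].
    by apply/andP; split; lra.
  by move=> /(_ ht hI); rewrite mulrC.
split; first exact: (cvgP l lim).
exact: cvg_lim lim.
Qed.

Variables (alpha T : R).
Hypothesis ha : 0 < alpha < 1.
Hypothesis T0 : 0 < T.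
Variables (v : R -> R) (v0 lam : R).
Hypothesis lam0 : 0 < lam.
Hypothesis vc : {within `[0, T], continuous v}.
Hypothesis veq : forall t, 0 < t < T -> exists2 d,
  is_RLderive alpha T (fun xi => v xi - v0) t d & d + lam * v t = 0.

Let s := 1 - alpha.
Let s01 : 0 < s < 1. Proof. by case/andP: ha => h1 h2; rewrite /s subr_gt0 h2 gtrBl h1. Qed.

(** The equation is only known up to [T]; cutting there makes averages over the half line
    meaningful. *)
Definition wcut (t : R) : R := if 0 < t < T then v t - v0 else 0.

Lemma measurable_wcut : measurable_fun (setT : set mR) wcut.
Proof.
have h : measurable_fun (`]0, T[ : set mR) (fun t => v t - v0).
  have vi : {in `]0, T[, continuous v} by have /(continuous_within_itvP _ T0)[] := vc.
  apply: measurable_funB; last exact: measurable_cst.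
  by apply: open_continuous_measurable_fun => // x; rewrite inE /=; exact: vi.
have -> : wcut = (fun t => v t - v0) \_ `]0, T[.
  apply/funext => t; rewrite /wcut /patch.
  have -> : (t \in (`]0, T[%classic : set R)) = (0 < t < T) by apply/idP/idP; rewrite inE /= in_itv.
  by [].
by apply: (iffLR (measurable_restrictT _ _)) => //; exact: measurable_itv.
Qed.

Lemma wcut_bounded : exists B, forall t, `|wcut t| <= B.
Proof.
have [c1 _ h1] := EVT_max (ltW T0) vc; have [c2 _ h2] := EVT_min (ltW T0) vc.
exists (`|v c1| + `|v c2| + `|v0|) => t; rewrite /wcut; case: ifP => [/andP[t0 tT]|_]; last first.
  by rewrite normr0 !addr_ge0.
have ht : t \in `[0, T] by rewrite in_itv /= !ltW.
apply: (le_trans (ler_normB _ _)); rewrite lerD2r.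
have a1 := h1 _ ht; have a2 := h2 _ ht.
rewrite ler_norml; apply/andP; split.
  have b1 := normr_ge0 (v c1); have b2 := ler_norm (- v c2); rewrite normrN in b2; lra.
have b1 := normr_ge0 (v c2); have b2 := ler_norm (v c1); lra.
Qed.

Lemma wcut0 t : t <= 0 -> wcut t = 0.
Proof. by rewrite /wcut ltNge => ->. Qed.

Lemma solution_integrable : leb.-integrable `[0, T] (EFin \o v).
Proof. by apply: continuous_compact_integrable => //; exact: segment_compact. Qed.

Lemma volterra_lhsE t : 0 < t < T -> volterra_lhs s wcut v0 lam t =
  \int[leb]_(xi in `[0%R, t]) ((t - xi) `^ (- alpha) * (v xi - v0))
  + lam * Gamma s * \int[leb]_(xi in `[0%R, t]) v xi.
Proof.
move=> /andP[t0 tT]; have [B wB] := wcut_bounded.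
have sc : s - 1 = - alpha by rewrite /s; ring.
have [sp s1] := andP s01.
have c1 : 0 < s - 1 + 1 by rewrite subrK.
have c0 : s - 1 <= 0 by rewrite subr_le0 ltW.
have ic := conv_point_integrable measurable_wcut wB wcut0 c1 c0 t.
rewrite /volterra_lhs; congr (_ + _ * _).
  have e1 x : `]0, t]%classic x -> pos_powR (s - 1) (t - x) * wcut x = (t - x) `^ (- alpha) * (v x - v0).
    rewrite /= in_itv /= => /andP[x0 xt].
    rewrite /wcut x0 (le_lt_trans xt tT) /=; congr (_ * _).
    rewrite /pos_powR subr_gt0 sc; case: ltgtP xt => // -> _.
    by rewrite subrr powR0 // oppr_eq0; case/andP: ha => /gt_eqF ->.
  have ig : leb.-integrable `]0, t] (fun x => ((t - x) `^ (- alpha) * (v x - v0))%:E).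
    have h : leb.-integrable `]0, t] (fun x => (pos_powR (s - 1) (t - x) * wcut x)%:E).
      by apply: (integrableS _ _ _ ic).
    by apply: eq_integrable h => // x; rewrite inE => hx; rewrite e1.
  rewrite -Rintegral_itv_obnd_cbnd // [RHS]Rintegral_mkcond; apply: eq_Rintegral => x _.
  rewrite /patch; case: ifPn => [|hx]; first by rewrite inE => hx; exact: e1.
  have [x0|x0] := leP x 0; first by rewrite wcut0 // mulr0.
  have : ~~ (x <= t) by apply: contra hx => xt; rewrite inE /= in_itv /= x0.
  by rewrite -ltNge => tx; rewrite /pos_powR subr_gt0 ltNge (ltW tx) mul0r.
have i1 : leb.-integrable `[0, t] (EFin \o v).
  apply: (integrableS _ _ _ solution_integrable) => // x /=; rewrite !in_itv /= => /andP[-> xt].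
  by rewrite (le_trans xt) // ltW.
have i2 : leb.-integrable `]0, t] (EFin \o v).
  by apply: (integrableS _ _ _ i1) => // x /=; rewrite !in_itv /= => /andP[x0 ->]; rewrite ltW.
have i3 : leb.-integrable `]0, t[ (EFin \o v).
  by apply: (integrableS _ _ _ i2) => // x /=; rewrite !in_itv /= => /andP[-> x0]; rewrite ltW.
rewrite -Rintegral_itv_obnd_cbnd // -Rintegral_itv_bndo_bndc // [RHS]Rintegral_mkcond.
apply: eq_Rintegral => x _; rewrite /patch /pos_powR subr_gt0 /forced.
have -> : (x \in (`]0, t[%classic : set R)) = (0 < x < t) by apply/idP/idP; rewrite inE /= in_itv.
case: (ltP 0 x) => x0; last by rewrite /= mulr0.
case: (ltP x t) => xt; last by rewrite /= mul0r.
by rewrite /= powRr0 mul1r /wcut x0 (lt_trans xt tT) /= subrK.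
Qed.

Lemma volterra_derive t : 0 < t < T -> is_derive t (1 : R) (fun t =>
  \int[leb]_(xi in `[0%R, t]) ((t - xi) `^ (- alpha) * (v xi - v0))
  + lam * Gamma s * \int[leb]_(xi in `[0%R, t]) v xi) 0.
Proof.
move=> ht; have /andP[t0 tT] := ht.
have [d [l hl dE] hd] : exists2 d, is_RLderive alpha T (fun xi => v xi - v0) t d & d + lam * v t = 0.
  exact: veq.
have h1 := is_derive_in_interior ht hl.
have vi : {for t, continuous v}.
  by have /(continuous_within_itvP _ T0)[+ _ _] := vc; apply; rewrite in_itv /= t0.
have [d2 e2] := continuous_FTC1_closed tT solution_integrable t0 vi.
have h2 : is_derive t (1 : R) (fun t => \int[leb]_(xi in `[0%R, t]) v xi) (v t).
  by split; [exact: d2|rewrite -derive1E].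
have h := is_deriveD1 h1 (is_deriveM1 (is_derive_cst1 (lam * Gamma s) t) h2).
refine (is_derive_eq h _).
have G0 : 0 < Gamma s by exact: Gamma_s s01.
have -> : l = - (lam * Gamma s * v t).
  have : Gamma s * d = l by rewrite dE -/s mulrA divff ?mul1r // gt_eqF.
  move=> <-; have -> : d = - (lam * v t) by apply/eqP; rewrite -addr_eq0 hd.
  by ring.
by rewrite mul0r add0r addNr.
Qed.

(** The derivative vanishes inside [0, T], and both terms tend to 0 at time 0, where the bound
    on convolutions at a point excludes a singular part. *)
Lemma volterra_zero t : 0 < t < T -> volterra_lhs s wcut v0 lam t = 0.
Proof.
move=> ht; have /andP[t0 tT] := ht; have [B wB] := wcut_bounded.
have [sp s1] := andP s01.
have c1 : 0 < s - 1 + 1 by rewrite subrK.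
have c0 : s - 1 <= 0 by rewrite subr_le0 ltW.
have z1 : 0 < (0 : R) + 1 by rewrite add0r.
have B0 : 0 <= B by exact: le_trans (wB 0).
have cstG x : 0 < x <= t -> volterra_lhs s wcut v0 lam x = volterra_lhs s wcut v0 lam t.
  move=> /andP[x0 xt]; rewrite !volterra_lhsE ?x0 ?(le_lt_trans xt) ?t0 //.
  set G := (fun t => \int[leb]_(xi in `[0%R, t]) ((t - xi) `^ (- alpha) * (v xi - v0))
    + lam * Gamma s * \int[leb]_(xi in `[0%R, t]) v xi).
  have hd y : x <= y <= t -> is_derive y (1 : R) G 0.
    by move=> /andP[xy yt]; apply: volterra_derive; rewrite (lt_le_trans x0 xy) (le_lt_trans yt).
  have hc := is_derive_continuous_itv hd.
  have [|c _] := @MVT_segment R G (fun=> 0) x t xt _ hc.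
    by move=> y; rewrite in_itv /= => /andP[h1 h2]; apply: hd; rewrite !ltW.
  by rewrite mul0r => /eqP; rewrite subr_eq0 => /eqP e; exact: esym e.
set M := volterra_lhs s wcut v0 lam t in cstG *.
pose K1 := B * expR 1 * Gamma s; pose K2 := lam * Gamma s * ((B + `|v0|) * expR 1 * Gamma 1).
have bound x : 0 < x <= t -> `|M| <= K1 * x `^ s + K2 * x.
  move=> hx; rewrite -(cstG x hx); have /andP[x0 xt] := hx.
  rewrite /volterra_lhs; apply: (le_trans (ler_normD _ _)); apply: lerD.
    have := conv_point_bound measurable_wcut wB wcut0 c1 c0 x0; by rewrite subrK.
  rewrite normrM ger0_norm; last by rewrite mulr_ge0 ?(ltW (Gamma_s s01)) // ltW.
  have := conv_point_bound (measurable_forced measurable_wcut v0) (forced_le wB v0) (@forced0 R wcut v0) z1 (lexx 0) x0.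
  rewrite add0r powRr1 ?(ltW x0) // => h; rewrite /K2 -[leRHS]mulrA ler_wpM2l //.
  by rewrite mulr_ge0 ?(ltW (Gamma_s s01)) // ltW.
have lim : (K1 * x `^ s + K2 * x) @[x --> 0^'+] --> (0 : R).
  have l1 : K1 * x `^ s @[x --> 0^'+] --> (0 : R).
    rewrite -[X in _ --> X](mulr0 K1).
    by apply: (cvgM (cvg_cst K1)); exact: (powR_cvg0 sp).
  have l2 : K2 * x @[x --> 0^'+] --> (0 : R).
    rewrite -[X in _ --> X](mulr0 K2); apply: (cvgM (cvg_cst K2)).
    exact: (cvg_at_right_filter (f := id) cvg_id).
  by rewrite -[X in _ --> X](addr0 (0 : R)); exact: (cvgD l1 l2).
apply/normr0_eq0/eqP; rewrite eq_le normr_ge0 andbT.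
rewrite -(cvg_lim _ lim) //; apply: limr_ge; first by apply/cvg_ex; exists 0.
near=> x; apply: bound; apply/andP; split; first by near: x; exact: nbhs_right_gt.
by near: x; exact: nbhs_right_le.
Unshelve. all: by end_near.
Qed.

End Volterra.

(** * Error of the scalar scheme *)

Section ScalarLimit.
Local Open Scope classical_set_scope.
Local Open Scope ring_scope.
Variable R : realType.
Local Notation mR := (measurableTypeR R).
Local Notation normc := (@normc R).
Variable s : R.
Hypothesis s01 : 0 < s < 1.

(** At index [k = n 2^j] the halved scheme is close to backward Euler, backward Euler to the
    average of [w] of index [k], and this average to the value of [w], with errors that tend
    to 0 as [j] grows; only the error of the halvings remains. *)
Lemma scalar_limit : exists2 K, 0 <= K &
  forall (w : R -> R) (B v0 lam t r : R) n, measurable_fun (setT : set mR) w ->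
  (forall x, `|w x| <= B) -> (forall x, x <= 0 -> w x = 0) -> 0 < lam -> 0 < t ->
  (forall x, 0 < x < t -> volterra_lhs s w v0 lam x = 0) ->
  0 < r < 1 -> {for r ^+ 2 * t, continuous w} -> (0 < n)%N ->
  normc ((w (r ^+ 2 * t))%:C%C - v0%:C%C * sbd_dev s (lam * (r ^+ 2 * t / n%:R) `^ (1 - s)) n) * n%:R ^+ 2 <= K * `|v0|.
Proof.
have [K2 [K20 hK2]] := sbd_be_close s01; have [K3 [K30 hK3]] := sbd_halvings s01.
exists K3 => // w B v0 lam t r n mw wB w0 lam0 t0 volt /[dup] hr /andP[r0 r1] wc n0.
have [K1 K10 hK1] := wavg_be_dev s01 mw wB w0 lam0 t0 volt hr.
have nR : 0 < n%:R :> R by rewrite ltr0n.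
set y := r ^+ 2 * t in wc *; have y0 : 0 < y by rewrite mulr_gt0 // exprn_gt0.
rewrite -/y in hK1; clearbody y.
set mu := lam * (y / n%:R) `^ (1 - s).
have mu0 : 0 < mu by rewrite mulr_gt0 // powR_gt0 // divr_gt0.
have B0 : 0 <= B by exact: le_trans (wB 0).
apply/ler_addgt0Pl => e e0.
set n2 := n%:R ^+ 2; have n20 : 0 < n2 by rewrite exprn_gt0.
pose e1 := e / n2 / 4; have e10 : 0 < e1 by rewrite !divr_gt0.
have [d d0 hd] : exists2 d, 0 < d & forall x, `|x - y| < d -> `|w x - w y| <= e1.
  move/cvgrPdist_lt/(_ e1 e10): wc => /nbhs_ballP [d /= d0 hd].
  by exists d => // x hx; rewrite distrC ltW //; apply: hd; rewrite /ball /= distrC.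
pose c2 := 2 * B / d ^+ 2; have c20 : 0 <= c2 by rewrite /c2 divr_ge0 ?sqr_ge0 ?mulr_ge0.
(* Rates [p >= M] make the variance term and both comparison errors at most [e1]. *)
pose M := 1 + c2 * (y + 2) / e1 + K1 / e1 + `|v0| * K2 / (e1 * y).
have [j hj] : exists j : nat, M <= 2 ^+ j * (n%:R / y).
  exists (Num.truncn (M * (y / n%:R))); set q := Num.truncn _.
  have h1 : M * (y / n%:R) <= q.+1%:R by apply/ltW/truncnS_gt.
  have h2 : (q.+1%:R : R) <= 2 ^+ q by rewrite -natrX ler_nat ltn_expl.
  have -> : M = M * (y / n%:R) * (n%:R / y).
    by field; rewrite !gt_eqF.
  by rewrite ler_wpM2r ?divr_ge0 ?(ltW y0) // (le_trans h1).
set p := 2 ^+ j * (n%:R / y) in hj; pose k := (n * 2 ^ j)%N.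
have k0 : (0 < k)%N by rewrite muln_gt0 n0 expn_gt0.
have hk : k%:R = p * y.
  by rewrite /k /p natrM natrX; field; rewrite gt_eqF.
have s1 : 0 <= c2 * (y + 2) / e1.
  by rewrite divr_ge0 ?(ltW e10) // mulr_ge0 // addr_ge0 // ltW.
have s2 : 0 <= K1 / e1 by rewrite divr_ge0 // ltW.
have s3 : 0 <= `|v0| * K2 / (e1 * y) by apply: divr_ge0; apply: mulr_ge0 => //; apply: ltW.
have p1 : 1 <= p by apply: le_trans hj; rewrite /M; lra.
have p0 : 0 < p by exact: lt_le_trans p1.
have b1 : c2 * (y + 2) / e1 <= p by apply: le_trans hj; rewrite /M; lra.
have b2 : K1 / e1 <= p by apply: le_trans hj; rewrite /M; lra.
have b3 : `|v0| * K2 / (e1 * y) <= p by apply: le_trans hj; rewrite /M; lra.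
set nu := lam * p `^ (s - 1).
have nu0 : 0 < nu by rewrite mulr_gt0 // powR_gt0.
have nuE : nu = mu / (2 * 2 `^ (- s)) ^+ j.
  rewrite /nu /mu -mulrA; congr (_ * _).
  have two : (2 : R) * 2 `^ (- s) = 2 `^ (1 - s).
    by rewrite powRD ?pnatr_eq0 ?implybT // powRr1.
  rewrite two -[X in _ / X]powR_mulrn ?powR_ge0 // -powRrM [(1 - s) * _]mulrC powRrM powR_mulrn //.
  rewrite /p; have -> : s - 1 = - (1 - s) by ring.
  have pM : (2 ^+ j * (n%:R / y)) `^ (1 - s) = (2 ^+ j) `^ (1 - s) * (n%:R / y) `^ (1 - s).
    by rewrite powRM // ?exprn_ge0 // divr_ge0 // ltW.
  rewrite powRN pM invfM [LHS]mulrC; congr (_ * _).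
  by rewrite -powRN -[n%:R / y]invrK invf_div -powR_inv1 ?divr_ge0 ?(ltW y0) // -powRrM mulrNN mul1r.
have a1 : `|wavg w p k - w y| <= e1 + e1.
  apply: (le_trans (wavg_concentration mw wB p0 d0 (ltW e10) (wB y) hd hk)); rewrite lerD2l -/c2.
  have : k.+2%:R / p ^+ 2 <= (y + 2) / p.
    rewrite -addn2 natrD hk ler_pdivrMr ?exprn_gt0 // expr2 mulrA divfK ?gt_eqF //.
    by rewrite mulrDl [p * y]mulrC lerD2l ler_peMr.
  move=> /(ler_wpM2l c20) h; apply: (le_trans h).
  by rewrite mulrA ler_pdivrMr // [leRHS]mulrC -ler_pdivrMr.
have a2 := hK1 p k p1 k0 hk; rewrite -/nu in a2.
have a2' : K1 / p <= e1 by rewrite ler_pdivrMr // mulrC -ler_pdivrMr.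
have a3 : `|v0| * normc (sbd_dev s nu k - be_dev s nu k) <= e1.
  have kR : 0 < k%:R :> R by rewrite ltr0n.
  have h := hK2 nu nu0 k k0; rewrite -ler_pdivlMr // in h.
  apply: (le_trans (ler_wpM2l (normr_ge0 v0) h)); rewrite mulrA ler_pdivrMr // hk.
  by move: b3; rewrite (ler_pdivrMr _ _ (mulr_gt0 e10 y0)) => b3; apply: (le_trans b3); rewrite le_eqVlt; apply/orP; left; apply/eqP; ring.
have a4 := hK3 mu n j mu0 n0; rewrite -nuE -/k in a4.
have tri : normc ((w y)%:C%C - v0%:C%C * sbd_dev s mu n) <=
    `|wavg w p k - w y| + normc ((wavg w p k)%:C%C - v0%:C%C * be_dev s nu k) +
    `|v0| * normc (sbd_dev s nu k - be_dev s nu k) + `|v0| * normc (sbd_dev s mu n - sbd_dev s nu k).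
  have -> : (w y)%:C%C - v0%:C%C * sbd_dev s mu n = - ((wavg w p k - w y)%:C%C) +
     ((wavg w p k)%:C%C - v0%:C%C * be_dev s nu k) + - (v0%:C%C * (sbd_dev s nu k - be_dev s nu k)) +
     - (v0%:C%C * (sbd_dev s mu n - sbd_dev s nu k)).
    by rewrite rmorphB /=; ring.
  apply: (le_trans (le_normcD _ _)); apply: lerD; last by rewrite normcN normcM normc_real.
  apply: (le_trans (le_normcD _ _)); apply: lerD; last by rewrite normcN normcM normc_real.
  by apply: (le_trans (le_normcD _ _)); apply: lerD; rewrite // normcN normc_real.
have a4' : `|v0| * normc (sbd_dev s mu n - sbd_dev s nu k) * n2 <= K3 * `|v0|.
  by rewrite -mulrA [leRHS]mulrC ler_wpM2l.
have sum4 : e1 + e1 + e1 + e1 = e / n2 by rewrite /e1; field; rewrite gt_eqF.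
have tri2 : normc ((w y)%:C%C - v0%:C%C * sbd_dev s mu n) <= e / n2 + `|v0| * normc (sbd_dev s mu n - sbd_dev s nu k).
  apply: (le_trans tri); rewrite lerD2r -sum4.
  apply: lerD => //; apply: lerD => //; exact: le_trans a2 a2'.
apply: (le_trans (ler_wpM2r (ltW n20) tri2)); rewrite mulrDl divfK ?gt_eqF //.
by rewrite lerD2l.
Qed.

End ScalarLimit.

Section ScalarTheorem.
Local Open Scope classical_set_scope.
Local Open Scope ring_scope.
Variable R : realType.
Local Notation normc := (@normc R).
Variable alpha : R.
Hypothesis ha : 0 < alpha < 1.

(** The bound holds at the times [r^2 t_n] with [r < 1]; both sides are continuous as [r]
    tends to 1. *)
Theorem scalar_error : exists2 K, 0 <= K &
  forall (T : R) (v : R -> R) (v0 lam tau : R) (n : nat), 0 < T ->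
  {within `[0, T], continuous v} ->
  (forall t, 0 < t < T -> exists2 d, is_RLderive alpha T (fun xi => v xi - v0) t d & d + lam * v t = 0) ->
  0 < lam -> 0 < tau -> (0 < n)%N -> n%:R * tau <= T ->
  normc ((v (n%:R * tau) - v0)%:C%C - v0%:C%C * sbd_dev (1 - alpha) (lam * tau `^ alpha) n) * n%:R ^+ 2 <= K * `|v0|.
Proof.
have s01 : 0 < 1 - alpha < 1 by case/andP: ha => h1 h2; rewrite subr_gt0 h2 gtrBl h1.
have [a0 _] := andP ha.
have [K K0 hK] := scalar_limit s01; exists K => // T v v0 lam tau n T0 vc veq lam0 tau0 n0 nT.
have nR : 0 < n%:R :> R by rewrite ltr0n.
set t := n%:R * tau; have t0 : 0 < t by rewrite mulr_gt0.
have [B wB] := wcut_bounded T0 v0 vc.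
set s := 1 - alpha in s01 hK *.
have key r : 0 < r < 1 -> normc ((v (r ^+ 2 * t) - v0)%:C%C - v0%:C%C * sbd_dev s (lam * (r ^+ 2 * tau) `^ alpha) n) * n%:R ^+ 2 <= K * `|v0|.
  move=> hr; have /andP[r0 r1] := hr.
  have yt : r ^+ 2 * t < t by rewrite gtr_pMl // exprn_ilt1 // ltW.
  have y0 : 0 < r ^+ 2 * t by rewrite mulr_gt0 // exprn_gt0.
  have hw : wcut T v v0 (r ^+ 2 * t) = v (r ^+ 2 * t) - v0 by rewrite /wcut y0 (lt_le_trans yt).
  have := hK (wcut T v v0) B v0 lam t r n (measurable_wcut T0 v0 vc) wB (wcut0 T v v0) lam0 t0.
  rewrite hw (_ : r ^+ 2 * t / n%:R = r ^+ 2 * tau); last by rewrite /t; field; rewrite gt_eqF.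
  rewrite (_ : 1 - s = alpha); last by rewrite /s; ring.
  apply => //.
    by move=> x /andP[x0 xt]; apply: (volterra_zero ha T0 lam0 vc veq); rewrite x0 (lt_le_trans xt).
  have vi : {for r ^+ 2 * t, continuous v}.
    by have /(continuous_within_itvP _ T0)[+ _ _] := vc; apply; rewrite in_itv /= y0 (lt_le_trans yt).
  have hv : {for r ^+ 2 * t, continuous (fun x => v x - v0)} by apply: cvgB => //; exact: cvg_cst.
  move=> A; rewrite hw => /hv h.
  have hI : \forall x \near r ^+ 2 * t, 0 < x < T.
    near=> x; apply/andP; split; first by near: x; exact: lt_nbhsr.
    by near: x; apply: lt_nbhsl; exact: lt_le_trans yt _.
  by refine (filterS2 _ _ hI h) => x hx hA; rewrite /= /wcut hx.
set mu := lam * tau `^ alpha.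
have mu0 : 0 < mu by rewrite mulr_gt0 // powR_gt0.
have [G [G0 hG]] := sbd_dev_lipschitz s01 n mu0.
apply/ler_addgt0Pl => e e0.
set n2 := n%:R ^+ 2; have n20 : 0 < n2 by rewrite exprn_gt0.
pose e1 := e / n2 / 2; have e10 : 0 < e1 by rewrite !divr_gt0.
have tI : `[0, T]%classic t by rewrite /= in_itv /= (ltW t0).
have [d d0 hd] := within_near vc tI e10.
pose e2 := e1 / ((`|v0| * G + 1) * mu).
have vG0 : 0 < (`|v0| * G + 1) by rewrite ltr_pwDr // mulr_ge0.
have e20 : 0 < e2 by rewrite divr_gt0 // mulr_gt0.
(* The time and the parameter are both contracted by powers of [1 - q]. *)
pose q := Num.min (2^-1) (Num.min (d / t / 2) e2).
have q0 : 0 < q by rewrite !lt_min invr_gt0 ltr0n e20 andbT /= !divr_gt0.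
have q1 : q <= 2^-1 by rewrite ge_min lexx.
have q2 : q <= d / t / 2 by rewrite !ge_min lexx orbT.
have q3 : q <= e2 by rewrite !ge_min lexx !orbT.
have qlt : q < 1 by apply: le_lt_trans q1 _; rewrite invf_lt1 // ltr1n.
pose r := Num.sqrt (1 - q).
have r2 : r ^+ 2 = 1 - q by rewrite sqr_sqrtr // subr_ge0 ltW.
have hr : 0 < r < 1.
  rewrite sqrtr_gt0 subr_gt0 qlt /= -[ltRHS]sqrtr1 ltr_sqrt //.
  by rewrite gtrBl.
have := key r hr; rewrite r2 => h.
have hv : `|v t - v ((1 - q) * t)| < e1.
  apply: hd.
    rewrite /= in_itv /=; apply/andP; split.
      by apply: mulr_ge0 (ltW t0); rewrite subr_ge0 ltW.
    by apply: le_trans nT; rewrite ler_piMl ?(ltW t0) // gerBl ltW.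
  rewrite (_ : t - (1 - q) * t = q * t); last by ring.
  rewrite (ger0_norm (mulr_ge0 (ltW q0) (ltW t0))).
  apply: (@le_lt_trans _ _ (d / 2)).
    by move: q2; rewrite mulrAC ler_pdivlMr.
  by rewrite ltr_pdivrMr // ltr_pMr // ltr1n.
set mu' := lam * ((1 - q) * tau) `^ alpha in h.
have pq : ((1 - q) : R) <= (1 - q) `^ alpha.
  have q1' : 0 <= 1 - q by rewrite subr_ge0 ltW.
  rewrite -[leLHS]powRr1 //; apply: ger_powR; last by case/andP: ha => _ /ltW.
  by rewrite subr_gt0 qlt gerBl ltW.
have pq1 : (1 - q) `^ alpha <= 1.
  have E1 : (1 : R) = 1 `^ alpha by rewrite powR1.
  by rewrite [leRHS]E1 ge0_ler_powR ?nnegrE ?(ltW a0) ?subr_ge0 ?(ltW qlt) // gerBl ltW.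
have muE : mu' = (1 - q) `^ alpha * mu.
  by rewrite /mu' /mu powRM ?subr_ge0 ?(ltW qlt) ?(ltW tau0) // mulrCA.
have hm1 : mu / 2 <= mu'.
  rewrite muE mulrC ler_wpM2r ?(ltW mu0) //; apply: le_trans pq.
  by rewrite lerBrDr -lerBrDl; apply: (le_trans q1); rewrite le_eqVlt; apply/orP; left; apply/eqP; field.
have hm2 : `|mu - mu'| <= q * mu.
  rewrite muE -{1}[mu]mul1r -mulrBl normrM (ger0_norm (ltW mu0)) ler_wpM2r ?(ltW mu0) //.
  by rewrite ger0_norm ?subr_ge0 // lerBlDr -lerBlDl.
have hs := hG mu' hm1.
have a2 : `|v0| * normc (sbd_dev s mu n - sbd_dev s mu' n) <= e1.
  apply: (@le_trans _ _ (`|v0| * (G * (q * mu)))).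
    by rewrite ler_wpM2l // (le_trans hs) // ler_wpM2l.
  rewrite [leLHS](_ : _ = (`|v0| * G) * mu * q); last by ring.
  apply: (@le_trans _ _ ((`|v0| * G + 1) * mu * q)).
    by rewrite ler_wpM2r ?(ltW q0) // ler_wpM2r ?(ltW mu0) // lerDl.
  by rewrite mulrC -ler_pdivlMr // mulr_gt0.
have tri : normc ((v t - v0)%:C%C - v0%:C%C * sbd_dev s mu n) <=
   e1 + e1 + normc ((v ((1 - q) * t) - v0)%:C%C - v0%:C%C * sbd_dev s mu' n).
  have -> : (v t - v0)%:C%C - v0%:C%C * sbd_dev s mu n = (v t - v ((1 - q) * t))%:C%C +
     - (v0%:C%C * (sbd_dev s mu n - sbd_dev s mu' n)) +
     ((v ((1 - q) * t) - v0)%:C%C - v0%:C%C * sbd_dev s mu' n).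
    by rewrite !rmorphB /=; ring.
  apply: (le_trans (le_normcD _ _)); rewrite lerD2r.
  apply: (le_trans (le_normcD _ _)); apply: lerD; first by rewrite normc_real; exact: ltW hv.
  by rewrite normcN normcM normc_real.
have ee : e1 + e1 = e / n2 by rewrite /e1; field; rewrite gt_eqF.
rewrite ee in tri.
apply: (le_trans (ler_wpM2r (ltW n20) tri)); rewrite mulrDl divfK ?gt_eqF //.
by rewrite lerD2l.
Unshelve. all: by end_near.
Qed.

End ScalarTheorem.

(** * The weights and the scalar scheme *)

Section PowerSeriesUniqueness.
Local Open Scope classical_set_scope.
Local Open Scope ring_scope.
Variable R : realType.

(** After division by [x^m], the first coefficient that could be nonzero is of order [x]. *)
Lemma power_series_eq0 (c : nat -> R) :
  (forall x, `|x| < 1 -> series (fun k => c k * x ^+ k) @ \oo --> (0 : R)) -> forall k, c k = 0.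
Proof.
move=> hc.
have [M M0 hM] : exists2 M, 0 <= M & forall k, `|c k| <= M * 2 ^+ k.
  have h2 : `|2^-1 : R| < 1 by rewrite ger0_norm ?invr_ge0 // invf_lt1 // ltr1n.
  have /cvg_seq_bounded : cvgn (fun k => c k * 2^-1 ^+ k).
    by apply/cvg_ex; exists 0; apply: cvg_series_cvg_0; apply/cvg_ex; exists 0; exact: hc h2.
  move=> /pinfty_ex_gt0[M M0 hM]; exists M; first exact: ltW.
  move=> k; have := hM k I; rewrite /= normrM exprVn normfV [`|2 ^+ k|]ger0_norm ?exprn_ge0 //.
  by rewrite ler_pdivrMr ?exprn_gt0.
elim/ltn_ind => m IH.
have bound x : 0 < x <= 4^-1 -> `|c m| <= 2 * M * 2 ^+ m.+1 * x.
  move=> /andP[x0 x4].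
  have x1 : `|x| < 1 by rewrite ger0_norm ?(ltW x0) // (le_lt_trans x4) // invf_lt1 // ltr1n.
  have h := hc x x1; have xx0 := ltW x0.
  have part N : `|c m * x ^+ m| <= `|series (fun k => c k * x ^+ k) (m.+1 + N)%N| + 2 * M * (2 * x) ^+ m.+1.
    rewrite seriesEord /= big_split_ord /= big_ord_recr /= big1 ?add0r; last first.
      by move=> i _; rewrite IH ?mul0r.
    set S := \sum_(i < N) _.
    have hS : `|S| <= 2 * M * (2 * x) ^+ m.+1.
      have hs n : \sum_(i < n) (2^-1 : R) ^+ i <= 2 - 2 * 2^-1 ^+ n.
        elim: n => [|n IHn]; first by rewrite big_ord0 expr0; lra.
        rewrite big_ord_recr /= exprS; move: IHn; move: (\sum_(i < n) _) (2^-1 ^+ n) => a b; lra.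
      apply: (le_trans (ler_norm_sum _ _ _)).
      apply: (@le_trans _ _ (\sum_(i < N) M * (2 * x) ^+ m.+1 * 2^-1 ^+ i)).
        apply: ler_sum => i _; rewrite normrM [`|x ^+ _|]ger0_norm ?exprn_ge0 //.
        apply: (le_trans (ler_wpM2r _ (hM _))); first by rewrite exprn_ge0.
        rewrite -!mulrA ler_wpM2l // -exprMn exprD ler_wpM2l ?exprn_ge0 ?mulr_ge0 //.
        rewrite lerXn2r ?nnegrE ?mulr_ge0 ?invr_ge0 //.
        by rewrite mulrC -ler_pdivlMr // -invfM -natrM.
      rewrite -big_distrr /= [leRHS](_ : _ = M * (2 * x) ^+ m.+1 * 2); last by ring.
      rewrite ler_wpM2l ?mulr_ge0 ?exprn_ge0 ?mulr_ge0 //.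
      by apply: (le_trans (hs N)); rewrite gerBl mulr_ge0 // exprn_ge0 // invr_ge0.
    have h0 : `|c m * x ^+ m| <= `|c m * x ^+ m + S| + `|S|.
      by rewrite -{1}[c m * x ^+ m](addrK S) ler_normB.
    by apply: (le_trans h0); rewrite lerD2l.
  have h2 : `|c m * x ^+ m| <= 2 * M * (2 * x) ^+ m.+1.
    apply/ler_addgt0Pl => e e0.
    move/cvgrPdist_lt/(_ e e0): h => [N _ hN].
    have := hN (m.+1 + N)%N (leq_addl _ _); rewrite sub0r normrN => hh.
    by apply: (le_trans (part N)); rewrite lerD2r ltW.
  move: h2; rewrite normrM [`|x ^+ m|]ger0_norm ?exprn_ge0 // exprMn => h2.
  rewrite -(ler_pM2r (exprn_gt0 m x0)); apply: (le_trans h2).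
  rewrite le_eqVlt; apply/orP; left; apply/eqP; rewrite !exprS; ring.
apply/eqP; rewrite -normr_le0; apply/ler_addgt0Pl => e e0; rewrite addr0.
set K := 2 * M * 2 ^+ m.+1 in bound.
have K0 : 0 <= K by rewrite /K mulr_ge0 ?exprn_ge0 // mulr_ge0.
have K1 : 0 < K + 1 by rewrite ltr_pwDr.
pose x := Num.min 4^-1 (e / (K + 1)).
have x0 : 0 < x by rewrite lt_min invr_gt0 ltr0n divr_gt0.
have x4 : x <= 4^-1 by rewrite ge_min lexx.
have xe : x <= e / (K + 1) by rewrite ge_min lexx orbT.
apply: (le_trans (bound x _)); first by rewrite x0.
apply: (@le_trans _ _ ((K + 1) * x)); first by rewrite ler_wpM2r ?(ltW x0) // lerDl.
by rewrite mulrC -ler_pdivlMr.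
Qed.

End PowerSeriesUniqueness.

Section DiscreteScalar.
Local Open Scope classical_set_scope.
Local Open Scope ring_scope.
Variable R : realType.
Local Notation C := (R[i]).
Local Notation x := (fpsX C).
Variable alpha : R.
Hypothesis ha : 0 < alpha < 1.
Let s := 1 - alpha.
Let s01 : 0 < s < 1. Proof. by case/andP: ha => h1 h2; rewrite /s subr_gt0 h2 gtrBl h1. Qed.

(** The coefficients of [delta_pow], as real numbers. *)
Definition delta_coef (n : nat) : R :=
  \sum_(i < n.+1) binom_coef s i * ((3 / 2) `^ (- s) * (3^-1 ^+ (n - i) * binom_coef s (n - i))).

Lemma delta_coefE n : delta_pow s n = (delta_coef n)%:C%C.
Proof.
rewrite /delta_pow fpsME /delta_coef rmorph_sum; apply: eq_bigr => i _.
rewrite /phi3 fpsCM /binser3 /binser /kap !rmorphM rmorphXn /= fmorphV rmorph_nat; by [].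
Qed.

Lemma delta_series (xi : R) : `|xi| < 1 ->
  series (fun k => delta_coef k * xi ^+ k) @ \oo --> (1 - xi) `^ (- s) * ((3 - xi) / 2) `^ (- s).
Proof.
move=> xi1; have x1 : normc xi%:C%C < 1 by rewrite normc_real.
move: (xi1); rewrite ltr_norml => /andP[l1 l2].
have hc := ev_cvg x1 (indisc_delta_pow s01).
have e : ev xi%:C%C (delta_pow s) = ((1 - xi) `^ (- s) * ((3 - xi) / 2) `^ (- s))%:C%C.
  rewrite ev_delta_pow // (_ : 1 - xi%:C%C = (1 - xi)%:C%C); last by rewrite rmorphB.
  rewrite (_ : (3 - xi%:C%C) / 2 = ((3 - xi) / 2)%:C%C); last by rewrite rmorphM rmorphB fmorphV /= !rmorph_nat.
  rewrite !cpow_real ?rmorphM ?subr_gt0 // divr_gt0 // subr_gt0; apply: lt_trans l2 _; by rewrite ltr1n.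
rewrite e in hc; apply/cvgrPdist_lt => d d0.
move/cvgrPdist_lt/(_ d d0): hc; apply: filterS => N; rewrite sub0r normrN ger0_norm ?normc_ge0 //.
apply: le_lt_trans; rewrite distrC.
rewrite (_ : series _ _ - _ = complex.Re (\sum_(n < N) delta_pow s n * xi%:C%C ^+ n -
   ((1 - xi) `^ (- s) * ((3 - xi) / 2) `^ (- s))%:C%C)); first exact: normc_Re.
rewrite seriesEord /= cReD cReN cRe_sum; congr (_ - _); apply: eq_bigr => i _.
by rewrite delta_coefE -rmorphXn -rmorphM.
Qed.

Lemma sbd_weightsE (tau : R) (g : nat -> R) : 0 < tau -> sbd_weights alpha tau g ->
  forall k, g k = tau `^ s * delta_coef k.
Proof.
move=> tau0 hg k; apply/eqP; rewrite -subr_eq0; apply/eqP.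
apply: (@power_series_eq0 _ (fun k => g k - tau `^ s * delta_coef k)) => xi xi1.
have h1 := hg xi xi1; have h2 := delta_series xi1.
have /andP[l1 l2] : - 1 < xi < 1 by rewrite -ltr_norml.
have e : (((1 - xi) + (1 - xi) ^+ 2 / 2) / tau) `^ (alpha - 1) =
    tau `^ s * ((1 - xi) `^ (- s) * ((3 - xi) / 2) `^ (- s)).
  have -> : (1 - xi) + (1 - xi) ^+ 2 / 2 = (1 - xi) * ((3 - xi) / 2) by field.
  have p1 : 0 <= 1 - xi by rewrite subr_ge0 ltW.
  have p2 : 0 <= (3 - xi) / 2 by rewrite divr_ge0 // subr_ge0 ltW // (lt_trans l2) // ltr1n.
  have -> : alpha - 1 = - s by rewrite /s; ring.
  rewrite (powRM _ (mulr_ge0 p1 p2)) ?invr_ge0 ?(ltW tau0) // (powRM _ p1 p2) mulrC; congr (_ * _).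
  by rewrite -powR_inv1 ?(ltW tau0) // -powRrM mulrNN mul1r.
rewrite e in h1.
have h3 := cvgB h1 (cvgM (cvg_cst (tau `^ s)) h2); rewrite subrr in h3.
rewrite (_ : series _ = fun N => series (fun k => g k * xi ^+ k) N -
  tau `^ s * series (fun k => delta_coef k * xi ^+ k) N); first exact: h3.
apply/funext => N; rewrite /= !seriesEord /= big_distrr /= -sumrB; apply: eq_bigr => i _; ring.
Qed.

Lemma fps_div_unique_le (q f f' : fps C) L : q 0%N != 0 ->
  (forall n, (n <= L)%N -> (q * f) n = (q * f') n) -> forall n, (n <= L)%N -> f n = f' n.
Proof.
move=> q0 h; elim/ltn_ind => n IH nL; have := h n nL.
rewrite !fpsME !big_ord_recl /= !subn0 => e.
have es : \sum_(i < n) q (bump 0 i) * f (n - bump 0 i)%N = \sum_(i < n) q (bump 0 i) * f' (n - bump 0 i)%N.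
  apply: eq_bigr => i _; rewrite IH //; first by rewrite /bump /= add1n ltn_subrL (leq_ltn_trans _ (ltn_ord i)).
  exact: leq_trans (leq_subr _ _) nL.
by move: e; rewrite es => /addIr; exact: mulfI.
Qed.

(** The weights carry a factor [tau^(1 - alpha)]; multiplying the scheme by [tau^alpha]
    removes [tau] up to the parameter [mu].  Causality restricts the comparison to indices
    up to [L]. *)
Lemma sbd_scheme_dev (tau lam v0 : R) (g : nat -> R) (U : int -> R) (L : nat) :
  0 < tau -> 0 <= lam -> sbd_weights alpha tau g -> U (-1) = v0 -> U 0 = v0 ->
  (forall n : nat, (1 <= n <= L)%N ->
     tau^-1 * (\sum_(0 <= k < n) g k * (U (n%:Z - k%:Z) - v0)
               - \sum_(0 <= k < n.-1) g k * (U (n%:Z - 1 - k%:Z) - v0))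
     + 4^-1 * (lam * (3 * U n%:Z + U (n%:Z - 2))) = 0) ->
  forall n, (n <= L)%N -> (U n%:Z - v0)%:C%C = v0%:C%C * sbd_dev s (lam * tau `^ alpha) n.
Proof.
move=> tau0 lam0 hg Um1 U0 hU.
set mu := lam * tau `^ alpha.
have mu0 : 0 <= mu by rewrite mulr_ge0 ?powR_ge0.
pose V : fps C := fun n => (U n%:Z - v0)%:C%C.
pose E n := \sum_(0 <= k < n) delta_coef k * (U (n%:Z - k%:Z) - v0).
have DV n : (delta_pow s * V) n = (E n)%:C%C.
  rewrite fpsME big_ord_recr /= {2}/V subnn U0 subrr mulr0 addr0 /E big_mkord rmorph_sum.
  apply: eq_bigr => i _; rewrite delta_coefE /V rmorphM /=; congr (_ * (U _ - _)%:C%C).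
  by rewrite subzn // ltnW.
have symV : sbd_sym s mu * V = (1 - x) * (delta_pow s * V) +
    fpsC mu%:C%C * (fpsC 4^-1 * (fpsC 3%:R * V + x * (x * V))).
  by rewrite /sbd_sym /bsym /gsym fpsCn; ring.
have eqs n : (n <= L)%N -> (sbd_sym s mu * V) n = (sbd_sym s mu * (fpsC v0%:C%C * sbd_dev s mu)) n.
  move=> nL; rewrite [RHS](_ : _ = (fpsC v0%:C%C * (fpsC (- mu%:C%C) * (x * geom R))) n); last first.
    by rewrite mulrCA (sbd_devP s mu0).
  rewrite !fpsCM fpsXM symV mulrBl mul1r fpsDE fpsBE fpsXM !fpsCM fpsDE fpsCM !fpsXM.
  case: n nL => [|n] nL.
    by rewrite DV /E big_geq // /V U0 subrr !(addr0, subr0, mulr0) subrr rmorph0 !mulr0 addr0.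
  have := hU n.+1; rewrite nL => /(_ isT) hn.
  rewrite !DV /geom mulr1.
  have gE := sbd_weightsE tau0 hg.
  have tt : tau `^ s * tau `^ alpha = tau.
    by rewrite -powRD ?(gt_eqF tau0) ?implybT // /s subrK powRr1 // ltW.
  have e1 : \sum_(0 <= k < n.+1) g k * (U (n.+1%:Z - k%:Z) - v0) = tau `^ s * E n.+1.
    by rewrite /E big_distrr /=; apply: eq_bigr => i _; rewrite gE mulrA.
  have e2 : \sum_(0 <= k < n.+1.-1) g k * (U (n.+1%:Z - 1 - k%:Z) - v0) = tau `^ s * E n.
    rewrite /E big_distrr /=; apply: eq_bigr => i _; rewrite gE mulrA; congr (_ * (U _ - _)).
    by rewrite -addn1 PoszD addrK.
  rewrite e1 e2 in hn.
  set W := U (n.+1%:Z - 2) in hn.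
  have eW : (if (n : nat) is m.+1 then V m else 0) = (W - v0)%:C%C.
    rewrite /W; case: (n) => [|m]; first by rewrite (_ : 1%:Z - 2 = -1) // Um1 subrr.
    by rewrite /V; congr (U _ - _)%:C%C; rewrite -addn2 PoszD addrK.
  rewrite fpsXM eW.
  have tn0 : tau `^ alpha != 0 by rewrite gt_eqF // powR_gt0.
  have hn2 : E n.+1 - E n + mu * (4^-1 * (3 * (U n.+1%:Z - v0) + (W - v0))) = - mu * v0.
    have h3 : tau `^ alpha * (tau^-1 * (tau `^ s * E n.+1 - tau `^ s * E n)) = E n.+1 - E n.
      rewrite -mulrBr mulrA mulrA [tau `^ alpha / tau * _](_ : _ = (tau `^ s * tau `^ alpha) / tau); last by ring.
      by rewrite tt divff ?mul1r // gt_eqF.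
    have := congr1 ( *%R (tau `^ alpha)) hn; rewrite mulr0 mulrDr h3 => h4.
    apply/eqP; rewrite -subr_eq0 -h4 /mu; apply/eqP; by field.
  transitivity ((- mu * v0)%:C%C); last by rewrite rmorphM rmorphN mulrC.
  rewrite -hn2 /V; move: (U n.+1%:Z - v0) (W - v0) (E n.+1) (E n) => a b e1' e2'; clearbody mu.
  rewrite rmorphD rmorphB !rmorphM fmorphV rmorph_nat.
  by congr (_ + _ * (_ * _)); rewrite rmorphD rmorphM rmorph_nat.
move=> n nL.
have q0 := sbd_sym0 s mu0.
have := fps_div_unique_le q0 eqs nL; by rewrite /V fpsCM.
Qed.

End DiscreteScalar.

(** * Diagonalisation by discrete sines *)

Section SineBasis.
Variable R : realType.
Variable M : nat.
Local Notation N := M.+1.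
Local Notation A := (fdmatrix R N).

Definition angle (j : nat) : R := pi * j.+1%:R / N%:R.
Definition fdeig (j : 'I_M) : R := N%:R ^+ 2 * (2 - 2 * cos (angle j)).
Definition sine_vec (j : 'I_M) (i : nat) : R := sin (angle j * i%:R).

Lemma mesh_gt0 : (0 : R) < N%:R. Proof. by rewrite ltr0n. Qed.

Lemma angle_itv (j : 'I_M) : 0 < angle j < pi.
Proof.
rewrite /angle !divr_gt0 ?mulr_gt0 ?pi_gt0 //=.
rewrite ltr_pdivrMr ?mesh_gt0 // ltr_pM2l ?pi_gt0 // ltr_nat ltnS; exact: ltn_ord.
Qed.

Lemma fdeig_gt0 j : 0 < fdeig j.
Proof.
have /andP[a0 a1] := angle_itv j.
rewrite /fdeig mulr_gt0 ?exprn_gt0 ?mesh_gt0 // subr_gt0 gtr_pMr // -cos0.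
by rewrite ltr_cos ?in_itv //= ?lexx ?pi_ge0 // (ltW a0) ltW.
Qed.

Lemma fdeig_inj : injective fdeig.
Proof.
move=> i j /(mulfI (lt0r_neq0 (exprn_gt0 2 mesh_gt0))) /addrI /oppr_inj /(mulfI (lt0r_neq0 (ltr0Sn R 1))) h.
have /andP[a0 a1] := angle_itv i; have /andP[b0 b1] := angle_itv j.
have : angle i = angle j by apply: cos_inj h; rewrite in_itv /= ?(ltW a0) ?(ltW b0) ltW.
rewrite /angle => /(mulIf (lt0r_neq0 (_ : 0 < N%:R^-1))); rewrite invr_gt0 mesh_gt0 => /(_ isT).
move=> /(mulfI (lt0r_neq0 (pi_gt0 R))) /eqP; rewrite eqr_nat eqSS => /eqP; exact: val_inj.
Qed.

Lemma sine_vec0 j : sine_vec j 0 = 0.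
Proof. by rewrite /sine_vec mulr0 sin0. Qed.

Lemma sin_natpi (k : nat) : sin (pi * k%:R) = 0 :> R.
Proof.
elim: k => [|k IH]; first by rewrite mulr0 sin0.
by rewrite -natr1 mulrDr mulr1 sinDpi IH oppr0.
Qed.

Lemma sine_vecN j : sine_vec j N = 0.
Proof.
rewrite /sine_vec /angle divfK ?gt_eqF ?mesh_gt0 //; exact: sin_natpi.
Qed.

Lemma sine_vec_rec j i : sine_vec j i.+2 + sine_vec j i = 2 * cos (angle j) * sine_vec j i.+1.
Proof.
rewrite /sine_vec.
have -> : angle j * i.+2%:R = angle j * i.+1%:R + angle j by rewrite -(natr1 i.+1) mulrDr mulr1.
have -> : angle j * i%:R = angle j * i.+1%:R - angle j by rewrite -(natr1 i) mulrDr mulr1 addrK.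
rewrite sinD sinB; ring.
Qed.

(** The vanishing boundary values make the three-point formula valid in the first and last
    rows. *)
Lemma fdmatrix_stencil (f : nat -> R) (i : 'I_M) : f 0%N = 0 -> f N = 0 ->
  \sum_(j < M) A i j * f j.+1 = N%:R ^+ 2 * (2 * f i.+1 - f i - f i.+2).
Proof.
move=> f0 fN.
have pick (k : nat) : (k < M)%N -> \sum_(j < M) (k == j :> nat)%:R * f j.+1 = f k.+1.
  move=> kM; rewrite (bigD1 (Ordinal kM)) //= eqxx mul1r big1 ?addr0 // => j.
  by rewrite eq_sym -val_eqE /= => /negPf ->; rewrite mul0r.
have -> : \sum_(j < M) A i j * f j.+1 = N%:R ^+ 2 * (2 * \sum_(j < M) (i == j :> nat)%:R * f j.+1
   - \sum_(j < M) (i == j.+1 :> nat)%:R * f j.+1 - \sum_(j < M) (i.+1 == j :> nat)%:R * f j.+1).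
  rewrite mulrBr mulrBr !big_distrr /= -!sumrB; apply: eq_bigr => j _; rewrite mxE [(j : nat) == _]eq_sym.
  have [-> |hij] := eqVneq (i : nat) j.
    by rewrite !(gtn_eqF (ltnSn _)) (ltn_eqF (ltnSn _)) /=; ring.
  have [e|h1] /= := eqVneq (i : nat) j.+1.
    have -> : (i.+1 == j :> nat) = false by rewrite e gtn_eqF // ltnS ltnW.
    by rewrite /=; ring.
  by case: eqP => _ /=; ring.
rewrite (pick i (ltn_ord i)); congr (_ * (_ - _ - _)).
  case ei : (i : nat) => [|k]; first by rewrite f0 big1 // => j _; rewrite mul0r.
  have kM : (k < M)%N by apply: ltnW; rewrite -ei ltn_ord.
  exact: pick kM.
have [iM|iM] := ltnP i.+1 M; first exact: pick.
have -> : i.+2 = N by congr _.+1; apply/eqP; rewrite eqn_leq iM ltn_ord.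
rewrite fN big1 // => j _; rewrite gtn_eqF ?mul0r //.
exact: leq_trans (ltn_ord j) iM.
Qed.

Definition rawsine : 'M[R]_M := \matrix_(j, i) sine_vec j i.+1.

Lemma fdmatrix_sym : A^T = A.
Proof.
apply/matrixP => i j; rewrite !mxE eq_sym orbC; by [].
Qed.

Lemma rawsine_eig : rawsine *m A = diag_mx (\row_j fdeig j) *m rawsine.
Proof.
apply/matrixP => j i; rewrite mul_diag_mx !mxE.
transitivity (\sum_(k < M) A i k * sine_vec j k.+1).
  by apply: eq_bigr => k _; rewrite -[in RHS]fdmatrix_sym !mxE mulrC.
rewrite (fdmatrix_stencil i (sine_vec0 j) (sine_vecN j)) /fdeig.
have h := sine_vec_rec j i.
transitivity (N%:R ^+ 2 * (2 * sine_vec j i.+1 - (sine_vec j i.+2 + sine_vec j i))); first by ring.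
by rewrite h; ring.
Qed.

Definition sine_norm2 (j : 'I_M) : R := \sum_i rawsine j i ^+ 2.

Lemma sine_norm2_gt0 j : 0 < sine_norm2 j.
Proof.
have M0 : (0 < M)%N by apply: leq_ltn_trans (ltn_ord j).
rewrite /sine_norm2 (bigD1 (Ordinal M0)) //= ltr_pwDl ?sumr_ge0 // => [|i _]; last exact: sqr_ge0.
rewrite exprn_gt0 // mxE /sine_vec mulr1; apply: sin_gt0_pi; exact: angle_itv.
Qed.

(** Eigenvectors of a symmetric matrix for distinct eigenvalues are orthogonal. *)
Lemma rawsine_gram : rawsine *m rawsine^T = diag_mx (\row_j sine_norm2 j).
Proof.
set G := rawsine *m rawsine^T.
have GT : G^T = G by rewrite /G trmx_mul trmxK.
have e1 : rawsine *m A *m rawsine^T = diag_mx (\row_j fdeig j) *m G by rewrite rawsine_eig mulmxA.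
have e2 : (rawsine *m A *m rawsine^T)^T = rawsine *m A *m rawsine^T.
  by rewrite !trmx_mul trmxK fdmatrix_sym mulmxA.
rewrite e1 trmx_mul GT tr_diag_mx in e2.
apply/matrixP => i j; rewrite [RHS]mxE [X in X *+ _]mxE.
have [<-|ij] := eqVneq i j.
  by rewrite mulr1n mxE /sine_norm2; apply: eq_bigr => k _; rewrite !mxE expr2.
rewrite mulr0n; have := congr1 (fun X : 'M[R]_M => X i j) e2.
rewrite mul_mx_diag mul_diag_mx !mxE => /eqP.
rewrite mulrC -subr_eq0 -mulrBl mulf_eq0 subr_eq0 => /orP[/eqP h|/eqP h].
  by move: ij; rewrite (fdeig_inj h) eqxx.
by rewrite -[RHS]h /G ?mxE.
Qed.

Definition sine_mx : 'M[R]_M := \matrix_(j, i) ((Num.sqrt (sine_norm2 j))^-1 * rawsine j i).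

Lemma sine_mxE : sine_mx = diag_mx (\row_j (Num.sqrt (sine_norm2 j))^-1) *m rawsine.
Proof. by apply/matrixP => i j; rewrite mul_diag_mx !mxE. Qed.

Lemma sine_mx_orth : sine_mx^T *m sine_mx = 1%:M.
Proof.
apply: mulmx1C; rewrite sine_mxE trmx_mul tr_diag_mx mulmxA -[_ *m rawsine *m _]mulmxA rawsine_gram.
apply/matrixP => i j; rewrite mul_mx_diag mxE mul_diag_mx !mxE.
have [<-|ij] := eqVneq i j; last by rewrite !mulr0n mulr0 mul0r.
rewrite !mulr1n -{2}(sqr_sqrtr (ltW (sine_norm2_gt0 i))).
by field; rewrite gt_eqF // sqrtr_gt0 sine_norm2_gt0.
Qed.

Lemma sine_mx_eig (X : 'cV[R]_M) j : (sine_mx *m (A *m X)) j 0 = fdeig j * (sine_mx *m X) j 0.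
Proof.
have -> : sine_mx *m (A *m X) = diag_mx (\row_j fdeig j) *m (sine_mx *m X).
  rewrite sine_mxE !mulmxA -[_ *m rawsine *m A]mulmxA rawsine_eig !mulmxA; congr (_ *m _ *m _).
  by apply/matrixP => k l; rewrite !mul_diag_mx !mxE; case: eqP => [->|]; rewrite ?mulr0n ?mulr0 // mulrC.
by rewrite mul_diag_mx !mxE.
Qed.

Lemma sine_mx_parseval (X : 'cV[R]_M) : \sum_j (sine_mx *m X) j 0 ^+ 2 = \sum_i X i 0 ^+ 2.
Proof.
have sq (Y : 'cV[R]_M) : \sum_i Y i 0 ^+ 2 = (Y^T *m Y) 0 0.
  by rewrite mxE; apply: eq_bigr => i _; rewrite mxE expr2.
by rewrite !sq trmx_mul mulmxA -[_ *m _ *m sine_mx]mulmxA sine_mx_orth mulmx1.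
Qed.

End SineBasis.

(** * Coordinates in the sine basis *)

Section Assembly.
Local Open Scope classical_set_scope.
Local Open Scope ring_scope.
Variable R : realType.
Local Notation leb := (@lebesgue_measure R).

Lemma within_continuous_sum (D : set R) (M : nat) (c : 'I_M -> R) (v : 'I_M -> R -> R) :
  (forall i, {within D, continuous (v i)}) -> {within D, continuous (fun t => \sum_i c i * v i t)}.
Proof.
move=> hv.
have -> : (fun t => \sum_i c i * v i t) = (fun t => \sum_(i <- index_enum 'I_M) c i * v i t) by [].
elim: (index_enum _) => [|i r IH].
  have -> : (fun t => \sum_(i <- [::]) c i * v i t) = (fun=> 0) by apply/funext => t; rewrite big_nil.
  by move=> t; exact: cvg_cst.
have -> : (fun t => \sum_(k <- i :: r) c k * v k t) = (fun t => c i * v i t + \sum_(k <- r) c k * v k t).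
  by apply/funext => t; rewrite big_cons.
by move=> t; apply: cvgD; [apply: cvgM; [exact: cvg_cst|exact: hv]|exact: IH].
Qed.

(** The kernel is the one of [conv_point_integrable] on the half-open interval; at [x = s]
    both vanish. *)
Lemma RL_integrable (alpha T s : R) (v : R -> R) (a : R) : 0 < alpha < 1 -> 0 < T -> 0 <= s <= T ->
  {within `[0, T], continuous v} ->
  leb.-integrable `]0, s] (fun x => ((s - x) `^ (- alpha) * (v x - a))%:E).
Proof.
move=> ha T0 /andP[s0 sT] vc; have [B wB] := wcut_bounded T0 a vc.
have c1 : 0 < - alpha + 1 by rewrite addrC subr_gt0; case/andP: ha.
have c0 : - alpha <= 0 by rewrite oppr_le0 ltW //; case/andP: ha.
have ic := conv_point_integrable (measurable_wcut T0 a vc) wB (wcut0 T v a) c1 c0 s.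
have h : leb.-integrable `]0, s] (fun x => (pos_powR (- alpha) (s - x) * wcut T v a x)%:E).
  by apply: (integrableS _ _ _ ic).
apply: eq_integrable h => // x; rewrite inE /= in_itv /= => /andP[x0 xs].
congr EFin; rewrite /pos_powR subr_gt0; case: ltgtP xs => // [xs _|-> _].
  by rewrite /wcut x0 (lt_le_trans xs sT).
by rewrite subrr powR0 ?mul0r // oppr_eq0; case/andP: ha => /gt_eqF ->.
Qed.

Lemma RL_linear (alpha T t : R) (M : nat) (c : 'I_M -> R) (v : 'I_M -> R -> R) (a d : 'I_M -> R) :
  0 < alpha < 1 -> 0 < T -> 0 <= t <= T -> (forall i, {within `[0, T], continuous (v i)}) ->
  (forall i, is_RLderive alpha T (fun xi => v i xi - a i) t (d i)) ->
  is_RLderive alpha T (fun xi => \sum_i c i * v i xi - \sum_i c i * a i) t (\sum_i c i * d i).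
Proof.
move=> ha T0 ht vc hd.
have /choice[l hl] : forall i, exists l : R, is_derive_in `[0, T]
      (fun s => \int[leb]_(xi in `[0%R, s]) ((s - xi) `^ (- alpha) * (v i xi - a i))) t l /\
    d i = (Gamma (1 - alpha))^-1 * l.
  by move=> i; have [l h1 h2] := hd i; exists l.
exists (\sum_i c i * l i); last first.
  rewrite big_distrr /=; apply: eq_bigr => i _; rewrite (hl i).2; ring.
have E s : 0 <= s <= T -> \int[leb]_(xi in `[0%R, s]) ((s - xi) `^ (- alpha) *
    (\sum_i c i * v i xi - \sum_i c i * a i)) =
   \sum_i c i * \int[leb]_(xi in `[0%R, s]) ((s - xi) `^ (- alpha) * (v i xi - a i)).
  move=> hs.
  have int1 i := RL_integrable (a i) ha T0 hs (vc i).
  have intS := RL_integrable (\sum_i c i * a i) ha T0 hs (@within_continuous_sum _ _ c v vc).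
  rewrite -Rintegral_itv_obnd_cbnd //.
  have e0 i : \int[leb]_(xi in `[0%R, s]) ((s - xi) `^ (- alpha) * (v i xi - a i)) =
     \int[leb]_(xi in `]0%R, s]) ((s - xi) `^ (- alpha) * (v i xi - a i)).
    by rewrite -Rintegral_itv_obnd_cbnd; last exact: int1.
  under [RHS]eq_bigr => i _ do rewrite e0.
  apply: EFin_inj; rewrite -sumEFin /Rintegral fineK; last exact: (integrable_fin_num _ intS).
  have e1 (x : measurableTypeR R) : ((s - x) `^ (- alpha) * (\sum_i c i * v i x - \sum_i c i * a i))%:E =
     (\sum_i (c i)%:E * ((s - x) `^ (- alpha) * (v i x - a i))%:E)%E.
    under [RHS]eq_bigr => i _ do rewrite -EFinM.
    rewrite sumEFin; congr EFin; rewrite -sumrB big_distrr /=; apply: eq_bigr => i _; ring.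
  rewrite (eq_integral _ _ (fun x _ => e1 x)) integral_sum //; last first.
    by move=> i; apply: integrableZl.
  apply: eq_bigr => i _; rewrite integralZl // EFinM fineK //.
  exact: (integrable_fin_num _ (int1 i)).
rewrite /is_derive_in.
have lim : (fun s => \sum_i c i * ((\int[leb]_(xi in `[0%R, s]) ((s - xi) `^ (- alpha) * (v i xi - a i))
   - \int[leb]_(xi in `[0%R, t]) ((t - xi) `^ (- alpha) * (v i xi - a i))) / (s - t)))
   @ within `[0, T] (t^') --> \sum_i c i * l i.
  elim: (index_enum 'I_M) => [|i r IH].
    rewrite big_nil (_ : (fun s => _) = (fun=> 0)); first exact: cvg_cst.
    by apply/funext => s; rewrite big_nil.
  rewrite big_cons; under eq_fun do rewrite big_cons.
  by apply: cvgD => //; apply: cvgM; [exact: cvg_cst|exact: (hl i).1].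
apply: cvg_trans lim; apply: near_eq_cvg; rewrite near_withinE; apply: nearW => s /= hs.
rewrite in_itv /= in hs.
rewrite (E s hs) (E t ht) -sumrB big_distrl /=; apply: eq_bigr => i _.
by rewrite -mulrBr mulrA.
Qed.

Lemma l2norm_le (M : nat) (K : R) (E u P Q : 'cV[R]_M) : 0 <= K ->
  \sum_j P j 0 ^+ 2 = \sum_i E i 0 ^+ 2 -> \sum_j Q j 0 ^+ 2 = \sum_i u i 0 ^+ 2 ->
  (forall j, `|P j 0| <= K * `|Q j 0|) -> l2norm E <= K * l2norm u.
Proof.
move=> K0 hP hQ h; rewrite /l2norm -hP -hQ -{1}(ger0_norm K0) -sqrtr_sqr -sqrtrM ?sqr_ge0 //.
rewrite ler_wsqrtr // mulrCA ler_wpM2l ?invr_ge0 // big_distrr /=; apply: ler_sum => j _.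
rewrite -[P j 0 ^+ 2]real_normK ?num_real // -[Q j 0 ^+ 2]real_normK ?num_real // -exprMn.
by rewrite lerXn2r ?nnegrE ?mulr_ge0.
Qed.

End Assembly.

Theorem theorem6 (R : realType) (alpha T : R)
    (halpha : 0 < alpha < 1) (hT : 0 < T) :
  exists C : R, 0 < C /\
    forall (N L : nat) (u0 : 'cV[R]_N.-1)
           (uh : R -> 'cV[R]_N.-1) (u2h : int -> 'cV[R]_N.-1),
      (0 < N)%N -> (0 < L)%N ->
      semidiscrete_solution alpha T (fun _ => 0) u0 uh ->
      sbd_solution alpha T L (fun _ => 0) u0 u2h ->
      forall n : nat, (1 <= n <= L)%N ->
        let tau := T / L%:R in
        let t_n := n%:R * tau in
        l2norm (uh t_n - u2h n%:Z) <= C * tau ^+ 2 * t_n ^- 2 * l2norm u0.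
Proof.
have [K K0 hK] := scalar_error halpha.
exists (K + 1); split; first by rewrite ltr_pwDr.
case=> [//|M] L u0 uh u2h _ L0 [uc ueq] hsbd n /andP[n1 nL].
pose tau := T / L%:R; pose t_n := n%:R * tau.
change (is_true (l2norm (uh t_n - u2h n%:Z) <= (K + 1) * tau ^+ 2 * t_n ^- 2 * l2norm u0)).
have [um1 u20 [g hg geq]] := hsbd.
have nR : 0 < n%:R :> R by rewrite ltr0n.
have LR : 0 < L%:R :> R by rewrite ltr0n.
have tau0 : 0 < tau by rewrite divr_gt0.
have tnT : n%:R * tau <= T.
  by rewrite /tau mulrA ler_pdivrMr // mulrC ler_pM2l // ler_nat.
have -> : (K + 1) * tau ^+ 2 * t_n ^- 2 = (K + 1) / n%:R ^+ 2.
  by rewrite /t_n; field; rewrite !gt_eqF.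
set S := sine_mx R M.
apply: (l2norm_le _ (sine_mx_parseval _) (sine_mx_parseval u0)) => [|j].
  by rewrite divr_ge0 ?addr_ge0 ?exprn_ge0.
have Sj (X : 'cV[R]_M) : (S *m X) j 0 = \sum_i S j i * X i 0 by rewrite mxE.
have Zj (a : R) (X : 'cV[R]_M) : (a *: X) j 0 = a * X j 0 by rewrite mxE.
have Dj (X Y : 'cV[R]_M) : (X + Y) j 0 = X j 0 + Y j 0 by rewrite mxE.
have Bj (X Y : 'cV[R]_M) : (X - Y) j 0 = X j 0 - Y j 0 by rewrite !mxE.
have S0 : (S *m (0 : 'cV[R]_M)) j 0 = 0 by rewrite mulmx0 mxE.
pose v (t : R) : R := \sum_i S j i * uh t i 0.
pose v0 : R := \sum_i S j i * u0 i 0.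
pose U (m : int) : R := (S *m u2h m) j 0.
have lam0 := fdeig_gt0 R j.
have vc : {within `[0, T], continuous v}%classic by exact: within_continuous_sum.
have veq (t : R) : 0 < t < T -> exists2 d, is_RLderive alpha T (fun xi => v xi - v0) t d & d + fdeig R j * v t = 0.
  move=> /andP[t0 tT]; have [|d hd dE] := ueq t; first by rewrite t0 ltW.
  exists (\sum_i S j i * d i 0).
    apply: RL_linear => //; first by rewrite (ltW t0) ltW.
    move=> i; have := hd i; congr (is_RLderive _ _ _ _ _).
    by apply/funext => xi; rewrite !mxE.
  have := congr1 (fun X : 'cV[R]_M => (S *m X) j 0) dE.
  by rewrite /= mulmxDr Dj (sine_mx_eig _ j) S0 !Sj.
have Ueq (m : nat) : (1 <= m <= L)%N ->
     tau^-1 * (\sum_(0 <= k < m) g k * (U (m%:Z - k%:Z) - v0)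
               - \sum_(0 <= k < m.-1) g k * (U (m%:Z - 1 - k%:Z) - v0))
     + 4^-1 * (fdeig R j * (3 * U m%:Z + U (m%:Z - 2))) = 0.
  move=> hm; have := congr1 (fun X : 'cV[R]_M => (S *m X) j 0) (geq m hm).
  rewrite /= addr0 scaler0 S0 => h; rewrite -[RHS]h.
  rewrite mulmxDr -!scalemxAr mulmxBr !mulmx_sumr.
  have Uk (w : nat -> int) r : (\sum_(0 <= k < r) S *m (g k *: (u2h (w k) - u0))) j 0 =
      \sum_(0 <= k < r) g k * (U (w k) - v0).
    rewrite summxE; apply: eq_bigr => k _.
    by rewrite -scalemxAr mulmxBr Zj Bj (Sj u0).
  have UD : (S *m (3 *: u2h m%:Z + u2h (m%:Z - 2))) j 0 = 3 * U m%:Z + U (m%:Z - 2).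
    by rewrite mulmxDr -scalemxAr Dj Zj.
  rewrite Dj !Zj Bj (Uk (fun k => m%:Z - k%:Z)) (Uk (fun k => m%:Z - 1 - k%:Z)).
  by rewrite (sine_mx_eig _ j) UD.
have hd := sbd_scheme_dev halpha tau0 (ltW lam0) hg _ _ Ueq nL.
have Um1 : U (-1) = v0 by rewrite /U um1 Sj.
have U0 : U 0 = v0 by rewrite /U u20 Sj.
have hU := hd Um1 U0.
have hv := hK T v v0 (fdeig R j) tau n hT vc veq lam0 tau0 n1 tnT.
rewrite -hU -rmorphB normc_real in hv.
rewrite mulrAC ler_pdivlMr ?exprn_gt0 // mulmxBr Bj -/(U n%:Z) !Sj -/v0 -/(v t_n).
rewrite [X in `|X|](_ : _ = v (n%:R * tau) - v0 - (U n - v0)); last by rewrite /t_n; ring.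
by apply: (le_trans hv); rewrite ler_wpM2r // lerDl.
Qed.
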